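(* Let $\vartheta_0\in\Theta$ be the true value. Suppose the following conditions hold. (P) There is a (preliminary) estimator $\bar\vartheta_n$, based on $n$ observations $X_1,\dots,X_n$, which is consistent and such that $\sqrt{n}\,(\bar\vartheta_n-\vartheta_0)$ is bounded in probability. (L) The function $\ell(\vartheta,t)=\ln\lambda(\vartheta,t)$ has three continuous bounded derivatives with respect to $\vartheta$, and the Fisher information matrix $\mathbb{I}(\vartheta)$ is uniformly non-degenerate: $$\inf_{\vartheta\in\Theta}\ \inf_{\mu\in\mathbb{R}^d,\,|\mu|=1}\mu^\top\mathbb{I}(\vartheta)\mu>0 .$$ Let $\delta\in(\tfrac12,1)$, let $N=[n^\delta]$, let $\bar\vartheta_N$ be the preliminary estimator constructed from the first $N$ observations $X_1,\dots,X_N$, and define the one-step MLE-process $(\vartheta_{k,n}^\star,\ k=N+1,\dots,n)$ by $$\vartheta_{k,n}^\star=\bar\vartheta_N+\mathbb{I}(\bar\vartheta_N)^{-1}\frac1k\sum_{j=N+1}^{k}\int_{\mathbb{T}}\dot\ell(\bar\vartheta_N,t)\bigl[dX_j(t)-\lambda(\bar\vartheta_N,t)\,dt\bigr].$$ Then the one-step MLE-process is consistent and asymptotically normal: for every $s\in(0,1]$, with $k=[sn]$, as $n\to\infty$, $\vartheta_{k,n}^\star\to\vartheta_0$ in probability and $$\sqrt{k}\,\bigl(\vartheta_{k,n}^\star-\vartheta_0\bigr)\Longrightarrow\mathcal{N}\bigl(0,\mathbb{I}(\vartheta_0)^{-1}\bigr).$$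
   Context: Model: $\mathbb{T}$ is an interval of observations, either finite, $\mathbb{T}=[0,T]$, or infinite, $\mathbb{T}=[0,\infty)$ or $\mathbb{T}=(-\infty,\infty)$. The parameter set $\Theta\subset\mathbb{R}^d$ is open, convex and bounded. For each $\vartheta\in\Theta$, $X_1,X_2,\dots$ are, under the probability $\mathbf{P}_\vartheta$, independent inhomogeneous Poisson (counting) processes $X_j=(X_j(t),t\in\mathbb{T})$ with the same intensity function $\lambda(\vartheta,t)$, $t\in\mathbb{T}$, which is a known function depending on the unknown parameter $\vartheta$. All convergences and boundedness in probability are under $\mathbf{P}_{\vartheta_0}$. Notation: a dot means derivation with respect to $\vartheta$, so $\dot\lambda(\vartheta,t),\dot\ell(\vartheta,t)\in\mathbb{R}^d$ are column gradients and $\dot\ell=\dot\lambda/\lambda$; $\top$ is transposition; $[a]$ is the integer part of $a$; $\Longrightarrow$ is convergence in distribution. The Fisher information matrix is $$\mathbb{I}(\vartheta)=\int_{\mathbb{T}}\dot\lambda(\vartheta,t)\,\dot\lambda(\vartheta,t)^\top\lambda(\vartheta,t)^{-1}\,dt .$$ It and the other displayed integrals are understood to be well defined and finite. Derivatives of $\ell$ are bounded on $\Theta\times\mathbb{T}$. Preliminary estimators are measurable functions of the observations with values in $\Theta$. For fixed $s\in(0,1]$ and $n$ large, $[sn]\ge N+1$.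
   Formalization: The integral of the score against dX_j − λdt is read as a difference of two absolutely convergent integrals, and the integral of |ℓ̇|λ over 𝕋 is assumed bounded locally uniformly in ϑ (automatic for finite total intensity); with finiteness only at each ϑ the claim fails. *)

(* Defs.v *)
From mathcomp Require Export all_boot all_order all_algebra.
From mathcomp Require Export finmap.
From mathcomp Require Export all_classical all_reals all_analysis.

Set Implicit Arguments.
Unset Strict Implicit.
Unset Printing Implicit Defensive.

Export Order.TTheory GRing.Theory Num.Theory.
Export numFieldNormedType.Exports.

#[global] Open Scope classical_set_scope.
#[global] Open Scope ring_scope.

Section Observations.
Context {R : realType}.

Definition observation_interval (T : set R) : Prop :=
  [\/ exists2 T0 : R, 0 < T0 & T = `[0, T0]%classic,
      T = `[0, +oo[%classic |
      T = [set: R]].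

(* The paths are the elements of [cumulative R R], i.e. the nondecreasing and
   right-continuous functions on the whole line; only the values at times of
   [T] matter.  On a half line or a bounded interval a path is extended by 0
   to the left, so that its Stieltjes measure has no atom at 0.  On the
   two-sided line a path is normalized by [F 0 = 0], so that it takes
   nonpositive integer values on the left of 0. *)
Definition counting_path (T : set R) (F : R -> R) : Prop :=
  [/\ F 0 = 0,
      forall t, T t -> exists z : int, F t = z%:~R &
      forall t, t < 0 -> ~ T t -> F t = 0].

Definition counting_process {dO} {Omega : measurableType dO} (T : set R)
    (X : Omega -> cumulative R R) : Prop :=
  (forall w, counting_path T (X w)) /\
  (forall t, T t -> measurable_fun [set: Omega] (fun w => X w t)).

Definition sigma_process {dO} {Omega : measurableType dO} (T : set R)
    (X : Omega -> cumulative R R) : set_system Omega :=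
  <<s \bigcup_(t in T)
        preimage_set_system [set: Omega] (fun w => X w t) measurable >>.

Definition sigma_first {dO} {Omega : measurableType dO} (T : set R)
    (X : nat -> Omega -> cumulative R R) (n : nat) : set_system Omega :=
  <<s \bigcup_(j in `I_n) sigma_process T (X j) >>.

Definition mutually_independent {dO} {Omega : measurableType dO}
    (P : probability Omega R) (I : choiceType) (G : I -> set_system Omega) :
    Prop :=
  forall (J : {fset I}) (A : I -> set Omega),
    (forall i, i \in J -> G i (A i)) ->
    P (\bigcap_(i in [set` J]) A i) = (\prod_(i <- J) P (A i))%E.

(* [poisson_pmf] is meant for a positive rate, and here the rates are integrals
   of positive functions over intervals of positive length. *)
Definition poisson_process {dO} {Omega : measurableType dO}
    (P : probability Omega R) (T : set R) (lam : R -> R)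
    (X : Omega -> cumulative R R) : Prop :=
  (forall s t, T s -> T t -> s < t -> forall k : nat,
     P [set w | X w t - X w s = k%:R] =
     (poisson_pmf (\int[lebesgue_measure]_(x in `[s, t]) lam x) k)%:E) /\
  (forall (m : nat) (t : nat -> R),
     (forall i, (i <= m)%N -> T (t i)) ->
     (forall i, (i < m)%N -> t i < t i.+1) ->
     mutually_independent P (fun i : 'I_m =>
       preimage_set_system [set: Omega]
         (fun w => X w (t i.+1) - X w (t i)) measurable)).

Definition intensity (T : set R) (lam : R -> R) : Prop :=
  [/\ forall t, T t -> 0 < lam t,
      measurable_fun T lam &
      forall s t, T s -> T t ->
        lebesgue_measure.-integrable `[s, t] (EFin \o lam)].

End Observations.

Section Model.
Context {R : realType} {d : nat}.
Implicit Types (T : set R) (D : set 'cV[R]_d) (th : 'cV[R]_d).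

(* The library norm on matrices is the maximum norm. *)
Definition enorm (x : 'cV[R]_d) : R := Num.sqrt (\sum_i x i ord0 ^+ 2).

Definition partial (i : 'I_d) (f : 'cV[R]_d -> R) (x : 'cV[R]_d) : R :=
  'D_(delta_mx i ord0) f x.

(* [g] has [k] continuous derivatives with respect to its first argument, all
   bounded on [D `*` T]; [g] itself need not be bounded. *)
Fixpoint bounded_derivatives (k : nat) D T (g : 'cV[R]_d -> R -> R) : Prop :=
  if k is k'.+1 then
    forall i : 'I_d,
      [/\ forall t x, T t -> D x -> derivable (g ^~ t) x (delta_mx i ord0),
          forall t x, T t -> D x -> {for x, continuous (partial i (g ^~ t))},
          exists M : R, forall t x, T t -> D x -> `|partial i (g ^~ t) x| <= M &
          bounded_derivatives k' D T (fun x t => partial i (g ^~ t) x)]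
  else True.

Variables (T : set R) (lam : 'cV[R]_d -> R -> R).

Definition ell th (t : R) : R := ln (lam th t).

Definition dlam th (t : R) : 'cV[R]_d := \col_i partial i (lam ^~ t) th.

Definition dell th (t : R) : 'cV[R]_d := \col_i partial i (ell ^~ t) th.

Definition fisher_density th (t : R) : 'M[R]_d :=
  (lam th t)^-1 *: (dlam th t *m (dlam th t)^T).

Definition fisher th : 'M[R]_d :=
  \matrix_(i, j) \int[lebesgue_measure]_(t in T) fisher_density th t i j.

Definition uniformly_nondegenerate D (J : 'cV[R]_d -> 'M[R]_d) : Prop :=
  let unit_sphere : set 'cV[R]_d := [set mu | enorm mu = 1] in
  let quad th mu : \bar R := ((mu^T *m J th *m mu) ord0 ord0)%:E in
  (0%:E < ereal_inf [set ereal_inf [set quad th mu | mu in unit_sphere]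
                    | th in D])%E.

(* Finiteness of the integrals that define the Fisher information and the
   compensator.  The compensator is evaluated at a random point, and its
   absolute integral is required to be finite locally uniformly in the
   parameter. *)
Definition finite_integrals D : Prop :=
  forall th, D th ->
    (forall i j, lebesgue_measure.-integrable T
       (fun t => (fisher_density th t i j)%:E)) /\
    (exists M : R, \forall th' \near th, forall i,
       (\int[lebesgue_measure]_(t in T) `|dell th' t i ord0 * lam th' t|%:E
          <= M%:E)%E).

(* [\int_T dell th t (dF(t) - lam th t dt)] for a path [F] *)
Definition centered_score th (F : cumulative R R) : 'cV[R]_d :=
  \col_i (\int[lebesgue_stieltjes_measure F]_(t in T) dell th t i ord0
          - \int[lebesgue_measure]_(t in T) (dell th t i ord0 * lam th t)).

(* The process [X j] is the observation number [j.+1], so the first [N]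
   observations are [X 0, ..., X N.-1]. *)
Definition one_step {Omega : Type} (X : nat -> Omega -> cumulative R R)
    (thbar : nat -> Omega -> 'cV[R]_d) (N k : nat) (w : Omega) : 'cV[R]_d :=
  thbar N w + invmx (fisher (thbar N w)) *m
    (k%:R^-1 *: \sum_(N <= j < k) centered_score (thbar N w) (X j w)).

Definition estimators {dO} {Omega : measurableType dO} D
    (X : nat -> Omega -> cumulative R R) (thbar : nat -> Omega -> 'cV[R]_d) :
    Prop :=
  (forall n w, D (thbar n w)) /\
  (forall n i (B : set R), measurable B ->
     sigma_first T X n ((fun w => thbar n w i ord0) @^-1` B)).

End Model.

Section Convergence.
Context {R : realType} {d : nat} {dO : measure_display}.
Context {Omega : measurableType dO} (P : probability Omega R).
Implicit Type Y : nat -> Omega -> 'cV[R]_d.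

Definition cvg_in_probability Y (y : 'cV[R]_d) : Prop :=
  forall eps : R, 0 < eps ->
    P [set w | eps < enorm (Y n w - y)] @[n --> \oo] --> 0%E.

Definition bounded_in_probability Y : Prop :=
  forall eps : R, 0 < eps -> exists M : R,
    \forall n \near \oo, (P [set w | (M < enorm (Y n w))%R] <= eps%:E)%E.

End Convergence.

Section Normal.
Context {R : realType}.

(* integral over [R^d], as an iterated Lebesgue integral *)
Fixpoint cV_integral (d : nat) : ('cV[R]_d -> R) -> R :=
  match d with
  | 0 => fun f => f 0
  | d'.+1 => fun f => \int[lebesgue_measure]_x
      cV_integral (fun v : 'cV[R]_d' => f (col_mx (const_mx x : 'cV[R]_1) v))
  end.

Definition mvnormal_pdf (d : nat) (m : 'cV[R]_d) (S : 'M[R]_d)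
    (x : 'cV[R]_d) : R :=
  (Num.sqrt ((2 * pi) ^+ d * \det S))^-1 *
  expR (- (((x - m)^T *m invmx S *m (x - m)) ord0 ord0) / 2).

(* convergence in distribution to [N(m, S)], for a positive definite [S] *)
Definition cvg_in_law_normal {d : nat} {dO} {Omega : measurableType dO}
    (P : probability Omega R) (Y : nat -> Omega -> 'cV[R]_d)
    (m : 'cV[R]_d) (S : 'M[R]_d) : Prop :=
  forall f : 'cV[R]_d -> R, continuous f -> (exists M : R, forall x, `|f x| <= M) ->
    ('E_P[(fun w => f (Y n w))])%E @[n --> \oo] -->
    (cV_integral (fun x => f x * mvnormal_pdf m S x))%:E.

End Normal.

(* Main.v *)
(* Let [th] be the preliminary estimate and [b = th - th0].  A second order
   expansion gives
     sqrt k (th* - th0) = I(th)^-1 k^(-1/2) \sum_(N <= j < k) (\int dell(th) dX_j - mean)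
                          + O((N / sqrt k) |b| + sqrt k |b|^2),
   and the remainder vanishes because [sqrt N b] is bounded in probability and
   [n^(1/2) << N << n].  The observations entering the sum are independent of
   [th], so that, conditionally on [th], linear functionals of the main term have
   an explicit Poisson characteristic function, which tends to the Gaussian one
   uniformly for [th] near [th0].  Pointwise convergence of characteristic
   functions and tightness give convergence in law, since a continuous function is
   uniformly approximated on a cube by bounded trigonometric polynomials. *)

(* Characteristic functions are kept real: r exp(i phi) is recorded by the expectations of cos(Y +
   c) for all phases [c], which multiply under independence. Second moments are read off from them
   through 1 - cos, so tightness needs no separate variance formula for Poisson integrals. The main
   obstacle is the plug-in parameter. The integral of the score is defined path by path, and at a
   random parameter independence can be used only once joint measurability in parameter and path is
   known. The sample space therefore carries two sigma-algebras, generated by the observations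
   before and after N, and Fubini on their product plays the part of conditioning. The local
   estimates are relative to the intensity, which may be unbounded. The preliminary estimate is
   close to [th0] only with large probability; on the exceptional event it is replaced by [th0],
   which keeps it measurable in the first block. The linear term of the drift of the score cancels b
   only up to the fraction N/k, because k - N terms are divided by k; this is the origin of (N /
   sqrt k)|b|. *)
From HB Require Import structures.
Require Import Defs.
From mathcomp Require Import measurable_realfun simple_functions ring lra.
Set Implicit Arguments.
Unset Strict Implicit.
Unset Printing Implicit Defensive.

(** * Elementary inequalities *)

Section RealInequalities.
Context {R : realType}.
Implicit Types (f : R -> R) (x y : R).

(** By the mean value theorem [f x] is [df z * x] with [z] between 0 and [x], so a bound on the
    derivative gains one power of [x]. Repeated use yields the Taylor bounds below, without the
    factorials. *)
Lemma le_norm_MVT f (df : R -> R) (C : R) (n : nat) :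
  (forall x, is_derive x 1 f (df x)) -> f 0 = 0 ->
  (forall x, `|df x| <= C * `|x| ^+ n) ->
  forall x, `|f x| <= C * `|x| ^+ n.+1.
Proof.
move=> fdf f0 dfC x.
have cf a b : {within `[a, b], continuous f}.
  apply: derivable_within_continuous => z _.
  by have [] := fdf z.
have step (a : R) : 0 <= C * `|a| ^+ n by rewrite (le_trans _ (dfC a)).
have [x0|x0|->] := ltgtP x 0; last by rewrite f0 !normr0 expr0n mulr0.
- have [z /andP[xz z0]] := MVT x0 (fun z _ => fdf z) (cf _ _).
  rewrite f0 sub0r => /(congr1 Num.norm); rewrite normrN => ->.
  rewrite sub0r normrM normrN exprSr mulrA ler_pM2r ?normr_gt0 ?lt_eqF//.
  apply: le_trans (dfC z) _.
  (* The hypothesis at 1 forces [C] to be nonnegative, so the second case is void. *)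
  have [C0|C0] := leP 0 C.
    rewrite ler_wpM2l// lerXn2r ?nnegrE// !ltr0_norm//.
    by rewrite lerN2 ltW.
  have := step 1; rewrite normr1 expr1n mulr1 => C1.
  by move: (lt_le_trans C0 C1); rewrite ltxx.
- have [z /andP[xz z0]] := MVT x0 (fun z _ => fdf z) (cf _ _).
  rewrite f0 subr0 => ->.
  rewrite subr0 normrM exprSr mulrA ler_pM2r ?normr_gt0 ?gt_eqF//.
  apply: le_trans (dfC z) _.
  have [C0|C0] := leP 0 C.
    rewrite ler_wpM2l// lerXn2r ?nnegrE// !gtr0_norm//.
    by rewrite ltW.
  have := step 1; rewrite normr1 expr1n mulr1 => C1.
  by move: (lt_le_trans C0 C1); rewrite ltxx.
Qed.

Lemma norm_sin_le x : `|sin x| <= `|x|.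
Proof.
have := @le_norm_MVT sin cos 1 0 _ (@sin0 R) _ x; rewrite mul1r expr1; apply => z.
by rewrite expr0 mulr1 cos_max.
Qed.

Lemma norm_cosB1_le x : `|cos x - 1| <= x ^+ 2.
Proof.
have := @le_norm_MVT (fun x => cos x - 1) (fun x => - sin x) 1 1 _ _ _ x.
rewrite mul1r real_normK ?num_real//; apply => [z||z].
- by apply: is_derive_eq; rewrite subr0.
- by rewrite cos0 subrr.
- by rewrite normrN mul1r expr1 norm_sin_le.
Qed.

Lemma norm_sinB_le x : `|sin x - x| <= `|x| ^+ 3.
Proof.
have := @le_norm_MVT (fun x => sin x - x) (fun x => cos x - 1) 1 2 _ _ _ x.
rewrite mul1r; apply => [|z]; first by rewrite sin0 subrr.
by rewrite mul1r real_normK ?num_real// norm_cosB1_le.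
Qed.

(** Unlike the cubic majorant, this one integrates to a multiple of the second moment without any
    supremum bound on the integrand. *)
Lemma norm_sinB_le2 x : `|sin x - x| <= 2 * x ^+ 2.
Proof.
have := @le_norm_MVT (fun x => sin x - x) (fun x => cos x - 1) 2 1 _ _ _ x.
rewrite real_normK ?num_real//; apply => [|z]; first by rewrite sin0 subrr.
rewrite expr1; have [z1|z1] := leP `|z| 1.
  apply: le_trans (norm_cosB1_le z) _; rewrite -real_normK ?num_real//.
  by rewrite expr2 ler_pM// (le_trans z1)// ler1n.
apply: (@le_trans _ _ 2); last by rewrite ler_peMr// ltW.
by rewrite (le_trans (ler_normB _ _))// normr1 -[leRHS]/(1 + 1) lerD2r cos_max.
Qed.

Lemma norm_cosB1D_le x : `|cos x - 1 + x ^+ 2 / 2| <= x ^+ 4.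
Proof.
have := @le_norm_MVT (fun x => cos x - 1 + x ^+ 2 / 2)
  (fun x => - (sin x - x)) 1 3 _ _ _ x.
rewrite mul1r -[_ ^+ 4]/(_ ^+ (2 * 2)) exprM real_normK ?num_real// -exprM.
apply => [z||z].
- apply: is_derive_eq. by rewrite /GRing.scale/=; field.
- by rewrite cos0 subrr expr0n mul0r addr0.
- by rewrite mul1r normrN norm_sinB_le.
Qed.

Lemma norm_cosB_le x y : `|cos x - cos y| <= `|x - y|.
Proof.
have := @le_norm_MVT (fun z => cos (z + y) - cos y) (fun z => - sin (z + y))
  1 0 _ _ _ (x - y).
rewrite subrK mul1r expr1; apply => [z||z].
- apply: is_derive_eq. by rewrite /GRing.scale/=; ring.
- by rewrite add0r subrr.
- by rewrite normrN mulr1 sin_max.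
Qed.

Lemma norm_sinB x y : `|sin x - sin y| <= `|x - y|.
Proof.
rewrite -(sinD2pi x) -(sinD2pi y).
have E (z : R) : sin (z + pi *+ 2) = cos (z + (pi *+ 2 - pi / 2)).
  by rewrite -cosBpihalf -(addrA z).
by rewrite !E (le_trans (norm_cosB_le _ _))// opprD addrACA subrr addr0.
Qed.


(** The product is the real part of a characteristic function: its defect from 1 is of first order
    in the exponent of the modulus but of second order in the phase. *)
Lemma one_sub_expR_cos_le (a b : R) : 0 <= a ->
  1 - expR (- a) * cos b <= a + b ^+ 2.
Proof.
move=> a0.
have e1 : expR (- a) <= 1 by rewrite -expR0 ler_expR oppr_le0.
have e0 := expR_gt0 (- a).
have ea : 1 - a <= expR (- a) by exact: expR_ge1Dx.
have := norm_cosB1_le b; rewrite ler_norml => /andP[cb _].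
have c1 := cos_le1 b.
have b0 : 0 <= b ^+ 2 by rewrite sqr_ge0.
nra.
Qed.

Lemma norm_expRB1_le x : `|x| <= 1 -> `|expR x - 1| <= 3 * `|x|.
Proof.
move=> x1.
have h y : -1 <= y -> y <= 1 -> expR y <= 1 + 3 * `|y|.
  move=> y1 y2.
  have [y0|y0] := leP y 0.
    by rewrite (@le_trans _ _ 1)// ?lerDl ?mulr_ge0// -expR0 ler_expR.
  have := expR_ge1Dx (- (y / 2)).
  have e2 : expR (- y) = expR (- (y / 2)) ^+ 2.
    by rewrite -expRM_natl; congr expR; field.
  have : expR y * expR (- y) = 1 by rewrite -expRD subrr expR0.
  rewrite e2 gtr0_norm// => eE le1.
  have q2 : (1 - y / 2) ^+ 2 <= expR (- (y / 2)) ^+ 2.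
    by rewrite lerXn2r// nnegrE ?expR_ge0//; lra.
  rewrite -(@ler_pM2r _ (expR (- (y / 2)) ^+ 2)) ?exprn_gt0 ?expR_gt0// eE.
  apply: (@le_trans _ _ ((1 + 3 * y) * (1 - y / 2) ^+ 2)).
    (* Four times (1 + 3 y)(1 - y / 2)^2 - 1 equals this product, which is nonnegative on [0, 1]. *)
    have : 0 <= y * ((1 - y) * (8 - 3 * y)) by rewrite !mulr_ge0//; lra.
    by lra.
  by rewrite ler_wpM2l//; lra.
have /andP[xl xu] : -1 <= x <= 1 by rewrite -ler_norml.
rewrite ler_norml; apply/andP; split; last by rewrite lerBlDl h.
have := expR_ge1Dx x; have := ler_norm (- x); rewrite normrN => h1 h2.
have := normr_ge0 x; lra.
Qed.

(** From [expR (- x) >= 1 - x] follows [expR x - 1 <= x * expR x], hence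
    [expR x - 1 - x <= x * (expR x - 1)], and the first-order bound finishes. *)
Lemma norm_expRB1B_le x : `|x| <= 1 -> `|expR x - 1 - x| <= 3 * x ^+ 2.
Proof.
move=> x1.
have /andP[xl xu] : -1 <= x <= 1 by rewrite -ler_norml.
rewrite ger0_norm; last by rewrite -addrA -opprD subr_ge0 expR_ge1Dx.
have := expR_ge1Dx (- x); have := norm_expRB1_le x1.
have : expR x * expR (- x) = 1 by rewrite -expRD subrr expR0.
have e0 := expR_gt0 x; rewrite ler_norml => eE /andP[le1 le2] le3.
have x0 := normr_ge0 x.
have xx : x ^+ 2 = `|x| ^+ 2 by rewrite real_normK// num_real.
have [x00|x00] := leP 0 x.
  rewrite ger0_norm// in le1 le2 xx; nra.
rewrite ltr0_norm// in le1 le2 xx; nra.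
Qed.

End RealInequalities.

(** * The power series behind the Poisson characteristic function *)

Section PoissonSeries.
Context {R : realType}.
Implicit Types (x y c : R).

(** The power series with these coefficients is the real part of exp(i c) exp(x exp(i y)).
    Differentiation in [x] multiplies it by exp(i y), which only moves the phase [c] to [c + y]. *)
Let coef y c (n : nat) : R := n`!%:R^-1 * cos (y * n%:R + c).

Let diffs_coef y c : pseries_diffs (coef y c) = coef y (y + c).
Proof.
apply/funext => n; rewrite /pseries_diffs /coef mulrA; congr (_ * cos _).
  by rewrite factS natrM invfM mulrA mulfV ?mul1r// pnatr_eq0.
by rewrite -natr1 mulrDr mulr1 addrA.
Qed.

Let cvg_coef y c x : cvgn (pseries (coef y c) x).
Proof.
apply: normed_cvg.
apply: (@series_le_cvg _ _ (exp_coeff `|x|)); last exact: is_cvg_series_exp_coeff.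
- by move=> n /=.
- by move=> n; rewrite /exp_coeff /= mulr_ge0// exprn_ge0.
move=> n /=; rewrite /coef /exp_coeff /= !normrM normfV normrX normr_nat.
rewrite [leRHS]mulrC ler_wpM2r ?exprn_ge0//.
by rewrite ler_piMr ?invr_ge0// cos_max.
Qed.

Let F y c x : R := limn (pseries (coef y c) x).

Let dF y c x : is_derive x 1 (F y c) (F y (y + c) x).
Proof.
have := @pseries_snd_diffs R (coef y c) (`|x| + 1) x.
rewrite !diffs_coef /F; apply; [exact: cvg_coef..|].
by rewrite [ltRHS]ger0_norm ?addr_ge0// ltrDl.
Qed.

(** All phases are combinations of two of them, so the derivatives of [F y 0] and [F y (pi / 2)]
    close up to a linear system of two equations. *)
Let F_addc y c d x : F y (c + d) x = cos d * F y c x + sin d * F y (c + pi / 2) x.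
Proof.
rewrite /F.
have -> : pseries (coef y (c + d)) x =
  (fun n => cos d * pseries (coef y c) x n) \+
  (fun n => sin d * pseries (coef y (c + pi / 2)) x n).
  apply/funext => n; rewrite /pseries /series/=.
  rewrite !mulr_sumr -big_split/=; apply: eq_bigr => i _.
  rewrite /coef !addrA cosD cosDpihalf; ring.
apply: cvg_lim => //.
by apply: cvgD; apply: cvgM; [exact: cvg_cst|exact: cvg_coef|exact: cvg_cst|exact: cvg_coef].
Qed.

Let F0 y c : F y c 0 = cos c.
Proof.
rewrite /F; apply: cvg_lim => //.
apply: (@cvg_trans _ (cst (cos c) @ \oo)); last exact: cvg_cst.
apply: near_eq_cvg; exists 1%N => // n /= n0.
rewrite /pseries /series/= -(prednK n0) big_nat_recl//= expr0 mulr1.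
rewrite /coef fact0 invr1 mul1r mulr0 add0r big1 ?addr0// => i _.
by rewrite expr0n mulr0.
Qed.

Lemma lim_poisson_cos y c x :
  limn (pseries (fun n => n`!%:R^-1 * cos (y * n%:R + c)) x) =
  expR (x * cos y) * cos (x * sin y + c).
Proof.
rewrite -/(F y c x).
pose A := F y 0; pose B := F y (pi / 2).
have Fc z : F y c z = cos c * A z + sin c * B z.
  by rewrite -[in LHS](add0r c) F_addc add0r.
(* [U] and [V] are the pair [A], [B] transported by the inverse flow exp(- z exp(i y)) of the
   system; they stay at their initial values 1 and 0. *)
pose U z := expR (- (z * cos y)) * (cos (z * sin y) * A z - sin (z * sin y) * B z).
pose V z := expR (- (z * cos y)) * (cos (z * sin y) * B z + sin (z * sin y) * A z).
have dA (z : R) : is_derive z 1 A (cos y * A z + sin y * B z).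
  by apply: is_derive_eq; [exact: dF|rewrite addrC F_addc add0r].
have dB (z : R) : is_derive z 1 B (cos y * B z - sin y * A z).
  apply: is_derive_eq; first exact: dF.
  rewrite addrC F_addc; congr (_ + _); rewrite -mulrN; congr (_ * _).
  have -> : pi / 2 + pi / 2 = 0 + pi :> R by rewrite add0r -splitr.
  by rewrite F_addc cospi sinpi /A; ring.
have dU (z : R) : is_derive z 1 U 0.
  have dAz := dA z; have dBz := dB z.
  apply: is_derive_eq; rewrite /GRing.scale/=; ring.
have dV (z : R) : is_derive z 1 V 0.
  have dAz := dA z; have dBz := dB z.
  apply: is_derive_eq; rewrite /GRing.scale/=; ring.
have U1 : U x = 1.
  rewrite (is_derive_0_is_cst x 0 dU) /U !mul0r oppr0 expR0 cos0 sin0 mul0r.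
  by rewrite subr0 !mul1r /A F0 cos0.
have V0 : V x = 0.
  rewrite (is_derive_0_is_cst x 0 dV) /V !mul0r oppr0 expR0 cos0 sin0 mul0r.
  by rewrite addr0 !mul1r /B F0 cos_pihalf.
rewrite Fc.
have eE : expR (x * cos y) * expR (- (x * cos y)) = 1.
  by rewrite -expRD subrr expR0.
have cs := cos2Dsin2 (x * sin y).
have AE : A x = expR (x * cos y) * (cos (x * sin y) * U x + sin (x * sin y) * V x).
  transitivity ((expR (x * cos y) * expR (- (x * cos y))) *
    (cos (x * sin y) ^+ 2 + sin (x * sin y) ^+ 2) * A x); last by rewrite /U /V; ring.
  by rewrite eE cs !mul1r.
have BE : B x = expR (x * cos y) * (cos (x * sin y) * V x - sin (x * sin y) * U x).
  transitivity ((expR (x * cos y) * expR (- (x * cos y))) *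
    (cos (x * sin y) ^+ 2 + sin (x * sin y) ^+ 2) * B x); last by rewrite /U /V; ring.
  by rewrite eE cs !mul1r.
by rewrite AE BE U1 V0 cosD; ring.
Qed.

Lemma cvg_poisson_cos y c x :
  pseries (fun n => n`!%:R^-1 * cos (y * n%:R + c)) x @ \oo -->
  expR (x * cos y) * cos (x * sin y + c).
Proof. by rewrite -lim_poisson_cos; exact: cvg_coef. Qed.

End PoissonSeries.

(** * Independence and characteristic functions *)

Section Independence.
Context {R : realType} {d : measure_display} {Omega : measurableType d}.
Variable P : probability Omega R.
Implicit Types (A B : set Omega).

(** Both sides are finite measures in [A], a restriction and a multiple of [P]. They agree on a
    pi-system, hence on the sigma-algebra that it generates. *)
Lemma indep_sigma_left (G : set_system Omega) B :
  G `<=` measurable -> setI_closed G -> G setT -> measurable B ->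
  (forall A, G A -> P (A `&` B) = (P A * P B)%E) ->
  forall A, <<s G >> A -> P (A `&` B) = (P A * P B)%E.
Proof.
move=> Gm GI GT mB GP A GA.
have PBfin : P B \is a fin_num by exact: fin_num_measure.
have PB0 : 0 <= fine (P B) by rewrite fine_ge0.
pose m1 : {measure set Omega -> \bar R} := mrestr P mB.
pose m2 : {measure set Omega -> \bar R} := mscale (NngNum PB0) P.
have -> : P (A `&` B) = m1 A by [].
have -> : (P A * P B)%E = m2 A by rewrite /m2/= /mscale/= fineK// muleC.
apply: (g_sigma_algebra_measure_unique G Gm (fun=> setT)) => //.
- by rewrite bigcup_const.
- by move=> C GC; rewrite /m1/m2/= /mscale/= /mrestr/= fineK// muleC GP.
- move=> _; rewrite /m1/= /mrestr/= setTI.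
  by rewrite (le_lt_trans (probability_le1 _ _))// ltry.
Qed.

Lemma indep_sigma (G H : set_system Omega) :
  G `<=` measurable -> setI_closed G -> G setT ->
  H `<=` measurable -> setI_closed H -> H setT ->
  (forall A B, G A -> H B -> P (A `&` B) = (P A * P B)%E) ->
  forall A B, <<s G >> A -> <<s H >> B -> P (A `&` B) = (P A * P B)%E.
Proof.
move=> Gm GI GT Hm HI HT GH A B GA HB.
have sm (K : set_system Omega) : K `<=` measurable -> <<s K >> `<=` measurable.
  by move=> Km; apply: smallest_sub => //; exact: sigma_algebra_measurable.
apply: (indep_sigma_left Gm GI GT _ _ GA); first exact: sm HB.
move=> C GC; rewrite setIC muleC.
apply: (indep_sigma_left Hm HI HT _ _ HB); first exact: Gm.
by move=> D HD; rewrite setIC muleC GH.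
Qed.

Section Blocks.
Variables (I : choiceType) (G : I -> set_system Omega).
Hypothesis sG : forall i, sigma_algebra setT (G i).
Hypothesis mG : forall i, G i `<=` measurable.
Hypothesis iG : mutually_independent P G.

Let cylinder (U : set I) : set_system Omega :=
  [set A | exists (J : {fset I}) (C : I -> set Omega),
     [/\ [set` J] `<=` U, forall i, i \in J -> G i (C i) &
         A = \bigcap_(i in [set` J]) C i]].

Let GI i : setI_closed (G i).
Proof.
rewrite -(sigma_algebra_id (sG i)).
exact: (@measurableI _ (g_sigma_algebraType (G i))).
Qed.

Let GT i : G i setT.
Proof. by have [] := sG i => G0 GC _; rewrite -(setD0 setT); exact: GC. Qed.

Let cylinder_setT U : cylinder U setT.
Proof.
exists fset0, (fun=> setT); split => //.
by apply/seteqP; split.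
Qed.

Let cylinder_setI U : setI_closed (cylinder U).
Proof.
move=> _ _ [J [C [JU GC ->]]] [J' [C' [JU' GC' ->]]].
exists (J `|` J')%fset, (fun i => (if i \in J then C i else setT) `&`
   (if i \in J' then C' i else setT)); split.
- by move=> i /=; rewrite in_fsetU => /orP[/JU|/JU'].
- move=> i _; apply: GI; case: ifPn => // ?; [exact: GC|exact: GC'].
- apply/seteqP; split => [w [wC wC'] i /= _|w wC].
    by split; case: ifPn => // ?; [exact: wC|exact: wC'].
  split => i /= iJ.
    by have := wC i; rewrite /= in_fsetU iJ => /(_ isT)[].
  by have := wC i; rewrite /= in_fsetU iJ orbT => /(_ isT)[].
Qed.

Let cylinder_measurable U : cylinder U `<=` measurable.
Proof.
move=> _ [J [C [JU GC ->]]]; apply: fin_bigcap_measurable => // i iJ.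
by apply: mG; exact: GC.
Qed.

Let cylinder_indep (U V : set I) A B : U `&` V = set0 ->
  cylinder U A -> cylinder V B -> P (A `&` B) = (P A * P B)%E.
Proof.
move=> UV0 [J [C [JU GC ->]]] [J' [C' [JV GC' ->]]].
have dJ i : i \in J -> i \notin J'.
  by move=> iJ; apply/negP => iJ'; move: UV0 => /seteqP[+ _]; apply; split;
    [exact: JU iJ|exact: JV iJ'].
pose D i := if i \in J then C i else C' i.
have -> : \bigcap_(i in [set` J]) C i `&` \bigcap_(i in [set` J']) C' i =
    \bigcap_(i in [set` (J `|` J')%fset]) D i.
  apply/seteqP; split => [w [wC wC'] i|w wD].
    rewrite /= in_fsetU /D; case: ifPn => [iJ _|_ iJ']; first exact: wC.
    exact: wC'.
  split => i /= iJ; have := wD i; rewrite /= in_fsetU iJ ?orbT /D.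
    by rewrite iJ; apply.
  by case: ifPn => [/dJ|_]; [rewrite iJ|apply].
rewrite iG; last first.
  move=> i; rewrite in_fsetU /D; case: ifPn => [iJ _|_ iJ']; first exact: GC.
  exact: GC'.
rewrite !iG//.
have pe : perm_eq (J `|` J')%fset (enum_fset J ++ enum_fset J').
  apply: uniq_perm; first exact: fset_uniq.
    rewrite cat_uniq !fset_uniq /= andbT; apply/hasPn => i iJ'.
    by apply/negP => /dJ; rewrite iJ'.
  by move=> i; rewrite in_fsetU mem_cat.
rewrite (perm_big _ pe)/= big_cat/=; congr (_ * _)%E.
  by apply: eq_big_seq => i iJ; rewrite /D iJ.
by apply: eq_big_seq => i iJ; rewrite /D; case: ifPn => // /dJ; rewrite iJ.
Qed.

(** Finite intersections of events of the [G i] with [i] in a block form a pi-system that generates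
    the sigma-algebra of the block. For disjoint blocks two such intersections merge into a single
    one, to which mutual independence applies. *)
Lemma mutually_independent_blocks (U V : set I) A B : U `&` V = set0 ->
  <<s \bigcup_(i in U) G i >> A -> <<s \bigcup_(i in V) G i >> B ->
  P (A `&` B) = (P A * P B)%E.
Proof.
have sub W : <<s \bigcup_(i in W) G i >> `<=` <<s cylinder W >>.
  apply: smallest_sub; first exact: smallest_sigma_algebra.
  move=> C [i Wi GC]; apply: sub_sigma_algebra.
  exists [fset i]%fset, (fun=> C); split.
  - by move=> j /=; rewrite in_fset1 => /eqP ->.
  - by move=> j; rewrite in_fset1 => /eqP ->.
  - by rewrite set_fset1 bigcap_set1.
move=> UV0 /sub GA /sub GB.
apply: (indep_sigma _ _ _ _ _ _ _ GA GB).
- exact: cylinder_measurable.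
- exact: cylinder_setI.
- exact: cylinder_setT.
- exact: cylinder_measurable.
- exact: cylinder_setI.
- exact: cylinder_setT.
- by move=> C D; exact: cylinder_indep.
Qed.

End Blocks.
End Independence.

Section BoundedExpectation.
Context {R : realType} {d : measure_display} {Omega : measurableType d}.
Variable P : probability Omega R.

Lemma bounded_integrable (f : Omega -> R) (M : R) :
  measurable_fun setT f -> (forall w, `|f w| <= M) ->
  P.-integrable setT (EFin \o f).
Proof.
move=> mf fM; apply: measurable_bounded_integrable => //.
  by rewrite (le_lt_trans (probability_le1 P _))// ltry.
exists M; split; first exact: num_real.
by move=> r Mr w _ /=; rewrite (le_trans (fM w))// ltW.
Qed.

Lemma probability_integral_cst (M : R) : (\int[P]_x M%:E)%E = M%:E.
Proof.
have PT : P setT = 1%E := probability_setT P.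
by rewrite integral_cst// [X in (_ * X)%E]PT mule1.
Qed.

Lemma probability_Rintegral_cst (M : R) : \int[P]_x M = M.
Proof. by rewrite /Rintegral probability_integral_cst. Qed.

(** Shifting a bounded function by its bound makes it nonnegative, so results on nonnegative
    extended integrals transfer to bounded real functions; this identity removes the shift. *)
Lemma probability_integralDcst (f : Omega -> R) (M : R) :
  P.-integrable setT (EFin \o f) ->
  (\int[P]_w (f w + M)%:E)%E = (\int[P]_w f w + M)%:E.
Proof.
move=> intf; rewrite (eq_integral (fun w => (f w)%:E + cst M%:E w)%E)//.
rewrite integralD_EFin//; last exact: finite_measure_integrable_cst.
rewrite [X in (_ + X)%E](_ : _ = M%:E); last exact: probability_integral_cst.
by rewrite EFinD /Rintegral fineK//; exact: (integrable_fin_num _ intf).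
Qed.

Lemma norm_Rintegral_le (f : Omega -> R) (M : R) :
  measurable_fun setT f -> (forall w, `|f w| <= M) ->
  `|\int[P]_w f w| <= M.
Proof.
move=> mf fM; have intf := bounded_integrable mf fM.
apply: le_trans (le_normr_Rintegral _ intf) _ => //.
apply: (@le_trans _ _ (\int[P]_w cst M w)).
  apply: le_Rintegral => //; first exact: integrable_norm.
  exact: finite_measure_integrable_cst.
by rewrite probability_Rintegral_cst.
Qed.

Lemma Rintegral_le_gen (f g : Omega -> R) (M : R) (h : Omega -> R) :
  measurable_fun setT f -> measurable_fun setT g -> measurable_fun setT h ->
  (forall w, `|f w| <= M) -> (forall w, `|g w| <= M) -> (forall w, `|h w| <= M) ->
  (forall w, `|f w - g w| <= h w) ->
  `|\int[P]_w f w - \int[P]_w g w| <= \int[P]_w h w.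
Proof.
move=> mf mg mh fM gM hM fgh.
have intf := bounded_integrable mf fM; have intg := bounded_integrable mg gM.
have inth := bounded_integrable mh hM.
rewrite -RintegralB//.
have intB : P.-integrable setT (EFin \o (fun w => f w - g w)).
  by apply: eq_integrable (integrableB _ intf intg).
apply: le_trans (le_normr_Rintegral _ intB) _ => //.
by apply: le_Rintegral => //; exact: integrable_norm.
Qed.

End BoundedExpectation.

Section IndependentFubini.
Context {R : realType} {d d1 d2 : measure_display}.
Context {Omega : measurableType d} {T1 : measurableType d1} {T2 : measurableType d2}.
Variable P : probability Omega R.
Variables (f : Omega -> T1) (g : Omega -> T2).
Hypotheses (mf : measurable_fun setT f) (mg : measurable_fun setT g).
Hypothesis fg : forall A B, measurable A -> measurable B ->
  P (f @^-1` A `&` g @^-1` B) = (P (f @^-1` A) * P (g @^-1` B))%E.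

(** Independence makes the joint law of [f] and [g] the product of their laws; Tonelli on the
    product is then pulled back to [Omega] in each variable. *)
Lemma indep_integral (psi : T1 * T2 -> \bar R) :
  measurable_fun [set: (T1 * T2)%type] psi -> (forall z, 0 <= psi z)%E ->
  (\int[P]_w psi (f w, g w) = \int[P]_w \int[P]_w' psi (f w, g w'))%E.
Proof.
move=> mpsi psi0.
pose f' : {mfun Omega >-> T1} := mfun_Sub (mem_set mf : f \in mfun).
pose g' : {mfun Omega >-> T2} := mfun_Sub (mem_set mg : g \in mfun).
have mfg : measurable_fun setT (fun w => (f w, g w)).
  exact/measurable_fun_pair.
pose h' : {mfun Omega >-> (T1 * T2)%type} := mfun_Sub (mem_set mfg : _ \in mfun).
transitivity (\int[distribution P h']_z psi z)%E.
  by rewrite ge0_integral_distribution.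
transitivity (\int[distribution P f' \x distribution P g']_z psi z)%E.
  apply: eq_measure_integral => A mA _; apply/esym.
  apply: product_measure_unique => // B C mB mC.
rewrite fubini_tonelli1// ge0_integral_distribution/=; last 2 first.
- exact: measurable_fun_fubini_tonelli_F.
- by move=> y; exact: integral_ge0.
apply: eq_integral => w _ /=.
rewrite /fubini_F ge0_integral_distribution//.
exact/measurableT_comp.
Qed.

Variables (psi : T1 * T2 -> R) (M : R).
Hypothesis mpsi : measurable_fun [set: (T1 * T2)%type] psi.
Hypothesis psiM : forall z, `|psi z| <= M.

Let intsec w : P.-integrable setT (EFin \o (fun w' => psi (f w, g w'))).
Proof.
apply: (@bounded_integrable _ _ _ _ _ M) => //.
by apply: measurableT_comp => //; exact: measurable_fun_pair.
Qed.

Let finsec w : (\int[P]_w' (psi (f w, g w') + M)%:E =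
  (\int[P]_w' psi (f w, g w') + M)%:E)%E.
Proof. exact: probability_integralDcst. Qed.

Lemma measurable_section_integral :
  measurable_fun setT (fun w => \int[P]_w' psi (f w, g w')).
Proof.
rewrite (_ : (fun w => _) = (fun w => fine (\int[P]_w' (psi (f w, g w') + M)%:E) - M)); last first.
  by apply/funext => w; rewrite finsec/= addrK.
apply: measurable_funB => //; apply: measurableT_comp => //.
apply: (@measurable_fun_fubini_tonelli_F _ _ _ _ _ P
   (fun z : Omega * Omega => (psi (f z.1, g z.2) + M)%:E)); last first.
  by move=> z; rewrite lee_fin; have := psiM (f z.1, g z.2); rewrite ler_norml => /andP[? _]; lra.
apply/measurable_EFinP; apply: measurable_funD => //.
apply: measurableT_comp => //; apply: measurable_fun_pair.
  exact: measurableT_comp.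
exact: measurableT_comp.
Qed.

Lemma indep_Rintegral :
  \int[P]_w psi (f w, g w) = \int[P]_w \int[P]_w' psi (f w, g w').
Proof.
have mfg : measurable_fun setT (fun w => (f w, g w)).
  exact/measurable_fun_pair.
have := @indep_integral (fun z => (psi z + M)%:E).
have mpsiM : measurable_fun [set: (T1 * T2)%type] (fun z => (psi z + M)%:E).
  by apply/measurable_EFinP; exact: measurable_funD.
move=> /(_ mpsiM); have psiM0 z : (0 <= (psi z + M)%:E)%E.
  by have := psiM z; rewrite ler_norml lee_fin => /andP[? _]; lra.
move=> /(_ psiM0); under [in RHS]eq_integral do rewrite finsec.
have i1 : P.-integrable setT (EFin \o (fun w => psi (f w, g w))).
  by apply: (@bounded_integrable _ _ _ _ _ (M)) => //; exact: measurableT_comp.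
have i2 : P.-integrable setT (EFin \o (fun w => \int[P]_w' psi (f w, g w'))).
  apply: (@bounded_integrable _ _ _ _ _ (M)) => [|w]; first exact: measurable_section_integral.
  apply: norm_Rintegral_le => //.
  by apply: measurableT_comp => //; exact: measurable_fun_pair.
by rewrite !probability_integralDcst// => -[/addIr].
Qed.

Lemma indep_Rintegral_dist (m e : R) :
  (forall w, `|\int[P]_w' psi (f w, g w') - m| <= e) ->
  `|\int[P]_w psi (f w, g w) - m| <= e.
Proof.
move=> me; rewrite indep_Rintegral -[X in _ - X](probability_Rintegral_cst P m).
have i1 : P.-integrable setT (EFin \o (fun w => \int[P]_w' psi (f w, g w'))).
  apply: (@bounded_integrable _ _ _ _ _ (`|m| + e)) => [|w].
    exact: measurable_section_integral.
  by rewrite -[X in `|X|](subrK m) (le_trans (ler_normD _ _))// addrC lerD2l.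
have i2 : P.-integrable setT (EFin \o (fun _ : Omega => m)).
  by apply: (@bounded_integrable _ _ _ _ _ `|m|).
rewrite -(@RintegralB _ _ _ P setT _ _ measurableT i1 i2).
apply: norm_Rintegral_le => //; apply: measurable_funB => //.
exact: measurable_section_integral.
Qed.

End IndependentFubini.

Section CosineTransform.
Context {R : realType} {d : measure_display} {Omega : measurableType d}.
Variable P : probability Omega R.
Implicit Types (Y : Omega -> R) (r phi c : R).

(** A real form of E exp(i Y) = r exp(i phi): the free phase [c] carries the real and the imaginary
    part at once. *)
Definition has_cf Y (r phi : R) : Prop :=
  forall c, \int[P]_w cos (Y w + c) = r * cos (phi + c).

Lemma measurable_cos_comp d' (T : measurableType d') (Y : T -> R) c :
  measurable_fun setT Y -> measurable_fun setT (fun w => cos (Y w + c)).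
Proof.
move=> mY; apply: (measurableT_comp (f := @cos R)).
  by apply: continuous_measurable_fun; exact: continuous_cos.
exact: measurable_funD.
Qed.

Lemma has_cf0 : has_cf (fun=> 0) 1 0.
Proof.
by move=> c; rewrite mul1r add0r probability_Rintegral_cst.
Qed.

Lemma has_cf_addc Y r phi a : has_cf Y r phi -> has_cf (fun w => Y w + a) r (phi + a).
Proof.
by move=> h c; under eq_Rintegral do rewrite -addrA; rewrite h addrA.
Qed.

Lemma eq_has_cf Y Z r phi : Y =1 Z -> has_cf Y r phi -> has_cf Z r phi.
Proof. by move=> /funext ->. Qed.

(** For a frozen outcome of [Y], the number [Y w + c] is just another phase for [Z]; this is where
    the quantification over phases is needed. *)
Lemma has_cfD Y Z r phi s psi :
  measurable_fun setT Y -> measurable_fun setT Z ->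
  (forall A B : set R, measurable A -> measurable B ->
     P (Y @^-1` A `&` Z @^-1` B) = (P (Y @^-1` A) * P (Z @^-1` B))%E) ->
  has_cf Y r phi -> has_cf Z s psi ->
  has_cf (fun w => Y w + Z w) (r * s) (phi + psi).
Proof.
move=> mY mZ YZ hY hZ c.
have mpsi : measurable_fun [set: (R * R)%type] (fun z => cos (z.1 + z.2 + c)).
  by apply: (@measurable_cos_comp _ (R * R)%type); exact: measurable_funD.
rewrite (indep_Rintegral (M := 1) mY mZ YZ mpsi)/=; last by move=> z; exact: cos_max.
under eq_Rintegral => w _.
  rewrite (_ : \int[P]__ _ = s * cos (Y w + (psi + c))); last first.
    rewrite (_ : _ * _ = s * cos (psi + (Y w + c))); last by rewrite addrCA.
    by rewrite -hZ; apply: eq_Rintegral => w' _; rewrite addrCA addrA.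
  over.
rewrite RintegralZl//; last first.
  apply: (@bounded_integrable _ _ _ _ _ 1); first exact: measurable_cos_comp.
  by move=> w; exact: cos_max.
by rewrite hY mulrCA mulrA addrA.
Qed.

(** The cosine is 1-Lipschitz, so L1 convergence of the variables, measured by [e], gives
    convergence of the expectations for every phase. *)
Lemma has_cf_cvg (Yn : nat -> Omega -> R) Y (rn phin e : nat -> R) r phi :
  (forall n, measurable_fun setT (Yn n)) -> measurable_fun setT Y ->
  (forall n, has_cf (Yn n) (rn n) (phin n)) ->
  (forall n, (\int[P]_w `|Yn n w - Y w|%:E <= (e n)%:E)%E) ->
  e @ \oo --> (0 : R) -> rn @ \oo --> r -> phin @ \oo --> phi ->
  has_cf Y r phi.
Proof.
move=> mYn mY hY YnY e0 rnr phinphi c.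
have lim1 : (fun n => rn n * cos (phin n + c)) @ \oo --> r * cos (phi + c).
  apply: cvgM => //; apply: continuous_cvg; first exact: continuous_cos.
  by apply: cvgD => //; exact: cvg_cst.
have lim2 : (fun n => \int[P]_w cos (Yn n w + c)) @ \oo --> \int[P]_w cos (Y w + c).
  apply/cvgrPdist_le => eps eps0; near=> n.
  have intY (Z : Omega -> R) : measurable_fun setT Z ->
      P.-integrable setT (EFin \o (fun w => cos (Z w + c))).
    move=> mZ; apply: (@bounded_integrable _ _ _ _ _ 1).
      exact: measurable_cos_comp.
    by move=> w; exact: cos_max.
  have mdist : measurable_fun setT (fun w => `|Yn n w - Y w|%:E).
    apply/measurable_EFinP; apply: measurableT_comp => //.
    exact: measurable_funB.
  rewrite distrC -RintegralB; [|by []|exact: intY|exact: intY].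
  rewrite -lee_fin EFin_normr_Rintegral//; last first.
    by apply: eq_integrable (integrableB _ (intY _ (mYn n)) (intY _ mY)).
  apply: (@le_trans _ _ (\int[P]_w `|Yn n w - Y w|%:E)%E).
    apply: le_trans (le_abse_integral _ _ _) _ => //.
      apply/measurable_EFinP.
      by apply: measurable_funB; exact: measurable_cos_comp.
    apply: ge0_le_integral => //.
    - apply/measurable_EFinP; apply: measurableT_comp => //.
      by apply: measurable_funB; exact: measurable_cos_comp.
    - move=> w _; rewrite lee_fin (le_trans (norm_cosB_le _ _))//.
      by rewrite opprD addrACA subrr addr0.
  apply: le_trans (YnY n) _; rewrite lee_fin.
  near: n; have /cvgrPdist_le /(_ _ eps0) := e0; apply: filterS => n.
  by rewrite sub0r normrN; apply: le_trans; exact: ler_norm.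
have E : (fun n => \int[P]_w cos (Yn n w + c)) = (fun n => rn n * cos (phin n + c)).
  by apply/funext => n; exact: hY.
rewrite E in lim2; exact: cvg_unique lim2 lim1.
Unshelve. all: by end_near.
Qed.

Lemma le_limn_einf (u v : nat -> \bar R) : (forall n, (u n <= v n)%E) ->
  (limn_einf u <= limn_einf v)%E.
Proof.
move=> uv; rewrite !limn_einf_lim; apply: lee_lim; [exact: is_cvg_einfs..|].
apply: nearW => n; apply: le_ereal_inf_tmp => _ [p /= np <-].
apply: le_trans (uv p); apply: ereal_inf_lbound; by exists p.
Qed.

(** The functions 2 m^2 (1 - cos(Y / m)) converge to Y^2, and the hypothesis at 1/m keeps their
    integrals below 2 v + 2 C / m^2. Fatou's lemma then bounds the second moment without knowing in
    advance that it is finite. *)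
Lemma second_moment_cf Y (v C : R) : measurable_fun setT Y -> 0 <= v -> 0 <= C ->
  (forall u, \int[P]_w (1 - cos (u * Y w)) <= u ^+ 2 * v + C * u ^+ 4) ->
  (\int[P]_w (Y w ^+ 2)%:E <= (2 * v)%:E)%E.
Proof.
move=> mY v0 C0 hY.
pose f n w : \bar R := (2 * n.+1%:R ^+ 2 * (1 - cos (n.+1%:R^-1 * Y w)))%:E.
have mf1 n : measurable_fun setT (fun w => 1 - cos (n.+1%:R^-1 * Y w)).
  apply: measurable_funB => //; under eq_fun do rewrite -[_ * _]addr0.
  by apply: measurable_cos_comp; exact: measurable_funM.
have mf n : measurable_fun setT (f n).
  by apply/measurable_EFinP; apply: measurable_funM => //.
have f0 n w : setT w -> (0 <= f n w)%E.
  by move=> _; rewrite lee_fin mulr_ge0 ?mulr_ge0 ?sqr_ge0// subr_ge0 cos_le1.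
have fY w : f ^~ w @ \oo --> (Y w ^+ 2)%:E.
  apply: cvg_EFin; first by apply: nearW => n.
  apply/cvgrPdist_le => eps eps0.
  have h n : `|Y w ^+ 2 - 2 * n.+1%:R ^+ 2 * (1 - cos (n.+1%:R^-1 * Y w))| <=
      2 * Y w ^+ 4 * n.+1%:R^-1.
    have := norm_cosB1D_le (n.+1%:R^-1 * Y w).
    set q : R := n.+1%:R; set x := cos _ => hx.
    have q0 : 0 < q by rewrite /q.
    have -> : Y w ^+ 2 - 2 * q ^+ 2 * (1 - x) =
        2 * q ^+ 2 * (x - 1 + (q^-1 * Y w) ^+ 2 / 2).
      by field; rewrite gt_eqF.
    rewrite normrM ger0_norm ?mulr_ge0 ?sqr_ge0//.
    apply: (@le_trans _ _ (2 * q ^+ 2 * (q^-1 * Y w) ^+ 4)).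
      by rewrite ler_wpM2l ?mulr_ge0 ?sqr_ge0.
    have -> : 2 * q ^+ 2 * (q^-1 * Y w) ^+ 4 = 2 * Y w ^+ 4 * q^-1 * q^-1.
      by field; rewrite gt_eqF.
    have y4 : 0 <= Y w ^+ 4 by exact: exprn_even_ge0.
    rewrite ler_piMr//; last by rewrite invf_le1// /q ler1n.
    apply: mulr_ge0; last by rewrite invr_ge0 ltW.
    exact: mulr_ge0.
  have := @cvg_harmonic R; move=> /(cvgM (cvg_cst (2 * Y w ^+ 4)))/cvgrPdist_le.
  rewrite mulr0 => /(_ _ eps0); apply: filterS => n /=.
  rewrite sub0r normrN => hn; apply: le_trans (h n) _.
  exact: le_trans (ler_norm _) hn.
have -> : (\int[P]_w (Y w ^+ 2)%:E = \int[P]_w limn_einf (f^~ w))%E.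
  apply: eq_integral => w _; apply/esym.
  by have /cvg_limn_einf_sup[] := fY w.
apply: le_trans (fatou _ _ _ _) _ => //.
have fle n : (\int[P]_w f n w <= (2 * v + 2 * C * n.+1%:R^-1)%:E)%E.
  rewrite /f; set q : R := n.+1%:R.
  have q0 : 0 < q by rewrite /q.
  have intf : P.-integrable setT (EFin \o (fun w => 1 - cos (q^-1 * Y w))).
    apply: (@bounded_integrable _ _ _ _ _ 2) => [|w]; first exact: mf1.
    have := cos_max (q^-1 * Y w); rewrite !ler_norml => /andP[? ?].
    by apply/andP; split; lra.
  under eq_integral do rewrite EFinM.
  rewrite integralZl// -[X in (_ * X)%E]fineK; last exact: integrable_fin_num.
  rewrite -EFinM lee_fin.
  have := hY q^-1; rewrite /Rintegral.
  move=> /(ler_wpM2l (_ : 0 <= 2 * q ^+ 2)).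
  move=> /(_ (mulr_ge0 _ (sqr_ge0 _))) h; apply: le_trans (h _) _ => //.
  have -> : 2 * q ^+ 2 * (q^-1 ^+ 2 * v + C * q^-1 ^+ 4) = 2 * v + 2 * C * q^-1 * q^-1.
    by field; rewrite gt_eqF.
  rewrite lerD2l ler_piMr ?mulr_ge0 ?invr_ge0 ?(ltW q0)//.
  by rewrite invf_le1// /q ler1n.
have gl : (fun n => (2 * v + 2 * C * n.+1%:R^-1)%:E) @ \oo --> (2 * v)%:E.
  apply: cvg_EFin; first by apply: nearW => n.
  have := @cvg_harmonic R => /(cvgM (cvg_cst (2 * C))).
  by move=> /(cvgD (cvg_cst (2 * v))); rewrite mulr0 addr0.
have /cvg_limn_einf_sup[<- _] := gl.
exact: le_limn_einf.
Qed.

Lemma chebyshev_second_moment Y (v eps : R) : measurable_fun setT Y -> 0 < eps ->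
  (\int[P]_w (Y w ^+ 2)%:E <= v%:E)%E ->
  (P [set w | (eps < `|Y w|)%R] <= (v / eps ^+ 2)%:E)%E.
Proof.
move=> mY eps0 hY.
have mS : measurable [set w | eps < `|Y w|].
  rewrite -[X in measurable X]setTI; apply: measurable_fun_ltr => //.
  exact: measurableT_comp.
have : (\int[P]_(w in [set w | (eps < `|Y w|)%R]) (cst (eps ^+ 2)%:E w) <=
    \int[P]_w (Y w ^+ 2)%:E)%E.
  apply: (@le_trans _ _ (\int[P]_(w in [set w | (eps < `|Y w|)%R]) (Y w ^+ 2)%:E)%E); last first.
    apply: ge0_subset_integral => //; last by move=> w _; rewrite lee_fin sqr_ge0.
    apply/measurable_EFinP; exact: measurable_funX.
  apply: ge0_le_integral => //.
  - by move=> w _; rewrite lee_fin sqr_ge0.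
  - by apply/measurable_EFinP; apply: measurable_funTS; exact: measurable_funX.
  - move=> w /= hw; rewrite lee_fin -[leRHS]real_normK ?num_real//.
    by rewrite lerXn2r// ?nnegrE// ltW.
rewrite integral_cst// => h; have h2 := le_trans h hY.
have {}h2 : ((eps ^+ 2)%:E * P [set w | (eps < `|Y w|)%R] <= v%:E)%E := h2.
have [r pr] : exists r, P [set w | (eps < `|Y w|)%R] = r%:E.
  by exists (fine (P [set w | (eps < `|Y w|)%R])); rewrite fineK// fin_num_measure.
move: h2; rewrite pr -EFinM !lee_fin => h2; by rewrite ler_pdivlMr ?exprn_gt0// mulrC.
Qed.

End CosineTransform.

(** * Weak convergence from characteristic functions *)

Section Bernstein.
Context {R : realType}.
Implicit Types (s : R) (m k : nat) (F : nat -> R).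

(** The binomial weights C(m, k) s^k (1 - s)^(m - k), obtained by conditioning on one trial. With
    this recursion the sums against them, and the closure of trigonometric polynomials under them,
    follow by induction on [m]. *)
Fixpoint bernstein m s k : R :=
  if m is m'.+1 then
    (if k is k'.+1 then s * bernstein m' s k' else 0) + (1 - s) * bernstein m' s k
  else (k == 0%N)%:R.

Lemma bernstein_ge0 m s k : 0 <= s <= 1 -> 0 <= bernstein m s k.
Proof.
move=> /andP[s0 s1]; elim: m k => [|m IH] k /=; first by rewrite ler0n.
by rewrite addr_ge0// ?mulr_ge0 ?subr_ge0//; case: k => // k; rewrite mulr_ge0.
Qed.

Lemma bernstein_gt m s k : (m < k)%N -> bernstein m s k = 0.
Proof.
elim: m k => [|m IH] [|k] //= mk; first by rewrite !IH ?mulr0 ?addr0// ltnW.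
Qed.

Lemma bernstein_sumS m s F :
  \sum_(k < m.+2) F k * bernstein m.+1 s k =
  s * (\sum_(k < m.+1) F k.+1 * bernstein m s k) +
  (1 - s) * (\sum_(k < m.+1) F k * bernstein m s k).
Proof.
under eq_bigr do rewrite /= mulrDr.
rewrite big_split/=; congr (_ + _).
  rewrite big_ord_recl/= mulr0 add0r mulr_sumr.
  by apply: eq_bigr => i _; rewrite /bump/= mulrCA.
rewrite big_ord_recr/= bernstein_gt// !mulr0 addr0 mulr_sumr.
by apply: eq_bigr => i _; rewrite mulrCA.
Qed.

Lemma bernstein_sum1 m s : \sum_(k < m.+1) bernstein m s k = 1.
Proof.
transitivity (\sum_(k < m.+1) (fun=> 1 : R) (nat_of_ord k) * bernstein m s k).
  by apply: eq_bigr => k _; rewrite mul1r.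
elim: m => [|m IH]; first by rewrite big_ord_recl big_ord0 /= mul1r addr0.
by rewrite (bernstein_sumS m s (fun=> 1)) IH; ring.
Qed.

(** The centre [a] is arbitrary for the sake of the induction: a success in one trial turns [a] into
    [a - 1]. The variance is the case where [a] is the mean. *)
Lemma bernstein_var m s a :
  \sum_(k < m.+1) (k%:R - a) ^+ 2 * bernstein m s k =
  m%:R * (s * (1 - s)) + (m%:R * s - a) ^+ 2.
Proof.
elim: m a => [|m IH] a.
  by rewrite big_ord_recl big_ord0 /=; ring.
rewrite (bernstein_sumS m s (fun k => (k%:R - a) ^+ 2)) IH.
rewrite (_ : \sum_(k < m.+1) (k.+1%:R - a) ^+ 2 * _ =
    \sum_(k < m.+1) (k%:R - (a - 1)) ^+ 2 * bernstein m s k); last first.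
  by apply: eq_bigr => k _; congr (_ ^+ 2 * _); rewrite -natr1; ring.
by rewrite IH -natr1; ring.
Qed.

(** Chebyshev's inequality for the binomial law, with the variance factor [s * (1 - s)] bounded by
    1. *)
Lemma bernstein_tail m s (dl : R) : 0 <= s <= 1 -> 0 < dl ->
  \sum_(k < m.+2 | dl <= `|k%:R / m.+1%:R - s|) bernstein m.+1 s k <=
  (m.+1%:R * dl ^+ 2)^-1.
Proof.
move=> s01 dl0; have m0 : 0 < m.+1%:R :> R by [].
have V := bernstein_var m.+1 s (m.+1%:R * s).
rewrite subrr expr0n addr0 in V.
have : (m.+1%:R * dl) ^+ 2 *
    \sum_(k < m.+2 | dl <= `|k%:R / m.+1%:R - s|) bernstein m.+1 s k <= m.+1%:R.
  apply: (@le_trans _ _ (m.+1%:R * (s * (1 - s)))); last first.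
    rewrite ler_piMr//; have /andP[? ?] := s01; nra.
  rewrite -V mulr_sumr big_mkcond/=; apply: ler_sum => k _.
  have b0 := bernstein_ge0 m.+1 k s01.
  case: ifPn => [h|_]; last by rewrite mulr_ge0// sqr_ge0.
  rewrite ler_wpM2r// -[leRHS]real_normK ?num_real// lerXn2r// ?nnegrE//.
    by rewrite mulr_ge0// ltW.
  have -> : k%:R - m.+1%:R * s = m.+1%:R * (k%:R / m.+1%:R - s) :> R.
    by field; rewrite gt_eqF.
  by rewrite normrM gtr0_norm// ler_pM2l.
rewrite -ler_pdivlMl ?exprn_gt0 ?mulr_gt0// => /le_trans; apply.
by rewrite le_eqVlt; apply/orP; left; apply/eqP; field; rewrite !gt_eqF.
Qed.

End Bernstein.

Section TrigPolynomials.
Context {R : realType} {d : nat}.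
Implicit Types (x u : 'cV[R]_d) (f g : 'cV[R]_d -> R).

Definition dot u x : R := \sum_i u i ord0 * x i ord0.

Lemma dotDl u v x : dot (u + v) x = dot u x + dot v x.
Proof. by rewrite /dot -big_split/=; apply: eq_bigr => i _; rewrite mxE mulrDl. Qed.

Lemma dotNl u x : dot (- u) x = - dot u x.
Proof. by rewrite /dot -sumrN; apply: eq_bigr => i _; rewrite mxE mulNr. Qed.

Lemma dot0l x : dot 0 x = 0.
Proof. by rewrite /dot big1// => i _; rewrite mxE mul0r. Qed.

Lemma dot_delta a i x : dot (a *: delta_mx i ord0) x = a * x i ord0.
Proof.
rewrite /dot (bigD1 i)//= !mxE !eqxx mulr1 big1 ?addr0// => j /negPf ji.
by rewrite !mxE ji mulr0 mul0r.
Qed.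

(** Each triple holds an amplitude, a frequency and a phase. Phases cover the sines, make the class
    closed under products, and let expectations be computed term by term from characteristic
    functions. *)
Definition trig_polynomial f : Prop :=
  exists s : seq (R * 'cV[R]_d * R),
    f = (fun x => \sum_(p <- s) p.1.1 * cos (dot p.1.2 x + p.2)).

Lemma trig_monomial a u c : trig_polynomial (fun x => a * cos (dot u x + c)).
Proof. by exists [:: (a, u, c)]; apply/funext => x; rewrite big_seq1. Qed.

Lemma trig_cst a : trig_polynomial (fun=> a).
Proof.
exists [:: (a, 0, 0)]; apply/funext => x.
by rewrite big_seq1/= dot0l add0r cos0 mulr1.
Qed.

Lemma trig_add f g : trig_polynomial f -> trig_polynomial g ->
  trig_polynomial (fun x => f x + g x).
Proof.
move=> [s ->] [t ->]; exists (s ++ t); apply/funext => x.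
by rewrite big_cat.
Qed.

Lemma trig_sum (I : Type) (r : seq I) (P : pred I) (F : I -> 'cV[R]_d -> R) :
  (forall i, P i -> trig_polynomial (F i)) ->
  trig_polynomial (fun x => \sum_(i <- r | P i) F i x).
Proof.
move=> h; elim: r => [|i r IH].
  by under eq_fun do rewrite big_nil; exact: trig_cst.
under eq_fun do rewrite big_cons.
case Pi: (P i) => //; by apply: trig_add => //; exact: h.
Qed.

Lemma trig_mul f g : trig_polynomial f -> trig_polynomial g ->
  trig_polynomial (fun x => f x * g x).
Proof.
move=> [s ->] [t ->].
under eq_fun do rewrite big_distrlr/=.
apply: trig_sum => p _; apply: trig_sum => q _.
have cc a b : cos a * cos b = 2^-1 * cos (a + b) + 2^-1 * cos (a - b) :> R.
  by rewrite cosD cosB; field.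
rewrite (_ : (fun x => _) = (fun x =>
    (p.1.1 * q.1.1 / 2) * cos (dot (p.1.2 + q.1.2) x + (p.2 + q.2)) +
    (p.1.1 * q.1.1 / 2) * cos (dot (p.1.2 - q.1.2) x + (p.2 - q.2)))).
  by apply: trig_add; exact: trig_monomial.
apply/funext => x; rewrite mulrACA cc mulrDr !mulrA.
by congr (_ * cos _ + _ * cos _); rewrite ?dotDl ?dotNl; ring.
Qed.

Lemma trig_prod (I : Type) (r : seq I) (P : pred I) (F : I -> 'cV[R]_d -> R) :
  (forall i, P i -> trig_polynomial (F i)) ->
  trig_polynomial (fun x => \prod_(i <- r | P i) F i x).
Proof.
move=> h; elim: r => [|i r IH].
  by under eq_fun do rewrite big_nil; exact: trig_cst.
under eq_fun do rewrite big_cons.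
case Pi: (P i) => //; by apply: trig_mul => //; exact: h.
Qed.

Lemma trig_sin_coord a i : trig_polynomial (fun x => sin (a * x i ord0)).
Proof.
rewrite (_ : (fun x => _) =
    fun x => 1 * cos (dot (a *: delta_mx i ord0) x + - (pi / 2))).
  exact: trig_monomial.
by apply/funext => x; rewrite mul1r dot_delta cosBpihalf.
Qed.

Lemma trig_bernstein m k f : trig_polynomial f ->
  trig_polynomial (fun x => bernstein m (f x) k).
Proof.
move=> tf; elim: m k => [|m IH] k /=; first exact: trig_cst.
apply: trig_add.
  by case: k => [|k]; [exact: trig_cst|exact: trig_mul].
apply: trig_mul => //; apply: trig_add; first exact: trig_cst.
rewrite (_ : (fun x => _) = (fun x => -1 * f x)); last first.
  by apply/funext => x; rewrite mulN1r.
by apply: trig_mul => //; exact: trig_cst.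
Qed.

Lemma measurable_dot d' (T : measurableType d') (W : T -> 'cV[R]_d) u :
  (forall i, measurable_fun setT (fun w => W w i ord0)) ->
  measurable_fun setT (fun w => dot u (W w)).
Proof.
move=> mW; apply: measurable_sum => i; exact: measurable_funM.
Qed.

Lemma measurable_trig d' (T : measurableType d') (W : T -> 'cV[R]_d) f :
  (forall i, measurable_fun setT (fun w => W w i ord0)) ->
  trig_polynomial f -> measurable_fun setT (fun w => f (W w)).
Proof.
move=> mW [s ->]; apply: measurable_sum => p; apply: measurable_funM => //.
exact/measurable_cos_comp/measurable_dot.
Qed.

End TrigPolynomials.

Section MatrixContinuity.
Context {R : realType}.

Lemma cvg_mx_coord (T : Type) (F : set_system T) {FF : Filter F} m n
    (g : T -> 'M[R]_(m, n)) (l : 'M[R]_(m, n)) :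
  (forall i j, g x i j @[x --> F] --> l i j) -> g x @[x --> F] --> l.
Proof.
move=> h; apply/cvg_ballP => e e0.
have : \forall x \near F, forall i j, ball (l i j) e (g x i j).
  apply: filter_forall => i; apply: filter_forall => j.
  by have /cvg_ballP := h i j; exact.
by apply: filterS.
Qed.

(** Only [s] is confined to [K]; the nearby point [y] may lie outside, as the nodes of a Bernstein
    polynomial do. Accordingly continuity is used only at points of [K], but as functions on the
    ambient space. *)
Lemma compact_uniform_modulus (U : pseudoMetricType R) (K : set U) (phi : U -> R) :
  compact K -> (forall x, K x -> {for x, continuous phi}) ->
  forall eps : R, 0 < eps -> exists2 dl : R, 0 < dl &
    forall s y, K s -> ball s dl y -> `|phi y - phi s| < eps.
Proof.
move=> /compact_near_coveringP cK cphi eps eps0.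
pose Q (dl : R) s := forall y, ball s dl y -> `|phi y - phi s| < eps.
have /cK : forall x, K x -> \forall x' \near x & dl \near (0 : R)^'+, Q dl x'.
  move=> x Kx; have /cvgrPdist_lt /(_ (eps / 2)) := cphi x Kx.
  rewrite divr_gt0// => /(_ isT) /nbhs_ballP[r /= r0 hr].
  near=> x' dl => y x'y.
  have h1 : ball x (r / 2) x' by near: x'; apply: nbhsx_ballx; rewrite divr_gt0.
  have dr : dl < r / 2 by near: dl; apply: nbhs_right_lt; rewrite divr_gt0.
  have h2 : ball x r y.
    rewrite [r]splitr; apply: ball_triangle h1 _.
    by apply: le_ball x'y; exact: ltW.
  have {}h1 : ball x r x' by apply: le_ball h1; rewrite ler_pdivrMr// ler_peMr ?ltW// ltr1n.
  have := hr _ h1; have := hr _ h2; rewrite /= => a b.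
  rewrite [eps]splitr -(subrK (phi x) (phi y)) -addrA.
  by rewrite (le_lt_trans (ler_normD _ _))// ltrD// distrC.
move=> KQ; near (0 : R)^'+ => dl.
exists dl => // s y Ks; move: s Ks y.
by near: dl.
Unshelve. all: end_near. Qed.

End MatrixContinuity.

Section TrigApproximation.
Context {R : realType} {d : nat}.
Variables (f : 'cV[R]_d -> R) (M : R).
Hypotheses (cf : continuous f) (fM : forall x, `|f x| <= M).

(* A function on the cube is a function of the variables
   [(1 + sin (kappa x_i)) / 2], whose Bernstein polynomials are trigonometric
   polynomials bounded by [M] on the whole space. *)
Lemma trig_approximation (L eps : R) : 0 < L -> 0 < eps ->
  exists p : 'cV[R]_d -> R, [/\ trig_polynomial p, forall x, `|p x| <= M &
    forall x : 'cV[R]_d, (forall i, `|x i ord0| <= L) -> `|p x - f x| <= eps].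
Proof.
move=> L0 eps0.
(* This scale sends [-L, L] into [-pi/4, pi/4], where [sin] is inverted by [asin] and the new
   variables stay away from 0 and 1. *)
pose kappa : R := pi / 4 / L.
have k0 : 0 < kappa by rewrite !divr_gt0// pi_gt0.
pose sg (t : R) : R := (1 + sin (kappa * t)) / 2.
have sg01 t : 0 <= sg t <= 1.
  rewrite /sg; have := sin_le1 (kappa * t); have := sin_geN1 (kappa * t).
  by move=> ? ?; apply/andP; split; lra.
(* [X] inverts the change of variables on the cube. Continuity of [phi] is available on [K], where
   the argument of [asin] remains strictly between -1 and 1. *)
pose X (s : 'rV[R]_d) : 'cV[R]_d := \col_i (asin (2 * s ord0 i - 1) / kappa).
pose phi s := f (X s).
pose K : set 'rV[R]_d := [set s | forall i, `[sg (- L), sg L]%classic (s ord0 i)].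
have cK : compact K by apply: (@rV_compact R d (fun=> `[sg (- L), sg L]%classic)) => i; exact: segment_compact.
have kL : kappa * L = pi / 4 by rewrite /kappa; field; rewrite gt_eqF.
have pi0 := pi_gt0 R.
have sgL : sg L < 1.
  rewrite /sg kL ltr_pdivrMr// mul1r -[ltRHS]/(1 + 1) ltrD2l.
  rewrite -[ltRHS](@sin_pihalf R) ltr_sin ?in_itv/=; lra.
have sgNL : 0 < sg (- L).
  rewrite /sg mulrN kL sinN divr_gt0// subr_gt0.
  rewrite -[ltRHS](@sin_pihalf R) ltr_sin ?in_itv/=; lra.
have cphi s : K s -> {for s, continuous phi}.
  move=> Ks; apply: continuous_comp; last exact: cf.
  apply: (@cvg_mx_coord R _ (nbhs s) _ _ _ X (X s)) => i j; rewrite (_ : (fun x => _) =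
    (fun x : 'rV[R]_d => asin (2 * x ord0 i - 1) / kappa)); last first.
    by apply/funext => x; rewrite mxE.
  rewrite mxE; apply: cvgM; last exact: cvg_cst.
  apply: (@continuous_cvg _ _ _ _ _ (fun x : 'rV[R]_d => 2 * x ord0 i - 1) (@asin R)).
    apply: continuous_asin; have := Ks i; rewrite /= in_itv/= => /andP[? ?].
    by apply/andP; split; lra.
  apply: cvgB; last exact: cvg_cst.
  by apply: cvgM; [exact: cvg_cst|exact: coord_continuous].
have [dl dl0 hdl] := compact_uniform_modulus cK cphi (divr_gt0 eps0 (ltr0Sn _ 1)).
have M0 : 0 <= M by rewrite (le_trans _ (fM 0)).
(* Large enough for the weight of the far grid points, at most d / ((N + 1) dl^2), times the
   oscillation 2 M to stay below eps / 2. *)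
pose N := Num.truncn (4 * (M + 1) * d%:R / (dl ^+ 2 * eps)).
have mN : 2 * M * (d%:R * (N.+1%:R * dl ^+ 2)^-1) <= eps / 2.
  have hN : 4 * (M + 1) * d%:R / (dl ^+ 2 * eps) < N.+1%:R.
    by rewrite truncnS_gt// divr_ge0 ?mulr_ge0 ?sqr_ge0 ?addr_ge0 ?(ltW eps0).
  have N0 : 0 < N.+1%:R :> R by [].
  move: hN; rewrite ltr_pdivrMr ?mulr_gt0 ?exprn_gt0// => hN.
  rewrite mulrA ler_pdivrMr ?mulr_gt0 ?exprn_gt0//.
  have d0 : 0 <= d%:R :> R by [].
  nra.
pose pt (j : {ffun 'I_d -> 'I_N.+2}) : 'rV[R]_d :=
  \row_i ((j i)%:R / N.+1%:R).
pose wt (j : {ffun 'I_d -> 'I_N.+2}) (x : 'cV[R]_d) : R :=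
  \prod_i bernstein N.+1 (sg (x i ord0)) (j i).
have wt0 j x : 0 <= wt j x by apply: prodr_ge0 => i _; exact: bernstein_ge0.
have wt1 x : \sum_j wt j x = 1.
  rewrite /wt -(bigA_distr_bigA (fun i k => bernstein N.+1 (sg (x i ord0)) (nat_of_ord k)))/=.
  by rewrite big1// => i _; exact: bernstein_sum1.
have wtm (x : 'cV[R]_d) i0 (Q : pred 'I_N.+2) :
    \sum_(j : {ffun 'I_d -> 'I_N.+2} | Q (j i0)) wt j x =
    \sum_(k < N.+2 | Q k) bernstein N.+1 (sg (x i0 ord0)) k.
  rewrite big_mkcond/=.
  (* The condition on coordinate [i0] becomes a factor 0 or 1, so that the sum of products
     distributes over the coordinates; all other coordinates sum to 1. *)
  transitivity (\sum_(j : {ffun 'I_d -> 'I_N.+2}) \prod_i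
      (bernstein N.+1 (sg (x i ord0)) (j i) *
       (if (i == i0) && ~~ Q (j i) then 0 else 1))).
    apply: eq_bigr => j _; rewrite big_split/= -/(wt j x).
    rewrite (bigD1 i0)//= eqxx/= big1 ?mulr1.
      by case: ifP => _; rewrite ?mulr1 ?mulr0.
    by move=> i /negPf ->.
  rewrite -(bigA_distr_bigA (fun i k => bernstein N.+1 (sg (x i ord0)) (nat_of_ord k) *
       (if (i == i0) && ~~ Q k then 0 else 1)))/=.
  rewrite (bigD1 i0)//= [X in _ * X]big1 ?mulr1.
    rewrite [RHS]big_mkcond/=; apply: eq_bigr => k _; rewrite eqxx/=.
    by case: (Q k); rewrite ?mulr1 ?mulr0.
  move=> i /negPf ni; rewrite -[RHS](bernstein_sum1 N.+1 (sg (x i ord0))).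
  by apply: eq_bigr => k _; rewrite ni mulr1.
exists (fun x => \sum_j phi (pt j) * wt j x); split.
- apply: trig_sum => j _; apply: trig_mul; first exact: trig_cst.
  apply: trig_prod => i _; apply: trig_bernstein.
  rewrite /sg; apply: trig_mul; last exact: trig_cst.
  by apply: trig_add; [exact: trig_cst|exact: trig_sin_coord].
- move=> x; rewrite (le_trans (ler_norm_sum _ _ _))//.
  rewrite -[leRHS]mulr1 -(wt1 x) mulr_sumr; apply: ler_sum => j _.
  rewrite normrM (ger0_norm (wt0 _ _)).
  by apply: ler_wpM2r; [exact: wt0|exact: fM].
- move=> x xL.
  pose s : 'rV[R]_d := \row_i sg (x i ord0).
  have xq i : - (pi / 4) <= kappa * x i ord0 <= pi / 4.
    by rewrite -ler_norml normrM gtr0_norm// -kL ler_pM2l.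
  have Ks : K s.
    move=> i; rewrite /= in_itv/= mxE /sg !ler_pM2r ?invr_gt0// !lerD2l.
    have /andP[? ?] := xq i.
    by rewrite !leNgt !ltr_sin -?leNgt ?in_itv/= ?mulrN ?kL; lra.
  have phis : phi s = f x.
    congr f; apply/matrixP => i j; rewrite !mxE !ord1.
    have -> : 2 * sg (x i ord0) - 1 = sin (kappa * x i ord0) by rewrite /sg; field.
    rewrite sinK; last by have /andP[? ?] := xq i; rewrite in_itv/=; lra.
    by field; rewrite gt_eqF.
  rewrite -phis -[X in _ - X]mulr1 -(wt1 x) mulr_sumr -sumrB.
  under eq_bigr do rewrite -mulrBl.
  apply: le_trans (ler_norm_sum _ _ _) _.
  under eq_bigr do rewrite normrM (ger0_norm (wt0 _ _)).
  (* A grid point far from [s] is far in some coordinate: there the one-dimensional tail bound is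
     used, with values differing by at most 2 M. At the other grid points the modulus of continuity
     gives eps / 2. *)
  pose far (i : 'I_d) (j : {ffun 'I_d -> 'I_N.+2}) : bool :=
    dl <= `|(j i)%:R / N.+1%:R - sg (x i ord0)|.
  apply: (@le_trans _ _ (\sum_j (eps / 2 * wt j x +
     \sum_(i < d) (if far i j then 2 * M * wt j x else 0)))).
    apply: ler_sum => j _.
    have [/existsP[i fi]|/existsPn nf] := boolP [exists i, far i j].
      have far0 i' : 0 <= (if far i' j then 2 * M * wt j x else 0).
        by case: ifP => // _; rewrite !mulr_ge0.
      rewrite (bigD1 i)//= fi.
      apply: (@le_trans _ _ (2 * M * wt j x)).
        rewrite ler_wpM2r// (le_trans (ler_normB _ _))//.
        by rewrite -[2 * M]/((1 + 1) * M) mulrDl mul1r; apply: lerD; exact: fM.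
      rewrite addrCA lerDl addr_ge0//; last exact: sumr_ge0.
      by rewrite mulr_ge0// divr_ge0// ltW.
    rewrite big1 ?addr0; last by move=> i _; rewrite (negbTE (nf i)).
    rewrite ler_wpM2r// ltW// hdl//; split=> // i' i; rewrite !mxE !ord1 /ball/= distrC.
    by have := nf i; rewrite -ltNge.
  rewrite big_split/= -mulr_sumr wt1 mulr1 [leRHS]splitr lerD2l.
  rewrite exchange_big/=; apply: le_trans mN.
  set q := (N.+1%:R * dl ^+ 2)^-1.
  have -> : 2 * M * (d%:R * q) = \sum_(i < d) 2 * M * q.
    by rewrite sumr_const card_ord -[RHS]mulr_natl; ring.
  apply: ler_sum => i _.
  rewrite -big_mkcond/= -mulr_sumr ler_wpM2l ?mulr_ge0//.
  rewrite (wtm x i (fun k => dl <= `|(nat_of_ord k)%:R / N.+1%:R - sg (x i ord0)|)).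
  exact: bernstein_tail.
Qed.

End TrigApproximation.

Section WeakConvergence.
Context {R : realType} {d : nat}.

(** Measurability of a random vector is expressed by its coordinates. The composite with [f] is the
    pointwise limit of trigonometric polynomials of [W], the one of index n being accurate to 1/(n +
    1) on a cube that eventually contains [W w]. *)
Lemma measurable_continuous_bounded d' (T : measurableType d')
    (W : T -> 'cV[R]_d) (f : 'cV[R]_d -> R) (M : R) :
  (forall i, measurable_fun setT (fun w => W w i ord0)) ->
  continuous f -> (forall x, `|f x| <= M) ->
  measurable_fun setT (fun w => f (W w)).
Proof.
move=> mW cf fM.
have H n : exists p : 'cV[R]_d -> R, trig_polynomial p /\
    forall x : 'cV[R]_d, (forall i, `|x i ord0| <= n.+1%:R) -> `|p x - f x| <= n.+1%:R^-1.
  have n0 : 0 < n.+1%:R^-1 :> R by rewrite invr_gt0.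
  have [p [tp _ hp]] := @trig_approximation R d f M cf fM n.+1%:R n.+1%:R^-1 (ltr0Sn _ _) n0.
  by exists p.
have [p hp] := choice H.
apply: (@measurable_fun_cvg _ _ _ _ (fun n w => p n (W w))).
- by move=> n; apply: measurable_trig => //; have [] := hp n.
- move=> w _; apply/cvgrPdist_le => e e0; near=> n.
  rewrite distrC (le_trans ((hp n).2 (W w) _))//.
    move=> i; apply: (@le_trans _ _ (\sum_j `|W w j ord0|)).
      by rewrite (bigD1 i)//= lerDl sumr_ge0.
    near: n; exists (Num.truncn (\sum_j `|W w j ord0|)) => // n /= hn.
    rewrite ltW// (@lt_le_trans _ _ (Num.truncn (\sum_j `|W w j ord0|)).+1%:R)//.
      by rewrite truncnS_gt// sumr_ge0.
    by rewrite ler_nat ltnS.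
  near: n; have := @cvg_harmonic R => /cvgrPdist_le /(_ _ e0).
  apply: filterS => n; rewrite sub0r normrN /harmonic/=; apply: le_trans.
  exact: ler_norm.
Unshelve. all: end_near. Qed.

Variables (dO : measure_display) (Omega : measurableType dO).
Variables (P : probability Omega R).
Variables (dQ : measure_display) (OmegaQ : measurableType dQ).
Variables (Q : probability OmegaQ R).
Variables (Y : nat -> Omega -> 'cV[R]_d) (W : OmegaQ -> 'cV[R]_d).
Hypothesis mY : forall n i, measurable_fun setT (fun w => Y n w i ord0).
Hypothesis mW : forall i, measurable_fun setT (fun w => W w i ord0).

Definition tight : Prop := forall eta : R, 0 < eta -> exists L : R,
  \forall n \near \oo, forall i, (P [set w | (L < `|Y n w i ord0|)%R] <= eta%:E)%E.

(** Inside the cube the two functions differ by at most [e]; outside, on an event of probability at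
    most d eta, by at most 2 M. It is essential that [p] obeys the bound [M] on the whole space. *)
Lemma integral_approx_cube d' (T : measurableType d') (P' : probability T R)
    (Z : T -> 'cV[R]_d) (f p : 'cV[R]_d -> R) (M L e eta : R) :
  (forall i, measurable_fun setT (fun w => Z w i ord0)) ->
  measurable_fun setT (fun w => f (Z w)) ->
  measurable_fun setT (fun w => p (Z w)) -> 0 <= e ->
  (forall x, `|f x| <= M) -> (forall x, `|p x| <= M) ->
  (forall x : 'cV[R]_d, (forall i, `|x i ord0| <= L) -> `|p x - f x| <= e) ->
  (forall i, (P' [set w | (L < `|Z w i ord0|)%R] <= eta%:E)%E) ->
  `|\int[P']_w f (Z w) - \int[P']_w p (Z w)| <= e + 2 * M * (d%:R * eta).
Proof.
move=> mZ mf mp e0 fM pM pf tail.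
have M0 : 0 <= M by rewrite (le_trans _ (fM 0)).
pose A i := [set w | L < `|Z w i ord0|].
have mA i : measurable (A i).
  rewrite -[A i]setTI; apply: measurable_fun_ltr => //.
  exact: measurableT_comp.
pose h w : R := e + \sum_i 2 * M * \1_(A i) w.
have h0 w i : 0 <= 2 * M * \1_(A i) w by rewrite mulr_ge0 ?mulr_ge0.
have mh1 i : measurable_fun setT (fun w => 2 * M * (\1_(A i) w : R)).
  by apply: measurable_funM => //; exact: measurable_indic.
have mh : measurable_fun setT h.
  by apply: measurable_funD => //; exact: measurable_sum.
have hM w : `|h w| <= e + d%:R * (2 * M).
  rewrite ger0_norm ?addr_ge0 ?sumr_ge0// lerD2l.
  have -> : d%:R * (2 * M) = \sum_(i < d) 2 * M.
    by rewrite sumr_const card_ord mulr_natl.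
  by apply: ler_sum => i _; rewrite ler_piMr ?mulr_ge0// indicE lern1 leq_b1.
have Mle : M <= e + d%:R * (2 * M) + M by rewrite lerDr addr_ge0 ?mulr_ge0.
have hMM : e + d%:R * (2 * M) <= e + d%:R * (2 * M) + M by rewrite lerDl.
apply: (@le_trans _ _ (\int[P']_w h w)).
  apply: (@Rintegral_le_gen _ _ _ P' _ _ (e + d%:R * (2 * M) + M)) => //.
  - by move=> w; rewrite (le_trans (fM _)).
  - by move=> w; rewrite (le_trans (pM _)).
  - by move=> w; rewrite (le_trans (hM _)).
  move=> w; have [/existsP[i Ai]|/existsPn nA] := boolP [exists i, L < `|Z w i ord0|].
    rewrite /h (bigD1 i)//= indicE mem_set// mulr1.
    apply: (@le_trans _ _ (2 * M)).
      rewrite (le_trans (ler_normB _ _))//.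
      by rewrite -[2 * M]/((1 + 1) * M) mulrDl mul1r lerD.
    by rewrite addrCA lerDl addr_ge0// sumr_ge0.
  rewrite distrC (le_trans (pf _ _))//; first by move=> i; rewrite leNgt.
  by rewrite lerDl sumr_ge0.
have inth : P'.-integrable setT (EFin \o h) by exact: bounded_integrable hM.
rewrite -lee_fin /Rintegral fineK; last exact: (integrable_fin_num _ inth).
rewrite (eq_integral (fun w => cst e%:E w + \sum_i (2 * M * \1_(A i) w)%:E))%E; last first.
  by move=> w _; rewrite /h EFinD sumEFin.
rewrite ge0_integralD//; last 2 first.
- by move=> w _; apply: sume_ge0 => i _; rewrite lee_fin.
- by apply: emeasurable_sum => i; exact/measurable_EFinP.
rewrite [X in (X + _)%E](_ : _ = e%:E); last exact: probability_integral_cst.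
rewrite EFinD leeD2l// ge0_integral_sum//; last 2 first.
- by move=> i; exact/measurable_EFinP.
- by move=> i w _; rewrite lee_fin.
have -> : 2 * M * (d%:R * eta) = \sum_(i < d) 2 * M * eta.
  by rewrite sumr_const card_ord -[RHS]mulr_natl; ring.
rewrite -sumEFin; apply: lee_sum => i _.
under eq_integral do rewrite EFinM.
rewrite ge0_integralZl_EFin ?mulr_ge0//; last first.
  by apply/measurable_EFinP; exact: measurable_indic.
rewrite integral_indic// setIT [leRHS]EFinM.
by apply: lee_wpmul2l; [rewrite lee_fin mulr_ge0|exact: tail].
Qed.

(** A single law is tight: the tail events of each coordinate decrease to the empty set, and
    finitely many coordinates can share one level. *)
Lemma tail_bound d' (T : measurableType d') (P' : probability T R)
    (Z : T -> 'cV[R]_d) (eta : R) :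
  (forall i, measurable_fun setT (fun w => Z w i ord0)) -> 0 < eta ->
  exists L : R, forall i, (P' [set w | (L < `|Z w i ord0|)%R] <= eta%:E)%E.
Proof.
move=> mZ eta0.
pose A i (n : nat) := [set w | n%:R < `|Z w i ord0|].
have mA i n : measurable (A i n).
  rewrite -[A i n]setTI; apply: measurable_fun_ltr => //.
  exact: measurableT_comp.
have H i : \forall n \near \oo, (P' (A i n) <= eta%:E)%E.
  have : P' (A i n) @[n --> \oo] --> P' (\bigcap_n A i n).
    apply: nonincreasing_cvg_mu => //.
    - by rewrite (le_lt_trans (probability_le1 P' _))// ltry.
    - exact: bigcapT_measurable.
    - move=> m n mn; apply/subsetPset => w /=; apply: le_lt_trans.
      by rewrite ler_nat.
  have -> : \bigcap_n A i n = set0.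
    apply/seteqP; split => // w /(_ (Num.truncn `|Z w i ord0|).+1 I) /=.
    by rewrite /A/= ltNge ltW// truncnS_gt.
  rewrite measure0 => /fine_cvgP[fin /cvgrPdist_le /(_ _ eta0)].
  move=> le; near=> n.
  have fn : P' (A i n) \is a fin_num by near: n.
  rewrite -(fineK fn) lee_fin.
  have : `|0 - fine (P' (A i n))| <= eta by near: n.
  by rewrite sub0r normrN; apply: le_trans; exact: ler_norm.
have HH : \forall n \near \oo, forall i, (P' (A i n) <= eta%:E)%E.
  exact: filter_forall.
have [n hn] := filter_ex HH.
by exists n%:R.
Unshelve. all: end_near. Qed.

Lemma trig_bounded (p : 'cV[R]_d -> R) : trig_polynomial p ->
  exists B, forall x, `|p x| <= B.
Proof.
move=> [s ->]; exists (\sum_(q <- s) `|q.1.1|) => x.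
rewrite (le_trans (ler_norm_sum _ _ _))//; apply: ler_sum => q _.
by rewrite normrM ler_piMr// cos_max.
Qed.

Lemma cf_cvg_trig (p : 'cV[R]_d -> R) :
  (forall u c, \int[P]_w cos (dot u (Y n w) + c) @[n --> \oo] -->
     \int[Q]_w cos (dot u (W w) + c)) ->
  trig_polynomial p -> \int[P]_w p (Y n w) @[n --> \oo] --> \int[Q]_w p (W w).
Proof.
move=> H [s ->].
pose ps s' := fun x : 'cV[R]_d => \sum_(q <- s') (q.1.1 : R) * cos (dot q.1.2 x + q.2).
have int d' (T : measurableType d') (P' : probability T R) (Z : T -> 'cV[R]_d) s' :
    (forall i, measurable_fun setT (fun w => Z w i ord0)) ->
    P'.-integrable setT (EFin \o (fun w => ps s' (Z w))).
  move=> mZ; have tp : trig_polynomial (ps s') by exists s'.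
  have [B hB] := trig_bounded tp.
  by apply: (@bounded_integrable _ _ _ _ _ B) => //; exact: measurable_trig.
have intc d' (T : measurableType d') (P' : probability T R) (Z : T -> 'cV[R]_d) a u c :
    (forall i, measurable_fun setT (fun w => Z w i ord0)) ->
    P'.-integrable setT (EFin \o (fun w => a * cos (dot u (Z w) + c))).
  move=> mZ; have := int _ _ P' Z [:: (a, u, c)] mZ.
  by rewrite /ps; under eq_fun do rewrite big_seq1.
have intc1 d' (T : measurableType d') (P' : probability T R) (Z : T -> 'cV[R]_d) u c :
    (forall i, measurable_fun setT (fun w => Z w i ord0)) ->
    P'.-integrable setT (EFin \o (fun w => cos (dot u (Z w) + c))).
  move=> mZ; have := intc _ _ P' Z 1 u c mZ.
  by under eq_fun do rewrite mul1r.
rewrite -/(ps s); elim: s => [|q s IH].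
  rewrite (_ : \int[Q]_w _ = 0); last first.
    by under eq_Rintegral do rewrite /ps big_nil; exact: probability_Rintegral_cst.
  rewrite (_ : (fun n => _) = fun=> 0); first exact: cvg_cst.
  apply/funext => n.
  by under eq_Rintegral do rewrite /ps big_nil; exact: probability_Rintegral_cst.
have E d' (T : measurableType d') (P' : probability T R) (Z : T -> 'cV[R]_d) :
    (forall i, measurable_fun setT (fun w => Z w i ord0)) ->
    \int[P']_w ps (q :: s) (Z w) =
    q.1.1 * \int[P']_w cos (dot q.1.2 (Z w) + q.2) + \int[P']_w ps s (Z w).
  move=> mZ; rewrite -RintegralZl//; last exact: intc1.
  rewrite -RintegralD//; [|exact: intc|exact: int].
  by apply: eq_Rintegral => w _; rewrite /ps big_cons.
rewrite E// (_ : (fun n => _) = (fun n =>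
   q.1.1 * \int[P]_w cos (dot q.1.2 (Y n w) + q.2) + \int[P]_w ps s (Y n w))); last first.
  by apply/funext => n; exact: E.
by apply: cvgD IH; apply: cvgM (H _ _); exact: cvg_cst.
Qed.

Lemma cf_weak_convergence (f : 'cV[R]_d -> R) (M : R) :
  (forall u c, \int[P]_w cos (dot u (Y n w) + c) @[n --> \oo] -->
     \int[Q]_w cos (dot u (W w) + c)) ->
  tight -> continuous f -> (forall x, `|f x| <= M) ->
  \int[P]_w f (Y n w) @[n --> \oo] --> \int[Q]_w f (W w).
Proof.
move=> H tY cf fM; apply/cvgrPdist_le => eps eps0.
have M0 : 0 <= M by rewrite (le_trans _ (fM 0)).
(* With this [eta] the tails contribute 2 M d eta, at most eps / 4; the increments by one avoid a
   zero denominator. The three errors add up to 7 eps / 8. *)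
pose eta := eps / 4 / (2 * (M + 1) * d.+1%:R).
have den0 : 0 < 2 * (M + 1) * d.+1%:R by rewrite !mulr_gt0// ltr_wpDl.
have eta0 : 0 < eta by rewrite !divr_gt0.
have [L1 HL1] := tY _ eta0.
have [L2 HL2] := tail_bound Q mW eta0.
pose L := `|L1| + `|L2| + 1.
have L0 : 0 < L by rewrite ltr_wpDl// addr_ge0.
have L1L : L1 <= L by rewrite (le_trans (ler_norm _))// /L -addrA lerDl addr_ge0.
have L2L : L2 <= L by rewrite (le_trans (ler_norm _))// /L addrAC lerDr addr_ge0.
have e4 : 0 < eps / 8 by rewrite divr_gt0.
have [p [tp pM pf]] := trig_approximation cf fM L0 e4.
have hq : eps / 8 + 2 * M * (d%:R * eta) <= 3 * eps / 8.
  have : 2 * M * (d%:R * eta) <= eps / 4.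
    rewrite (_ : _ * _ = 2 * M * d%:R / (2 * (M + 1) * d.+1%:R) * (eps / 4)).
      rewrite ler_piMl ?divr_ge0 ?(ltW eps0)// ler_pdivrMr// mul1r.
      by rewrite ler_pM ?mulr_ge0// ?ler_wpM2l ?lerDl// ler_nat.
    by rewrite /eta; ring.
  lra.
have mono a b d' (T : measurableType d') (P' : probability T R) (Z : T -> R) :
    measurable_fun setT Z -> a <= b ->
    (P' [set w | (b < `|Z w|)%R] <= P' [set w | (a < `|Z w|)%R])%E.
  move=> mZ ab.
  have mS c : measurable [set w | c < `|Z w|].
    rewrite -[X in measurable X]setTI; apply: measurable_fun_ltr => //.
    exact: measurableT_comp.
  by apply: le_measure; rewrite ?inE// => w /=; apply: le_lt_trans.
have WQ : `|\int[Q]_w f (W w) - \int[Q]_w p (W w)| <= 3 * eps / 8.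
  apply: le_trans hq; apply: (@integral_approx_cube _ _ Q W f p M L) => //.
  - exact: measurable_continuous_bounded cf fM.
  - exact: measurable_trig.
  - exact: ltW.
  - by move=> i; apply: le_trans (HL2 i); exact: mono.
have /cvgrPdist_le /(_ _ e4) Hp := cf_cvg_trig H tp.
near=> n.
have YP : `|\int[P]_w f (Y n w) - \int[P]_w p (Y n w)| <= 3 * eps / 8.
  apply: le_trans hq; apply: (@integral_approx_cube _ _ P (Y n) f p M L) => //.
  - exact: measurable_continuous_bounded cf fM.
  - exact: measurable_trig.
  - exact: ltW.
  - move=> i; apply: (@le_trans _ _ (P [set w | (L1 < `|Y n w i ord0|)%R])).
      exact: mono.
    by move: i; near: n.
have PQ : `|\int[Q]_w p (W w) - \int[P]_w p (Y n w)| <= eps / 8 by near: n.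
have h1 := ler_distD (\int[Q]_w p (W w)) (\int[Q]_w f (W w)) (\int[P]_w f (Y n w)).
have h2 := ler_distD (\int[P]_w p (Y n w)) (\int[Q]_w p (W w)) (\int[P]_w f (Y n w)).
by rewrite (distrC (\int[P]_w p (Y n w)) (\int[P]_w f (Y n w))) in h2; lra.
Unshelve. all: end_near. Qed.

End WeakConvergence.

(** * The multivariate normal distribution *)

Section MixtureIntegral.
Context {R : realType} {d1 d2 : measure_display}.
Context {T1 : measurableType d1} {T2 : measurableType d2}.
Variables (mu : {measure set T1 -> \bar R}) (kappa : T1 -> {measure set T2 -> \bar R}).
Variable nu : {measure set T2 -> \bar R}.
Hypothesis mkappa : forall A, measurable A -> measurable_fun setT (fun w => kappa w A).
Hypothesis nuE : forall A, measurable A -> (nu A = \int[mu]_w kappa w A)%E.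

Import HBNNSimple.

Let integral_mixture_nnsfun (g : {nnsfun T2 >-> R}) :
  (\int[nu]_x (g x)%:E = \int[mu]_w \int[kappa w]_x (g x)%:E)%E.
Proof.
have E (m : {measure set T2 -> \bar R}) : (\int[m]_x (g x)%:E =
    \sum_(r \in range g) r%:E * m (g @^-1` [set r]))%E.
  under eq_integral do rewrite fimfunE -fsumEFin//.
  rewrite ge0_integral_fsum//; last 2 first.
  - move=> r; apply/measurable_EFinP; exact: measurable_funM.
  - by move=> r z _; rewrite EFinM nnfun_muleindic_ge0.
  apply: eq_fsbigr => r _.
  by rewrite (integralZl_indic _ (fun r => g @^-1` [set r]))//; 
    [rewrite integral_indic// setIT|move=> r0; rewrite preimage_nnfun0].
rewrite E; under [in RHS]eq_integral do rewrite E.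
rewrite ge0_integral_fsum//; last 2 first.
- by move=> r; apply: measurable_funeM; exact: mkappa.
- move=> r w _; have := mulemu_ge0 (fun n => g @^-1` [set n]); apply.
  exact: preimage_nnfun0.
apply: eq_fsbigr => r _; rewrite nuE//.
have [r0|r0] := leP 0 r.
  by rewrite ge0_integralZl//; exact: mkappa.
rewrite preimage_nnfun0// !integral0_eq ?mule0// => w _; by rewrite measure0 ?mule0.
Qed.

(** True for simple functions by the formula for [nu], then for monotone limits. It serves twice:
    for measures with a density and for the mean of a random measure. *)
Lemma integral_mixture (f : T2 -> \bar R) :
  measurable_fun setT f -> (forall x, 0 <= f x)%E ->
  (\int[nu]_x f x = \int[mu]_w \int[kappa w]_x f x)%E.
Proof.
move=> mf f0; pose g := nnsfun_approx measurableT mf.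
have gf x : (g n x)%:E @[n --> \oo] --> f x by exact: cvg_nnsfun_approx.
have mg n : measurable_fun setT (fun x => (g n x)%:E) by exact/measurable_EFinP.
have g0 n x : setT x -> (0 <= (g n x)%:E)%E by rewrite lee_fin.
have ndg x : setT x -> nondecreasing_seq (fun n => (g n x)%:E).
  by move=> _ a b ab; rewrite lee_fin; exact/lefP/nd_nnsfun_approx.
have MC (m : {measure set T2 -> \bar R}) :
    (\int[m]_x (g n x)%:E)%E @[n --> \oo] --> (\int[m]_x f x)%E.
  have := @cvg_monotone_convergence _ _ _ m setT measurableT _ mg g0 ndg.
  by under eq_integral do rewrite (cvg_lim _ (gf _))//.
have mk n : measurable_fun setT (fun w => \int[kappa w]_x (g n x)%:E)%E.
  by apply: measurable_fun_integral_kernel => // x; rewrite lee_fin.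
have L := @cvg_monotone_convergence _ _ _ mu setT measurableT _ mk.
have l1 : (\int[mu]_w \int[kappa w]_x (g n x)%:E)%E @[n --> \oo] -->
    (\int[mu]_w \int[kappa w]_x f x)%E.
  have {}L := L _ _; rewrite (_ : (\int[mu]_w \int[kappa w]_x f x)%E =
    (\int[mu]_w limn (fun n => \int[kappa w]_x (g n x)%:E))%E); last first.
    by apply: eq_integral => w _; rewrite (cvg_lim _ (MC _)).
  apply: L.
  - by move=> n w _; apply: integral_ge0 => x _; rewrite lee_fin.
  - move=> w _ a b ab; apply: ge0_le_integral => //.
    + by move=> x _; rewrite lee_fin.
    + by move=> x _; exact: ndg.
have := MC nu.
under eq_fun do rewrite integral_mixture_nnsfun.
by move=> h; apply: (cvg_unique _ h l1).
Qed.

End MixtureIntegral.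

Section Density.
Context {R : realType} {d : measure_display} {T : measurableType d}.
Variables (mu nu : {measure set T -> \bar R}) (rho : T -> R).

(** A measure with density [rho] is a mixture of Dirac masses at [x] weighted by [rho x]. *)
Lemma integral_density (f : T -> \bar R) :
  measurable_fun setT rho -> (forall x, 0 <= rho x) ->
  (forall A, measurable A -> (nu A = \int[mu]_(x in A) (rho x)%:E)%E) ->
  measurable_fun setT f -> (forall x, 0 <= f x)%E ->
  (\int[nu]_x f x = \int[mu]_x ((rho x)%:E * f x))%E.
Proof.
move=> mrho rho0 nuE mf f0.
pose kappa x : {measure set T -> \bar R} := mscale (NngNum (rho0 x)) \d_x.
have kE x A : (kappa x A = (rho x)%:E * (\1_A x)%:E)%E.
  by rewrite /kappa/= /mscale/= diracE indicE.
rewrite (@integral_mixture _ _ _ _ _ mu kappa)//.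
- apply: eq_integral => x _; rewrite ge0_integral_mscale//.
  by rewrite integral_dirac// diracT mul1e.
- move=> A mA; under eq_fun do rewrite kE.
  by apply/measurable_EFinP; apply: measurable_funM => //; exact: measurable_indic.
- move=> A mA; rewrite nuE// integral_mkcond; apply: eq_integral => x _.
  by rewrite kE /patch indicE; case: (x \in A); rewrite ?mule1 ?mule0.
Qed.

End Density.

Section RealIntegrability.
Context {R : realType} {d : measure_display} {T : measurableType d}.
Variables (mu : {measure set T -> \bar R}) (D : set T).
Hypothesis mD : measurable D.
Implicit Types (f g : T -> R).

Lemma le_integrable_real f g : measurable_fun D f ->
  (forall x, D x -> `|f x| <= g x) -> mu.-integrable D (EFin \o g) ->
  mu.-integrable D (EFin \o f).
Proof.
move=> mf fg; apply: le_integrable => //; first exact/measurable_EFinP.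
by move=> x Dx; rewrite /= lee_fin (le_trans (fg x Dx))// ler_norm.
Qed.

Lemma integrable_mul_bounded f g (B : R) : measurable_fun D g ->
  (forall x, D x -> `|g x| <= B) -> mu.-integrable D (EFin \o f) ->
  mu.-integrable D (EFin \o (fun x => g x * f x)).
Proof.
move=> mg gB intf; have mf : measurable_fun D f.
  by apply/measurable_EFinP; exact: measurable_int intf.
apply: (@le_integrable_real _ (fun x => B * `|f x|)).
- exact: measurable_funM.
- by move=> x Dx; rewrite normrM ler_wpM2r// gB.
- have := integrableZl mD B (integrable_norm intf).
  by apply: eq_integrable => // x _; rewrite /= EFinM.
Qed.

Lemma integrableZ_real f (k : R) : mu.-integrable D (EFin \o f) ->
  mu.-integrable D (EFin \o (fun x => k * f x)).
Proof.
by move=> /(integrableZl mD k); apply: eq_integrable.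
Qed.

Lemma integrableB_real f g : mu.-integrable D (EFin \o f) ->
  mu.-integrable D (EFin \o g) -> mu.-integrable D (EFin \o (fun x => f x - g x)).
Proof. by move=> intf intg; have := integrableB mD intf intg; apply: eq_integrable. Qed.

Lemma integrableD_real f g : mu.-integrable D (EFin \o f) ->
  mu.-integrable D (EFin \o g) -> mu.-integrable D (EFin \o (fun x => f x + g x)).
Proof. by move=> intf intg; have := integrableD mD intf intg; apply: eq_integrable. Qed.

Lemma Rintegral_cvg_sets (F : nat -> set T) f :
  (forall n, measurable (F n)) -> (forall n, F n `<=` D) ->
  {ae mu, forall x, D x -> \forall n \near \oo, F n x} ->
  mu.-integrable D (EFin \o f) ->
  \int[mu]_(x in F n) f x @[n --> \oo] --> \int[mu]_(x in D) f x.
Proof.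
move=> mF FD FT intf.
have mf : measurable_fun D f by apply/measurable_EFinP; exact: measurable_int intf.
have E n : \int[mu]_(x in F n) f x = \int[mu]_(x in D) (f \_ (F n)) x.
  by rewrite -Rintegral_mkcondr setIidr.
rewrite (_ : (fun n => _) = (fun n => \int[mu]_(x in D) (f \_ (F n)) x)); last first.
  by apply/funext => n; exact: E.
apply: fine_cvg.
rewrite [X in _ --> X]fineK; last exact: integrable_fin_num intf.
have := @dominated_convergence _ _ _ mu D mD (fun n x => ((f \_ (F n)) x)%:E)
  (EFin \o f) (EFin \o (fun x => `|f x|)).
move=> [].
- move=> n; apply/measurable_EFinP; apply/measurable_restrict => //.
  by rewrite setIidr//; exact: measurable_funS mf.
- exact/measurable_EFinP.
- apply: filterS FT => x h Dx; apply: cvg_EFin; first exact: nearW.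
  apply: (@cvg_trans _ (cst (f x) @ \oo)); last exact: cvg_cst.
  apply: near_eq_cvg; have := h Dx; apply: filterS => n Fn.
  by rewrite /= patchE mem_set.
- exact: integrable_norm.
- apply: aeW => x n Dx; rewrite /= lee_fin patchE; case: ifP => // _.
  by rewrite normr0.
- by [].
Qed.

End RealIntegrability.

Section RintegralTransfer.
Context {R : realType}.

Lemma Rintegral_density d (T : measurableType d) (mu nu : {measure set T -> \bar R})
    (rho h : T -> R) :
  measurable_fun setT rho -> (forall x, 0 <= rho x) ->
  (forall A, measurable A -> (nu A = \int[mu]_(x in A) (rho x)%:E)%E) ->
  measurable_fun setT h ->
  \int[nu]_x h x = \int[mu]_x (h x * rho x).
Proof.
move=> mrho rho0 nuE mh; rewrite /Rintegral; congr fine.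
rewrite integralE [RHS]integralE; congr (_ - _)%E.
  rewrite (integral_density mrho rho0 nuE)//; last first.
    by apply: measurable_funepos; exact/measurable_EFinP.
  apply: eq_integral => x _; rewrite !funeposE /= -!EFin_max -EFinM.
  by congr EFin; rewrite maxr_pMr// mulr0 mulrC.
rewrite (integral_density mrho rho0 nuE)//; last first.
  by apply: measurable_funeneg; exact/measurable_EFinP.
apply: eq_integral => x _; rewrite !funenegE /= -!EFin_max -EFinM.
by congr EFin; rewrite maxr_pMr// mulr0 mulrN mulrC.
Qed.

Let shift (a : R) : measurableTypeR R -> measurableTypeR R := fun z => a + z.

Let measurable_shift a : measurable_fun [set: measurableTypeR R] (shift a).
Proof. exact: (@measurable_funD _ _ R). Qed.

Let nu a : {measure set (measurableTypeR R) -> \bar R} :=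
  measure_function_pushforward__canonical__measure_function_Measure
    lebesgue_measure (measurable_shift a).

Lemma lebesgue_measure_shift (a : R) (A : set (measurableTypeR R)) : measurable A ->
  lebesgue_measure A = lebesgue_measure ((shift a) @^-1` A).
Proof.
move=> mA.
apply: (@lebesgue_measure_unique R (nu a)) => // _ [[x y] _ <-].
rewrite /nu/= /pushforward/=.
rewrite (_ : _ @^-1` _ = `]x - a, y - a]%classic); last first.
  by apply/seteqP; split => z /=; rewrite !in_itv/= ltrBlDl lerBrDl.
by rewrite !lebesgue_measure_itv/= !lte_fin ltrD2r -!EFinB opprB addrA subrK.
Qed.

Let integral_lebesgue_shift (a : R) (h : measurableTypeR R -> \bar R) :
  measurable_fun [set: measurableTypeR R] h -> (forall x, 0 <= h x)%E ->
  (\int[lebesgue_measure]_x h x = \int[lebesgue_measure]_z h (shift a z))%E.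
Proof.
move=> mh h0.
have := @ge0_integral_pushforward _ _ _ _ R (shift a) (measurable_shift a) lebesgue_measure setT h measurableT mh (fun x _ => h0 x).
rewrite preimage_setT => <-.
apply: eq_measure_integral => A mA _; exact: lebesgue_measure_shift.
Qed.

Lemma Rintegral_lebesgue_shift (a : R) (h : R -> R) : measurable_fun [set: R] h ->
  \int[lebesgue_measure]_x h x = \int[lebesgue_measure]_z h (a + z).
Proof.
move=> mh; rewrite /Rintegral; congr fine.
rewrite integralE [RHS]integralE; congr (_ - _)%E.
  rewrite [LHS](@integral_lebesgue_shift a (fun x => (EFin \o h)^\+ x)%E) => //.
    by apply: eq_integral => x _; rewrite !funeposE.
  by apply: measurable_funepos; exact/measurable_EFinP.
rewrite [LHS](@integral_lebesgue_shift a (fun x => (EFin \o h)^\- x)%E) => //.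
  by apply: eq_integral => x _; rewrite !funenegE.
by apply: measurable_funeneg; exact/measurable_EFinP.
Qed.

Lemma Rintegral_prod_bounded d1 d2 (T1 : measurableType d1) (T2 : measurableType d2)
    (P1 : probability T1 R) (P2 : probability T2 R) (psi : T1 * T2 -> R) (M : R) :
  measurable_fun [set: (T1 * T2)%type] psi -> (forall z, `|psi z| <= M) ->
  \int[(P1 \x P2)%E]_z psi z = \int[P1]_x \int[P2]_y psi (x, y).
Proof.
move=> mpsi psiM.
have intpsi : (P1 \x P2)%E.-integrable [set: (T1 * T2)%type] (EFin \o psi).
  exact: (@bounded_integrable _ _ _ (P1 \x P2)%E psi M).
have := integral12_prod_meas1 intpsi; rewrite /Rintegral => <-.
congr fine; apply: eq_integral => x _; rewrite fineK//.
have : P2.-integrable setT (EFin \o (fun y => psi (x, y))).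
  by apply: (@bounded_integrable _ _ _ _ _ M) => //; exact: measurableT_comp.
by move=> /integrable_fin_num -> //.
Qed.

End RintegralTransfer.

Section NormalCosine.
Context {R : realType}.
Variable s : R.
Hypothesis s0 : 0 < s.
Notation mu := lebesgue_measure.

Let phi := normal_pdf 0 s : R -> R.

Let phiE x : phi x = normal_peak s * expR (- x ^+ 2 / (s ^+ 2 *+ 2)).
Proof. by rewrite /phi normal_pdfE ?gt_eqF// /normal_fun subr0. Qed.

Let phi0 x : 0 <= phi x. Proof. exact: normal_pdf_ge0. Qed.

Let mphi : measurable_fun setT phi. Proof. exact: measurable_normal_pdf. Qed.

Let int_phi : mu.-integrable [set: R] (EFin \o phi).
Proof. exact: integrable_normal_pdf. Qed.

Let is_derive_phi (x : R) : is_derive x 1 phi (- (x / s ^+ 2) * phi x).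
Proof.
have -> : phi = (fun x => normal_peak s * expR (- x ^+ 2 / (s ^+ 2 *+ 2))).
  by apply/funext => y; exact: phiE.
apply: is_derive_eq; rewrite /GRing.scale/=; field; by rewrite gt_eqF.
Qed.

Let int_bounded_phi (g : R -> R) (B : R) : measurable_fun setT g -> (forall x, `|g x| <= B) ->
  mu.-integrable [set: R] (EFin \o (fun x => g x * phi x)).
Proof.
move=> mg gB.
by apply: (@integrable_mul_bounded _ _ _ lebesgue_measure [set: R] _ phi g B).
Qed.

Let int_abs_phi : mu.-integrable [set: R] (EFin \o (fun x => `|x| * phi x)).
Proof.
(* The Gaussian exponent splits into two copies of t = x^2 / (4 s^2). One absorbs the factor |x|,
   since |x| <= s (1 + t) <= s exp(t); the other is the exponent for the deviation [s'], whose
   density is integrable. *)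
pose s' := Num.sqrt 2 * s.
have s'0 : 0 < s' by rewrite mulr_gt0// sqrtr_gt0.
pose C := s * normal_peak s / normal_peak s'.
have p0 : 0 < normal_peak s by rewrite normal_peak_gt0// gt_eqF.
have p'0 : 0 < normal_peak s' by rewrite normal_peak_gt0// gt_eqF.
have C0 : 0 <= C by rewrite !mulr_ge0 ?invr_ge0// ltW.
apply: (@le_integrable_real _ _ _ lebesgue_measure [set: R] _ _
    (fun x : R => C * normal_pdf 0 s' x)).
- exact: measurableT.
- by apply: (@measurable_funM _ R) => //; exact: (@measurableT_comp _ _ _ R R R).
- move=> x _; rewrite ger0_norm ?mulr_ge0//.
  rewrite phiE normal_pdfE ?gt_eqF// /normal_fun subr0.
  have ss : s' ^+ 2 *+ 2 = 4 * s ^+ 2.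
    by rewrite /s' exprMn sqr_sqrtr// -mulr_natl; ring.
  pose t := x ^+ 2 / (4 * s ^+ 2).
  have -> : - x ^+ 2 / (s' ^+ 2 *+ 2) = - t by rewrite ss /t mulNr.
  have -> : - x ^+ 2 / (s ^+ 2 *+ 2) = - t + - t.
    by rewrite /t; field; rewrite gt_eqF.
  have xt : `|x| <= s * expR t.
    apply: (@le_trans _ _ (s * (1 + t))); last by rewrite ler_pM2l// expR_ge1Dx.
    have tE : s * (1 + t) * (4 * s) = 4 * s ^+ 2 + `|x| ^+ 2.
      by rewrite /t real_normK ?num_real//; field; rewrite gt_eqF.
    rewrite -(@ler_pM2r _ (4 * s)) ?mulr_gt0// tE.
    by have := sqr_ge0 (2 * s - `|x|); have := normr_ge0 x; nra.
  rewrite expRD /C.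
  rewrite (_ : _ * normal_peak s / _ * _ = normal_peak s * (s * expR (- t))); last first.
    by field; rewrite gt_eqF.
  rewrite mulrCA ler_pM2l// mulrA ler_pM2r ?expR_gt0//.
  apply: le_trans (ler_wpM2r (expR_ge0 _) xt) _.
  by rewrite -mulrA -expRD subrr expR0 mulr1.
- have := integrableZl measurableT C (integrable_normal_pdf 0 s').
  by apply: eq_integrable => // x _; rewrite /= EFinM.
Qed.

Let mcos u c : measurable_fun setT (fun x : R => cos (u * x + c)).
Proof. by apply: (@measurable_cos_comp R _ R); exact: measurable_funM. Qed.

Let msin u c : measurable_fun setT (fun x : R => sin (u * x + c)).
Proof.
rewrite (_ : (fun x => _) = (fun x : R => cos (u * x + (c - pi / 2)))).
  exact: mcos.
by apply/funext => x; rewrite addrA cosBpihalf.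
Qed.

Let F c u := \int[mu]_x (cos (u * x + c) * phi x).

Let int_xsin u c : mu.-integrable [set: R] (EFin \o (fun x => x * sin (u * x + c) * phi x)).
Proof.
apply: (@le_integrable_real _ _ _ lebesgue_measure [set: R] _ _
    (fun x : R => `|x| * phi x)) => //.
- by apply: (@measurable_funM _ R) => //; exact: (@measurable_funM _ R).
- move=> x _; rewrite normrM (ger0_norm (phi0 x)).
  by rewrite ler_wpM2r// normrM ler_piMr// sin_max.
Qed.

Let dF (c u : R) : is_derive u 1 (F c) (- \int[mu]_x (x * sin (u * x + c) * phi x)).
Proof.
pose f (v x : R) := cos (v * x + c) * phi x.
have Iu : `]u - 1, u + 1[%classic u by rewrite /= in_itv/= ltrBlDr ltrDl ltr01.
have intf v : `]u - 1, u + 1[%classic v -> mu.-integrable [set: R] (EFin \o f v).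
  by move=> _; apply: (int_bounded_phi (mcos v c) (fun x => cos_max _)).
have df (v x : R) : is_derive v 1 (f ^~ x) (- (x * sin (v * x + c) * phi x)).
  by rewrite /f; apply: is_derive_eq; rewrite /GRing.scale/=; ring.
have derf (v x : R) : `]u - 1, u + 1[%classic v -> setT x -> derivable (f ^~ x) v 1.
  by move=> _ _; have [] := df v x.
have dE v x : partial1of2 f v x = - (x * sin (v * x + c) * phi x).
  by rewrite partial1of2E; have [_] := df v x.
have G0 x : 0 <= `|x| * phi x by rewrite mulr_ge0.
have Gub v x : `]u - 1, u + 1[%classic v -> setT x ->
    `|partial1of2 f v x| <= `|x| * phi x.
  move=> _ _; rewrite dE normrN normrM (ger0_norm (phi0 x)) ler_wpM2r//.
  by rewrite normrM ler_piMr// sin_max.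
have D := derivable_under_integral measurableT Iu intf derf G0 int_abs_phi Gub.
have DE := differentiation_under_integral measurableT Iu intf derf G0 int_abs_phi Gub.
split; first exact: D.
rewrite -derive1E [LHS]DE; rewrite -mulN1r.
apply: (etrans _ (@RintegralZl _ _ _ lebesgue_measure [set: R] _ (-1) measurableT (int_xsin u c))).
by apply: eq_Rintegral => x _; rewrite mulN1r; exact: dE.
Qed.

(** The derivative of [h] integrates to 0 over the line. This is integration by parts for the
    Gaussian density, whose derivative is - x / s^2 times itself. *)
Let h u c x := sin (u * x + c) * phi x.
Let h' u c x := u * (cos (u * x + c) * phi x) - s ^- 2 * (x * sin (u * x + c) * phi x).

Let is_derive_h u c (x : R) : is_derive x 1 (h u c) (h' u c x).
Proof.
have dphi := is_derive_phi x; rewrite /h.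
have -> : h' u c x = sin (u * x + c) * (- (x / s ^+ 2) * phi x) +
    phi x * (cos (u * x + c) * u).
  by rewrite /h'; field; rewrite gt_eqF.
apply: is_derive_eq; rewrite /GRing.scale/=; ring.
Qed.

Let int_h' u c : mu.-integrable [set: R] (EFin \o h' u c).
Proof.
apply: (@integrableB_real _ _ _ lebesgue_measure [set: R]) => //.
  apply: (@integrableZ_real _ _ _ lebesgue_measure [set: R]) => //.
  exact: (int_bounded_phi (mcos u c) (fun x => cos_max _)).
by apply: (@integrableZ_real _ _ _ lebesgue_measure [set: R]).
Qed.

Let continuous_h' u c : continuous (h' u c).
Proof.
have cphi : continuous phi by apply: continuous_normal_pdf; rewrite gt_eqF.
have caff x : (fun y : R => u * y + c) @ x --> u * x + c.
  by apply: cvgD; [apply: cvgM; [exact: cvg_cst|exact: cvg_id]|exact: cvg_cst].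
move=> x; apply: cvgB; apply: cvgM; try exact: cvg_cst; apply: cvgM; try exact: cphi.
  by apply: continuous_cvg (caff x); exact: continuous_cos.
apply: cvgM; first exact: cvg_id.
by apply: continuous_cvg (caff x); exact: continuous_sin.
Qed.

Let h_cvg0 u c (b : bool) :
  (fun n : nat => h u c ((-1) ^+ b * n.+1%:R)) @ \oo --> (0 : R).
Proof.
(* Since exp(y) >= y at y = q^2 / (2 s^2), the Gaussian factor is at most 2 s^2 / q^2, hence at most
   2 s^2 / q for q >= 1. *)
pose C := normal_peak s * (s ^+ 2 *+ 2).
have C0 : 0 <= C by rewrite mulr_ge0 ?normal_peak_ge0// mulrn_wge0// sqr_ge0.
have hC n : `|h u c ((-1) ^+ b * n.+1%:R)| <= C * n.+1%:R^-1.
  rewrite /h normrM (ger0_norm (phi0 _)) phiE.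
  apply: le_trans (ler_wpM2r _ (sin_max _)) _.
    by rewrite mulr_ge0 ?normal_peak_ge0 ?expR_ge0.
  rewrite mul1r /C -mulrA ler_wpM2l ?normal_peak_ge0//.
  rewrite exprMn sqrr_sign mul1r mulNr expRN.
  set q : R := n.+1%:R; have q1 : 1 <= q by rewrite /q ler1n.
  have s2 : 0 < s ^+ 2 *+ 2 by rewrite mulrn_wgt0// exprn_gt0.
  have q0 : 0 < q by rewrite (lt_le_trans ltr01).
  rewrite -[leRHS]invrK invfM invrK lef_pV2 ?posrE ?expR_gt0 ?mulr_gt0 ?invr_gt0//.
  apply: le_trans (expR_ge1Dx _).
  apply: (@le_trans _ _ (q ^+ 2 / (s ^+ 2 *+ 2))); last by rewrite lerDr.
  by rewrite mulrC ler_wpM2r ?invr_ge0 ?(ltW s2)// expr2 ler_peMr// ltW.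
apply/cvgrPdist_le => e e0.
have := @cvg_harmonic R => /(cvgM (cvg_cst C)); rewrite mulr0 => /cvgrPdist_le /(_ _ e0).
apply: filterS => n; rewrite !sub0r !normrN => hn.
by rewrite (le_trans (hC n))// (le_trans _ hn)// /harmonic/= ler_norm.
Qed.

Let int_h'0 u c : \int[mu]_x h' u c x = 0.
Proof.
pose I (n : nat) : set R := `[- n.+1%:R, n.+1%:R]%classic.
have lim1 : \int[mu]_(x in I n) h' u c x @[n --> \oo] --> \int[mu]_x h' u c x.
  apply: (@Rintegral_cvg_sets _ _ _ lebesgue_measure [set: R]) => //.
  - by move=> n; exact: measurable_itv.
  - apply: aeW => x _; exists (Num.truncn `|x|) => // n /= hn.
    rewrite /I/= in_itv/= -ler_norml ltW// (lt_le_trans (truncnS_gt _))//.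
    by rewrite ler_nat ltnS.
have E n : \int[mu]_(x in I n) h' u c x = h u c n.+1%:R - h u c (- n.+1%:R).
  rewrite /Rintegral (@continuous_FTC2 _ (h' u c) (h u c))//.
  - by rewrite (@lt_trans _ _ 0)// oppr_lt0.
  - by apply: continuous_subspaceT => x; exact: continuous_h'.
  - have ch x : {for x, continuous (h u c)}.
      by apply/differentiable_continuous/derivable1_diffP; have [] := is_derive_h u c x.
    split.
    + by move=> x _; have [] := is_derive_h u c x.
    + by apply: cvg_at_right_filter; exact: ch.
    + by apply: cvg_at_left_filter; exact: ch.
  - by move=> x _; rewrite derive1E; have [_ ->] := is_derive_h u c x.
have lim2 : \int[mu]_(x in I n) h' u c x @[n --> \oo] --> (0 : R).
  rewrite (_ : (fun n => _) = (fun n => h u c n.+1%:R - h u c (- n.+1%:R))); last first.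
    by apply/funext => n; exact: E.
  rewrite -[X in _ --> X](subr0 0); apply: cvgB.
    by have := h_cvg0 u c false; under eq_fun do rewrite mul1r.
  by have := h_cvg0 u c true; under eq_fun do rewrite mulN1r.
exact: (cvg_unique _ lim1 lim2).
Qed.

(** Differentiating under the integral and integrating by parts gives F' = - s^2 u F, so exp(s^2 u^2
    / 2) F is constant and equals its value cos(c) at 0. *)
Lemma integral_cos_normal_pdf u c :
  \int[mu]_x (cos (u * x + c) * normal_pdf 0 s x) =
  expR (- (s ^+ 2 * u ^+ 2) / 2) * cos c.
Proof.
have dF' (v : R) : is_derive v 1 (F c) (- (s ^+ 2 * v) * F c v).
  have i1 := int_bounded_phi (mcos v c) (fun x => cos_max (v * x + c)).
  have Z1 := @RintegralZl _ _ _ lebesgue_measure [set: R] _ v measurableT i1.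
  have Z2 := @RintegralZl _ _ _ lebesgue_measure [set: R] _ (s ^- 2) measurableT (int_xsin v c).
  have := @RintegralB _ _ _ lebesgue_measure [set: R] _ _ measurableT
    (@integrableZ_real _ _ _ lebesgue_measure [set: R] measurableT _ v i1)
    (@integrableZ_real _ _ _ lebesgue_measure [set: R] measurableT _ (s ^- 2) (int_xsin v c)).
  rewrite Z1 Z2 [LHS](_ : _ = 0); last exact: int_h'0.
  move=> /esym/eqP; rewrite subr_eq0 => /eqP E.
  apply: is_derive_eq (dF c v) _; rewrite mulNr -mulrA; congr (- _); rewrite /F E; field; by rewrite gt_eqF.
pose E v := expR (s ^+ 2 * v ^+ 2 / 2) * F c v.
have dE (v : R) : is_derive v 1 E 0.
  have := dF' v => dFv; rewrite /E.
  by apply: is_derive_eq; rewrite /GRing.scale/=; field.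
have := is_derive_0_is_cst u 0 dE.
rewrite /E expr0n mulr0 mul0r expR0 mul1r.
have -> : F c 0 = cos c.
  rewrite /F; under eq_Rintegral do rewrite mul0r add0r.
  rewrite [LHS](@RintegralZl _ _ _ lebesgue_measure [set: R] phi (cos c) measurableT int_phi).
  by rewrite /Rintegral integral_normal_pdf// mulr1.
rewrite mulNr -/phi -/(F c u) => <-.
by rewrite mulrA -expRD addNr expR0 mul1r.
Qed.

End NormalCosine.

(** * Positive definite matrices and the Schur complement of the first entry *)

Section PositiveDefinite.
Context {R : realType}.

Definition posdef d (S : 'M[R]_d) : Prop :=
  S^T = S /\ forall x : 'cV[R]_d, x != 0 -> 0 < (x^T *m S *m x) ord0 ord0.

Lemma posdef_unitmx d (S : 'M[R]_d) : posdef S -> S \in unitmx.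
Proof.
move=> [_ pS]; rewrite -row_free_unit -kermx_eq0; apply/eqP/row_matrixP => i.
rewrite row0; apply/eqP/negPn/negP => r0.
have := pS (row i (kermx S))^T; rewrite trmxK -row_mul mulmx_ker row0 mul0mx mxE ltxx.
move=> h; apply/notF/h; apply: contraNN r0 => /eqP r0.
by rewrite -[row i _]trmxK r0 trmx0.
Qed.

Definition schur d (S : 'M[R]_(1 + d)) : 'M[R]_d :=
  drsubmx S - (S ord0 ord0)^-1 *: (dlsubmx S *m (dlsubmx S)^T).

Variable d : nat.
Variable S : 'M[R]_(1 + d).
Let a := S ord0 ord0.
Let b : 'cV[R]_d := dlsubmx S.
Let Cs : 'M[R]_d := schur S.

Hypothesis pS : posdef S.

Let Sblock : S = block_mx (a%:M) b^T b (drsubmx S).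
Proof.
rewrite -[LHS]submxK; congr block_mx.
  apply/matrixP => i j; rewrite !ord1 !mxE eqxx mulr1n /a.
  by congr (S _ _); apply/val_inj.
by rewrite -[S in ursubmx S](pS.1) /b trmx_dlsub.
Qed.

Let entryD (A B : 'M[R]_1) : (A + B) ord0 ord0 = A ord0 ord0 + B ord0 ord0.
Proof. by rewrite mxE. Qed.

Let entryZ k (A : 'M[R]_1) : (k *: A) ord0 ord0 = k * A ord0 ord0.
Proof. by rewrite mxE. Qed.

Lemma quad_block (t : R) (v : 'cV[R]_d) :
  ((col_mx t%:M v)^T *m S *m col_mx t%:M v) ord0 ord0 =
  a * t ^+ 2 + 2 * t * (b^T *m v) ord0 ord0 + (v^T *m drsubmx S *m v) ord0 ord0.
Proof.
rewrite [in LHS]Sblock tr_col_mx mul_row_block mul_row_col !mulmxDl.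
have vb : v^T *m b = (b^T *m v)^T by rewrite trmx_mul trmxK.
rewrite !tr_scalar_mx !mul_scalar_mx !mul_mx_scalar vb -scalemxAl.
rewrite !(entryD, entryZ) [a%:M _ _]mxE eqxx mulr1n [(_ ^T) _ _]mxE; ring.
Qed.

Lemma quad_schur (v : 'cV[R]_d) : (v^T *m Cs *m v) ord0 ord0 =
  (v^T *m drsubmx S *m v) ord0 ord0 - a^-1 * (b^T *m v) ord0 ord0 ^+ 2.
Proof.
rewrite /Cs mulmxBr mulmxBl -scalemxAr -scalemxAl -scaleNr entryD entryZ mulNr.
congr (_ - _ * _).
by rewrite [v^T *m _]mulmxA -[_ *m _ *m v]mulmxA [LHS]mxE big_ord1 -[v^T *m b]trmxK trmx_mul trmxK mxE.
Qed.

Lemma posdef_corner : 0 < a.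
Proof.
have := pS.2 (col_mx 1%:M 0); rewrite quad_block mulmx0 trmx0 !mul0mx !mxE expr1n.
rewrite mulr1 mulr0 !addr0; apply.
by apply/eqP => /matrixP /(_ ord0 ord0)/eqP; rewrite -[ord0](lshift0 _ 0) col_mxEu !mxE eqxx oner_eq0.
Qed.

Lemma posdef_schur : posdef Cs.
Proof.
have a0 := posdef_corner; split.
  rewrite /Cs linearB/= linearZ/= trmx_mul trmxK; congr (_ - _).
  by rewrite trmx_drsub pS.1.
move=> v v0; rewrite quad_schur.
(* This first coordinate minimizes the quadratic form of [S] for a given [v]; the minimum is the
   form of the Schur complement. *)
have := pS.2 (col_mx (- a^-1 * (b^T *m v) ord0 ord0)%:M v).
rewrite quad_block; set q := (b^T *m v) _ _ => h.
have {}h := h _; apply: lt_le_trans (h _) _; last first.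
  by rewrite le_eqVlt; apply/orP; left; apply/eqP; field; rewrite gt_eqF.
apply: contra_neq v0 => h0.
by rewrite -[v](col_mxKd (- a^-1 * q)%:M) h0 linear0.
Qed.

Lemma det_schur : \det S = a * \det Cs.
Proof.
have a0 := posdef_corner.
have -> : S = block_mx 1%:M 0 (a^-1 *: b) 1%:M *m block_mx a%:M b^T 0 Cs.
  rewrite {1}Sblock mulmx_block !mul1mx !mul0mx !addr0 mul_mx_scalar scalerA.
  by rewrite divff ?gt_eqF// scale1r /Cs -scalemxAl addrC subrK.
by rewrite det_mulmx det_lblock det_ublock !det1 !mul1r det_scalar expr1.
Qed.

Lemma invmx_quad_schur (t : R) (v : 'cV[R]_d) :
  ((col_mx t%:M v)^T *m invmx S *m col_mx t%:M v) ord0 ord0 =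
  t ^+ 2 / a + ((v - (t / a) *: b)^T *m invmx Cs *m (v - (t / a) *: b)) ord0 ord0.
Proof.
have a0 := posdef_corner; have an0 : a != 0 by rewrite gt_eqF.
have uS := posdef_unitmx pS; have uC := posdef_unitmx posdef_schur.
(* Block elimination for S z = (t, v): [z2] is the lower part of the solution, and the first
   equation then yields [z1]. *)
pose r := v - (t / a) *: b; pose z2 := invmx Cs *m r.
pose z1 := (t - (b^T *m z2) ord0 ord0) / a.
have Sz : S *m col_mx z1%:M z2 = col_mx t%:M v.
  rewrite {1}Sblock mul_block_col; congr col_mx.
    rewrite mul_scalar_mx; apply/matrixP => i j; rewrite !ord1 entryD entryZ.
    rewrite ![_%:M _ _]mxE eqxx !mulr1n /z1; by field.
  have -> : drsubmx S = Cs + a^-1 *: (b *m b^T) by rewrite /Cs subrK.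
  rewrite mulmxDl /z2 mulKVmx// -/z2 mul_mx_scalar -scalemxAl -mulmxA.
  rewrite [b^T *m z2]mx11_scalar mul_mx_scalar scalerA /r addrCA addrA addrAC.
  rewrite -[RHS]addr0 -!addrA; congr (_ + _).
  rewrite -scaleNr -!scalerDl /z1.
  by rewrite -[RHS](scale0r b); congr (_ *: _); field.
rewrite -mulmxA; have -> : invmx S *m col_mx t%:M v = col_mx z1%:M z2 by rewrite -Sz mulKmx.
rewrite tr_col_mx mul_row_col tr_scalar_mx entryD mul_scalar_mx entryZ.
rewrite -/r -[in RHS]mulmxA -/z2.
have -> : v = r + (t / a) *: b by rewrite /r subrK.
rewrite linearD/= linearZ/= mulmxDl -scalemxAl entryD entryZ.
by rewrite [_%:M _ _]mxE eqxx mulr1n /z1; field.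
Qed.

End PositiveDefinite.

Section Gaussian.
Context {R : realType}.

(** The density factors into the law of the first coordinate and the conditional law of the others,
    whose mean is affine in [x] and whose covariance is the Schur complement. *)
Lemma mvnormal_pdf_schur d (S : 'M[R]_(1 + d)) (m : 'cV[R]_(1 + d)) (x : R) (v : 'cV[R]_d) :
  posdef S ->
  mvnormal_pdf m S (col_mx (const_mx x) v) =
  normal_pdf (m ord0 ord0) (Num.sqrt (S ord0 ord0)) x *
  mvnormal_pdf (dsubmx m + ((x - m ord0 ord0) / S ord0 ord0) *: dlsubmx S)
    (schur S) v.
Proof.
move=> pS; have a0 := posdef_corner pS.
set a := S ord0 ord0 in a0 *; set m0 := m ord0 ord0.
rewrite /mvnormal_pdf; have -> : col_mx (const_mx x) v - m = col_mx (x - m0)%:M (v - dsubmx m).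
  rewrite -[m in LHS]vsubmxK opp_col_mx add_col_mx; congr col_mx.
  apply/matrixP => i j; rewrite !ord1 !mxE eqxx mulr1n; congr (_ - m _ _).
  exact/val_inj.
rewrite invmx_quad_schur// -/a -addrA -opprD det_schur// -/a.
rewrite normal_pdfE ?gt_eqF ?sqrtr_gt0// /normal_peak /normal_fun.
rewrite sqr_sqrtr ?ltW//.
have -> : (2 * pi) ^+ (1 + d) * (a * \det (schur S)) =
    (a * pi *+ 2) * ((2 * pi) ^+ d * \det (schur S)).
  by rewrite exprD expr1 -[in RHS]mulr_natl; ring.
rewrite sqrtrM; last by rewrite mulrn_wge0// mulr_ge0 ?pi_ge0// ltW.
rewrite invfM -mulr_natl mulrACA -expRD; congr (_ * expR _).
by field; rewrite gt_eqF.
Qed.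

Lemma const_mx11 (x : R) : const_mx x = x%:M :> 'M[R]_1.
Proof. by apply/matrixP => i j; rewrite !ord1 !mxE eqxx mulr1n. Qed.

Lemma continuous_col_mx d1 d2 (u : 'cV[R]_d1) : continuous (@col_mx R d1 d2 1 u).
Proof.
move=> v; apply: (@cvg_mx_coord R _ (nbhs v)) => i j; rewrite mxE.
rewrite (_ : (fun x => _) = (fun x : 'cV[R]_d2 => match fintype.split i with
  | inl i1 => u i1 j | inr i2 => x i2 j end)); last by apply/funext => x; rewrite mxE.
by case: fintype.split => k; [exact: cvg_cst|exact: coord_continuous].
Qed.

Section ProductWithNormal.
Variables (s : R) (dQ : measure_display) (OQ : measurableType dQ) (Q : probability OQ R).
Variables (psi : R * OQ -> R) (M : R).
Hypothesis mpsi : measurable_fun [set: (R * OQ)%type] psi.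
Hypothesis psiM : forall z, `|psi z| <= M.

Lemma Rintegral_normal_prod :
  measurable_fun [set: R] (fun x => \int[Q]_w psi (x, w)) /\
  \int[((normal_prob 0 s : probability _ R) \x Q)%E]_z psi z =
  \int[lebesgue_measure]_x ((\int[Q]_w psi (x, w)) * normal_pdf 0 s x).
Proof.
pose P1 : probability (measurableTypeR R) R := normal_prob 0 s.
have mE : measurable_fun [set: R] (fun x => \int[Q]_w psi (x, w)).
  have intpsi : (P1 \x Q)%E.-integrable setT (EFin \o psi).
    exact: (@bounded_integrable _ _ _ (P1 \x Q)%E psi M).
  have := measurable_fubini_F intpsi; exact: measurableT_comp.
split => //; rewrite (@Rintegral_prod_bounded _ _ _ _ _ P1 Q psi M mpsi psiM).
apply: (@Rintegral_density _ _ _ lebesgue_measure P1 (normal_pdf 0 s)) => //.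
- exact: measurable_normal_pdf.
- by move=> x; exact: normal_pdf_ge0.
Qed.

End ProductWithNormal.

(** It turns the iterated Lebesgue integral of the limit law into an expectation of a random vector,
    to which the convergence criterion applies. The induction builds the first coordinate with
    variance [a] and, given it, adds its regression on the others to an independent vector with the
    Schur complement as covariance. The mean [m] is general because the conditional mean depends on
    the first coordinate. *)
Lemma gaussian_representation d (S : 'M[R]_d) : posdef S ->
  exists (dQ : measure_display) (OQ : measurableType dQ) (Q : probability OQ R)
    (W : OQ -> 'cV[R]_d),
  [/\ forall i, measurable_fun setT (fun w => W w i ord0),
     forall m (f : 'cV[R]_d -> R) (M : R), continuous f -> (forall x, `|f x| <= M) ->
       cV_integral (fun x => f x * mvnormal_pdf m S x) = \int[Q]_w f (m + W w) &
     forall u c, \int[Q]_w cos (dot u (W w) + c) =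
       expR (- ((u^T *m S *m u) ord0 ord0) / 2) * cos c].
Proof.
elim: d S => [|d IH] S pS.
  exists _, unit, (\d_tt : probability unit R), (fun=> 0); split.
  - by case.
  - move=> m f M _ _ /=; rewrite probability_Rintegral_cst /mvnormal_pdf.
    rewrite det_mx00 expr0 mulr1 sqrtr1 invr1 mul1r [X in expR (- X / _)]mxE big_ord0.
    by rewrite oppr0 mul0r expR0 mulr1 addr0; congr f; apply/matrixP => -[].
  - move=> u c; rewrite probability_Rintegral_cst [X in expR (- X / _)]mxE big_ord0.
    by rewrite oppr0 mul0r expR0 mul1r /dot big_ord0 add0r.
have {IH} [dQ [OQ [Q [W [mW fW cfW]]]]] := IH _ (posdef_schur pS).
have a0 := posdef_corner (pS : posdef (S : 'M[R]_(1 + d))).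
set a := (S : 'M[R]_(1 + d)) ord0 ord0 in a0.
pose b := dlsubmx (S : 'M[R]_(1 + d)).
pose s := Num.sqrt a; have s0 : 0 < s by rewrite sqrtr_gt0.
pose P1 : probability (measurableTypeR R) R := normal_prob 0 s.
pose Z (z : R * OQ) : 'cV[R]_(1 + d) := col_mx (const_mx z.1) ((z.1 / a) *: b + W z.2).
have mZ i : measurable_fun [set: (R * OQ)%type] (fun z => Z z i ord0).
  rewrite /Z; under eq_fun do rewrite mxE.
  case: fintype.split => k; under eq_fun do rewrite !mxE; first exact: measurable_fst.
  apply: measurable_funD; first by apply: measurable_funM => //; apply: measurable_funM => //; exact: measurable_fst.
  exact: measurableT_comp (mW k) _.
exists _, _, (P1 \x Q)%E, Z; split => //.
- move=> m f M cf fM /=.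
  pose m' := dsubmx (m : 'cV[R]_(1 + d)); pose m0 := (m : 'cV[R]_(1 + d)) ord0 ord0.
  pose psi (z : R * OQ) := f (m + Z z).
  have mpsi : measurable_fun [set: (R * OQ)%type] psi.
    apply: (@measurable_continuous_bounded R d.+1 _ _ (fun z => m + Z z) f M) => // i.
    by under eq_fun do rewrite mxE; apply: measurable_funD.
  have [mE] := @Rintegral_normal_prod s _ _ Q psi M mpsi (fun z => fM _).
  move=> ->.
  (* The constructed vector is centred, whereas the density has mean [m]: the first coordinate is
     translated by [m0]. *)
  rewrite [RHS](_ : _ = \int[lebesgue_measure]_x
      ((\int[Q]_w psi (x - m0, w)) * normal_pdf 0 s (x - m0))); last first.
    rewrite [RHS](@Rintegral_lebesgue_shift _ m0); last first.
      have mB : measurable_fun [set: R] (fun x : R => x - m0) by apply: measurable_funB.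
      apply: measurable_funM; first exact: (measurableT_comp mE mB).
      by apply: (measurableT_comp _ mB); exact: measurable_normal_pdf.
    by apply: eq_Rintegral => x _; rewrite addrC addKr.
  apply: eq_Rintegral => x _.
  have np : normal_pdf 0 s (x - m0) = normal_pdf m0 s x.
    by rewrite !normal_pdfE ?gt_eqF// /normal_fun subr0.
  (* The density of the first coordinate, constant in [v], is absorbed into the test function before
     the induction hypothesis is applied. *)
  pose g v := normal_pdf m0 s x * f (col_mx (const_mx x : 'cV[R]_1) v).
  have := fW (m' + ((x - m0) / a) *: b) g (normal_pdf m0 s x * M).
  rewrite (_ : (fun x0 => g x0 * _) = (fun v => f (col_mx (const_mx x : 'cV[R]_1) v) *
      mvnormal_pdf m S (col_mx (const_mx x : 'cV[R]_1) v))); last first.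
    apply/funext => v; rewrite (mvnormal_pdf_schur _ _ _ (pS : posdef (S : 'M[R]_(1 + d)))).
    by rewrite /g [RHS]mulrA; congr (_ * _); exact: mulrC.
  move=> ->; last 2 first.
  - move=> v; apply: (@cvgM R _ (nbhs v) _ (cst (normal_pdf m0 s x))
      (fun v => f (col_mx (const_mx x : 'cV[R]_1) v))); first exact: cvg_cst.
    apply: (@continuous_comp _ _ _ (col_mx (const_mx x : 'cV[R]_1)) f); last exact: cf.
    exact: continuous_col_mx.
  - by move=> v; rewrite normrM ger0_norm ?normal_pdf_ge0// ler_wpM2l ?normal_pdf_ge0.
  rewrite np [RHS]mulrC -RintegralZl//; last first.
    apply: (@bounded_integrable _ _ _ Q _ M) => //.
    + apply: (measurableT_comp mpsi); exact: measurable_pair1.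
    + by move=> w; exact: fM.
  apply: eq_Rintegral => w _; rewrite /g /psi; congr (_ * f _).
  have mE' : m = col_mx (usubmx (m : 'cV[R]_(1 + d))) m' by rewrite vsubmxK.
  rewrite [in RHS]mE'.
  apply: etrans (esym (@add_col_mx R 1 d 1 (usubmx (m : 'cV[R]_(1 + d))) m'
    (const_mx (x - m0)) (((x - m0) / a) *: b + W w))); congr col_mx.
    apply/matrixP => i j; rewrite !ord1 !mxE [X in m X](_ : _ = ord0); last exact/val_inj.
    by rewrite addrC subrK.
  by rewrite addrA.
- move=> u c.
  pose u' := dsubmx (u : 'cV[R]_(1 + d)); pose u0 := (u : 'cV[R]_(1 + d)) ord0 ord0.
  (* [k] is the total weight of the first coordinate in [dot u (Z z)]: direct, and through the
     conditional mean of the others. *)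
  pose q := (b^T *m u') ord0 ord0; pose k := u0 + q / a.
  have uE : u = col_mx u0%:M u' :> 'cV[R]_(1 + d).
    rewrite -[LHS](@vsubmxK _ 1 d); congr col_mx.
    apply/matrixP => i j; rewrite !ord1 !mxE eqxx mulr1n; congr (u _ _).
    exact/val_inj.
  have dotE n (x y : 'cV[R]_n) : dot x y = (x^T *m y) ord0 ord0.
    by rewrite mxE; apply: eq_bigr => i _; rewrite mxE.
  have dZ z : dot u (Z z) = k * z.1 + dot u' (W z.2).
    rewrite (dotE (1 + d)%N) uE (@tr_col_mx R 1 d) /Z const_mx11.
    rewrite (@mul_row_col R 1 1 d) tr_scalar_mx mul_scalar_mx dotE.
    rewrite mulmxDr -scalemxAr; have -> : u'^T *m b = (b^T *m u')^T by rewrite trmx_mul trmxK.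
    rewrite /k /q; move: (b^T *m u') (u'^T *m W z.2) => B p.
    by rewrite !(mxE, eqxx, mulr1n); field; rewrite gt_eqF.
  pose psi (z : R * OQ) := cos (dot u (Z z) + c).
  have mpsi : measurable_fun [set: (R * OQ)%type] psi.
    by apply: measurable_cos_comp; exact: (measurable_dot _ mZ).
  have [_] := @Rintegral_normal_prod s _ _ Q psi 1 mpsi (fun z => cos_max _).
  move=> ->.
  pose r := expR (- ((u'^T *m schur (S : 'M[R]_(1 + d)) *m u') ord0 ord0) / 2).
  have E x : \int[Q]_w psi (x, w) = r * cos (k * x + c).
    rewrite -cfW; apply: eq_Rintegral => w _; rewrite /psi dZ/=; congr cos; ring.
  have intc : lebesgue_measure.-integrable [set: R]
      (EFin \o (fun x => cos (k * x + c) * normal_pdf 0 s x)).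
    apply: (@integrable_mul_bounded _ _ _ lebesgue_measure [set: R] _ _ _ 1) => //.
    + by apply: (@measurable_cos_comp R _ R); exact: measurable_funM.
    + by move=> x _; exact: cos_max.
    + exact: integrable_normal_pdf.
  transitivity (\int[lebesgue_measure]_x (r * (cos (k * x + c) * normal_pdf 0 s x))).
    by apply: eq_Rintegral => x _; rewrite E mulrA.
  rewrite [LHS](@RintegralZl _ _ _ lebesgue_measure [set: R] _ r measurableT intc).
  rewrite integral_cos_normal_pdf// mulrA -expRD sqr_sqrtr ?ltW//; congr (expR _ * _).
  rewrite uE (@quad_block R d S pS) (@quad_schur R d S) -/a -/b -/q /k; by field; rewrite gt_eqF.
Qed.

End Gaussian.

(** * Integrals against a Poisson process *)

Section PoissonVariable.
Context {R : realType} {dO : measure_display} {Omega : measurableType dO}.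
Variables (P : probability Omega R) (Y : Omega -> R) (rate : R).
Hypothesis mY : measurable_fun setT Y.
Hypothesis PY : forall k : nat, P [set w | Y w = k%:R] = (poisson_pmf rate k)%:E.

Let measurable_level k : measurable [set w | Y w = k%:R].
Proof. by have := mY measurableT (measurable_set1 k%:R); rewrite setTI. Qed.

(** For a nonpositive rate [poisson_pmf] has the default value 1 at every [k], so the disjoint
    events Y = 0 and Y = 1 would both have probability 1. *)
Lemma poisson_rate_gt0 : 0 < rate.
Proof.
rewrite ltNge; apply/negP => r0.
have P1 k : P [set w | Y w = k%:R] = 1%E.
  by rewrite PY /poisson_pmf ltNge r0.
have : P ([set w | Y w = 0%:R] `|` [set w | Y w = 1%:R]) = (1 + 1)%E.
  rewrite measureU//; first by congr (_ + _)%E; [exact: (P1 0)|exact: (P1 1)].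
  rewrite -subset0 => w [/= ->] /eqP.
  by rewrite eqr_nat.
move=> E; have := probability_le1 P (measurableU _ _ (measurable_level 0) (measurable_level 1)).
by rewrite E -EFinD lee_fin; lra.
Qed.

Lemma poisson_pmf_sum1 : (\sum_(k <oo) (poisson_pmf rate k)%:E = 1)%E.
Proof.
rewrite nneseries_esumT; last by move=> n; rewrite lee_fin poisson_pmf_ge0.
have H : poisson_prob rate 0 setT = 1%E := probability_setT _.
by move: H; rewrite /poisson_prob poisson_rate_gt0.
Qed.

(** The point masses add up to 1, so [Y] is almost surely a natural number and the integral splits
    over its level sets. *)
Lemma integral_poisson (g : R -> R) : measurable_fun setT g -> (forall x, 0 <= g x) ->
  (\int[P]_w (g (Y w))%:E = \sum_(k <oo) (g k%:R * poisson_pmf rate k)%:E)%E.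
Proof.
move=> mg g0; pose F (k : nat) := [set w | Y w = k%:R].
have tF : trivIset setT F.
  move=> i j _ _ [w [/= Yi Yj]]; apply/eqP; by rewrite -(eqr_nat R) -Yi -Yj.
have mF : measurable (\bigcup_k F k) by apply: bigcup_measurable => k _; exact: measurable_level.
have PF : P (~` \bigcup_k F k) = 0%E.
  rewrite probability_setC// measure_bigcup//=; last first.
    by move=> k _; exact: measurable_level.
  rewrite [X in (_ - X)%E](_ : _ = 1%E) ?subee// -poisson_pmf_sum1.
  rewrite (@eq_eseriesl _ _ xpredT); last by move=> k; rewrite in_setT.
    by apply: eq_eseriesr => k _; exact: PY.
have mgY : measurable_fun setT (fun w => (g (Y w))%:E).
  by apply/measurable_EFinP; exact: measurableT_comp.
rewrite -(setUv (\bigcup_k F k)) ge0_integral_setU//; last 4 first.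
- exact: measurableC.
- by rewrite setUv.
- by move=> w _; rewrite lee_fin.
- by rewrite disj_set2E setICr.
rewrite [X in (_ + X)%E]null_set_integral//; last 2 first.
- exact: measurableC.
- exact: measurable_funS mgY.
rewrite adde0 ge0_integral_bigcup//; last first.
- by move=> w _; rewrite lee_fin.
- exact: measurable_funS mgY.
apply: eq_eseriesr => k _.
rewrite (eq_integral (cst (g k%:R)%:E)); last by move=> w /[!inE] /= ->.
rewrite integral_cst; last exact: measurable_level.
by rewrite [X in (_ * X)%E]PY EFinM.
Qed.

Let series_poisson_pmf (f : nat -> R) n : series (fun k => f k * poisson_pmf rate k) n =
  expR (- rate) * pseries (fun k => k`!%:R^-1 * f k) rate n.
Proof.
rewrite /pseries /series/= mulr_sumr; apply: eq_bigr => k _.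
by rewrite /poisson_pmf poisson_rate_gt0; ring.
Qed.

Lemma poisson_has_cf (y : R) :
  has_cf P (fun w => y * Y w) (expR (rate * (cos y - 1))) (rate * sin y).
Proof.
move=> c.
have mc : measurable_fun setT (fun w => cos (y * Y w + c)).
  by apply: measurable_cos_comp; exact: measurable_funM.
have intc : P.-integrable setT (EFin \o (fun w => cos (y * Y w + c))).
  by apply: (@bounded_integrable _ _ _ P _ 1) => // w; exact: cos_max.
have /esym := probability_integralDcst 1 intc.
rewrite (integral_poisson (g := fun x => cos (y * x + c) + 1)); last 2 first.
- apply: measurable_funD => //; apply: (@measurable_cos_comp R _ R).
  exact: measurable_funM.
- by move=> x; have := cos_geN1 (y * x + c); lra.
have -> : (\sum_(k <oo) ((cos (y * k%:R + c) + 1) * poisson_pmf rate k)%:E =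
    (expR (- rate) * (expR (rate * cos y) * cos (rate * sin y + c) + expR rate))%:E)%E.
  apply/cvg_lim => //.
  (* The constant 1, added for nonnegativity, is itself a cosine series with y = 0 and c = 0; its
     sum is [expR rate]. *)
  rewrite (_ : (fun n => _) = EFin \o
      (fun n => expR (- rate) * (pseries (fun k => k`!%:R^-1 * cos (y * k%:R + c)) rate n
       + pseries (fun k => k`!%:R^-1 * cos (0 * k%:R + 0)) rate n))); last first.
    apply/funext => n /=; rewrite sumEFin; congr EFin.
    rewrite [LHS](series_poisson_pmf (fun k => cos (y * k%:R + c) + 1)).
    congr (_ * _); rewrite /pseries /series/= -big_split/=; apply: eq_bigr => k _.
    by rewrite mul0r addr0 cos0; ring.
  apply: cvg_EFin; first exact: nearW.
  apply: cvgM; first exact: cvg_cst.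
  apply: cvgD; first exact: cvg_poisson_cos.
  by have := @cvg_poisson_cos R 0 0 rate; rewrite cos0 sin0 mulr0 add0r mulr1 cos0 mulr1.
move=> E; have {}E := EFin_inj E; rewrite -[LHS](addrK 1) E.
rewrite mulrDr -expRD addNr expR0 addrK mulrA -expRD; congr (expR _ * _); ring.
Qed.

(** The term at 0 vanishes and k times the mass at k is the rate times the mass at k - 1. The
    absolute value only provides a test function that is nonnegative on the whole line. *)
Lemma poisson_mean : (forall w, 0 <= Y w) -> (\int[P]_w (Y w)%:E = rate%:E)%E.
Proof.
move=> Y0; transitivity (\int[P]_w (`|Y w|)%:E)%E.
  by apply: eq_integral => w _; rewrite ger0_norm.
rewrite (integral_poisson (g := fun x => `|x|))//.
rewrite nneseries_recl//; last first.
  by move=> k _; rewrite lee_fin mulr_ge0// poisson_pmf_ge0.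
rewrite normr0 mul0r add0e -(@nneseries_addn _ _ 1); last first.
  by move=> k; rewrite lee_fin mulr_ge0// poisson_pmf_ge0.
have r0 := poisson_rate_gt0.
rewrite (eq_eseriesr (g := fun k => (rate%:E * (poisson_pmf rate k)%:E)%E)); last first.
  move=> k _; rewrite -EFinM; congr EFin.
  rewrite normr_nat addn1 /poisson_pmf r0 factS natrM exprS.
  by field; rewrite pnatr_eq0 -lt0n fact_gt0 addrC natr1 pnatr_eq0.
rewrite nneseriesZl; last by move=> k _; rewrite lee_fin poisson_pmf_ge0.
by rewrite poisson_pmf_sum1 mule1.
Qed.

End PoissonVariable.

Notation lsm := lebesgue_stieltjes_measure.

Section StieltjesMeasure.
Context {R : realType}.

Lemma lsm_itv_oc (F : cumulative R R) (x y : R) : x <= y ->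
  lsm F `]x, y]%classic = (F y - F x)%:E.
Proof.
move=> xy; rewrite /lebesgue_stieltjes_measure/= /measure_extension/= measurable_mu_extE/=; last exact: is_ocitv.
by rewrite wlength_itv_bnd.
Qed.

Lemma cumulative_le (F : cumulative R R) x y : x <= y -> F x <= F y.
Proof. exact: cumulative_is_nondecreasing. Qed.

Lemma observation_interval_is_interval (T : set R) : observation_interval T -> is_interval T.
Proof.
by case=> [[T0 _ ->]|->|->]; [exact: interval_is_interval..|].
Qed.

Lemma observation_interval_measurable (T : set R) : observation_interval T ->
  measurable T.
Proof. by case=> [[T0 _ ->]|->|->] //; exact: measurable_itv. Qed.

Lemma integral_mrestr d (S : measurableType d) (mu : {measure set S -> \bar R})
    (D : set S) (mD : measurable D) (f : S -> \bar R) : measurable_fun setT f ->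
  (forall x, 0 <= f x)%E ->
  (\int[mrestr mu mD]_x f x = \int[mu]_(x in D) f x)%E.
Proof.
move=> mf f0; rewrite (@integral_density _ _ _ mu _ (\1_D))//.
- rewrite [RHS]integral_mkcond; apply: eq_integral => x _.
  by rewrite patchE indicE; case: (x \in D); rewrite ?mul1e ?mul0e.
- by move=> A mA; rewrite integral_indic// setIC.
Qed.

End StieltjesMeasure.

Section Windows.
Context {R : realType}.
Variable T : set R.
Hypothesis oT : observation_interval T.

(** Bounded windows that exhaust [T] up to the point 0. They are open on the left because the
    Stieltjes measure of such an interval is an increment of the path, and the remaining point must
    be negligible for every path. *)
Definition is_windows (a b : nat -> R) : Prop :=
  [/\ forall n, [/\ T (a n), T (b n) & a n < b n],
      nondecreasing_seq (fun n => `]a n, b n]%classic),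
      forall n, `]a n, b n]%classic `<=` T,
      T `\` \bigcup_n `]a n, b n]%classic `<=` [set 0] &
      forall F : cumulative R R, counting_path T F -> lsm F (T `\` \bigcup_n `]a n, b n]%classic) = 0%E].

(** The path vanishes at -1 and at 0, so even the interval ]-1, 0] has mass 0. *)
Let atom0 (F : cumulative R R) : counting_path T F -> (forall t, t < 0 -> ~ T t) -> lsm F [set 0] = 0%E.
Proof.
move=> [F0 _ Fneg] T0; apply/eqP; rewrite eq_le measure_ge0 andbT.
have -> : 0%E = lsm F `]-1, 0]%classic.
  have m1 : -1 < 0 :> R by lra.
  by rewrite lsm_itv_oc ?(ltW m1)// F0 (Fneg _ m1 (T0 _ m1)) subrr.
apply: le_measure; rewrite ?inE.
- exact: (@measurable_set1 R 0).
- exact: measurable_itv.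
- by move=> _ ->; rewrite /= in_itv/=; lra.
Qed.

Lemma exists_windows : exists a b, is_windows a b.
Proof.
have sub0 (W : set R) : W `<=` [set 0] -> (forall t, t < 0 -> ~ T t) -> 
    forall F : cumulative R R, counting_path T F -> measurable W -> lsm F W = 0%E.
  move=> W0 Tneg F cF mW; apply/eqP; rewrite eq_le measure_ge0 andbT -(atom0 cF Tneg).
  by apply: le_measure; rewrite ?inE//; exact: (@measurable_set1 R 0).
have mT := observation_interval_measurable oT.
case: oT => [[T0 T00 TE]|TE|TE].
- exists (fun=> 0), (fun=> T0).
  have TW : T `\` \bigcup_(n : nat) `]0, T0]%classic `<=` [set 0].
    move=> t []; rewrite TE/= in_itv/= => /andP[t0 tT] h.
    apply/eqP/negPn/negP => tn0; apply: h; exists 0%N => //=.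
    by rewrite in_itv/= lt_neqAle eq_sym tn0 t0.
  split => //.
  + by move=> _; split; rewrite // TE/= !in_itv/= lexx ltW.
  + by move=> _ t; rewrite TE/= !in_itv/= => /andP[/ltW -> ->].
  + move=> F cF; apply: sub0 => //.
      by move=> t t0; rewrite TE/= in_itv/= leNgt t0.
    by apply: measurableD => //; apply: bigcup_measurable => n _; exact: measurable_itv.
- exists (fun=> 0), (fun n => n.+1%:R).
  have TW : T `\` \bigcup_n `]0, n.+1%:R]%classic `<=` [set 0].
    move=> t []; rewrite TE/= in_itv/= andbT => t0 h.
    apply/eqP/negPn/negP => tn0; apply: h; exists (Num.truncn t) => //=.
    by rewrite in_itv/= lt_neqAle eq_sym tn0 t0 ltW// truncnS_gt.
  split => //.
  + by move=> n; split; rewrite ?ltr0Sn// TE/= !in_itv/= ?lexx ?ler0n.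
  + move=> n m nm; rewrite subsetEset => t /=; rewrite !in_itv/= => /andP[-> /le_trans]; apply.
    by rewrite ler_nat ltnS.
  + by move=> n t; rewrite TE/= !in_itv/= andbT => /andP[/ltW].
  + move=> F cF; apply: sub0 => //.
      by move=> t t0; rewrite TE/= in_itv/= andbT leNgt t0.
    by apply: measurableD => //; apply: bigcup_measurable => n _; exact: measurable_itv.
- exists (fun n => - n.+1%:R), (fun n => n.+1%:R).
  have TW : T `\` \bigcup_n `]- n.+1%:R, n.+1%:R]%classic = set0.
    rewrite -subset0 => t [_]; apply; exists (Num.truncn `|t|) => //=.
    have := truncnS_gt `|t|; rewrite ltr_norml in_itv/= => /andP[-> /ltW ->] //.
  split => //.
  + by move=> n; split; rewrite ?TE// (@lt_trans _ _ 0)// ?oppr_lt0 ltr0Sn.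
  + move=> n m nm; rewrite subsetEset => t /=; rewrite !in_itv/= => /andP[h1 h2].
    have nm' : n.+1%:R <= m.+1%:R :> R by rewrite ler_nat ltnS.
    by rewrite (le_trans h2)// (le_lt_trans _ h1)// lerN2.
  + by move=> n t; rewrite TE.
  + by rewrite TW.
  + by move=> F cF; rewrite TW measure0.
Qed.

End Windows.

Section PathMeasure.
Context {R : realType} {d : measure_display} {A : measurableType d}.
Variables (T : set R) (X : A -> cumulative R R) (a b : R).
Hypothesis iT : is_interval T.
Hypothesis mX : forall t, T t -> measurable_fun setT (fun w => X w t).
Hypothesis Ta : T a.
Hypothesis Tb : T b.
Hypothesis ab : a < b.

Let W : set (measurableTypeR R) := `]a, b]%classic.
Let mW : measurable W. Proof. exact: measurable_itv. Qed.

(** Restriction to a window makes the measure finite, and its values on half-open intervals involve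
    the path only at times of [T], where measurability is known. *)
Definition path_measure (w : A) : {measure set (measurableTypeR R) -> \bar R} :=
  mrestr (lsm (X w)) mW.

Lemma path_measureT w : path_measure w setT = (X w b - X w a)%:E.
Proof. by rewrite /path_measure/= /mrestr setTI lsm_itv_oc// ltW. Qed.

Lemma path_measure_fin_num w U : measurable U -> path_measure w U \is a fin_num.
Proof.
move=> mU; rewrite ge0_fin_numE ?measure_ge0//.
apply: (@le_lt_trans _ _ (path_measure w setT)); last by rewrite path_measureT ltry.
by apply: le_measure; rewrite ?inE.
Qed.

Lemma path_measure_itv w x y :
  path_measure w `]x, y]%classic =
  (if Num.max x a < Num.min y b then X w (Num.min y b) - X w (Num.max x a) else 0)%:E.
Proof.
rewrite /path_measure/= /mrestr.
have -> : `]x, y]%classic `&` W = `]Num.max x a, Num.min y b]%classic.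
  apply/seteqP; split => t; rewrite /W/= !in_itv/= gt_max le_min.
    by move=> [/andP[-> ->] /andP[-> ->]].
  by move=> /andP[/andP[-> ->] /andP[-> ->]].
case: ifPn => [h|]; first by rewrite lsm_itv_oc// ltW.
by rewrite -leNgt => h; rewrite set_itv_ge ?measure0// bnd_simp -leNgt.
Qed.

(** Dynkin's theorem starts from half-open intervals, whose mass is an increment; complements are
    handled by the finiteness of the total mass. *)
Lemma measurable_path_measure U : measurable U ->
  measurable_fun setT (fun w => path_measure w U).
Proof.
move: U; apply: (@dynkin_induction _ (measurableTypeR R) (@ocitv R)
  (fun U => measurable_fun setT (fun w => path_measure w U))) => //.
- exact: ocitvI.
- under eq_fun do rewrite path_measureT.
  by apply/measurable_EFinP; apply: measurable_funB; exact: mX.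
- move=> _ [[x y] _ <-] /=; under eq_fun do rewrite path_measure_itv.
  apply/measurable_EFinP; have [|_] := ltP; last exact: measurable_cst.
  rewrite gt_max => +.
  have iTab u : a <= u <= b -> T u by exact: iT.
  move=> /andP[xm am]; have mb : Num.min y b <= b by rewrite ge_min lexx orbT.
  apply: measurable_funB; apply: mX; apply: iTab; first by rewrite (ltW am).
  by rewrite le_max lexx orbT ge_max !(le_trans (ltW _) mb).
- move=> U mU IH; rewrite (_ : (fun w => _) =
      (fun w => path_measure w setT - path_measure w U)%E); last first.
    apply/funext => w; rewrite -setTD measureD//.
      by rewrite setTI.
    by rewrite -ge0_fin_numE ?measure_ge0//; exact: path_measure_fin_num.
  apply: emeasurable_funB => //; under eq_fun do rewrite path_measureT.
  by apply/measurable_EFinP; apply: measurable_funB; exact: mX.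
- move=> F mF tF IH; rewrite (_ : (fun w => _) =
      (fun w => \sum_(i <oo | i \in xpredT) path_measure w (F i))%E); last first.
    by apply/funext => w; rewrite measure_bigcup//; apply: eq_eseriesl => i; rewrite in_setT.
  by apply: ge0_emeasurable_sum => //.
Qed.

Lemma measurable_window_integral (f : R -> \bar R) :
  measurable_fun `]a, b]%classic f -> (forall t, `]a, b]%classic t -> 0 <= f t)%E ->
  measurable_fun setT (fun w => \int[lsm (X w)]_(t in `]a, b]%classic) f t)%E.
Proof.
move=> mf f0; have mf' : measurable_fun [set: measurableTypeR R] (f \_ W).
  by apply/(measurable_restrictT f).
have f'0 x : (0 <= (f \_ W) x)%E by apply: erestrict_ge0.
rewrite (_ : (fun w => _) = (fun w => \int[path_measure w]_t (f \_ W) t)%E).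
  exact: measurable_fun_integral_kernel measurable_path_measure _ f'0 mf'.
apply/funext => w; rewrite integral_mrestr//.
by rewrite -[RHS](@integral_mkcondr _ _ _ _ W W) setIid.
Qed.

End PathMeasure.

Section DensityMeasure.
Context {R : realType} {d : measure_display} {S : measurableType d}.
Variables (mu : {measure set S -> \bar R}) (rho : S -> \bar R).
Hypothesis mrho : measurable_fun setT rho.
Hypothesis rho0 : forall x, (0 <= rho x)%E.

(** The two proofs are arguments so that the measure structure can be attached to the resulting
    function. *)
Definition density_measure (mu : set S -> \bar R) of measurable_fun setT rho
  & (forall x, 0 <= rho x)%E := fun A : set S => (\int[mu]_(x in A) rho x)%E.

Local Notation nu := (density_measure mu mrho rho0).

Let nu0 : nu set0 = 0%E. Proof. exact: integral_set0. Qed.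

Let nu_ge0 A : (0 <= nu A)%E.
Proof. by apply: integral_ge0 => x _. Qed.

Let nu_sigma_additive : semi_sigma_additive nu.
Proof.
move=> F mF tF mUF; rewrite /nu ge0_integral_bigcup//=; last first.
  exact: measurable_funS mrho.
by apply: is_cvg_ereal_nneg_natsum_cond => n _ _; exact: nu_ge0.
Qed.

HB.instance Definition _ := isMeasure.Build _ _ _ nu nu0 nu_ge0 nu_sigma_additive.

End DensityMeasure.

Section WindowLimit.
Context {R : realType}.
Variables (T : set R) (a b : nat -> R).
Hypothesis oT : observation_interval T.
Hypothesis wT : is_windows T a b.
Variables (mu : {measure set (measurableTypeR R) -> \bar R}) (f : R -> \bar R).
Hypothesis mu0 : mu (T `\` \bigcup_n `]a n, b n]%classic) = 0%E.
Hypothesis mf : measurable_fun T f.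
Hypothesis f0 : forall t, T t -> (0 <= f t)%E.

(** The windows increase to [T] up to a null set, so the integrals of a nonnegative function
    converge monotonically. *)
Lemma cvg_window_integral :
  (\int[mu]_(t in `]a n, b n]%classic) f t)%E @[n --> \oo] --> (\int[mu]_(t in T) f t)%E.
Proof.
have [wab ndW WT _ _] := wT; have mT := observation_interval_measurable oT.
pose U := \bigcup_n `]a n, b n]%classic.
have UT : U `<=` T by move=> t [n _]; exact: WT.
have mU : measurable U by apply: bigcup_measurable => n _; exact: measurable_itv.
have -> : (\int[mu]_(t in T) f t)%E = (\int[mu]_(t in U) f t)%E.
  have TE : T = U `|` (T `\` U) by rewrite setUDr ?setDv ?setD0 ?setUidr.
  have mTU : measurable (T `\` U) by exact: measurableD.
  rewrite {1}TE ge0_integral_setU//; last 3 first.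
  - by rewrite -TE.
  - by move=> t; rewrite -TE; exact: f0.
  - by rewrite disj_set2E setDE setICA setICr setI0.
  rewrite [X in (_ + X)%E]null_set_integral ?adde0//.
  by apply: measurable_funS mf => //; exact: subDsetl.
apply: ge0_nondecreasing_set_cvg_integral => //.
- move=> n; apply: measurable_funS mf => //; exact: WT.
- by move=> n t /WT; exact: f0.
Qed.

End WindowLimit.

Section PathIntegral.
Context {R : realType} {d : measure_display} {A : measurableType d}.
Variables (T : set R) (X : A -> cumulative R R).
Hypothesis oT : observation_interval T.
Hypothesis cX : counting_process T X.

Lemma measurable_path_integral (f : R -> \bar R) :
  measurable_fun T f -> (forall t, T t -> 0 <= f t)%E ->
  measurable_fun setT (fun w => \int[lsm (X w)]_(t in T) f t)%E.
Proof.
move=> mf f0; have [a [b wT]] := exists_windows oT.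
have [wab _ WT _ null] := wT.
have mI n : measurable_fun setT (fun w => \int[lsm (X w)]_(t in `]a n, b n]%classic) f t)%E.
  have [Ta Tb ab] := wab n.
  apply: (measurable_window_integral (observation_interval_is_interval oT)
    cX.2 Ta Tb ab).
    by have mT := observation_interval_measurable oT; exact: measurable_funS mT (WT n) mf.
  by move=> t /WT; exact: f0.
have := emeasurable_fun_cvg (fun n w => \int[lsm (X w)]_(t in `]a n, b n]%classic) f t)%E
  (fun w => \int[lsm (X w)]_(t in T) f t)%E mI; apply.
move=> w _; apply: (cvg_window_integral oT wT) => //; exact: null (cX.1 w).
Qed.

End PathIntegral.

Section Campbell.
Context {R : realType} {dO : measure_display} {Omega : measurableType dO}.
Variables (P : probability Omega R) (T : set R) (lam : R -> R) (X : Omega -> cumulative R R).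
Hypothesis oT : observation_interval T.
Hypothesis cX : counting_process T X.
Hypothesis lamT : intensity T lam.
Hypothesis PX : poisson_process P T lam X.

Let mX t : T t -> measurable_fun setT (fun w => X w t).
Proof. exact: cX.2. Qed.

Lemma measurable_increment s t : T s -> T t -> measurable_fun setT (fun w => X w t - X w s).
Proof. by move=> Ts Tt; apply: measurable_funB; exact: mX. Qed.

Lemma integral_lam_itv s t : T s -> T t ->
  (\int[lebesgue_measure]_(x in `]s, t]%classic) (lam x)%:E =
   (\int[lebesgue_measure]_(x in `[s, t]) lam x)%:E)%E.
Proof.
move=> Ts Tt; have [_ _ /(_ s t Ts Tt) int] := lamT.
rewrite integral_itv_obnd_cbnd; last first.
  by apply: measurable_funS (measurable_int _ int) => //; apply: subset_itvr; rewrite bnd_simp.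
by rewrite /Rintegral fineK//; exact: integrable_fin_num.
Qed.

Lemma increment_mean s t : T s -> T t -> s < t ->
  (\int[P]_w (X w t - X w s)%:E =
   \int[lebesgue_measure]_(x in `]s, t]%classic) (lam x)%:E)%E.
Proof.
move=> Ts Tt st; rewrite integral_lam_itv//.
apply: poisson_mean.
- exact: measurable_increment.
- by move=> k; exact: PX.1.
- by move=> w; rewrite subr_ge0 cumulative_le// ltW.
Qed.

Lemma increment_has_cf s t y : T s -> T t -> s < t ->
  let L := \int[lebesgue_measure]_(x in `[s, t]) lam x in
  has_cf P (fun w => y * (X w t - X w s)) (expR (L * (cos y - 1))) (L * sin y).
Proof.
move=> Ts Tt st L; apply: poisson_has_cf; first exact: measurable_increment.
by move=> k; exact: PX.1.
Qed.

Section Window.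
Variables a b : R.
Hypothesis Ta : T a.
Hypothesis Tb : T b.
Hypothesis ab : a < b.

Let W : set (measurableTypeR R) := `]a, b]%classic.
Let mW : measurable W. Proof. exact: measurable_itv. Qed.
Let iT := observation_interval_is_interval oT.

Let WT : W `<=` T.
Proof. by move=> t; rewrite /W/= in_itv/= => /andP[/ltW at_ tb]; apply: (iT Ta Tb); rewrite at_. Qed.

Let rho t : \bar R := ((fun x => (lam x)%:E) \_ W) t.

Let mrho : measurable_fun [set: measurableTypeR R] rho.
Proof.
apply/(measurable_restrictT (fun x => (lam x)%:E)) => //.
have [_ mlam _] := lamT; apply/measurable_EFinP; apply: measurable_funS mlam => //.
exact: observation_interval_measurable.
Qed.

Let rho0 t : (0 <= rho t)%E.
Proof.
apply: erestrict_ge0 => x Wx; rewrite lee_fin ltW//.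
by have [+ _ _] := lamT; apply; exact: WT.
Qed.

Let nu : {measure set (measurableTypeR R) -> \bar R} := density_measure lebesgue_measure mrho rho0.

Let nu_val U : nu U = (\int[lebesgue_measure]_(x in U) ((fun x => (lam x)%:E) \_ W) x)%E.
Proof. by []. Qed.

Let nu_itv x y : nu `]x, y]%classic = (\int[P]_w path_measure X a b w `]x, y]%classic)%E.
Proof.
under eq_integral do rewrite path_measure_itv.
rewrite nu_val -integral_mkcondr.
have -> : `]x, y]%classic `&` W = `]Num.max x a, Num.min y b]%classic.
  apply/seteqP; split => t; rewrite /W/= !in_itv/= gt_max le_min.
    by move=> [/andP[-> ->] /andP[-> ->]].
  by move=> /andP[/andP[-> ->] /andP[-> ->]].
have [h|h] := ltP (Num.max x a) (Num.min y b); last first.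
  by rewrite set_itv_ge ?integral_set0 ?integral0// bnd_simp -leNgt.
move: h; rewrite gt_max => /andP[xm am]; have mb : Num.min y b <= b by rewrite ge_min lexx orbT.
have hm : Num.max x a < Num.min y b by rewrite gt_max xm.
have am' : a <= Num.max x a by rewrite le_max lexx orbT.
rewrite increment_mean//; apply: (iT Ta Tb); lra.
Qed.

(** The mean of the random measure has density [lam] on the window. On half-open intervals this is
    the mean of a Poisson increment, and Dynkin's theorem extends it; the mean mass of the window is
    finite, which permits the subtraction for complements. *)
Let nuE U : measurable U -> nu U = (\int[P]_w path_measure X a b w U)%E.
Proof.
have mpath := measurable_path_measure iT mX Ta Tb ab.
have fin U' : measurable U' -> (\int[P]_w path_measure X a b w U')%E \is a fin_num.
  move=> mU; rewrite ge0_fin_numE; last by apply: integral_ge0.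
  apply: (@le_lt_trans _ _ (\int[P]_w (X w b - X w a)%:E)%E).
    apply: ge0_le_integral => //; first exact: mpath.
    - by apply/measurable_EFinP; exact: measurable_increment.
    - by move=> w _; rewrite -path_measureT//; apply: le_measure; rewrite ?inE.
  by rewrite increment_mean// integral_lam_itv// ltry.
have nuT : nu setT = (\int[P]_w path_measure X a b w setT)%E.
  under eq_integral do rewrite path_measureT//.
  rewrite increment_mean// nu_val -integral_mkcondr.
  by rewrite setTI.
move: U; apply: (@dynkin_induction _ (measurableTypeR R) (@ocitv R)
  (fun U => nu U = (\int[P]_w path_measure X a b w U)%E)) => //.
- exact: ocitvI.
- by move=> _ [[x y] _ <-]; exact: nu_itv.
- move=> U mU IH.
  have mUC : measurable (~` U) by exact: measurableC.
  have E : (nu U + nu (~` U) =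
      \int[P]_w path_measure X a b w U + \int[P]_w path_measure X a b w (~` U))%E.
    transitivity (nu setT).
      by rewrite -(setUv U); apply/esym; apply: measureU => //; exact: setICr.
    rewrite nuT -ge0_integralD//; try exact: mpath.
    by apply: eq_integral => w _; rewrite -measureU ?setUv ?setICr.
  move: E; rewrite IH => /(congr1 (fun x => x - \int[P]_w path_measure X a b w U)%E).
  by rewrite addeAC subee ?fin// add0e addeAC subee ?fin// add0e.
- move=> F mF tF IH.
  rewrite measure_bigcup// (eq_eseriesr (fun i _ => IH i)).
  rewrite (@eq_eseriesl _ _ xpredT); last by move=> k; rewrite in_setT.
  rewrite -integral_nneseries//; last by move=> n; exact: mpath.
  apply: eq_integral => w _; rewrite measure_bigcup//.
  by apply: eq_eseriesl => k; rewrite in_setT.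
Qed.

Lemma campbell_window (f : R -> \bar R) : measurable_fun [set: R] f -> (forall t, 0 <= f t)%E ->
  (\int[P]_w \int[lsm (X w)]_(t in `]a, b]%classic) f t =
   \int[lebesgue_measure]_(t in `]a, b]%classic) ((lam t)%:E * f t))%E.
Proof.
move=> mf f0; have mpath := measurable_path_measure iT mX Ta Tb ab.
transitivity (\int[P]_w \int[path_measure X a b w]_t f t)%E.
  by apply: eq_integral => w _; rewrite integral_mrestr.
rewrite -(@integral_mixture _ _ _ _ _ P (path_measure X a b) nu)//.
pose r t := fine (rho t).
have rhoE t : rho t = (r t)%:E by rewrite /r /rho patchE; case: ifP.
rewrite (@integral_density _ _ _ lebesgue_measure nu r)//.
- rewrite [RHS]integral_mkcond; apply: eq_integral => t _.
  by rewrite -rhoE /rho !patchE; case: ifP; rewrite ?mul0e.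
- exact: measurableT_comp.
- by move=> t; rewrite -lee_fin -rhoE.
- by move=> U mU; rewrite /nu/= /density_measure; apply: eq_integral => t _; rewrite rhoE.
Qed.

End Window.

(** Campbell's formula. On a window it integrates [f] against the mean measure; monotone convergence
    along the windows gives all of [T]. *)
Lemma campbell (f : R -> \bar R) : measurable_fun T f -> (forall t, T t -> 0 <= f t)%E ->
  (\int[P]_w \int[lsm (X w)]_(t in T) f t =
   \int[lebesgue_measure]_(t in T) ((lam t)%:E * f t))%E.
Proof.
move=> mf f0; have mT := observation_interval_measurable oT.
have [lam0 mlam _] := lamT.
have [a [b wT]] := exists_windows oT; have [wab ndW WT T0 null] := wT.
(* The extension by 0 is measurable and nonnegative on the whole line, as the formula on a window
   requires. *)
pose g := f \_ T.
have mg : measurable_fun [set: R] g by apply/(measurable_restrictT f).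
have g0 t : (0 <= g t)%E by exact: erestrict_ge0.
have gE t : T t -> g t = f t by move=> Tt; rewrite /g patchE mem_set.
have mg' : measurable_fun T g by exact: measurable_funS mg.
have -> : (\int[P]_w \int[lsm (X w)]_(t in T) f t = \int[P]_w \int[lsm (X w)]_(t in T) g t)%E.
  by apply: eq_integral => w _; apply: eq_integral => t /[!inE] Tt; rewrite gE.
have -> : (\int[lebesgue_measure]_(t in T) ((lam t)%:E * f t) =
    \int[lebesgue_measure]_(t in T) ((lam t)%:E * g t))%E.
  by apply: eq_integral => t /[!inE] Tt; rewrite gE.
have l1 : (\int[lebesgue_measure]_(t in `]a n, b n]%classic) ((lam t)%:E * g t))%E
    @[n --> \oo] --> (\int[lebesgue_measure]_(t in T) ((lam t)%:E * g t))%E.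
  apply: (cvg_window_integral oT wT).
  - apply/eqP; rewrite eq_le measure_ge0 andbT -(@lebesgue_measure_set1 R 0).
    apply: le_measure; rewrite ?inE//.
    by apply: measurableD => //; apply: bigcup_measurable => n _; exact: measurable_itv.
  - by apply: emeasurable_funM => //; exact/measurable_EFinP.
  - by move=> t Tt; rewrite mule_ge0// lee_fin ltW// lam0.
apply: (cvg_unique _ _ l1) => //.
rewrite (_ : (fun n => _) = (fun n => \int[P]_w \int[lsm (X w)]_(t in `]a n, b n]%classic) g t)%E);
  last by apply/funext => n; have [Ta Tb ab] := wab n; rewrite campbell_window.
have mI n : measurable_fun setT (fun w => \int[lsm (X w)]_(t in `]a n, b n]%classic) g t)%E.
  have [Ta Tb ab] := wab n.
  apply: (measurable_window_integral (observation_interval_is_interval oT) mX Ta Tb ab) => //.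
  exact: measurable_funS mg.
have cI w : (\int[lsm (X w)]_(t in `]a n, b n]%classic) g t)%E @[n --> \oo] -->
    (\int[lsm (X w)]_(t in T) g t)%E.
  by apply: (cvg_window_integral oT wT) => //; exact: null (cX.1 w).
have := @cvg_monotone_convergence _ _ _ P setT measurableT _ mI.
rewrite [X in _ -> _ -> _ --> X](_ : _ = (\int[P]_w \int[lsm (X w)]_(t in T) g t)%E);
  last by apply: eq_integral => w _; rewrite (cvg_lim _ (cI w)).
apply.
- by move=> n w _; apply: integral_ge0.
- move=> w _ n m nm; apply: ge0_subset_integral => //.
  + exact: measurable_funS mg.
  + by rewrite -subsetEset; exact: ndW.
Qed.

End Campbell.

Section LipschitzIntegral.
Context {R : realType} {d : measure_display} {S : measurableType d}.
Variables (mu : {measure set S -> \bar R}) (D : set S) (lam : S -> R).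
Hypothesis mD : measurable D.
Hypothesis mlam : measurable_fun D lam.
Hypothesis lam0 : forall t, D t -> 0 <= lam t.

(* [cos - 1] and [sin] are the instances of interest *)
Definition lipschitz0 (phi : R -> R) : Prop :=
  [/\ measurable_fun setT phi, phi 0 = 0 & forall x y, `|phi x - phi y| <= `|x - y|].

Variable phi : R -> R.
Hypothesis phiL : lipschitz0 phi.

Let weighted (g : S -> R) := mu.-integrable D (EFin \o (fun t => g t * lam t)).

Lemma lipschitz0_integrable g : measurable_fun D g -> weighted g ->
  weighted (phi \o g).
Proof.
have [mphi phi0 phiL'] := phiL.
move=> mg ig; apply: (@le_integrable_real _ _ _ mu D mD _ (fun t => `|g t * lam t|)).
- by apply: measurable_funM => //; exact: measurableT_comp.
- move=> t Dt; rewrite !normrM ler_wpM2r//.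
  by have := phiL' (g t) 0; rewrite phi0 !subr0.
- exact: integrable_norm ig.
Qed.

Lemma weightedB g h : weighted g -> weighted h -> weighted (fun t => g t - h t).
Proof.
move=> ig ih; have := integrableB_real mD ig ih.
by apply: eq_integrable => // t _; rewrite /= mulrBl.
Qed.

Lemma weighted_norm g : weighted g -> weighted (fun t => `|g t|).
Proof.
move=> ig; have := integrable_norm ig; apply: eq_integrable => // t /[!inE] Dt.
by rewrite /= normrM (ger0_norm (lam0 Dt)).
Qed.

Lemma lipschitz0_integral_dist g h : measurable_fun D g -> measurable_fun D h ->
  weighted g -> weighted h ->
  `|\int[mu]_(t in D) (phi (g t) * lam t) - \int[mu]_(t in D) (phi (h t) * lam t)| <=
  \int[mu]_(t in D) (`|g t - h t| * lam t).
Proof.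
move=> mg mh ig ih.
have ipg := lipschitz0_integrable mg ig; have iph := lipschitz0_integrable mh ih.
rewrite -RintegralB//; apply: le_trans (le_normr_Rintegral mD _) _.
  exact: integrableB_real.
apply: le_Rintegral => //.
- by apply: integrable_norm; exact: integrableB_real.
- exact: (weighted_norm (weightedB ig ih)).
- move=> t Dt; rewrite -mulrBl normrM (ger0_norm (lam0 Dt)).
  by rewrite ler_wpM2r ?lam0//; have [_ _] := phiL; exact.
Qed.

End LipschitzIntegral.

Section DominatedConvergence.
Context {R : realType} {d : measure_display} {S : measurableType d}.
Variables (mu : {measure set S -> \bar R}) (D : set S).
Hypothesis mD : measurable D.

Lemma Rintegral_eq0 : \int[mu]_(x in D) (0 : R) = 0.
Proof. by rewrite /Rintegral integral0. Qed.

Lemma EFin_Rintegral (f : S -> R) : mu.-integrable D (EFin \o f) ->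
  (\int[mu]_(x in D) f x)%:E = (\int[mu]_(x in D) (f x)%:E)%E.
Proof. by move=> intf; rewrite /Rintegral fineK//; exact: integrable_fin_num intf. Qed.

Lemma integrable_sum_real (I : Type) (s : seq I) (f : I -> S -> R) :
  (forall i, mu.-integrable D (EFin \o f i)) ->
  mu.-integrable D (EFin \o (fun x => \sum_(i <- s) f i x)).
Proof.
move=> intf; elim: s => [|i s IH].
  by under eq_fun do rewrite big_nil; exact: integrable0.
have := integrableD_real mD (intf i) IH; apply: eq_integrable => // x _.
by rewrite /= big_cons.
Qed.

Lemma Rintegral_sum (I : Type) (s : seq I) (f : I -> S -> R) :
  (forall i, mu.-integrable D (EFin \o f i)) ->
  \int[mu]_(x in D) (\sum_(i <- s) f i x) = \sum_(i <- s) \int[mu]_(x in D) f i x.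
Proof.
move=> intf; elim: s => [|i s IH].
  by under eq_Rintegral do rewrite big_nil; rewrite big_nil Rintegral_eq0.
under eq_Rintegral do rewrite big_cons.
by rewrite big_cons RintegralD// ?IH//; exact: integrable_sum_real.
Qed.

Lemma Rintegral_dominated_cvg (fn : nat -> S -> R) (f G : S -> R) :
  (forall n, measurable_fun D (fn n)) -> measurable_fun D f ->
  {ae mu, forall x, D x -> fn n x @[n --> \oo] --> f x} ->
  mu.-integrable D (EFin \o G) ->
  (forall n x, D x -> `|fn n x| <= G x) ->
  \int[mu]_(x in D) fn n x @[n --> \oo] --> \int[mu]_(x in D) f x.
Proof.
move=> mfn mf fnf iG fnG.
have := @dominated_convergence _ _ _ mu D mD (fun n x => (fn n x)%:E) (EFin \o f) (EFin \o G).
move=> [].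
- by move=> n; apply/measurable_EFinP.
- exact/measurable_EFinP.
- by apply: filterS fnf => x h Dx; apply: cvg_EFin; [exact: nearW|exact: h].
- exact: iG.
- by apply: aeW => x n Dx; rewrite /= lee_fin fnG.
move=> intf _ cvg; apply: fine_cvg.
by rewrite [X in _ --> X]fineK//; exact: integrable_fin_num intf.
Qed.

End DominatedConvergence.

Section LipschitzInstances.
Context {R : realType}.

Lemma lipschitz0_cosB1 : lipschitz0 (fun x : R => cos x - 1).
Proof.
split.
- by apply: measurable_funB => //; exact: continuous_measurable_fun (@continuous_cos R).
- by rewrite cos0 subrr.
- move=> x y; rewrite opprB addrA subrK; exact: norm_cosB_le.
Qed.

Lemma lipschitz0_sin : lipschitz0 (@sin R).
Proof.
split.
- exact: continuous_measurable_fun (@continuous_sin R).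
- exact: sin0.
- exact: norm_sinB.
Qed.

End LipschitzInstances.

Section RiemannSum.
Context {R : realType}.
Variables (mu : {measure set (measurableTypeR R) -> \bar R}) (rho f : R -> R).
Variables (t : nat -> R) (m : nat) (eps : R).
Hypothesis tm : forall i, (i < m)%N -> t i < t i.+1.
Hypothesis mf : measurable_fun [set: R] f.
Hypothesis rho0 : forall x, `]t 0%N, t m]%classic x -> 0 <= rho x.
Hypothesis irho : mu.-integrable `]t 0%N, t m]%classic (EFin \o rho).
Hypothesis B : R.
Hypothesis fB : forall x, `|f x| <= B.
Hypothesis feps : forall i x, (i < m)%N -> t i < x <= t i.+1 -> `|f x - f (t i)| <= eps.

Lemma le_grid i j : (i <= j)%N -> (j <= m)%N -> t i <= t j.
Proof.
elim: j => [|j IH]; first by rewrite leqn0 => /eqP ->.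
rewrite leq_eqVlt => /predU1P[-> //|ij] jm.
by rewrite (le_trans (IH _ (ltnW jm)))// ltW// tm.
Qed.

Let cell_split (g : R -> R) j : (j <= m)%N ->
  mu.-integrable `]t 0%N, t m]%classic (EFin \o g) ->
  \int[mu]_(x in `]t 0%N, t j]%classic) g x =
  \sum_(i < j) \int[mu]_(x in `]t i, t i.+1]%classic) g x.
Proof.
elim: j => [|j IH] jm ig.
  by rewrite big_ord0 set_itv_ge ?Rintegral_set0// bnd_simp ltxx.
rewrite big_ord_recr/= -IH ?(ltnW jm)//.
have jj := ltW (tm jm).
have E : `]t 0%N, t j.+1]%classic = `]t 0%N, t j]%classic `|` `]t j, t j.+1]%classic.
  apply/seteqP; split => x /=; rewrite !in_itv/=.
    by move=> /andP[-> ->]; rewrite andbT; case: leP => _; [left|right].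
  have t0j := @le_grid 0 j (leq0n _) (ltnW jm).
  by case=> /andP[h1 h2]; [rewrite h1 (le_trans h2)|rewrite h2 (le_lt_trans _ h1)].
rewrite E Rintegral_setU//; try exact: measurable_itv.
- rewrite -E; apply: integrableS ig => //; try exact: measurable_itv.
  by move=> x; rewrite /= !in_itv/= => /andP[-> /le_trans]; apply; exact: le_grid.
- rewrite disj_set2E; apply/eqP; rewrite -subset0 => x /= [].
  by rewrite !in_itv/= => /andP[_ h1] /andP[h2 _]; move: h1; rewrite leNgt h2.
Qed.

Let cell_sub i x : (i < m)%N -> `]t i, t i.+1]%classic x -> `]t 0%N, t m]%classic x.
Proof.
move=> im; rewrite /= !in_itv/= => /andP[h1 h2].
rewrite (le_lt_trans _ h1) ?(@le_grid 0)// ?(ltnW im)//=.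
by rewrite (le_trans h2)// le_grid.
Qed.

(** One estimate for two measures: Lebesgue measure with density [lam], which gives the exponent of
    the characteristic function, and a path measure with density 1, which gives the path
    integral. *)
Lemma riemann_sum_dist :
  `|\int[mu]_(x in `]t 0%N, t m]%classic) (f x * rho x) -
    \sum_(i < m) f (t i) * \int[mu]_(x in `]t i, t i.+1]%classic) rho x| <=
  eps * \int[mu]_(x in `]t 0%N, t m]%classic) rho x.
Proof.
have mf' (D : set (measurableTypeR R)) : measurable_fun D f.
  exact: measurable_funS mf.
have ifrho : mu.-integrable `]t 0%N, t m]%classic (EFin \o (fun x => f x * rho x)).
  by apply: (@integrable_mul_bounded _ _ _ mu _ _ rho f B) => //; exact: measurable_itv.
rewrite !cell_split// -sumrB mulr_sumr; apply: le_trans (ler_norm_sum _ _ _) _.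
apply: ler_sum => i _.
have mI : measurable (`]t i, t i.+1]%classic : set (measurableTypeR R)).
  exact: measurable_itv.
have mT : measurable (`]t 0%N, t m]%classic : set (measurableTypeR R)).
  exact: measurable_itv.
have sub : `]t i, t i.+1]%classic `<=` `]t 0%N, t m]%classic by move=> x; exact: cell_sub.
have ir := integrableS mT mI sub irho.
have ifr := integrableS mT mI sub ifrho.
rewrite -RintegralZl// -RintegralB//; last exact: integrableZ_real.
apply: le_trans (le_normr_Rintegral mI _) _.
  by apply: integrableB_real => //; exact: integrableZ_real.
rewrite -RintegralZl//; apply: le_Rintegral => //.
- by apply: integrable_norm; apply: integrableB_real => //; exact: integrableZ_real.
- exact: integrableZ_real.
- move=> x Ix; rewrite -mulrBl normrM (ger0_norm (rho0 (cell_sub (ltn_ord i) Ix))).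
  apply: ler_wpM2r; first exact: (rho0 (cell_sub (ltn_ord i) Ix)).
  by apply: feps => //; move: Ix; rewrite /= in_itv.
Qed.

End RiemannSum.

(** * The characteristic functional of a Poisson process *)

Section PathCF.
Context {R : realType} {dO : measure_display} {Omega : measurableType dO}.
Variables (P : probability Omega R) (T : set R) (lam : R -> R) (X : Omega -> cumulative R R).
Hypothesis oT : observation_interval T.
Hypothesis cX : counting_process T X.
Hypothesis lamT : intensity T lam.
Hypothesis PX : poisson_process P T lam X.

Let mT : measurable (T : set (measurableTypeR R)).
Proof. exact: observation_interval_measurable. Qed.
Let iT := observation_interval_is_interval oT.
Let mlam : measurable_fun T lam. Proof. by have [] := lamT. Qed.
Let lam_ge0 t : T t -> 0 <= lam t. Proof. by have [h _ _] := lamT; move=> /h/ltW. Qed.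

Section Grid.
Variables (t : nat -> R) (m : nat) (c : nat -> R).
Hypothesis Tt : forall i, (i <= m)%N -> T (t i).
Hypothesis tm : forall i, (i < m)%N -> t i < t i.+1.

Let L i := \int[lebesgue_measure]_(x in `[t i, t i.+1]) lam x.
Let Y i w := X w (t i.+1) - X w (t i).
Let G (i : 'I_m) := preimage_set_system [set: Omega] (fun w => Y i w) measurable.

Let mY i : (i < m)%N -> measurable_fun setT (Y i).
Proof. by move=> im; apply: (measurable_increment cX); apply: Tt => //; exact: ltnW. Qed.

Let sG i : sigma_algebra setT (G i).
Proof. apply: sigma_algebra_preimage; exact: sigma_algebra_measurable. Qed.

Let mG i : G i `<=` measurable.
Proof. by move=> _ [B mB <-]; apply: mY. Qed.

(** The increments before cell [j] and the increment on cell [j] belong to disjoint blocks of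
    independent sigma-algebras, so the characteristic functions multiply. *)
Lemma grid_has_cf j : (j <= m)%N ->
  has_cf P (fun w => \sum_(i < j) c i * (X w (t i.+1) - X w (t i)))
    (expR (\sum_(i < j) L i * (cos (c i) - 1))) (\sum_(i < j) L i * sin (c i)).
Proof.
elim: j => [|j IH] jm.
  rewrite !big_ord0 expR0; apply: eq_has_cf (@has_cf0 _ _ _ P) => w.
  by rewrite big_ord0.
rewrite !big_ord_recr/= expRD.
apply: (@eq_has_cf _ _ _ P (fun w => \sum_(i < j) c i * Y i w + c j * Y j w)).
  by move=> w; rewrite big_ord_recr.
have lt_m (i : 'I_j) : (i < m)%N by rewrite (ltn_trans (ltn_ord i)).
apply: has_cfD.
- by apply: measurable_sum => i; apply: measurable_funM => //; exact: mY.
- by apply: measurable_funM => //; exact: mY.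
- move=> B1 B2 mB1 mB2.
  pose U := [set i : 'I_m | (i < j)%N]; pose V := [set Ordinal jm].
  apply: (@mutually_independent_blocks _ _ _ P _ G sG mG _ U V).
  + apply: PX.2 => [i|i] im; [exact: Tt|exact: tm].
  + rewrite -subset0 => i [ij iE]; move: ij; rewrite iE /U.
    by rewrite mksetE/= ltnn.
  + pose O' := g_sigma_algebraType (\bigcup_(i in U) G i).
    have : measurable_fun [set: O'] (fun w => \sum_(i < j) c i * Y i w).
      apply: measurable_sum => i; apply: measurable_funM => // _ B mB.
      rewrite setTI; apply: sub_sigma_algebra; exists (Ordinal (lt_m i)); first exact: (ltn_ord i).
      by exists B => //; rewrite setTI.
    by move=> /(_ measurableT _ mB1); rewrite setTI.
  + pose O' := g_sigma_algebraType (\bigcup_(i in V) G i).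
    have : measurable_fun [set: O'] (fun w => c j * Y j w).
      apply: measurable_funM => // _ B mB.
      rewrite setTI; apply: sub_sigma_algebra; exists (Ordinal jm) => //=.
      by exists B => //; rewrite setTI.
    by move=> /(_ measurableT _ mB2); rewrite setTI.
- exact: IH (ltnW jm).
- by apply: (increment_has_cf cX PX); [exact: Tt (ltnW jm)|exact: Tt|exact: tm].
Qed.

End Grid.

Definition weighted_integrable (g : R -> R) :=
  lebesgue_measure.-integrable T (EFin \o (fun t => g t * lam t)).

Definition path_integral (g : R -> R) (w : Omega) : R :=
  \int[lsm (X w)]_(t in T) g t.

(** Modulus and phase of the characteristic functional E exp(i int g dX) = exp(int (exp(i g) - 1)
    lam dt). *)
Definition has_poisson_cf (g : R -> R) : Prop :=
  has_cf P (path_integral g)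
    (expR (\int[lebesgue_measure]_(t in T) ((cos (g t) - 1) * lam t)))
    (\int[lebesgue_measure]_(t in T) (sin (g t) * lam t)).

Lemma measurable_Rpath_integral (g : R -> R) : measurable_fun T g ->
  measurable_fun setT (path_integral g).
Proof.
move=> mg; have mg' : measurable_fun T (EFin \o g) by exact/measurable_EFinP.
rewrite /path_integral /Rintegral.
apply: (measurableT_comp (@fine_measurable R setT measurableT)).
rewrite (_ : (fun w => _) = (fun w => \int[lsm (X w)]_(t in T) (EFin \o g)^\+ t -
    \int[lsm (X w)]_(t in T) (EFin \o g)^\- t)%E); last first.
  by apply/funext => w; rewrite integralE.
apply: emeasurable_funB; apply: measurable_path_integral => //.
- exact: measurable_funepos.
- exact: measurable_funeneg.
Qed.

Lemma integral_path_norm (g : R -> R) : measurable_fun T g -> weighted_integrable g ->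
  (\int[P]_w \int[lsm (X w)]_(t in T) `|g t|%:E =
   (\int[lebesgue_measure]_(t in T) (`|g t| * lam t))%:E)%E.
Proof.
move=> mg ig; rewrite (campbell oT cX lamT PX)//.
- rewrite /Rintegral fineK.
    by apply: eq_integral => t _; rewrite EFinM muleC.
  apply: integrable_fin_num => //.
  exact: (@weighted_norm _ _ _ lebesgue_measure T lam).
- by apply/measurable_EFinP; exact: measurableT_comp.
Qed.

(** By Campbell's formula the path integral of the absolute value of [g] has finite mean, hence is
    almost surely finite. *)
Lemma ae_path_integrable (g : R -> R) : measurable_fun T g -> weighted_integrable g ->
  {ae P, forall w, (lsm (X w)).-integrable T (EFin \o g)}.
Proof.
move=> mg ig.
have mg' : measurable_fun T (fun t => `|g t|%:E).
  by apply/measurable_EFinP; exact: measurableT_comp.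
have mI : measurable_fun setT (fun w => \int[lsm (X w)]_(t in T) `|g t|%:E)%E.
  exact: measurable_path_integral.
have : P.-integrable setT (fun w => \int[lsm (X w)]_(t in T) `|g t|%:E)%E.
  apply/integrableP; split => //.
  under eq_integral do rewrite gee0_abs ?integral_ge0//.
  by rewrite integral_path_norm// ltry.
move=> /(integrable_ae measurableT); apply: filterS => w /(_ I) fin.
apply/integrableP; split; first exact/measurable_EFinP.
by move: fin; rewrite ge0_fin_numE ?integral_ge0.
Qed.

(** L1 approximation of integrands with weight [lam] thus yields L1 approximation of path integrals.
    Subtracting the two integrals is legitimate only along almost every path. *)
Lemma path_integral_dist (g h : R -> R) : measurable_fun T g -> measurable_fun T h ->
  weighted_integrable g -> weighted_integrable h ->
  (\int[P]_w `|path_integral g w - path_integral h w|%:E <=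
   (\int[lebesgue_measure]_(t in T) (`|g t - h t| * lam t))%:E)%E.
Proof.
move=> mg mh ig ih.
have mgh : measurable_fun T (fun t => g t - h t) by exact: measurable_funB.
have igh : weighted_integrable (fun t => g t - h t).
  exact: (@weightedB _ _ _ lebesgue_measure T lam).
rewrite -integral_path_norm//; apply: ae_ge0_le_integral => //.
- apply/measurable_EFinP; apply: measurableT_comp => //.
  by apply: measurable_funB; exact: measurable_Rpath_integral.
- by move=> w _; apply: integral_ge0.
- by apply: measurable_path_integral => //; apply/measurable_EFinP; exact: measurableT_comp.
- have := ae_path_integrable mh ih; apply: filterS2 (ae_path_integrable mg ig) => w iw jw _.
  rewrite /path_integral -RintegralB// EFin_normr_Rintegral//; last exact: integrableB_real.
  apply: le_trans (le_abse_integral _ _ _) _ => //.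
  exact/measurable_EFinP.
Qed.

(** The class of integrands with the right functional is closed in weighted L1. It therefore grows
    from Riemann sums to continuous functions, then to bounded functions on a window, then to all
    weighted integrable functions. *)
Lemma has_poisson_cf_cvg (gn : nat -> R -> R) (g : R -> R) (e : nat -> R) :
  (forall n, measurable_fun T (gn n)) -> measurable_fun T g ->
  (forall n, weighted_integrable (gn n)) -> weighted_integrable g ->
  (forall n, \int[lebesgue_measure]_(t in T) (`|gn n t - g t| * lam t) <= e n) ->
  e @ \oo --> (0 : R) ->
  (forall n, has_poisson_cf (gn n)) -> has_poisson_cf g.
Proof.
move=> mgn mg ign ig gne e0 hgn.
have lim phi : lipschitz0 phi ->
    \int[lebesgue_measure]_(t in T) (phi (gn n t) * lam t) @[n --> \oo] -->
    \int[lebesgue_measure]_(t in T) (phi (g t) * lam t).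
  move=> phiL; apply/cvgrPdist_le => eps eps0.
  have /cvgrPdist_le /(_ _ eps0) := e0; apply: filterS => n.
  rewrite sub0r normrN distrC => en; apply: le_trans (le_trans (ler_norm _) en).
  apply: le_trans (gne n).
  exact: (@lipschitz0_integral_dist _ _ _ lebesgue_measure T lam mT mlam lam_ge0
    phi phiL (gn n) g (mgn n) mg (ign n) ig).
apply: (has_cf_cvg (fun n => measurable_Rpath_integral (mgn n))
  (measurable_Rpath_integral mg) hgn _ e0).
- by move=> n; apply: le_trans (path_integral_dist _ _ _ _) _ => //; rewrite lee_fin.
- apply: continuous_cvg; first exact: continuous_expR.
  exact: lim lipschitz0_cosB1.
- exact: lim lipschitz0_sin.
Qed.

Section Window.
Variables a b : R.
Hypothesis Ta : T a.
Hypothesis Tb : T b.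
Hypothesis ab : a < b.

Let W : set (measurableTypeR R) := `]a, b]%classic.
Let mW : measurable W. Proof. exact: measurable_itv. Qed.
Let WT : W `<=` T.
Proof. by move=> t; rewrite /W/= in_itv/= => /andP[/ltW at_ tb]; apply: (iT Ta Tb); rewrite at_. Qed.

Let LW := \int[lebesgue_measure]_(x in `]a, b]%classic) lam x.

Let ilamW : lebesgue_measure.-integrable W (EFin \o lam).
Proof.
have [_ _ /(_ a b Ta Tb)] := lamT; apply: integrableS => //.
by apply: subset_itvr; rewrite bnd_simp.
Qed.

Lemma window_integral_lipschitz0 phi (h : R -> R) : lipschitz0 phi ->
  \int[lebesgue_measure]_(t in T) (phi ((h \_ W) t) * lam t) =
  \int[lebesgue_measure]_(t in W) (phi (h t) * lam t).
Proof.
move=> [_ phi0 _]; rewrite -[in RHS](setIidr WT) Rintegral_mkcondr.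
apply: eq_Rintegral => t _; rewrite !patchE.
by case: ifP; rewrite ?phi0 ?mul0r.
Qed.

Lemma window_path_integral (h : R -> R) w :
  path_integral (h \_ W) w = \int[lsm (X w)]_(t in W) h t.
Proof. by rewrite /path_integral -Rintegral_mkcondr setIidr. Qed.

Lemma window_weighted_integrable (h : R -> R) (B : R) : measurable_fun W h ->
  (forall t, W t -> `|h t| <= B) -> weighted_integrable (h \_ W).
Proof.
move=> mh hB.
have B0 : 0 <= B.
  by apply: le_trans (hB b _) => //; rewrite /W/= in_itv/= ab lexx.
have hWB t : `|(h \_ W) t| <= B.
  by rewrite patchE; case: ifPn => [/set_mem /hB//|_]; rewrite normr0.
have mhW : measurable_fun [set: R] (h \_ W) by apply/(measurable_restrictT h).
rewrite /weighted_integrable.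
have ilW : lebesgue_measure.-integrable T (EFin \o (lam \_ W)).
  have := ilamW; rewrite integrable_mkcond// => /(integrableS measurableT mT (@subsetT _ T)).
  by apply: eq_integrable => // t _; rewrite /= !patchE; case: ifP.
have := @integrable_mul_bounded _ _ _ lebesgue_measure T mT (lam \_ W) (h \_ W) B
  (measurable_funS measurableT (@subsetT _ T) mhW) (fun t _ => hWB t) ilW.
apply: eq_integrable => // t _; rewrite /= !patchE; case: ifP => //.
by rewrite mulr0 mul0r.
Qed.

Section ContinuousIntegrand.
Variables (h : R -> R) (B : R).
Hypothesis ch : continuous h.
Hypothesis hB : forall x, `|h x| <= B.

Let mh : measurable_fun [set: R] h.
Proof. exact: continuous_measurable_fun. Qed.

Lemma exists_fine_grid (eps : R) : 0 < eps -> exists mt : nat * (nat -> R),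
  let m := mt.1 in let t := mt.2 in
  [/\ t 0%N = a, t m = b, forall i, (i < m)%N -> t i < t i.+1,
      forall i, (i <= m)%N -> T (t i) &
      forall i x, (i < m)%N -> t i < x <= t i.+1 -> `|h x - h (t i)| <= eps].
Proof.
move=> eps0.
have hch (x : R) : `[a, b]%classic x -> {for x, continuous h} by move=> _; exact: ch.
have [dl dl0 hdl] := @compact_uniform_modulus R _ `[a, b]%classic h
  (@segment_compact R a b) hch eps eps0.
pose m := (Num.truncn ((b - a) / dl)).+1.
pose t (i : nat) := a + (b - a) * i%:R / m%:R.
have m0 : 0 < m%:R :> R by rewrite ltr0n.
have ba : 0 < b - a by rewrite subr_gt0.
have step i : t i.+1 = t i + (b - a) / m%:R.
  by rewrite /t -natr1 mulrDr mulr1 mulrDl addrA.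
have small : (b - a) / m%:R < dl.
  by rewrite ltr_pdivrMr// mulrC -ltr_pdivrMr// truncnS_gt.
have tab i : (i <= m)%N -> a <= t i <= b.
  move=> im; rewrite /t lerDl mulr_ge0 ?invr_ge0 ?(ltW m0)//=; last by rewrite mulr_ge0// ltW.
  rewrite -lerBrDl ler_pdivrMr// ler_wpM2l ?(ltW ba)//.
  by rewrite ler_nat.
exists (m, t); split => /=.
- by rewrite /t mulr0 mul0r addr0.
- by rewrite /t mulfK ?gt_eqF// addrC subrK.
- by move=> i _; rewrite step ltrDl divr_gt0.
- by move=> i im; apply: (iT Ta Tb); exact: tab.
- move=> i x im /andP[tx xt]; apply: ltW; apply: hdl.
    by rewrite /= in_itv/= tab// ltnW.
  rewrite -ball_normE/= ltr_norml; move: xt; rewrite step => xt; lra.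
Qed.

(** Riemann sums have an exact characteristic function. Their distance to the path integral is at
    most the oscillation on the cells times the increment of the path over the window, whose mean is
    finite. *)
Lemma continuous_window_poisson_cf : has_poisson_cf (h \_ W).
Proof.
have /choice[mt mtP] : forall n : nat, exists mt : nat * (nat -> R),
    let m := mt.1 in let t := mt.2 in
    [/\ t 0%N = a, t m = b, forall i, (i < m)%N -> t i < t i.+1,
      forall i, (i <= m)%N -> T (t i) &
      forall i x, (i < m)%N -> t i < x <= t i.+1 -> `|h x - h (t i)| <= n.+1%:R^-1].
  by move=> n; apply: exists_fine_grid; rewrite invr_gt0.
pose m n := (mt n).1; pose t n := (mt n).2.
pose L n i := \int[lebesgue_measure]_(x in `[t n i, t n i.+1]) lam x.
pose Yn n w := \sum_(i < m n) h (t n i) * (X w (t n i.+1) - X w (t n i)).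
have cvg0 (C : R) : (fun n => n.+1%:R^-1 * C) @ \oo --> (0 : R).
  by rewrite -[X in _ --> X](mul0r C); apply: cvgM; [exact: cvg_harmonic|exact: cvg_cst].
have LE n i : (i < m n)%N ->
    \int[lebesgue_measure]_(x in `]t n i, t n i.+1]%classic) lam x = L n i.
  move=> im; have [_ _ _ Tt _] := mtP n.
  rewrite /L -Rintegral_itv_obnd_cbnd//.
  have [_ _ /(_ (t n i) (t n i.+1) (Tt _ (ltnW im)) (Tt _ im))] := lamT.
  by apply: integrableS => //; apply: subset_itvr; rewrite bnd_simp.
have lim phi : lipschitz0 phi ->
    \sum_(i < m n) L n i * phi (h (t n i)) @[n --> \oo] -->
    \int[lebesgue_measure]_(x in T) (phi ((h \_ W) x) * lam x).
  move=> phiL; have [mphi phi0 phi_dist] := phiL.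
  rewrite window_integral_lipschitz0//; apply/cvgrPdist_le => eps eps0.
  have /cvgrPdist_le /(_ _ eps0) := cvg0 LW; apply: filterS => n.
  rewrite sub0r normrN => en; apply: le_trans (le_trans (ler_norm _) en).
  have [ta tb tm Tt hh] := mtP n.
  rewrite (eq_bigr (fun i : 'I_(m n) => phi (h (t n i)) *
      \int[lebesgue_measure]_(x in `]t n i, t n i.+1]%classic) lam x)); last first.
    by move=> i _; rewrite LE// mulrC.
  have := @riemann_sum_dist R lebesgue_measure lam (phi \o h) (t n) (m n) n.+1%:R^-1 tm.
  rewrite /t /m ta tb; apply => //.
  - exact: measurableT_comp.
  - by move=> x Wx; apply/lam_ge0/WT.
  - move=> x /=; have := phi_dist (h x) 0; rewrite phi0 !subr0 => /le_trans; apply.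
    exact: hB.
  - move=> i x im tx /=; apply: le_trans (phi_dist _ _) _; exact: hh.
apply: (@has_cf_cvg _ _ _ P Yn _ (fun n => expR (\sum_(i < m n) L n i * (cos (h (t n i)) - 1)))
  (fun n => \sum_(i < m n) L n i * sin (h (t n i))) (fun n => n.+1%:R^-1 * LW)).
- move=> n; have [_ _ _ Tt _] := mtP n.
  apply: measurable_sum => i; apply: measurable_funM => //.
  by apply: (measurable_increment cX); apply: Tt => //; exact: ltnW.
- by apply: measurable_Rpath_integral; apply: measurable_funS (_ : measurable_fun [set: R] _) => //;
    apply/(measurable_restrictT h) => //; exact: measurable_funS mh.
- move=> n; have [_ _ tm Tt _] := mtP n.
  exact: (@grid_has_cf (t n) (m n) (fun i => h (t n i)) Tt tm (m n)).
- move=> n; have [ta tb tm Tt hh] := mtP n.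
  have dist w : `|Yn n w - path_integral (h \_ W) w| <= n.+1%:R^-1 * (X w b - X w a).
    rewrite distrC window_path_integral.
    have mass s u : s <= u ->
        \int[lsm (X w)]_(x in `]s, u]%classic) cst 1 x = X w u - X w s.
      move=> su; rewrite Rintegral_cst ?mul1r; last exact: measurable_itv.
      exact: (congr1 fine (lsm_itv_oc (X w) su)).
    have := @riemann_sum_dist R (lsm (X w)) (cst 1) h (t n) (m n) n.+1%:R^-1 tm.
    rewrite /t /m ta tb mass ?(ltW ab)//.
    rewrite (eq_bigr (fun i : 'I_(m n) => h (t n i) * (X w (t n i.+1) - X w (t n i)))); last first.
      by move=> i _; rewrite mass// ltW// tm.
    under eq_Rintegral do rewrite mulr1.
    apply => //.
    apply/integrableP; split; first exact/measurable_EFinP/measurable_cst.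
    rewrite (eq_integral (cst 1%E)); last by move=> x _; rewrite /= normr1.
    rewrite integral_cst; last exact: measurable_itv.
    by rewrite mul1e [X in (X < _)%E](lsm_itv_oc (X w) (ltW ab)) ltry.
  apply: (@le_trans _ _ (\int[P]_w (n.+1%:R^-1 * (X w b - X w a))%:E)%E).
    apply: ge0_le_integral => //.
    + apply/measurable_EFinP; apply: measurableT_comp => //; apply: measurable_funB.
        apply: measurable_sum => i; apply: measurable_funM => //.
        by apply: (measurable_increment cX); apply: Tt => //; exact: ltnW.
      by apply: measurable_Rpath_integral; apply: measurable_funS (_ : measurable_fun [set: R] _) => //;
        apply/(measurable_restrictT h) => //; exact: measurable_funS mh.
    + apply/measurable_EFinP; apply: measurable_funM => //; exact: (measurable_increment cX).
    + by move=> w _; rewrite lee_fin.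
  under eq_integral do rewrite EFinM.
  rewrite ge0_integralZl_EFin//; last 2 first.
  + by move=> w _; rewrite lee_fin subr_ge0 cumulative_le// ltW.
  + by apply/measurable_EFinP; exact: (measurable_increment cX).
  rewrite (increment_mean cX lamT PX)// (integral_lam_itv lamT)// -EFinM lee_fin.
  by rewrite /LW Rintegral_itv_obnd_cbnd.
- exact: cvg0.
- apply: continuous_cvg; first exact: continuous_expR.
  exact: lim lipschitz0_cosB1.
- exact: lim lipschitz0_sin.
Qed.

End ContinuousIntegrand.

End Window.

Lemma continuous_clamp (h : R -> R) (B : R) : continuous h ->
  continuous (fun x => Num.max (- B) (Num.min B (h x))).
Proof.
move=> ch x; apply: (@continuous_max _ _ (cst (- B)) (fun x => Num.min B (h x))).
  exact: cvg_cst.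
by apply: (@continuous_min _ _ (cst B) h); [exact: cvg_cst|exact: ch].
Qed.

Lemma clamp_bound (B x : R) : 0 <= B -> `|Num.max (- B) (Num.min B x)| <= B.
Proof.
move=> B0; rewrite ler_norml le_max lexx/= ge_max ge_min lexx/= andbT.
by rewrite (le_trans _ B0)// oppr_le0.
Qed.

Lemma clamp_id (B x : R) : `|x| <= B -> Num.max (- B) (Num.min B x) = x.
Proof. by rewrite ler_norml => /andP[h1 h2]; rewrite min_r// max_r. Qed.

Lemma clamp_self_dist (B x : R) : 0 <= B ->
  `|Num.max (- B) (Num.min B x) - x| <= `|x|.
Proof.
move=> B0; have := ler_norm x; have := ler_norm (- x); rewrite normrN => h1 h2.
rewrite ler_norml.
by have [?|?] := leP B x; have [?|?] := leP (- B) B; have [?|?] := leP (- B) x; lra.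
Qed.

Lemma clamp_dist (B x y : R) :
  `|Num.max (- B) (Num.min B x) - Num.max (- B) (Num.min B y)| <= `|x - y|.
Proof.
have := ler_norm (x - y); have := ler_norm (- (x - y)); rewrite normrN => h1 h2.
rewrite ler_norml.
by have [?|?] := leP B x; have [?|?] := leP B y;
  have [?|?] := leP (- B) B; have [?|?] := leP (- B) x; have [?|?] := leP (- B) y; lra.
Qed.

Section BoundedIntegrand.
Variables a b : R.
Hypothesis Ta : T a.
Hypothesis Tb : T b.
Hypothesis ab : a < b.
Let W : set (measurableTypeR R) := `]a, b]%classic.
Let mW : measurable W. Proof. exact: measurable_itv. Qed.

(** Continuous functions approximate [g] in L1 for Lebesgue measure; clamping restores the bound [B]
    without increasing the distance. The difficulty is to pass to the weight [lam], which may be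
    unbounded on the window. *)
Lemma bounded_window_poisson_cf (g : R -> R) (B : R) : measurable_fun T g ->
  (forall t, T t -> `|g t| <= B) -> has_poisson_cf (g \_ W).
Proof.
move=> mg gB.
have WT : W `<=` T.
  by move=> t; rewrite /W/= in_itv/= => /andP[/ltW at_ tb]; apply: (iT Ta Tb); rewrite at_.
have B0 : 0 <= B by exact: le_trans (gB _ Ta).
have mgW : measurable_fun W g by exact: measurable_funS mT WT mg.
have muW : (lebesgue_measure W < +oo)%E.
  by rewrite /W lebesgue_measure_itv/= lte_fin ab -EFinB ltry.
have igW : lebesgue_measure.-integrable W (EFin \o g).
  apply: measurable_bounded_integrable => //.
  exists B; split; first by rewrite num_real.
  by move=> x Bx t /WT /gB /le_trans; apply; exact: ltW.
have ilamW : lebesgue_measure.-integrable W (EFin \o lam).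
  have [_ _ /(_ a b Ta Tb)] := lamT; apply: integrableS => //.
  by apply: subset_itvr; rewrite bnd_simp.
have [gs [cgs igs gsg]] := approximation_continuous_integrable mW muW igW.
pose hn n x := Num.max (- B) (Num.min B (gs n x)).
have chn n : continuous (hn n) by apply: continuous_clamp; exact: cgs.
have hB n x : `|hn n x| <= B by exact: clamp_bound.
have mh n (D : set (measurableTypeR R)) : measurable_fun D (hn n).
  by apply: measurable_funTS; exact: continuous_measurable_fun.
have mgW' : measurable_fun [set: R] (g \_ W) by apply/(measurable_restrictT g).
have mhW' n : measurable_fun [set: R] (hn n \_ W).
  by apply/(measurable_restrictT (hn n)) => //; exact: mh.
have dB n x : W x -> `|hn n x - g x| <= 2 * B.
  move=> Wx; apply: le_trans (ler_normB _ _) _.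
  by have := hB n x; have := gB x (WT x Wx); lra.
have idist n : lebesgue_measure.-integrable W (EFin \o (fun x => `|hn n x - g x|)).
  apply: (@le_integrable_real _ _ _ lebesgue_measure W mW _ (cst (2 * B))).
  - by apply: measurableT_comp => //; apply: measurable_funB.
  - by move=> x Wx; rewrite normr_id dB.
  - by apply: measurable_bounded_integrable => //;
      exists (2 * B); split; [rewrite num_real|move=> x Bx t _; rewrite /= ger0_norm ?mulr_ge0// ltW].
pose u n := \int[lebesgue_measure]_(x in W) `|hn n x - g x|.
have u0 : u @ \oo --> (0 : R).
  have uE n : (u n)%:E = (\int[lebesgue_measure]_(x in W) `|hn n x - g x|%:E)%E.
    exact: (EFin_Rintegral mW (idist n)).
  have : (u n)%:E @[n --> \oo] --> 0%E.
    apply: (@squeeze_cvge _ _ _ _ (cst 0%E) _ (fun n =>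
        \int[lebesgue_measure]_(x in W) `|(g x - gs n x)%:E|)%E) => //; last exact: cvg_cst.
    apply: nearW => n; rewrite uE integral_ge0//=.
    apply: ge0_le_integral => //.
    - exact: measurable_int (idist n).
    - apply/measurable_EFinP; apply: measurableT_comp => //.
      apply: (@measurable_funB _ (measurableTypeR R) R) => //.
      by apply/measurable_EFinP; exact: measurable_int (igs n).
    - move=> x Wx; rewrite lee_fin -{1}(clamp_id (gB x (WT x Wx))) (distrC (g x)).
      exact: clamp_dist.
  exact: fine_cvg.
(* The intensity is cut at height [K]: below it, the Lebesgue L1 distance is enough; above it, the
   distance is at most 2 B and the excess of [lam] has a small integral. *)
pose tail (K : nat) := \int[lebesgue_measure]_(x in W) Num.max 0 (lam x - K%:R).
have mtail K : measurable_fun W (fun x => Num.max 0 (lam x - K%:R)).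
  by apply: measurable_maxr => //; apply: measurable_funB => //; exact: measurable_funS mT WT mlam.
have tailK (K : nat) x : W x -> `|Num.max 0 (lam x - K%:R)| <= lam x.
  move=> /WT /lam_ge0 l0; have K0 : 0 <= K%:R :> R by [].
  by rewrite ger0_norm ?le_max ?lexx// ge_max l0 lerBlDr lerDl.
have itail K : lebesgue_measure.-integrable W (EFin \o (fun x => Num.max 0 (lam x - K%:R))).
  exact: (@le_integrable_real _ _ _ lebesgue_measure W mW _ lam (mtail K) (tailK K) ilamW).
have tail0 : tail @ \oo --> (0 : R).
  rewrite -[X in _ --> X](@Rintegral_eq0 _ _ _ lebesgue_measure W).
  apply: (@Rintegral_dominated_cvg _ _ _ lebesgue_measure W mW _ _ lam) => //.
  apply: aeW => x Wx; apply: (@cvg_trans _ (cst (0 : R) @ \oo)); last exact: cvg_cst.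
  apply: near_eq_cvg; exists (Num.truncn (lam x)).+1 => // K /= lK.
  rewrite max_l// subr_le0 ltW// (lt_le_trans (truncnS_gt _))//.
  by rewrite ler_nat.
pose v n := \int[lebesgue_measure]_(x in W) (`|hn n x - g x| * lam x).
have iv n : lebesgue_measure.-integrable W (EFin \o (fun x => `|hn n x - g x| * lam x)).
  apply: (@integrable_mul_bounded _ _ _ lebesgue_measure W mW _ _ (2 * B)) => //.
    by apply: measurableT_comp => //; apply: measurable_funB.
  by move=> x Wx; rewrite normr_id dB.
have vle (K : nat) n : v n <= K%:R * u n + 2 * B * tail K.
  rewrite /u /tail -(@RintegralZl _ _ _ lebesgue_measure W _ K%:R mW (idist n)).
  rewrite -(@RintegralZl _ _ _ lebesgue_measure W _ (2 * B) mW (itail K)).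
  have i1 := @integrableZ_real _ _ _ lebesgue_measure W mW _ K%:R (idist n).
  have i2 := @integrableZ_real _ _ _ lebesgue_measure W mW _ (2 * B) (itail K).
  rewrite -(@RintegralD _ _ _ lebesgue_measure W _ _ mW i1 i2).
  apply: le_Rintegral => //.
    exact: (@integrableD_real _ _ _ lebesgue_measure W mW _ _ i1 i2).
  move=> x Wx; have := dB n x Wx; have l0 := lam_ge0 (WT x Wx).
  have d0 := normr_ge0 (hn n x - g x); have K0 : 0 <= K%:R :> R by [].
  move: (`|_|) d0 (K%:R : R) K0 => z z0 q q0 zB.
  by have [h|h] := leP 0 (lam x - q); nra.
apply: (@has_poisson_cf_cvg (fun n => hn n \_ W) _ (fun n =>
  \int[lebesgue_measure]_(t in T) (`|(hn n \_ W) t - (g \_ W) t| * lam t))) => //.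
- by move=> n; exact: measurable_funS measurableT (@subsetT _ T) (mhW' n).
- exact: measurable_funS measurableT (@subsetT _ T) mgW'.
- by move=> n; apply: (@window_weighted_integrable _ _ Ta Tb ab _ B).
- by apply: (@window_weighted_integrable _ _ Ta Tb ab _ B) => // t /WT /gB.
- have -> : (fun n => \int[lebesgue_measure]_(t in T) (`|(hn n \_ W) t - (g \_ W) t| * lam t)) = v.
    apply/funext => n; rewrite /v -[in RHS](setIidr WT) Rintegral_mkcondr.
    apply: eq_Rintegral => t _; rewrite !patchE.
    by case: ifP; rewrite // subrr normr0 mul0r.
  apply/cvgrPdist_le => eps eps0.
  (* First [K] makes the excess small, then [n] is taken large for this [K]; each part costs at most
     eps / 2. *)
  have B1 : 0 < 2 * (2 * B + 1) by lra.
  have /cvgrPdist_le /(_ _ (divr_gt0 eps0 B1)) [K _ /(_ K (leqnn K))] := tail0.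
  have tl0 : 0 <= tail K.
    by apply: Rintegral_ge0 => x _; rewrite le_max lexx.
  rewrite sub0r normrN (ger0_norm tl0) ler_pdivlMr// => hK.
  have /cvgrPdist_le /(_ _ (divr_gt0 eps0 (_ : 0 < 2 * (K%:R + 1))))  := u0.
  have K1 : 0 < 2 * (K%:R + 1) :> R by rewrite mulr_gt0// ltr_wpDl.
  move=> /(_ K1); apply: filterS => n.
  have un0 : 0 <= u n by apply: Rintegral_ge0.
  rewrite sub0r normrN (ger0_norm un0) ler_pdivlMr// => hu.
  have v0 : 0 <= v n.
    by apply: Rintegral_ge0 => x Wx; rewrite mulr_ge0//; apply/lam_ge0/WT.
  rewrite sub0r normrN (ger0_norm v0); apply: le_trans (vle K n) _.
  by move: hu hK; set q := (K%:R : R) => hu hK; lra.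
- by move=> n; apply: (@continuous_window_poisson_cf _ _ Ta Tb ab _ B).
Qed.

End BoundedIntegrand.

(** The integrand is clamped at height n and restricted to the n-th window; dominated convergence
    applies off the point 0, which no window need contain. *)
Lemma poisson_cf (g : R -> R) : measurable_fun T g -> weighted_integrable g ->
  has_poisson_cf g.
Proof.
move=> mg ig; have [a [b wT]] := exists_windows oT; have [wab ndW WT T0 _] := wT.
pose W n := `]a n, b n]%classic : set R.
pose clamp (n : nat) x := Num.max (- n%:R) (Num.min n%:R x) : R.
pose gn n := (fun t => clamp n (g t)) \_ (W n).
have mW n : measurable (W n) by exact: measurable_itv.
have mclamp n : measurable_fun T (fun t => clamp n (g t)).
  apply: measurable_maxr => //; exact: measurable_minr.
have mgn n : measurable_fun T (gn n).
  have : measurable_fun setT (gn n).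
    apply/(measurable_restrictT (fun t => clamp n (g t))) => //.
    exact: measurable_funS mT (@WT n) (mclamp n).
  exact: measurable_funS.
have ign n : weighted_integrable (gn n).
  have [Ta Tb ab] := wab n.
  apply: (@window_weighted_integrable _ _ Ta Tb ab _ n%:R).
    exact: measurable_funS (mclamp n).
  by move=> t _; exact: clamp_bound.
apply: (@has_poisson_cf_cvg gn g (fun n =>
  \int[lebesgue_measure]_(t in T) (`|gn n t - g t| * lam t))) => //.
  have gnE n t : `|gn n t - g t| <= `|g t|.
    rewrite /gn patchE; case: ifPn => _; last by rewrite sub0r normrN.
    exact: clamp_self_dist.
  rewrite -[X in _ --> X](@Rintegral_eq0 _ _ _ lebesgue_measure T).
  apply: (@Rintegral_dominated_cvg _ _ _ lebesgue_measure T mT _ _ (fun t => `|g t| * lam t)).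
  - move=> n; apply: measurable_funM => //; apply: measurableT_comp => //.
    exact: (@measurable_funB _ (measurableTypeR R) R T (gn n) g (mgn n) mg).
  - exact: measurable_cst.
  - exists [set 0]; split.
    + exact: (@measurable_set1 R 0).
    + exact: lebesgue_measure_set1.
    + move=> t /= /not_implyP[Tt h]; apply: T0; split => // -[n0 _ Wn0]; apply: h.
      apply: (@cvg_trans _ (cst (0 : R) @ \oo)); last exact: cvg_cst.
      apply: near_eq_cvg; exists (maxn n0 (Num.truncn `|g t|).+1) => // n /=.
      rewrite geq_max => /andP[n0n gn0].
      have Wn : W n t by have := ndW _ _ n0n; rewrite subsetEset; apply.
      rewrite /gn patchE mem_set// /clamp clamp_id ?subrr ?normr0 ?mul0r//.
      by rewrite ltW// (lt_le_trans (truncnS_gt _))// ler_nat.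
  - exact: (@weighted_norm _ _ _ lebesgue_measure T lam).
  - move=> n t Tt; rewrite normrM normr_id (ger0_norm (lam_ge0 Tt)).
    by rewrite ler_wpM2r ?lam_ge0.
move=> n; have [Ta Tb ab] := wab n.
apply: (@bounded_window_poisson_cf _ _ Ta Tb ab _ n%:R) => //.
by move=> t _; exact: clamp_bound.
Qed.

Lemma has_cf_ae (Y Z : Omega -> R) r phi :
  measurable_fun setT Y -> measurable_fun setT Z ->
  {ae P, forall w, Y w = Z w} -> has_cf P Y r phi -> has_cf P Z r phi.
Proof.
move=> mY mZ YZ hY c; rewrite -hY /Rintegral; congr fine.
apply: ae_eq_integral => //.
- by apply/measurable_EFinP; exact: measurable_cos_comp.
- by apply/measurable_EFinP; exact: measurable_cos_comp.
- by apply: filterS YZ => w -> _.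
Qed.

(** Linearity of the real-valued integral requires integrability along the path of each [g i], which
    holds for almost every path. *)
Lemma path_integral_linear_ae (d : nat) (v : 'I_d -> R) (g : 'I_d -> R -> R) :
  (forall i, measurable_fun T (g i)) -> (forall i, weighted_integrable (g i)) ->
  {ae P, forall w, path_integral (fun t => \sum_i v i * g i t) w =
    \sum_i v i * path_integral (g i) w}.
Proof.
move=> mg ig.
have : {ae P, forall w, forall i, (lsm (X w)).-integrable T (EFin \o g i)}.
  by apply: filter_forall => i; exact: ae_path_integrable (mg i) (ig i).
apply: filterS => w iw; rewrite /path_integral.
rewrite (@Rintegral_sum _ _ _ (lsm (X w)) T mT).
  by apply: eq_bigr => i _; rewrite RintegralZl.
by move=> i; exact: integrableZ_real.
Qed.

Lemma weighted_integrable_sum (d : nat) (v : 'I_d -> R) (g : 'I_d -> R -> R) :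
  (forall i, weighted_integrable (g i)) ->
  weighted_integrable (fun t => \sum_i v i * g i t).
Proof.
move=> ig; rewrite /weighted_integrable.
have := @integrable_sum_real _ _ _ lebesgue_measure T mT _ (index_enum 'I_d)
  (fun i t => v i * (g i t * lam t))
  (fun i => @integrableZ_real _ _ _ lebesgue_measure T mT _ (v i) (ig i)).
apply: eq_integrable => // t _; rewrite /= mulr_suml; congr EFin.
by apply: eq_bigr => i _; rewrite mulrA.
Qed.

Lemma poisson_cf_linear (d : nat) (v : 'I_d -> R) (g : 'I_d -> R -> R) :
  (forall i, measurable_fun T (g i)) -> (forall i, weighted_integrable (g i)) ->
  let h t := \sum_i v i * g i t in
  has_cf P (fun w => \sum_i v i * path_integral (g i) w)
    (expR (\int[lebesgue_measure]_(t in T) ((cos (h t) - 1) * lam t)))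
    (\int[lebesgue_measure]_(t in T) (sin (h t) * lam t)).
Proof.
move=> mg ig h.
have mh : measurable_fun T h.
  by apply: measurable_sum => i; apply: measurable_funM.
apply: has_cf_ae (path_integral_linear_ae _ mg ig) (poisson_cf mh (weighted_integrable_sum _ ig)).
- exact: measurable_Rpath_integral.
- by apply: measurable_sum => i; apply: measurable_funM => //; exact: measurable_Rpath_integral.
Qed.

End PathCF.

(** * Local regularity of the model *)

Section MatrixNorm.
Context {R : realType} {d : nat}.
Implicit Types x y : 'cV[R]_d.

Lemma coord_norm_le x i : `|x i ord0| <= `|x|.
Proof.
rewrite /Num.Def.normr/= mx_normrE.
exact: (le_trans _ (le_bigmax _ _ (i, ord0))).
Qed.

Lemma norm_cV_le x r : 0 <= r -> (forall i, `|x i ord0| <= r) -> `|x| <= r.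
Proof.
move=> r0 h; rewrite /Num.Def.normr/= mx_normrE; apply: bigmax_le => //= -[i j] _.
by rewrite ord1.
Qed.

Lemma norm_cV_lt x r : 0 < r -> (forall i, `|x i ord0| < r) -> `|x| < r.
Proof.
move=> r0 h; rewrite /Num.Def.normr/= mx_normrE; apply: bigmax_lt => //= -[i j] _.
by rewrite ord1.
Qed.

End MatrixNorm.

Section PartialIncrement.
Context {R : realType} {d : nat}.

Lemma is_derive_line (f : 'cV[R]_d -> R) (z v : 'cV[R]_d) (s : R) :
  derivable f (z + s *: v) v ->
  is_derive s 1 (fun s : R => f (z + s *: v)) ('D_v f (z + s *: v)).
Proof.
move=> df.
have E : (fun h : R => h^-1 *: (f (z + (h *: 1 + s) *: v) - f (z + s *: v))) =
    (fun h : R => h^-1 *: (f (h *: v + (z + s *: v)) - f (z + s *: v))).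
  apply/funext => h; congr (_ *: (f _ - _)).
  have -> : h *: (1 : R) + s = h + s by rewrite /GRing.scale/= mulr1.
  by rewrite scalerDl addrCA.
split; first by rewrite /derivable E.
by rewrite /derive E.
Qed.

Lemma derive_line (f : 'cV[R]_d -> R) (z v : 'cV[R]_d) :
  'D_v f z = 'D_1 (fun s : R => f (z + s *: v)) 0.
Proof.
have E : (fun h : R => h^-1 *: (f (z + (h *: 1 + 0) *: v) - f (z + 0 *: v))) =
    (fun h : R => h^-1 *: (f (h *: v + z) - f z)).
  apply/funext => h; have -> : h *: (1 : R) + 0 = h by rewrite /GRing.scale/= mulr1 addr0.
  by rewrite (scale0r v) addr0 (addrC z).
by rewrite /derive E.
Qed.

Lemma MVT_increment (phi dphi : R -> R) (a b c e : R) : a <= b ->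
  (forall s, a <= s <= b -> is_derive s 1 phi (dphi s)) ->
  (forall s, a <= s <= b -> `|dphi s - c| <= e) ->
  `|phi b - phi a - c * (b - a)| <= e * (b - a).
Proof.
rewrite le_eqVlt => /predU1P[->|ab] dP he.
  by rewrite !subrr !mulr0 subrr normr0.
have cphi : {within `[a, b], continuous phi}.
  apply: derivable_within_continuous => s; rewrite in_itv/= => sab.
  by have [] := dP s sab.
have dP' (s : R) : s \in `]a, b[ -> is_derive s 1 phi (dphi s).
  by rewrite in_itv/= => /andP[/ltW as_ /ltW sb]; apply: dP; rewrite as_.
have [s] := MVT ab dP' cphi; rewrite in_itv/= => /andP[/ltW as_ /ltW sb] ->.
rewrite -mulrBl normrM (ger0_norm (_ : 0 <= b - a)); last by rewrite subr_ge0 ltW.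
by rewrite ler_wpM2r ?subr_ge0 ?(ltW ab)// he// as_.
Qed.

Let between_shift (p q s : R) : Num.min 0 (q - p) <= s <= Num.max 0 (q - p) ->
  Num.min p q <= p + s <= Num.max p q.
Proof. by have [?|?] := leP 0 (q - p); have [?|?] := leP p q; lra. Qed.

(** The coordinates are changed one at a time, so only partial derivatives on the box spanned by [x]
    and [y] are used. With [c] zero this is a Lipschitz bound, with [c] the gradient at [x] a
    second-order expansion. *)
Lemma partial_increment (f : 'cV[R]_d -> R) (x y : 'cV[R]_d) (c : 'I_d -> R) (e : R) :
  (forall p : 'cV[R]_d,
     (forall i, Num.min (x i ord0) (y i ord0) <= p i ord0 <= Num.max (x i ord0) (y i ord0)) ->
     forall i, derivable f p (delta_mx i ord0) /\ `|partial i f p - c i| <= e) ->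
  `|f y - f x - \sum_i c i * (y - x) i ord0| <= e * \sum_i `|(y - x) i ord0|.
Proof.
move=> H.
(* The first [j] coordinates are already those of [y]; consecutive points differ in a single
   coordinate. *)
pose z (j : nat) : 'cV[R]_d := \col_i (if (i < j)%N then y i ord0 else x i ord0).
have z0 : z 0%N = x by apply/matrixP => i j; rewrite mxE (ord1 j).
have zd : z d = y by apply/matrixP => i j; rewrite mxE ltn_ord (ord1 j).
have -> : f y - f x = \sum_(j < d) (f (z j.+1) - f (z j)).
  by rewrite -(big_mkord xpredT (fun j => f (z j.+1) - f (z j))) telescope_sumr// zd z0.
rewrite -sumrB mulr_sumr; apply: le_trans (ler_norm_sum _ _ _) _.
apply: ler_sum => j _.
set de := (y - x) j ord0.
have deE : de = y j ord0 - x j ord0 by rewrite /de !mxE.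
have zS : z j.+1 = z j + de *: delta_mx j ord0.
  apply/matrixP => i k; rewrite !mxE (ord1 k) eqxx andbT ltnS leq_eqVlt.
  have [->|ij] := eqVneq i j; first by rewrite eqxx/= ltnn mulr1 deE addrC subrK.
  by rewrite (negPf (_ : (i : nat) != j))//= mulr0 addr0.
pose phi s := f (z j + s *: delta_mx j ord0).
have box s : Num.min 0 de <= s <= Num.max 0 de ->
    is_derive s 1 phi (partial j f (z j + s *: delta_mx j ord0)) /\
    `|partial j f (z j + s *: delta_mx j ord0) - c j| <= e.
  move=> hs; have [] := H (z j + s *: delta_mx j ord0) _ j.
    move=> i; rewrite !mxE eqxx andbT.
    have [->|ij] := eqVneq i j; last first.
      by rewrite mulr0 addr0; case: ifP => _; rewrite ge_min le_max !lexx ?orbT.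
    by rewrite ltnn mulr1; apply: between_shift; rewrite -deE.
  move=> df hc; split; last exact: hc.
  exact: (@is_derive_line f (z j) (delta_mx j ord0) s df).
have phi0 : phi 0 = f (z j) by rewrite /phi scale0r addr0.
have phid : phi de = f (z j.+1) by rewrite /phi zS.
rewrite -phi0 -phid.
have [d0|d0] := leP 0 de.
  rewrite (ger0_norm d0) -[X in c j * X]subr0 -[X in e * X]subr0.
  apply: (MVT_increment d0 (dphi := fun s => partial j f (z j + s *: delta_mx j ord0))) => s hs;
  by have [] := box s; rewrite ?min_l ?max_r.
rewrite (ltr0_norm d0) -normrN.
have -> : - (phi de - phi 0 - c j * de) = phi 0 - phi de - c j * (0 - de).
  by rewrite sub0r mulrN opprK !opprB addrC.
rewrite -[X in e * X]sub0r.
apply: (MVT_increment (ltW d0) (dphi := fun s => partial j f (z j + s *: delta_mx j ord0))) => s hs;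
by have [] := box s; rewrite ?min_r ?max_l ?(ltW d0).
Qed.

Lemma between_norm (x y p : 'cV[R]_d) :
  (forall i, Num.min (x i ord0) (y i ord0) <= p i ord0 <= Num.max (x i ord0) (y i ord0)) ->
  `|p - x| <= `|y - x|.
Proof.
move=> h; apply: norm_cV_le => // i; apply: le_trans (coord_norm_le _ i).
rewrite !mxE; have := h i; move: (x i ord0) (y i ord0) (p i ord0) => a b q.
rewrite ler_norml; have [ab|ab] := leP a b.
  by rewrite (ger0_norm (_ : 0 <= b - a)) ?subr_ge0//; lra.
by rewrite (ltr0_norm (_ : b - a < 0)) ?subr_lt0//; lra.
Qed.

Lemma between_ball (x y p c : 'cV[R]_d) (r : R) : `|x - c| < r -> `|y - c| < r ->
  (forall i, Num.min (x i ord0) (y i ord0) <= p i ord0 <= Num.max (x i ord0) (y i ord0)) ->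
  `|p - c| < r.
Proof.
move=> xr yr h; apply: norm_cV_lt => [|i]; first exact: le_lt_trans xr.
have := le_lt_trans (coord_norm_le _ i) xr; have := le_lt_trans (coord_norm_le _ i) yr.
rewrite !mxE; have := h i; move: (x i ord0) (y i ord0) (p i ord0) (c i ord0) => a b q e.
by rewrite !ltr_norml; have [ab|ab] := leP a b; lra.
Qed.

End PartialIncrement.

Section UniformBound.
Context {R : realType}.

Lemma exists_uniform_bound (d : nat) (Q : 'I_d -> R -> Prop) :
  (forall i M M', M <= M' -> Q i M -> Q i M') -> (forall i, exists M, Q i M) ->
  exists2 M, 0 <= M & forall i, Q i M.
Proof.
move=> mono /choice[M QM]; exists (\sum_i `|M i|); first by apply: sumr_ge0.
move=> i; apply: mono (QM i); rewrite (bigD1 i)//=.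
by rewrite (le_trans (ler_norm _))// lerDl sumr_ge0.
Qed.

Lemma open_cV_ball (d : nat) (D : set 'cV[R]_d) x : open D -> D x ->
  exists2 rho : R, 0 < rho & forall y : 'cV[R]_d, `|y - x| < rho -> D y.
Proof.
move=> oD Dx; have /nbhs_ballP[r r0 h] : nbhs x D by exact: open_nbhs_nbhs.
exists r => // y yr; apply: h; rewrite -ball_normE/=.
by rewrite distrC.
Qed.

End UniformBound.

Section DominatedIntegral.
Context {R : realType} {d : measure_display} {S : measurableType d}.
Variables (mu : {measure set S -> \bar R}) (D : set S).
Hypothesis mD : measurable D.

Lemma norm_Rintegral_le_dominated (f g : S -> R) : mu.-integrable D (EFin \o f) ->
  mu.-integrable D (EFin \o g) -> (forall x, D x -> `|f x| <= g x) ->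
  `|\int[mu]_(x in D) f x| <= \int[mu]_(x in D) g x.
Proof.
move=> intf intg fg; apply: le_trans (le_normr_Rintegral mD intf) _.
by apply: le_Rintegral => //; exact: integrable_norm.
Qed.

End DominatedIntegral.

Section LocalAnalysis.
Context {R : realType} {d : nat}.
Variables (T : set R) (Theta : set 'cV[R]_d) (lam : 'cV[R]_d -> R -> R).
Hypothesis oT : observation_interval T.
Hypothesis openTheta : open Theta.
Hypothesis lamT : forall th, Theta th -> intensity T (lam th).
Hypothesis fin : finite_integrals T lam Theta.
Hypothesis bd : bounded_derivatives 3 Theta T (ell lam).

Let mT : measurable (T : set (measurableTypeR R)).
Proof. exact: observation_interval_measurable. Qed.

Definition score (i : 'I_d) (th : 'cV[R]_d) (t : R) : R := partial i (ell lam ^~ t) th.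

Lemma dellE th t i : dell lam th t i ord0 = score i th t.
Proof. by rewrite mxE. Qed.

Let lam_gt0 th t : Theta th -> T t -> 0 < lam th t.
Proof. by move=> Dth Tt; have [h _ _] := lamT Dth; exact: h. Qed.

Lemma lam_expR th t : Theta th -> T t -> lam th t = expR (ell lam th t).
Proof. by move=> Dth Tt; rewrite /ell lnK// posrE lam_gt0. Qed.

Lemma derivable_ell th t i : Theta th -> T t ->
  derivable (ell lam ^~ t) th (delta_mx i ord0).
Proof. by move=> Dth Tt; have [h _ _ _] := bd i; exact: h. Qed.

Lemma score_bounds : exists2 M : R, 0 <= M &
  (forall i th t, T t -> Theta th -> `|score i th t| <= M) /\
  (forall i j th t, T t -> Theta th -> derivable (score i ^~ t) th (delta_mx j ord0) /\
     `|partial j (score i ^~ t) th| <= M).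
Proof.
have [M1 M10 h1] : exists2 M, 0 <= M & forall i : 'I_d, forall th t, T t -> Theta th ->
    `|score i th t| <= M.
  apply: exists_uniform_bound => [i M M' MM' h th t Tt Dth|i].
    by rewrite (le_trans (h _ _ Tt Dth)).
  by have [_ _ [M hM] _] := bd i; exists M => th t Tt Dth; exact: hM.
have [M2 M20 h2] : exists2 M, 0 <= M & forall i : 'I_d, forall j th t, T t -> Theta th ->
    `|partial j (score i ^~ t) th| <= M.
  apply: exists_uniform_bound => [i M M' MM' h j th t Tt Dth|i].
    by rewrite (le_trans (h _ _ _ Tt Dth)).
  have [M M0 h] : exists2 M, 0 <= M & forall j : 'I_d, forall th t, T t -> Theta th ->
      `|partial j (score i ^~ t) th| <= M.
    apply: exists_uniform_bound => [j M M' MM' h th t Tt Dth|j].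
      by rewrite (le_trans (h _ _ Tt Dth)).
    have [_ _ _ b2] := bd i; have [_ _ [M hM] _] := b2 j.
    by exists M => th t Tt Dth; exact: hM.
  by exists M.
exists (M1 + M2); first exact: addr_ge0.
split => [i th t Tt Dth|i j th t Tt Dth].
  by rewrite (le_trans (h1 i th t Tt Dth))// lerDl.
split; last by rewrite (le_trans (h2 i j th t Tt Dth))// lerDr.
by have [_ _ _ b2] := bd i; have [h _ _ _] := b2 j; exact: h.
Qed.

Lemma partial_lam i th t : Theta th -> T t ->
  partial i (lam ^~ t) th = lam th t * score i th t.
Proof.
move=> Dth Tt; rewrite /score /partial.
have -> : 'D_(delta_mx i ord0) (lam ^~ t) th =
    'D_(delta_mx i ord0) (fun th => expR (ell lam th t)) th.
  apply: near_eq_derive.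
  have : nbhs th Theta by exact: open_nbhs_nbhs.
  by apply: filterS => th' Dth'; rewrite lam_expR.
pose phi (s : R) := ell lam (th + s *: delta_mx i ord0) t.
have dphi : is_derive (0 : R) 1 phi (score i th t).
  have := @is_derive_line _ _ (ell lam ^~ t) th (delta_mx i ord0) 0.
  by rewrite scale0r addr0; apply; exact: derivable_ell.
rewrite derive_line (@derive_val _ _ _ _ _ _ (expR (phi 0) * score i th t)).
by rewrite /phi scale0r addr0 lam_expR.
Qed.

Let fisher_density_alg (p q r : R) : 0 < r -> r^-1 * (r * p * (r * q)) = p * q * r.
Proof. by move=> r0; field; rewrite gt_eqF. Qed.

Lemma fisherE th i j : Theta th ->
  fisher T lam th i j =
  \int[lebesgue_measure]_(t in T) (score i th t * score j th t * lam th t).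
Proof.
move=> Dth; rewrite mxE; apply: eq_Rintegral => t /[!inE] Tt.
rewrite /fisher_density !mxE big_ord1 !mxE !partial_lam//.
have := lam_gt0 Dth Tt.
exact: fisher_density_alg.
Qed.

Lemma measurable_lam th : Theta th -> measurable_fun T (lam th).
Proof. by move=> /lamT[]. Qed.

Lemma measurable_ell th : Theta th -> measurable_fun T (ell lam th).
Proof. by move=> Dth; apply: (measurableT_comp (@measurable_ln R)); exact: measurable_lam. Qed.

(** The score is a pointwise limit in [t] of difference quotients of the measurable functions
    [ell]. *)
Lemma measurable_score i th : Theta th -> measurable_fun T (score i th).
Proof.
move=> Dth; have [rho rho0 hrho] := open_cV_ball openTheta Dth.
(* The index [n.+2] keeps every increment strictly inside the ball on which the parameter is
   admissible. *)
pose h (n : nat) : R := rho / n.+2%:R.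
have h0 n : 0 < h n by rewrite divr_gt0.
have hlt n : h n < rho by rewrite ltr_pdivrMr// ltr_pMr// ltr1n.
pose e : 'cV[R]_d := delta_mx i ord0.
have Dn n : Theta (h n *: e + th).
  apply: hrho; rewrite addrK; apply: norm_cV_lt => // k.
  rewrite !mxE; case: (_ && _); rewrite ?mulr0 ?normr0// mulr1.
  by rewrite gtr0_norm.
apply: (@measurable_fun_cvg _ _ _ _ (fun n t => (h n)^-1 * (ell lam (h n *: e + th) t - ell lam th t))).
  by move=> n; apply: measurable_funM => //; apply: measurable_funB; exact: measurable_ell.
move=> t Tt; have := @derivable_ell th t i Dth Tt; rewrite /score /partial /derivable /derive => cv.
have hcv : h @ \oo --> (0 : R)^'.
  move=> B [r /= r0 hB].
  have := @cvg_harmonic R => /cvgrPdist_lt /(_ _ (divr_gt0 r0 rho0)); apply: filterS => n.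
  rewrite sub0r normrN gtr0_norm ?invr_gt0// => hn; apply: hB; last by rewrite gt_eqF.
  rewrite /= sub0r normrN gtr0_norm// /h mulrC -ltr_pdivlMr//.
  by apply: le_lt_trans hn; rewrite lef_pV2 ?posrE// ler_nat.
exact: (cvg_comp _ _ hcv cv).
Qed.

(** Bounds on the intensity are relative, with the intensity itself as a factor, so that they
    survive integration over an unbounded [T]. The last one expands [lam th1] around [th], not
    conversely: the score enters at the plug-in parameter. *)
Definition local_bounds (th1 : 'cV[R]_d) (rho C : R) : Prop :=
  [/\ 0 < rho, 0 <= C &
   forall th : 'cV[R]_d, `|th - th1| < rho ->
   [/\ Theta th,
     forall i t, T t -> `|score i th t| <= C,
     forall i t, T t -> `|score i th t - score i th1 t| <= C * `|th - th1|,
     forall t, T t -> `|lam th t - lam th1 t| <= C * `|th - th1| * lam th1 t &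
     forall t, T t -> `|lam th1 t - lam th t +
       (\sum_i score i th t * (th - th1) i ord0) * lam th t| <=
       C * `|th - th1| ^+ 2 * lam th t]].

(** The derivatives of [ell] are bounded uniformly in [t]; increments of [ell] are estimated first
    and then exponentiated, which produces the relative bounds. *)
Lemma exists_local_bounds th1 : Theta th1 -> exists rho C, local_bounds th1 rho C.
Proof.
move=> D1; have [M M0 [sM dsM]] := score_bounds.
have [r r0 hr] := open_cV_ball openTheta D1.
have sum_coord (z : 'cV[R]_d) : \sum_i `|z i ord0| <= d%:R * `|z|.
  apply: le_trans (ler_sum _ (fun i _ => coord_norm_le z i)) _.
  by rewrite sumr_const card_ord mulr_natl.
have ls x y i t : `|x - th1| < r -> `|y - th1| < r -> T t ->
    `|score i y t - score i x t| <= M * d%:R * `|y - x|.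
  move=> xr yr Tt.
  have := @partial_increment R d (score i ^~ t) x y (fun=> 0) M.
  rewrite big1 ?subr0 => [h|j _]; last by rewrite mul0r.
  apply: le_trans (h _) _; last by rewrite -mulrA ler_wpM2l.
  move=> p hp j; have Dp : Theta p by apply: hr; exact: between_ball hp.
  by have [h1 h2] := dsM i j p t Tt Dp; rewrite subr0.
have le1 x y t : `|x - th1| < r -> `|y - th1| < r -> T t ->
    `|ell lam y t - ell lam x t| <= M * d%:R * `|y - x|.
  move=> xr yr Tt.
  have := @partial_increment R d (ell lam ^~ t) x y (fun=> 0) M.
  rewrite big1 ?subr0 => [h|j _]; last by rewrite mul0r.
  apply: le_trans (h _) _; last by rewrite -mulrA ler_wpM2l.
  move=> p hp j; have Dp : Theta p by apply: hr; exact: between_ball hp.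
  by split; [exact: derivable_ell|rewrite subr0; exact: sM].
have le2 x y t : `|x - th1| < r -> `|y - th1| < r -> T t ->
    `|ell lam y t - ell lam x t - \sum_i score i x t * (y - x) i ord0| <=
    M * d%:R ^+ 2 * `|y - x| ^+ 2.
  move=> xr yr Tt.
  apply: (@le_trans _ _ (M * d%:R * `|y - x| * \sum_i `|(y - x) i ord0|)); last first.
    rewrite !expr2; have := sum_coord (y - x) => h.
    apply: le_trans (ler_wpM2l _ h) _; last by rewrite le_eqVlt; apply/orP; left; apply/eqP; ring.
    by rewrite !mulr_ge0.
  apply: (@partial_increment R d (ell lam ^~ t)) => p hp j.
  have pr : `|p - th1| < r by exact: between_ball hp.
  split; first by apply: derivable_ell => //; exact: hr.
  apply: le_trans (ls x p j t xr pr Tt) _.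
  by rewrite ler_wpM2l ?mulr_ge0// (between_norm hp).
pose K := M * d%:R + M * d%:R ^+ 2.
have K0 : 0 <= K by rewrite addr_ge0// mulr_ge0.
have K1 : M * d%:R <= K by rewrite lerDl mulr_ge0.
have K2 : M * d%:R ^+ 2 <= K by rewrite lerDr mulr_ge0.
(* The second radius keeps the increment of [ell] below 1, the range where the bounds on the
   exponential hold. *)
pose rho := Num.min r (K + 1)^-1.
have rho0 : 0 < rho by rewrite lt_min r0 invr_gt0 ltr_wpDl.
exists rho, (M + 3 * K + K + 3 * K ^+ 2); split => //.
  by rewrite !addr_ge0// mulr_ge0// sqr_ge0.
move=> th; rewrite lt_min => /andP[thr thK].
have Dth := hr _ thr.
set z := `|th - th1| in thK *; have z0 : 0 <= z := normr_ge0 _.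
have r1 : `|th1 - th1| < r by rewrite subrr normr0.
have Kz1 : K * z <= 1.
  apply: le_trans (_ : K * (K + 1)^-1 <= 1); first by rewrite ler_wpM2l// ltW.
  by rewrite ler_pdivrMr ?ltr_wpDl// mul1r lerDl.
have K20 : 0 <= 3 * K ^+ 2 by rewrite mulr_ge0// sqr_ge0.
have xb t : T t -> `|ell lam th t - ell lam th1 t| <= K * z.
  move=> Tt; apply: le_trans (le1 th1 th t r1 thr Tt) _.
  by rewrite ler_wpM2r.
split => //.
- move=> i t Tt; apply: le_trans (sM i th t Tt Dth) _; lra.
- move=> i t Tt; apply: le_trans (ls th1 th i t r1 thr Tt) _.
  rewrite ler_wpM2r//; lra.
- move=> t Tt.
  have -> : lam th t - lam th1 t =
      (expR (ell lam th t - ell lam th1 t) - 1) * lam th1 t.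
    rewrite mulrBl mul1r [in X in _ * X - _](lam_expR D1 Tt) -expRD subrK.
    by rewrite -lam_expR.
  rewrite normrM (ger0_norm (ltW (lam_gt0 D1 Tt))) ler_wpM2r ?(ltW (lam_gt0 D1 Tt))//.
  apply: le_trans (norm_expRB1_le (le_trans (xb t Tt) Kz1)) _.
  have := xb t Tt; set q := `|_| => hq.
  apply: (@le_trans _ _ (3 * (K * z))); first by rewrite ler_wpM2l.
  rewrite mulrA ler_wpM2r//; lra.
- move=> t Tt; set x := ell lam th1 t - ell lam th t.
  have xz : `|x| <= K * z by rewrite /x distrC; exact: xb.
  set s := \sum_i _.
  have sE : \sum_i score i th t * (th1 - th) i ord0 = - s.
    rewrite -sumrN; apply: eq_bigr => i _; rewrite !mxE; ring.
  have xs : `|x + s| <= K * z ^+ 2.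
    have := le2 th th1 t thr r1 Tt; rewrite sE opprK -/x => h.
    apply: le_trans h _; rewrite distrC -/z ler_wpM2r// sqr_ge0//.
  have -> : lam th1 t - lam th t + s * lam th t =
      ((expR x - 1 - x) + (x + s)) * lam th t.
    have -> : lam th1 t = expR x * lam th t.
      by rewrite [in RHS](lam_expR Dth Tt) -expRD subrK -lam_expR.
    ring.
  rewrite normrM (ger0_norm (ltW (lam_gt0 Dth Tt))) ler_wpM2r ?(ltW (lam_gt0 Dth Tt))//.
  apply: le_trans (ler_normD _ _) _.
  have h1 := norm_expRB1B_le (le_trans xz Kz1).
  have h2 : x ^+ 2 <= (K * z) ^+ 2.
    by rewrite -(real_normK (num_real x)) lerXn2r// nnegrE mulr_ge0.
  have z20 : 0 <= z ^+ 2 by rewrite sqr_ge0.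
  move: h1 h2 xs; rewrite exprMn => h1 h2 xs.
  apply: le_trans (lerD h1 xs) _.
  apply: (@le_trans _ _ ((3 * K ^+ 2 + K) * z ^+ 2)); first by nra.
  rewrite ler_wpM2r//; lra.
Qed.

Lemma local_boundsW th1 rho C rho' C' : local_bounds th1 rho C ->
  0 < rho' -> rho' <= rho -> C <= C' -> local_bounds th1 rho' C'.
Proof.
move=> [rho0 C0 h] rho'0 rr CC; split => //; first exact: le_trans C0 CC.
move=> th thr; have [D h1 h2 h3 h4] := h _ (lt_le_trans thr rr); split => //.
- by move=> i t Tt; exact: le_trans (h1 _ _ Tt) CC.
- by move=> i t Tt; apply: le_trans (h2 _ _ Tt) _; rewrite ler_wpM2r.
- move=> t Tt; apply: le_trans (h3 _ Tt) _; rewrite !ler_wpM2r//.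
  have D1 : Theta th1 by have [] := h th1; rewrite ?subrr ?normr0.
  exact/ltW/lam_gt0.
- move=> t Tt; apply: le_trans (h4 _ Tt) _; rewrite !ler_wpM2r ?sqr_ge0//.
  exact/ltW/lam_gt0.
Qed.

Notation leb := lebesgue_measure.

(* [J] stands for [fisher T lam]: as a variable it is never unfolded during
   unification. *)
Definition is_information (J : 'cV[R]_d -> 'M[R]_d) : Prop := forall th i j, Theta th ->
  J th i j = \int[leb]_(t in T) (score i th t * score j th t * lam th t).

(** The last clause is the drift of the centred score at [th] when [th1] is true: - J(th) (th - th1)
    up to second order. The Newton correction is designed to cancel this linear term. *)
Definition local_integrals (J : 'cV[R]_d -> 'M[R]_d) (th1 : 'cV[R]_d) (rho C : R) : Prop :=
  forall th : 'cV[R]_d, `|th - th1| < rho ->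
  [/\ forall i, weighted_integrable T (lam th1) (score i th) /\
        \int[leb]_(t in T) (`|score i th t| * lam th1 t) <= C,
    forall i, weighted_integrable T (lam th) (score i th),
    forall i j, `|\int[leb]_(t in T) (score i th t * score j th t * lam th1 t) -
      J th1 i j| <= C * `|th - th1|,
    forall i j, `|J th i j - J th1 i j| <= C * `|th - th1| &
    forall i, `|\int[leb]_(t in T) (score i th t * lam th1 t) -
       \int[leb]_(t in T) (score i th t * lam th t) +
       (J th *m (th - th1)) i ord0| <= C * `|th - th1| ^+ 2].

Let alg1 (a b c e : R) : a * b - c * e = a * (b - e) + (a - c) * e.
Proof. by ring. Qed.

Let alg2 (C z M : R) : C * z * (2 * M + 2 * M) = 4 * C * M * z.
Proof. by ring. Qed.

Let alg3 (C z a l : R) : C * (C * z) * (a * l) = a * C * (C * z * l).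
Proof. by ring. Qed.

Let alg4 (C z M : R) : C * (C * z) * (2 * M) = 2 * C ^+ 2 * M * z.
Proof. by ring. Qed.

Let alg5 (a b c e : R) : a * (b * c * e) = b * (c * a * e).
Proof. by ring. Qed.

Lemma exists_local_integrals J th1 : is_information J -> Theta th1 ->
  exists rho C, local_bounds th1 rho C /\ local_integrals J th1 rho C.
Proof.
move=> JE D1; have [r [C lb]] := exists_local_bounds D1.
have [r0 C0 hb] := lb.
have [_ [M'' /nbhs_ballP[r' r'0 hM']]] := fin D1.
pose M' := `|M''|; have M'0 : 0 <= M' := normr_ge0 _.
(* The third radius keeps [lam th] and [lam th1] within a factor 2 of each other, so integrability
   passes from one parameter to the other. *)
pose rho := Num.min (Num.min r r') (2 * (C + 1))^-1.
have rho0 : 0 < rho by rewrite !lt_min r0 r'0 invr_gt0 mulr_gt0// ltr_wpDl.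
have rhor : rho <= r by rewrite !ge_min lexx.
have bnd1 th : `|th - th1| < rho -> forall t, T t ->
    lam th t <= 2 * lam th1 t /\ lam th1 t <= 2 * lam th t.
  rewrite !lt_min => /andP[/andP[thr _] thC] t Tt.
  have [Dth _ _ /(_ t Tt) h _] := hb th thr.
  have Cz : C * `|th - th1| <= 1 / 2.
    apply: (@le_trans _ _ (C * (2 * (C + 1))^-1)); first by rewrite ler_wpM2l// ltW.
    by rewrite ler_pdivrMr ?mulr_gt0 ?ltr_wpDl//; lra.
  have l1 := lam_gt0 D1 Tt; have l2 := lam_gt0 Dth Tt.
  have {}h : `|lam th t - lam th1 t| <= 1 / 2 * lam th1 t.
    by apply: le_trans h _; rewrite ler_wpM2r// ltW.
  by move: h; rewrite ler_norml; lra.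
have M'h th : `|th - th1| < rho -> forall i,
    weighted_integrable T (lam th) (score i th) /\
    \int[leb]_(t in T) (`|score i th t| * lam th t) <= M'.
  move=> thr i; have : `|th - th1| < r' by move: thr; rewrite !lt_min => /andP[/andP[_ ->]].
  move=> thr'; have Dth : Theta th by have [] := hb th (lt_le_trans thr rhor).
  have : (\int[leb]_(t in T) `|dell lam th t i ord0 * lam th t|%:E <= M'%:E)%E.
    apply: (@le_trans _ _ M''%:E); last by rewrite lee_fin ler_norm.
    by apply: hM'; rewrite -ball_normE/= distrC.
  have -> : (\int[leb]_(t in T) `|dell lam th t i ord0 * lam th t|%:E =
      \int[leb]_(t in T) `|(score i th t * lam th t)%:E|)%E.
    by apply: eq_integral => t _; rewrite dellE.
  move=> h; have iw : weighted_integrable T (lam th) (score i th).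
    apply/integrableP; split; last exact: le_lt_trans h (ltry _).
    by apply/measurable_EFinP; apply: measurable_funM; [exact: measurable_score|exact: measurable_lam].
  split => //; rewrite -lee_fin EFin_Rintegral//; last first.
    by apply: (@weighted_norm _ _ _ leb T) => // t Tt; exact/ltW/lam_gt0.
  apply: le_trans h; rewrite le_eqVlt; apply/orP; left; apply/eqP.
  apply: eq_integral => t /[!inE] Tt.
  by rewrite /= normrM (gtr0_norm (lam_gt0 Dth Tt)).
have r1 : `|th1 - th1| < rho by rewrite subrr normr0.
have w1 th : `|th - th1| < rho -> forall i,
    weighted_integrable T (lam th1) (score i th) /\
    \int[leb]_(t in T) (`|score i th t| * lam th1 t) <= 2 * M'.
  move=> thr i; have [iw h] := M'h th thr i.
  have Dth : Theta th by have [] := hb th (lt_le_trans thr rhor).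
  have iwn : leb.-integrable T (EFin \o (fun t => `|score i th t| * lam th t)).
    by apply: (@weighted_norm _ _ _ leb T) => // t Tt; exact/ltW/lam_gt0.
  have iw2 := @integrableZ_real _ _ _ leb T mT _ 2 iwn.
  have dom t : T t -> `|score i th t * lam th1 t| <= 2 * (`|score i th t| * lam th t).
    move=> Tt; rewrite normrM (gtr0_norm (lam_gt0 D1 Tt)) mulrCA ler_wpM2l//.
    by have [_] := bnd1 th thr t Tt.
  have iw1 : weighted_integrable T (lam th1) (score i th).
    apply: (@le_integrable_real _ _ _ leb T mT _ _ _ dom iw2).
    by apply: measurable_funM; [exact: measurable_score|exact: measurable_lam].
  split => //; apply: (@le_trans _ _ (\int[leb]_(t in T) (2 * (`|score i th t| * lam th t)))).
    apply: le_Rintegral => //.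
      by apply: (@weighted_norm _ _ _ leb T) => // t Tt; exact/ltW/lam_gt0.
    move=> t Tt; apply: le_trans (dom t Tt).
    by rewrite normrM (gtr0_norm (lam_gt0 D1 Tt)).
  by rewrite [leLHS](@RintegralZl _ _ _ leb T _ 2 mT iwn) ler_wpM2l.
have prod_int th th' : `|th - th1| < rho -> Theta th' ->
    (forall i, weighted_integrable T (lam th') (score i th)) ->
    forall i j, leb.-integrable T (EFin \o (fun t => score i th t * score j th t * lam th' t)).
  move=> thr Dth' iw i j; have [Dth sb _ _ _] := hb th (lt_le_trans thr rhor).
  have := @integrable_mul_bounded _ _ _ leb T mT _ (score i th) C
    (measurable_score i Dth) (sb i) (iw j).
  by apply: eq_integrable => // t _; rewrite /= mulrA.
exists rho, (C + 2 * M' + 4 * C * M' + 2 * C ^+ 2 * M' + C * M').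
have CM : 0 <= C * M' by rewrite mulr_ge0.
have CCM : 0 <= C ^+ 2 * M' by rewrite mulr_ge0// sqr_ge0.
split; first by apply: local_boundsW lb rho0 rhor _; lra.
move=> th thr; set z := `|th - th1|; have z0 : 0 <= z := normr_ge0 _.
have [Dth sb sl ll lt] := hb th (lt_le_trans thr rhor).
have [_ sb1 _ _ _] := hb th1 (lt_le_trans r1 rhor).
have ms i := measurable_score i Dth; have ms1 i := measurable_score i D1.
have ml := measurable_lam Dth; have ml1 := measurable_lam D1.
have absw x i : Theta x -> weighted_integrable T (lam th1) (score i x) ->
    leb.-integrable T (EFin \o (fun t => `|score i x t| * lam th1 t)).
  by move=> Dx iw; apply: (@weighted_norm _ _ _ leb T) => // t Tt; exact/ltW/lam_gt0.
(* The two scores are moved from [th] to [th1] one after the other; each move costs a Lipschitz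
   factor times the weighted L1 norm of the other score. *)
have cross i j : `|\int[leb]_(t in T) (score i th t * score j th t * lam th1 t) -
    J th1 i j| <= 4 * C * M' * z.
  rewrite JE//.
  have p1 := prod_int th th1 thr D1 (fun i => (w1 th thr i).1) i j.
  have p2 := prod_int th1 th1 r1 D1 (fun i => (w1 th1 r1 i).1) i j.
  rewrite -(@RintegralB _ _ _ leb T _ _ mT p1 p2).
  pose G t := C * z * (`|score i th t| * lam th1 t) + C * z * (`|score j th1 t| * lam th1 t).
  have iG1 := @integrableZ_real _ _ _ leb T mT _ (C * z) (absw th i Dth (w1 th thr i).1).
  have iG2 := @integrableZ_real _ _ _ leb T mT _ (C * z) (absw th1 j D1 (w1 th1 r1 j).1).
  apply: le_trans (@norm_Rintegral_le_dominated _ _ _ leb T mT _ G _ _ _) _.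
  - exact: (@integrableB_real _ _ _ leb T mT _ _ p1 p2).
  - exact: (@integrableD_real _ _ _ leb T mT _ _ iG1 iG2).
  - move=> t Tt; rewrite -mulrBl normrM (gtr0_norm (lam_gt0 D1 Tt)) /G !mulrA -mulrDl.
    apply: ler_wpM2r; first exact/ltW/lam_gt0.
    rewrite alg1; apply: le_trans (ler_normD _ _) _; rewrite !normrM lerD//.
      by rewrite mulrC ler_wpM2r// sl.
    by rewrite ler_wpM2r// sl.
  rewrite [leLHS](@RintegralD _ _ _ leb T _ _ mT iG1 iG2).
  rewrite [X in X + _ <= _](@RintegralZl _ _ _ leb T _ (C * z) mT (absw th i Dth (w1 th thr i).1)).
  rewrite [X in _ + X <= _](@RintegralZl _ _ _ leb T _ (C * z) mT (absw th1 j D1 (w1 th1 r1 j).1)).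
  rewrite -mulrDr.
  have := (w1 th thr i).2; have := (w1 th1 r1 j).2 => h2 h1.
  apply: le_trans (ler_wpM2l _ (lerD h1 h2)) _; first exact: mulr_ge0.
  by rewrite alg2.
split.
- move=> i; have [iw h] := w1 th thr i; split => //; apply: le_trans h _; lra.
- by move=> i; have [] := M'h th thr i.
- move=> i j; apply: le_trans (cross i j) _; rewrite ler_wpM2r//; lra.
- move=> i j; have h2 := cross i j.
  rewrite (JE th i j Dth).
  have p1 := prod_int th th1 thr D1 (fun i => (w1 th thr i).1) i j.
  have p2 := prod_int th th thr Dth (fun i => (M'h th thr i).1) i j.
  have h : `|\int[leb]_(t in T) (score i th t * score j th t * lam th t) -
      \int[leb]_(t in T) (score i th t * score j th t * lam th1 t)| <= 2 * C ^+ 2 * M' * z.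
    rewrite -(@RintegralB _ _ _ leb T _ _ mT p2 p1).
    have iG := @integrableZ_real _ _ _ leb T mT _ (C * (C * z)) (absw th i Dth (w1 th thr i).1).
    apply: le_trans (@norm_Rintegral_le_dominated _ _ _ leb T mT _ _ _ iG _) _.
    + exact: (@integrableB_real _ _ _ leb T mT _ _ p2 p1).
    + move=> t Tt; rewrite -mulrBr !normrM.
      have l1 := lam_gt0 D1 Tt.
      rewrite alg3; apply: ler_pM; rewrite ?mulr_ge0//; last exact: ll.
      by rewrite ler_wpM2l// sb.
    rewrite [leLHS](@RintegralZl _ _ _ leb T _ _ mT (absw th i Dth (w1 th thr i).1)).
    apply: le_trans (ler_wpM2l _ (w1 th thr i).2) _; first by rewrite !mulr_ge0.
    by rewrite alg4.
  move: h h2; set a := \int[leb]_(t in T) _; set b := \int[leb]_(t in T) _ => h1 h2.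
  have -> : a - J th1 i j = (a - b) + (b - J th1 i j) by rewrite addrA subrK.
  apply: le_trans (ler_normD _ _) _; apply: le_trans (lerD h1 h2) _.
  rewrite -mulrDl ler_wpM2r//; lra.
- move=> i; have [iw1 _] := w1 th thr i; have [iw hM] := M'h th thr i.
  pose dz k := (th - th1) k ord0.
  have pk k : leb.-integrable T (EFin \o (fun t => dz k * (score i th t * score k th t * lam th t))).
    apply: (@integrableZ_real _ _ _ leb T mT).
    exact: (prod_int th th thr Dth (fun i => (M'h th thr i).1) i k).
  have -> : (J th *m (th - th1)) i ord0 =
      \int[leb]_(t in T) \sum_k dz k * (score i th t * score k th t * lam th t).
    rewrite [RHS](@Rintegral_sum _ _ _ leb T mT _ _ _ pk) mxE; apply: eq_bigr => k _.
    rewrite (@RintegralZl _ _ _ leb T _ (dz k) mT (prod_int th th thr Dth (fun i => (M'h th thr i).1) i k)).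
    by rewrite JE// mulrC.
  have isum := @integrable_sum_real _ _ _ leb T mT _ (index_enum 'I_d) _ pk.
  rewrite -(@RintegralB _ _ _ leb T _ _ mT iw1 iw).
  have iB := @integrableB_real _ _ _ leb T mT _ _ iw1 iw.
  rewrite -(@RintegralD _ _ _ leb T _ _ mT iB isum).
  have iwn : leb.-integrable T (EFin \o (fun t => `|score i th t| * lam th t)).
    by apply: (@weighted_norm _ _ _ leb T) => // t Tt; exact/ltW/lam_gt0.
  have iG := @integrableZ_real _ _ _ leb T mT _ (C * z ^+ 2) iwn.
  apply: le_trans (@norm_Rintegral_le_dominated _ _ _ leb T mT _ _ _ iG _) _.
  + exact: (@integrableD_real _ _ _ leb T mT _ _ iB isum).
  + move=> t Tt.
    (* With the sum under the integral, the score factors out of the pointwise second-order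
       expansion of the intensity. *)
    have -> : score i th t * lam th1 t - score i th t * lam th t +
        \sum_k dz k * (score i th t * score k th t * lam th t) =
        score i th t * (lam th1 t - lam th t + (\sum_k score k th t * dz k) * lam th t).
      rewrite mulrDr mulrBr; congr (_ + _).
      by rewrite mulr_suml mulr_sumr; apply: eq_bigr => k _; rewrite alg5.
    rewrite normrM mulrCA; apply: ler_wpM2l => //; exact: lt.
  rewrite [leLHS](@RintegralZl _ _ _ leb T _ _ mT iwn).
  apply: le_trans (ler_wpM2l _ hM) _; first by rewrite mulr_ge0// sqr_ge0.
  rewrite mulrAC ler_wpM2r ?sqr_ge0//; lra.
Qed.

End LocalAnalysis.

(** * Measurability of integrals at a random parameter *)

Section Caratheodory.
Context {R : realType} {d : nat} {dA : measure_display} {A : measurableType dA}.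
Variables (Theta : set 'cV[R]_d) (th : A -> 'cV[R]_d) (phi : A -> 'cV[R]_d -> R).
Hypothesis openTheta : open Theta.
Hypothesis Dth : forall w, Theta (th w).
Hypothesis mth : forall i, measurable_fun setT (fun w => th w i ord0).
Hypothesis mphi : forall x, Theta x -> measurable_fun setT (phi ^~ x).
Hypothesis cphi : forall w, phi w x @[x --> th w] --> phi w (th w).

(** The random parameter is rounded to a grid of mesh 1/(n + 1). If the node leaves [Theta],
    [approx] has the default value 0; since [Theta] is open this happens for finitely many n
    only. *)
Let cell (n : nat) (w : A) : 'cV[int]_d := \col_i Num.floor (n.+1%:R * th w i ord0).
Let node (n : nat) (z : 'cV[int]_d) : 'cV[R]_d := \col_i ((z i ord0)%:~R / n.+1%:R).
Let approx n z w : R := if `[< Theta (node n z) >] then phi w (node n z) else 0.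

Let mapprox n z : measurable_fun setT (approx n z).
Proof.
have [h|h] := pselect (Theta (node n z)).
  by rewrite (_ : approx n z = phi ^~ (node n z)); [exact: mphi|apply/funext => w; rewrite /approx asboolT].
by rewrite (_ : approx n z = cst 0); [exact: measurable_cst|apply/funext => w; rewrite /approx asboolF].
Qed.

Let mcell n z : measurable [set w | cell n w = z].
Proof.
rewrite (_ : [set w | _] = \bigcap_(i in [set: 'I_d])
    [set w | ((z i ord0)%:~R <= n.+1%:R * th w i ord0) && (n.+1%:R * th w i ord0 < ((z i ord0 + 1)%:~R : R))]); last first.
  apply/seteqP; split => w /=.
    by move=> <- i _ /=; rewrite mxE floor_le_tmp floorD1_gt.
  move=> h; apply/matrixP => i j; rewrite mxE (ord1 j).
  by apply: floor_def; exact: h.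
apply: fin_bigcap_measurable => // i _.
have mi : measurable_fun setT (fun w => n.+1%:R * th w i ord0) by exact: measurable_funM.
have := mi measurableT `[(z i ord0)%:~R, (z i ord0 + 1)%:~R[%classic (measurable_itv _).
by rewrite setTI; congr (measurable _); apply/seteqP; split => w /=; rewrite in_itv.
Qed.

Let node_dist n w i : `|node n (cell n w) i ord0 - th w i ord0| <= n.+1%:R^-1.
Proof.
rewrite !mxE; set x := th w i ord0; set q : R := n.+1%:R.
have q0 : 0 < q by rewrite /q.
have := floor_le_tmp (q * x); have := floorD1_gt (q * x).
set z : R := (Num.floor (q * x))%:~R; rewrite intrD mulr1z -/z => h1 h2.
have -> : z / q - x = (z - q * x) / q by field; rewrite gt_eqF.
rewrite normrM (gtr0_norm (_ : 0 < q^-1)) ?invr_gt0// ler_piMl ?invr_ge0 ?ltW//.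
by rewrite ltr_norml; apply/andP; split; lra.
Qed.

(** At a rounded parameter the function is measurable on each of countably many cells; continuity in
    the parameter then makes the original a pointwise limit. *)
Lemma measurable_caratheodory : measurable_fun setT (fun w => phi w (th w)).
Proof.
apply: (@measurable_fun_cvg _ _ _ _ (fun n w => approx n (cell n w) w)).
  move=> n _ B mB; rewrite setTI.
  rewrite (_ : _ @^-1` B = \bigcup_(z in [set: 'cV[int]_d])
      ([set w | cell n w = z] `&` approx n z @^-1` B)); last first.
    apply/seteqP; split => w /=; first by move=> Bw; exists (cell n w).
    by move=> [z _ [<-]].
  apply: countable_bigcupT_measurable => [|z]; first exact: countableP.
  apply: measurableI; first exact: mcell.
  by have := mapprox n z measurableT mB; rewrite setTI.
move=> w _.
have nodecvg : node n (cell n w) @[n --> \oo] --> th w.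
  apply: cvg_mx_coord => i j; rewrite (ord1 j); apply/cvgrPdist_le => e e0.
  have := @cvg_harmonic R => /cvgrPdist_le /(_ _ e0); apply: filterS => n.
  rewrite sub0r normrN ger0_norm ?invr_ge0// => hn.
  by rewrite distrC; apply: le_trans (node_dist n w i) hn.
have nodeT : \forall n \near \oo, Theta (node n (cell n w)).
  by apply: nodecvg; exact: open_nbhs_nbhs.
apply: (@cvg_trans _ (phi w (node n (cell n w)) @[n --> \oo])); last first.
  exact: (@cvg_comp _ _ _ (fun n => node n (cell n w)) (phi w) _ _ _ nodecvg (@cphi w)).
apply: near_eq_cvg; apply: filterS nodeT => n hn.
by rewrite /approx asboolT.
Qed.

End Caratheodory.

Section ParametrizedIntegral.
Context {R : realType} {d : nat} {dA : measure_display} {A : measurableType dA}.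
Variables (T : set R) (a b : nat -> R) (Theta : set 'cV[R]_d).
Hypothesis oT : observation_interval T.
Hypothesis wT : is_windows T a b.
Hypothesis openTheta : open Theta.
Variable m : A -> {measure set (measurableTypeR R) -> \bar R}.
Notation W n := (`]a n, b n]%classic : set (measurableTypeR R)).
Hypothesis m0 : forall w, m w (T `\` \bigcup_n W n) = 0%E.
Hypothesis mm : forall n (g : R -> \bar R), measurable_fun (W n) g ->
  (forall t, W n t -> (0 <= g t)%E) ->
  measurable_fun setT (fun w => \int[m w]_(t in W n) g t)%E.
Variables (h : 'cV[R]_d -> R -> R) (th : A -> 'cV[R]_d).
Hypothesis mh : forall x, Theta x -> measurable_fun T (h x).
Hypothesis ih : forall x n w, Theta x -> (m w).-integrable (W n) (EFin \o h x).
Hypothesis lh : forall x, Theta x -> exists r C rho, [/\ 0 < r, 0 <= C,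
  forall n w, (m w).-integrable (W n) (EFin \o rho) &
  forall y : 'cV[R]_d, `|y - x| < r -> Theta y /\
    forall t, T t -> `|h y t - h x t| <= C * `|y - x| * rho t].
Hypothesis Dth : forall w, Theta (th w).
Hypothesis mth : forall i, measurable_fun setT (fun w => th w i ord0).

Let mW n : measurable (W n). Proof. exact: measurable_itv. Qed.
Let WT n : W n `<=` T. Proof. by have [_ _ sub _ _] := wT; exact: sub. Qed.

Let max0_dist (x y : R) : `|Num.max x 0 - Num.max y 0| <= `|x - y|.
Proof.
have := ler_norm (x - y); have := ler_norm (- (x - y)); rewrite normrN => h1 h2.
by rewrite ler_norml; have [?|?] := leP x 0; have [?|?] := leP y 0; lra.
Qed.

Section Sign.
Variable s : R.
Hypothesis s1 : `|s| = 1.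

Let p x t := Num.max (s * h x t) 0.

Let mp x : Theta x -> measurable_fun T (p x).
Proof. by move=> Dx; apply: measurable_maxr => //; apply: measurable_funM => //; exact: mh. Qed.

Let ip x n w : Theta x -> (m w).-integrable (W n) (EFin \o p x).
Proof.
move=> Dx; have iw := ih n w Dx.
apply: (@le_integrable_real _ _ _ (m w) (W n) (mW n) _ (fun t => `|h x t|)).
- exact: measurable_funS (observation_interval_measurable oT) (@WT n) (mp Dx).
- move=> t _; have := max0_dist (s * h x t) 0.
  by rewrite maxxx !subr0 normrM s1 mul1r.
- exact: integrable_norm iw.
Qed.

(** On a window the Lipschitz hypothesis makes the integral continuous in the parameter, so the grid
    argument applies. Passing to [T] is a monotone limit and needs a nonnegative integrand; [s] of
    modulus 1 serves the positive and the negative part. *)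
Lemma measurable_positive_part_integral :
  measurable_fun setT (fun w => \int[m w]_(t in T) (p (th w) t)%:E)%E.
Proof.
pose phi n w x := \int[m w]_(t in W n) p x t.
have mphi n : measurable_fun setT (fun w => (phi n w (th w))%:E).
  apply/measurable_EFinP; apply: (measurable_caratheodory openTheta Dth mth).
    move=> x Dx; rewrite /phi /Rintegral.
    apply: (measurableT_comp (@fine_measurable R setT measurableT)).
    apply: mm; last by move=> t _; rewrite lee_fin le_max lexx orbT.
    apply/measurable_EFinP.
    exact: measurable_funS (observation_interval_measurable oT) (@WT n) (mp Dx).
  move=> w; have [r [C [rho [r0 C0 irho hl]]]] := lh (Dth w).
  pose K := C * \int[m w]_(t in W n) `|rho t|.
  have irn := integrable_norm (irho n w).
  have K0 : 0 <= K by rewrite mulr_ge0//; apply: Rintegral_ge0.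
  have le y : `|y - th w| < r -> `|phi n w y - phi n w (th w)| <= K * `|y - th w|.
    move=> yr; have [Dy hy] := hl y yr.
    rewrite /phi -(@RintegralB _ _ _ (m w) (W n) _ _ (mW n) (ip n w Dy) (ip n w (Dth w))).
    have iG := @integrableZ_real _ _ _ (m w) (W n) (mW n) _ (C * `|y - th w|) irn.
    apply: le_trans (@norm_Rintegral_le_dominated _ _ _ (m w) (W n) (mW n) _ _ _ iG _) _.
    - exact: (@integrableB_real _ _ _ (m w) (W n) (mW n) _ _ (ip n w Dy) (ip n w (Dth w))).
    - move=> t Wt; apply: le_trans (max0_dist _ _) _.
      rewrite -mulrBr normrM s1 mul1r; apply: le_trans (hy t (WT Wt)) _.
      by rewrite ler_wpM2l ?mulr_ge0// ler_norm.
    rewrite [leLHS](@RintegralZl _ _ _ (m w) (W n) _ _ (mW n) irn).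
    by rewrite /K mulrAC.
  apply/(@cvgrPdist_lt _ _ _ (nbhs (th w))) => e e0.
  have K1 : 0 < K + 1 by rewrite ltr_wpDl.
  apply/nbhs_ballP; exists (Num.min r (e / (K + 1))).
    by rewrite /= lt_min r0 divr_gt0.
  move=> y; rewrite -ball_normE/= distrC lt_min => /andP[yr ye].
  rewrite distrC; apply: le_lt_trans (le y yr) _.
  move: ye; rewrite ltr_pdivlMr// mulrC => ye.
  by apply: le_lt_trans ye; rewrite ler_wpM2r// lerDl.
have := emeasurable_fun_cvg _ (fun w => \int[m w]_(t in T) (p (th w) t)%:E)%E mphi; apply.
move=> w _; rewrite (_ : (fun n => _) =
    (fun n => \int[m w]_(t in W n) (p (th w) t)%:E)%E); last first.
  by apply/funext => n; rewrite EFin_Rintegral//; exact: ip.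
apply: (cvg_window_integral oT wT) => //.
- by apply/measurable_EFinP; exact: mp.
- by move=> t _; rewrite lee_fin le_max lexx orbT.
Qed.

End Sign.

Lemma measurable_parametrized_integral :
  measurable_fun setT (fun w => \int[m w]_(t in T) h (th w) t).
Proof.
rewrite /Rintegral; apply: (measurableT_comp (@fine_measurable R setT measurableT)).
rewrite (_ : (fun w => _) = (fun w => \int[m w]_(t in T) (Num.max (1 * h (th w) t) 0)%:E -
    \int[m w]_(t in T) (Num.max ((-1) * h (th w) t) 0)%:E)%E).
  by apply: emeasurable_funB; apply: measurable_positive_part_integral; rewrite ?normrN normr1.
apply/funext => w; rewrite integralE; congr (_ - _)%E; apply: eq_integral => t _.
  by rewrite funeposE /= -EFin_max mul1r.
by rewrite funenegE /= -EFin_max mulN1r.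
Qed.

End ParametrizedIntegral.

(** * Coercive matrices and their inverses *)

Section Coercive.
Context {R : realType} {d : nat}.

Lemma norm_cV_sqr (x : 'cV[R]_d) : `|x| ^+ 2 <= \sum_i x i ord0 ^+ 2.
Proof.
have s0 : 0 <= \sum_i x i ord0 ^+ 2 by apply: sumr_ge0 => i _; exact: sqr_ge0.
rewrite -[leRHS]sqr_sqrtr// lerXn2r ?nnegrE ?sqrtr_ge0//.
apply: norm_cV_le; first exact: sqrtr_ge0.
move=> i; rewrite -sqrtr_sqr ler_sqrt// (bigD1 i)//= lerDl.
by apply: sumr_ge0 => j _; exact: sqr_ge0.
Qed.

Lemma sum_coord_le (x : 'cV[R]_d) : \sum_i `|x i ord0| <= d%:R * `|x|.
Proof.
apply: le_trans (ler_sum _ (fun i _ => coord_norm_le x i)) _.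
by rewrite sumr_const card_ord mulr_natl.
Qed.

Lemma norm_mulmx_le (M : 'M[R]_d) (B : R) (x : 'cV[R]_d) : 0 <= B ->
  (forall i j, `|M i j| <= B) -> `|M *m x| <= B * d%:R * `|x|.
Proof.
move=> B0 MB; apply: norm_cV_le; first by rewrite !mulr_ge0.
move=> i; rewrite mxE; apply: le_trans (ler_norm_sum _ _ _) _.
apply: (@le_trans _ _ (\sum_j B * `|x j ord0|)).
  by apply: ler_sum => j _; rewrite normrM ler_wpM2r.
by rewrite -mulr_sumr -mulrA ler_wpM2l// sum_coord_le.
Qed.

Definition coercive (c : R) (M : 'M[R]_d) : Prop :=
  [/\ 0 < c, M^T = M &
  forall x : 'cV[R]_d, c * \sum_i x i ord0 ^+ 2 <= (x^T *m M *m x) ord0 ord0].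

Lemma coercive_posdef c M : coercive c M -> posdef M.
Proof.
move=> [c0 sM h]; split => // x x0; apply: lt_le_trans (h x).
rewrite mulr_gt0//; apply: lt_le_trans (norm_cV_sqr x).
by rewrite exprn_gt0// normr_gt0.
Qed.

Lemma coercive_unitmx c M : coercive c M -> M \in unitmx.
Proof. by move=> /coercive_posdef/posdef_unitmx. Qed.

Lemma posdef_invmx M : posdef M -> posdef (invmx M : 'M[R]_d).
Proof.
move=> pM; have uM := posdef_unitmx pM; have [sM h] := pM; split.
  by rewrite trmx_inv sM.
move=> x x0; have y0 : invmx M *m x != 0.
  by apply: contraNneq x0 => y0; rewrite -(mulKVmx uM x) y0 mulmx0.
have := h _ y0; rewrite trmx_mul trmx_inv sM -!mulmxA mulKVmx//.
Qed.

(** For m the solution of M m = x, coercivity gives c |m|^2 <= m^T M m = m^T x, and the right-hand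
    side is at most d |x| |m| in the maximum norm. *)
Lemma norm_invmx_le c M (x : 'cV[R]_d) : coercive c M ->
  `|invmx M *m x| <= d%:R / c * `|x|.
Proof.
move=> cM; have uM := coercive_unitmx cM; have [c0 sM h] := cM.
set m := invmx M *m x; have := h m.
have -> : (m^T *m M *m m) ord0 ord0 = \sum_i m i ord0 * x i ord0.
  by rewrite -mulmxA mulKVmx// mxE; apply: eq_bigr => i _; rewrite mxE.
move=> hm; have {hm} : c * `|m| ^+ 2 <= d%:R * `|x| * `|m|.
  apply: (@le_trans _ _ (c * \sum_i m i ord0 ^+ 2)).
    by rewrite ler_wpM2l ?(ltW c0)// norm_cV_sqr.
  apply: le_trans hm _; apply: (@le_trans _ _ (\sum_i `|m| * `|x i ord0|)).
    apply: ler_sum => i _; apply: le_trans (ler_norm _) _.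
    by rewrite normrM ler_wpM2r// coord_norm_le.
  by rewrite -mulr_sumr mulrC ler_wpM2r// sum_coord_le.
have [->|m0] := eqVneq `|m| 0; first by rewrite mulr_ge0// divr_ge0// ltW.
have m1 : 0 < `|m| by rewrite lt_def m0 normr_ge0.
rewrite expr2 mulrA ler_pM2r// => hm.
by rewrite mulrAC ler_pdivlMr// mulrC.
Qed.

(** The resolvent identity, through which Lipschitz bounds on the information pass to its
    inverse. *)
Lemma invmx_distE M M' (x : 'cV[R]_d) : M \in unitmx -> M' \in unitmx ->
  invmx M *m x - invmx M' *m x = invmx M *m ((M' - M) *m (invmx M' *m x)).
Proof.
move=> uM uM'; rewrite mulmxBl mulmxBr mulKVmx//; congr (_ - _).
by rewrite mulKmx.
Qed.

Lemma norm_invmx_dist c M c' M' B (x : 'cV[R]_d) : coercive c M -> coercive c' M' ->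
  0 <= B -> (forall i j, `|M i j - M' i j| <= B) ->
  `|invmx M *m x - invmx M' *m x| <= d%:R / c * (B * d%:R * (d%:R / c' * `|x|)).
Proof.
move=> cM cM' B0 h; have [c0 _ _] := cM.
rewrite invmx_distE ?(coercive_unitmx cM) ?(coercive_unitmx cM')//.
apply: le_trans (norm_invmx_le _ cM) _.
rewrite ler_wpM2l ?divr_ge0 ?ler0n ?(ltW c0)//.
have h' i j : `|(M' - M) i j| <= B by rewrite !mxE distrC.
apply: le_trans (norm_mulmx_le (invmx M' *m x) B0 h') _.
by rewrite ler_wpM2l ?mulr_ge0// norm_invmx_le.
Qed.

Lemma uniformly_nondegenerate_coercive (D : set 'cV[R]_d) (J : 'cV[R]_d -> 'M[R]_d) :
  (forall th, D th -> (J th)^T = J th) ->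
  uniformly_nondegenerate D J -> exists c, forall th, D th -> coercive c (J th).
Proof.
move=> sJ; rewrite /uniformly_nondegenerate /=; set E := ereal_inf _ => E0.
have [c c0 cE] : exists2 c : R, 0 < c & (c%:E <= E)%E.
  case: E E0 => [r| |//]; first by rewrite lte_fin => r0; exists r.
  (* The infimum is infinite when the unit sphere or [D] is empty, as in dimension 0; the choice 1
     is then arbitrary. *)
  by move=> _; exists 1 => //; rewrite leey.
exists c => th Dth; split => //; first exact: sJ.
move=> x; set s := \sum_i _; have s0 : 0 <= s by apply: sumr_ge0 => i _; exact: sqr_ge0.
have [x0|x0] := eqVneq x 0.
  have -> : s = 0 by rewrite /s big1// => i _; rewrite x0 mxE expr0n.
  by rewrite x0 mulmx0 mxE mulr0.
have s1 : 0 < s.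
  by apply: lt_le_trans (norm_cV_sqr x); rewrite exprn_gt0// normr_gt0.
have q0 : 0 < Num.sqrt s by rewrite sqrtr_gt0.
pose mu := (Num.sqrt s)^-1 *: x.
have mu1 : enorm mu = 1.
  rewrite /enorm (_ : \sum_i _ = 1) ?sqrtr1//.
  rewrite (eq_bigr (fun i => s^-1 * x i ord0 ^+ 2)); last first.
    by move=> i _; rewrite mxE exprMn exprVn sqr_sqrtr.
  by rewrite -mulr_sumr mulVf// gt_eqF.
have : (c%:E <= ((mu^T *m J th *m mu) ord0 ord0)%:E)%E.
  apply: le_trans cE _; apply: (@le_trans _ _ (ereal_inf [set ((m^T *m J th *m m) ord0 ord0)%:E | m in [set m | enorm m = 1]])).
    by apply: ereal_inf_lbound; exists th.
  by apply: ereal_inf_lbound; exists mu.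
rewrite lee_fin /mu (_ : _^T = (Num.sqrt s)^-1 *: x^T); last by apply/matrixP => i j; rewrite !mxE.
rewrite -!scalemxAl -scalemxAr scalerA.
rewrite mxE -invfM -expr2 sqr_sqrtr// mulrC ler_pdivlMr//.
Qed.

End Coercive.

(** * Measurability of the score and of the inverse information at a random parameter *)

Section MeasurableScores.
Context {R : realType} {d : nat}.
Variables (T : set R) (Theta : set 'cV[R]_d) (lam : 'cV[R]_d -> R -> R).
Hypothesis oT : observation_interval T.
Hypothesis openTheta : open Theta.
Hypothesis lamT : forall th, Theta th -> intensity T (lam th).
Hypothesis bd : bounded_derivatives 3 Theta T (ell lam).
Context {dA : measure_display} {A : measurableType dA}.
Variable th : A -> 'cV[R]_d.
Hypothesis Dth : forall w, Theta (th w).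
Hypothesis mth : forall i, measurable_fun setT (fun w => th w i ord0).
Notation leb := lebesgue_measure.

Let mT : measurable (T : set (measurableTypeR R)).
Proof. exact: observation_interval_measurable. Qed.

Let ms i x : Theta x -> measurable_fun T (score lam i x).
Proof. by move=> Dx; exact: (measurable_score openTheta lamT bd). Qed.

Lemma measurable_score_path (X : A -> cumulative R R) i : counting_process T X ->
  measurable_fun setT (fun w => \int[lsm (X w)]_(t in T) score lam i (th w) t).
Proof.
move=> cX; have [a [b wT]] := exists_windows oT.
have [wab _ WT _ null] := wT; have [M M0 [sM _]] := score_bounds bd.
have fW n w : (lsm (X w) `]a n, b n]%classic < +oo)%E.
  by have [_ _ /ltW ab] := wab n; rewrite lsm_itv_oc// ltry.
apply: (@measurable_parametrized_integral R d _ A T a b Theta oT wT openTheta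
  (fun w => lsm (X w)) _ _ (score lam i) th) => //.
- by move=> w; apply: null; have [h _] := cX.
- move=> n g mg g0; have [Ta Tb ab] := wab n.
  have [_ mX] := cX.
  exact: (measurable_window_integral (observation_interval_is_interval oT) mX Ta Tb ab).
- by move=> x Dx; exact: ms.
- move=> x n w Dx; apply: (@measurable_bounded_integrable _ _ _ (lsm (X w))) => //.
  + exact: fW.
  + by apply: measurable_funS mT (WT n) _; exact: ms.
  + exists M; split; first exact: num_real.
    by move=> y My t Wt; exact: le_trans (sM i x t (WT n t Wt) Dx) (ltW My).
- move=> x Dx; have [r [C [r0 C0 h]]] := exists_local_bounds openTheta lamT bd Dx.
  exists r, C, (fun=> 1); split => //.
    move=> n w; apply: (@measurable_bounded_integrable _ _ _ (lsm (X w))) => //; first exact: fW.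
    by exists 1; split; [exact: num_real|move=> y y1 t _; rewrite /= normr1 ltW].
  by move=> y yr; have [Dy _ h2 _ _] := h y yr; split => // t Tt; rewrite mulr1 h2.
Qed.

Let measurable_leb (h : 'cV[R]_d -> R -> R) :
  (forall x, Theta x -> measurable_fun T (h x)) ->
  (forall x s t, T s -> T t -> Theta x ->
     leb.-integrable `]s, t]%classic (EFin \o h x)) ->
  (forall x, Theta x -> exists r C rho, [/\ 0 < r, 0 <= C,
    forall s t, T s -> T t -> leb.-integrable `]s, t]%classic (EFin \o rho) &
    forall y : 'cV[R]_d, `|y - x| < r -> Theta y /\
      forall t, T t -> `|h y t - h x t| <= C * `|y - x| * rho t]) ->
  measurable_fun setT (fun w => \int[leb]_(t in T) h (th w) t).
Proof.
move=> mh ih lh; have [a [b wT]] := exists_windows oT.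
have [wab _ WT sub0 null] := wT.
apply: (@measurable_parametrized_integral R d _ A T a b Theta oT wT openTheta
  (fun w => leb) _ _ h th) => //.
- move=> _; apply/eqP; rewrite eq_le measure_ge0 andbT -(lebesgue_measure_set1 0).
  apply: le_measure => //; rewrite inE//.
  apply: measurableD => //; apply: bigcup_measurable => n _; exact: measurable_itv.
- by move=> x n _ Dx; have [Ta Tb ab] := wab n; exact: ih.
- move=> x Dx; have [r [C [rho [r0 C0 irho hr]]]] := lh x Dx.
  by exists r, C, rho; split => // n _; have [Ta Tb _] := wab n; exact: irho.
Qed.

Let ilam x s t : T s -> T t -> Theta x -> leb.-integrable `]s, t]%classic (EFin \o lam x).
Proof.
move=> Ts Tt Dx; have [_ _ /(_ s t Ts Tt)] := lamT Dx.
apply: integrableS; [exact: measurable_itv|exact: measurable_itv|].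
exact: subset_itv_oc_cc.
Qed.

Let iscore x y i s t : T s -> T t -> Theta x -> Theta y ->
  leb.-integrable `]s, t]%classic (EFin \o (fun u => score lam i x u * lam y u)).
Proof.
move=> Ts Tt Dx Dy; have [M M0 [sM _]] := score_bounds bd.
have sub : `]s, t]%classic `<=` T.
  move=> u /=; rewrite in_itv/= => /andP[/ltW su ut].
  by apply: (observation_interval_is_interval oT Ts Tt); rewrite su.
apply: (@integrable_mul_bounded _ _ _ leb _ _ _ (score lam i x) M).
- exact: measurable_itv.
- by apply: measurable_funS mT sub _; exact: ms.
- by move=> u /sub Tu; exact: sM.
- exact: ilam.
Qed.

Lemma measurable_score_compensator i :
  measurable_fun setT (fun w => \int[leb]_(t in T) (score lam i (th w) t * lam (th w) t)).
Proof.
apply: (measurable_leb (h := fun x t => score lam i x t * lam x t)) => [x Dx|x s t Ts Tt Dx|x Dx].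
- by apply: measurable_funM; [exact: ms|exact: (measurable_lam lamT)].
- exact: iscore.
have [r [C [r0 C0 h]]] := exists_local_bounds openTheta lamT bd Dx.
have [lx _ _] := lamT Dx.
exists r, (C * C + C), (lam x); split => //; first by rewrite addr_ge0// mulr_ge0.
  by move=> s t Ts Tt; exact: ilam.
move=> y yr; have [Dy h1 h2 h3 _] := h y yr; split => // t Tt.
have -> : score lam i y t * lam y t - score lam i x t * lam x t =
    score lam i y t * (lam y t - lam x t) + (score lam i y t - score lam i x t) * lam x t.
  by rewrite mulrBr mulrBl addrA subrK.
apply: le_trans (ler_normD _ _) _; rewrite 2!normrM (gtr0_norm (lx t Tt)).
rewrite !mulrDl; apply: lerD.
  by rewrite -!mulrA; apply: ler_pM => //; [exact: h1|rewrite mulrA; exact: h3].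
by apply: ler_wpM2r; [exact/ltW/lx|exact: h2].
Qed.

Lemma measurable_score_drift i th1 : Theta th1 ->
  measurable_fun setT (fun w => \int[leb]_(t in T) (score lam i (th w) t * lam th1 t)).
Proof.
move=> D1.
apply: (measurable_leb (h := fun x t => score lam i x t * lam th1 t)) => [x Dx|x s t Ts Tt Dx|x Dx].
- by apply: measurable_funM; [exact: ms|exact: (measurable_lam lamT)].
- exact: iscore.
have [r [C [r0 C0 h]]] := exists_local_bounds openTheta lamT bd Dx.
have [lx _ _] := lamT D1.
exists r, C, (lam th1); split => //; first by move=> s t Ts Tt; exact: ilam.
move=> y yr; have [Dy _ h2 _ _] := h y yr; split => // t Tt.
by rewrite -mulrBl normrM (gtr0_norm (lx t Tt)); apply: ler_wpM2r; [exact/ltW/lx|exact: h2].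
Qed.

Variables (J : 'cV[R]_d -> 'M[R]_d) (c : R).
Hypothesis fin : finite_integrals T lam Theta.
Hypothesis JE : is_information T Theta lam J.
Hypothesis cJ : forall x, Theta x -> coercive c (J x).

(** An entry of the inverse is a coordinate of the inverse applied to a basis vector; the resolvent
    bound makes it continuous in the parameter. *)
Lemma measurable_inverse_information i j :
  measurable_fun setT (fun w => (invmx (J (th w))) i j).
Proof.
apply: (measurable_caratheodory (phi := fun _ x => (invmx (J x)) i j) openTheta Dth mth).
  by move=> x Dx; exact: measurable_cst.
move=> w; set x := th w; have Dx : Theta x := Dth w.
have [r [C [[r0 C0 lb] li]]] := exists_local_integrals oT openTheta lamT fin bd JE Dx.
pose u : 'cV[R]_d := delta_mx j ord0.
have entry (M : 'M[R]_d) : M i j = (M *m u) i ord0 :> R.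
  rewrite mxE (bigD1 j)//= !mxE !eqxx mulr1 big1 ?addr0// => k kj.
  by rewrite !mxE (negbTE kj) mulr0.
have [c0 _ _] := cJ Dx.
pose K := d%:R / c * (C * d%:R * (d%:R / c * `|u|)).
have K0 : 0 <= K by rewrite !mulr_ge0// ?invr_ge0 ltW.
have le y : `|y - x| < r -> `|(invmx (J y)) i j - (invmx (J x)) i j| <= K * `|y - x|.
  move=> yr; have [Dy _ _ _ _] := lb y yr; have [_ _ _ hJ _] := li y yr.
  rewrite !entry.
  have := norm_invmx_dist (B := C * `|y - x|) u (cJ Dy) (cJ Dx) (mulr_ge0 C0 (normr_ge0 _)) hJ.
  move=> h; have := coord_norm_le (invmx (J y) *m u - invmx (J x) *m u) i.
  rewrite !mxE => h'; apply: le_trans h' _; apply: le_trans h _.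
  by rewrite /K le_eqVlt; apply/orP; left; apply/eqP; ring.
apply/(@cvgrPdist_lt _ _ _ (nbhs x)) => e e0.
have K1 : 0 < K + 1 by rewrite ltr_wpDl.
apply/nbhs_ballP; exists (Num.min r (e / (K + 1))).
  by rewrite /= lt_min r0 divr_gt0.
move=> y; rewrite -ball_normE/= distrC lt_min => /andP[yr ye].
rewrite distrC; apply: le_lt_trans (le y yr) _.
move: ye; rewrite ltr_pdivlMr// mulrC => ye.
by apply: le_lt_trans ye; rewrite ler_wpM2r// lerDl.
Qed.

End MeasurableScores.

(** * The normalized score *)

Section Blocks.
Context {R : realType} {dO : measure_display} {Omega : measurableType dO}.
Variables (P : probability Omega R) (T : set R) (X : nat -> Omega -> cumulative R R).
Hypothesis cX : forall j, counting_process T (X j).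
Hypothesis iX : mutually_independent P (fun j => sigma_process T (X j)).

Lemma sigma_process_measurable j : sigma_process T (X j) `<=` measurable.
Proof.
apply: smallest_sub; first exact: sigma_algebra_measurable.
move=> B [t Tt] [C mC <-]; have [_ mX] := cX j.
exact: mX.
Qed.

Definition block (U : set nat) : set_system Omega := \bigcup_(j in U) sigma_process T (X j).

Lemma block_measurable U : <<s block U >> `<=` measurable.
Proof.
apply: smallest_sub; first exact: sigma_algebra_measurable.
by move=> B [j _]; exact: sigma_process_measurable.
Qed.

Lemma block_indep (U V : set nat) A B : U `&` V = set0 ->
  <<s block U >> A -> <<s block V >> B -> P (A `&` B) = (P A * P B)%E.
Proof.
apply: (mutually_independent_blocks _ _ iX) => j.
  exact: smallest_sigma_algebra.
exact: sigma_process_measurable.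
Qed.

Lemma counting_process_block (U : set nat) j : U j ->
  @counting_process R _ (g_sigma_algebraType (block U)) T (X j).
Proof.
move=> Uj; have [pX mX] := cX j; split => // t Tt _ B mB; rewrite setTI.
apply: sub_sigma_algebra; exists j => //; apply: sub_sigma_algebra; exists t => //.
by exists B => //; rewrite setTI.
Qed.

(** The same outcome, seen through the coarser sigma-algebra of a block; the pair of such maps for
    past and future feeds the Fubini argument. *)
Lemma measurable_block_id (U : set nat) :
  measurable_fun setT (fun w : Omega => w : g_sigma_algebraType (block U)).
Proof. by move=> _ B mB; rewrite setTI; apply: (@block_measurable U). Qed.

End Blocks.

Section SumNat.
Context {R : realType} {dA : measure_display} {A : measurableType dA}.

Lemma measurable_sum_nat (N k : nat) (h : nat -> A -> R) :
  (forall j, (N <= j < k)%N -> measurable_fun setT (h j)) ->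
  measurable_fun setT (fun w => \sum_(N <= j < k) h j w).
Proof.
move=> mh; rewrite (_ : (fun w => _) =
    fun w => \sum_(N <= j < k) (if (N <= j < k)%N then h j w else 0)); last first.
  by apply/funext => w; apply: eq_big_nat => j ->.
apply: measurable_sum => j; have [Nk|_] := boolP (N <= j < k)%N; first exact: mh.
exact: measurable_cst.
Qed.

End SumNat.

Section ExpR.
Context {R : realType}.

Lemma expRN_dist_le (a b : R) : 0 <= a -> 0 <= b -> `|expR (- a) - expR (- b)| <= `|a - b|.
Proof.
have h (x y : R) : 0 <= x -> x <= y -> `|expR (- x) - expR (- y)| <= `|x - y|.
  move=> x0 xy; rewrite ger0_norm ?subr_ge0 ?ler_expR ?lerN2//.
  rewrite distrC (ger0_norm (_ : 0 <= y - x)) ?subr_ge0//.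
  have -> : expR (- y) = expR (- x) * expR (- (y - x)) by rewrite -expRD; congr expR; ring.
  have e1 : expR (- x) <= 1 by rewrite -expR0 ler_expR oppr_le0.
  have e0 := expR_gt0 (- x); have := expR_ge1Dx (- (y - x)); set q := expR (- (y - x)) => hq.
  have q1 : q <= 1 by rewrite -expR0 ler_expR oppr_le0 subr_ge0.
  by nra.
move=> a0 b0; have [ab|/ltW ba] := leP a b; first exact: h.
by rewrite distrC [leRHS]distrC; exact: h.
Qed.

Lemma cf_approximation (a b phi sigma c : R) : 0 <= a -> 0 <= sigma ->
  `|expR (- a) * cos (phi + c) - expR (- sigma) * cos c| <= `|a - sigma| + `|phi|.
Proof.
move=> a0 s0.
have -> : expR (- a) * cos (phi + c) - expR (- sigma) * cos c =
   expR (- a) * (cos (phi + c) - cos c) + (expR (- a) - expR (- sigma)) * cos c by ring.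
rewrite addrC; apply: le_trans (ler_normD _ _) _; rewrite !normrM; apply: lerD.
  apply: le_trans (expRN_dist_le a0 s0); rewrite ler_piMr//.
  by rewrite cos_max.
have e1 : expR (- a) <= 1 by rewrite -expR0 ler_expR oppr_le0.
apply: (@le_trans _ _ `|cos (phi + c) - cos c|).
  by rewrite ler_piMl// gtr0_norm// expR_gt0.
by apply: le_trans (norm_cosB_le _ _) _; rewrite addrK.
Qed.

End ExpR.

Section Noise.
Context {R : realType} {dO : measure_display} {Omega : measurableType dO}.
Variables (P : probability Omega R) (T : set R) (X : nat -> Omega -> cumulative R R).
Variable lam0 : R -> R.
Hypothesis oT : observation_interval T.
Hypothesis lamT : intensity T lam0.
Hypothesis cX : forall j, counting_process T (X j).
Hypothesis PX : forall j, poisson_process P T lam0 (X j).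
Hypothesis iX : mutually_independent P (fun j => sigma_process T (X j)).
Notation leb := lebesgue_measure.

Let mT : measurable (T : set (measurableTypeR R)).
Proof. exact: observation_interval_measurable. Qed.

Variables (d : nat) (g : 'I_d -> R -> R).
Hypothesis mg : forall i, measurable_fun T (g i).
Hypothesis wg : forall i, weighted_integrable T lam0 (g i).

Let S (v : 'I_d -> R) N k w := \sum_(N <= j < k) \sum_i v i * path_integral T (X j) (g i) w.

Let measurable_S v N k : measurable_fun setT (S v N k).
Proof.
apply: measurable_sum => j; apply: measurable_sum => i; apply: measurable_funM => //.
exact: measurable_Rpath_integral.
Qed.

Lemma has_cf_poisson_sum (v : 'I_d -> R) N k : (N <= k)%N ->
  let h t := \sum_i v i * g i t in
  has_cf P (fun w => \sum_(N <= j < k) \sum_i v i * path_integral T (X j) (g i) w)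
    (expR (\int[leb]_(t in T) ((cos (h t) - 1) * lam0 t) *+ (k - N)))
    ((\int[leb]_(t in T) (sin (h t) * lam0 t)) *+ (k - N)).
Proof.
move=> Nk h; rewrite -(subnK Nk) addnK; elim: (k - N)%N => [|m IH].
  apply: (@eq_has_cf _ _ _ P (fun=> 0)); first by move=> w; rewrite add0n big_geq.
  by rewrite !mulr0n expR0; exact: has_cf0.
apply: (@eq_has_cf _ _ _ P (fun w => S v N (m + N) w + \sum_i v i * path_integral T (X (m + N)%N) (g i) w)).
  by move=> w; rewrite /S addSn big_nat_recr//= leq_addl.
rewrite !mulrSr expRD; apply: has_cfD IH _ => //.
- exact: measurable_S.
- by apply: measurable_sum => i; apply: measurable_funM => //; exact: measurable_Rpath_integral.
- move=> A B mA mB; pose U := [set j | (j < m + N)%N]; pose V := [set (m + N)%N].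
  have mU : measurable_fun (setT : set (g_sigma_algebraType (block T X U)))
      (fun w => \sum_(N <= j < m + N) \sum_i v i * path_integral T (X j) (g i) w).
    apply: measurable_sum_nat => j /andP[_ jm]; apply: measurable_sum => i.
    apply: measurable_funM; first exact: measurable_cst.
    exact: (measurable_Rpath_integral oT (counting_process_block (U := U) cX jm)).
  have mV : measurable_fun (setT : set (g_sigma_algebraType (block T X V)))
      (fun w => \sum_i v i * path_integral T (X (m + N)%N) (g i) w).
    apply: measurable_sum => i; apply: measurable_funM; first exact: measurable_cst.
    exact: (measurable_Rpath_integral oT (counting_process_block (U := V) cX erefl)).
  apply: (block_indep cX iX (U := U) (V := V)).
  + by apply/seteqP; split => // j [h1 h2]; move: h1; rewrite /U/= h2 ltnn.
  + by have := mU measurableT A mA; rewrite setTI.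
  + by have := mV measurableT B mB; rewrite setTI.
exact: (poisson_cf_linear oT (cX _) lamT (PX _)).
Qed.

Variables (N k : nat) (v : 'I_d -> R) (B : R).
Hypotheses (Nk : (N <= k)%N) (k0 : (0 < k)%N).
Let q t := \sum_i v i * g i t.
Hypothesis B0 : 0 <= B.
Hypothesis qB : forall t, T t -> `|q t| <= B.
Let Q := \int[leb]_(t in T) (q t ^+ 2 * lam0 t).
Let eps : R := (Num.sqrt k%:R)^-1.

Let lam_ge0 t : T t -> 0 <= lam0 t.
Proof. by have [h _ _] := lamT => /h/ltW. Qed.

Let mq : measurable_fun T q.
Proof. by apply: measurable_sum => i; apply: measurable_funM. Qed.

Let ml : measurable_fun T lam0. Proof. by have [] := lamT. Qed.

Let wq : weighted_integrable T lam0 q.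
Proof. exact: weighted_integrable_sum. Qed.

Let iQ : leb.-integrable T (EFin \o (fun t => q t ^+ 2 * lam0 t)).
Proof.
have := @integrable_mul_bounded _ _ _ leb T mT _ q B mq qB wq.
by apply: eq_integrable => // t _; rewrite /= expr2 mulrA.
Qed.

Let Q0 : 0 <= Q.
Proof. by apply: Rintegral_ge0 => t Tt; rewrite mulr_ge0 ?sqr_ge0 ?lam_ge0. Qed.

Let eps0 : 0 < eps. Proof. by rewrite invr_gt0 sqrtr_gt0 ltr0n. Qed.

Let eps2 : eps ^+ 2 = k%:R^-1.
Proof. by rewrite exprVn sqr_sqrtr. Qed.

Let keps : k%:R * eps ^+ 2 = 1.
Proof. by rewrite eps2 divff// pnatr_eq0 -lt0n. Qed.

Let h t := \sum_i (eps * v i) * g i t.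

Let hE t : h t = eps * q t.
Proof. by rewrite /h mulr_sumr; apply: eq_bigr => i _; rewrite mulrA. Qed.

Let mh : measurable_fun T h.
Proof. by apply: measurable_sum => i; apply: measurable_funM. Qed.

(* Each remainder is dominated by a multiple of [q ^+ 2 * lam0]. *)
Let remainder (f : R -> R) (K : R) : measurable_fun T f ->
  (forall t, T t -> `|f t| <= K * q t ^+ 2) ->
  leb.-integrable T (EFin \o (fun t => f t * lam0 t)) /\
  `|\int[leb]_(t in T) (f t * lam0 t)| <= K * Q.
Proof.
move=> mf fK; have iK := @integrableZ_real _ _ _ leb T mT _ K iQ.
have dom t : T t -> `|f t * lam0 t| <= K * (q t ^+ 2 * lam0 t).
  move=> Tt; rewrite normrM (ger0_norm (lam_ge0 Tt)) mulrA.
  by apply: ler_wpM2r; [exact: lam_ge0|exact: fK].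
have i1 : leb.-integrable T (EFin \o (fun t => f t * lam0 t)).
  apply: (@le_integrable_real _ _ _ leb T mT _ _ _ dom iK).
  exact: measurable_funM.
split => //; apply: le_trans (@norm_Rintegral_le_dominated _ _ _ leb T mT _ _ i1 iK dom) _.
by rewrite [leLHS](@RintegralZl _ _ _ leb T _ K mT iQ).
Qed.

Let mcosh : measurable_fun T (cos \o h).
Proof. by apply: (measurableT_comp (continuous_measurable_fun (@continuous_cos R)) mh). Qed.

Let msinh : measurable_fun T (sin \o h).
Proof. by apply: (measurableT_comp (continuous_measurable_fun (@continuous_sin R)) mh). Qed.

Let Ic := \int[leb]_(t in T) ((cos (h t) - 1) * lam0 t).
Let Is := \int[leb]_(t in T) ((sin (h t) - h t) * lam0 t).

Let cos_part1 : leb.-integrable T (EFin \o (fun t => (cos (h t) - 1) * lam0 t)) /\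
  `|Ic| <= eps ^+ 2 * Q.
Proof.
apply: remainder => [|t Tt]; first exact: measurable_funB.
by apply: le_trans (norm_cosB1_le _) _; rewrite hE exprMn.
Qed.

(** Multiplied by k - N, this puts the logarithm of the modulus at - Q / 2 up to the fraction N / k
    and an error of order B^2 Q / k. *)
Let cos_part2 : `|Ic + eps ^+ 2 * Q / 2| <= eps ^+ 4 * B ^+ 2 * Q.
Proof.
have [i1 _] := cos_part1.
have iK := @integrableZ_real _ _ _ leb T mT _ (eps ^+ 2 / 2) iQ.
have -> : eps ^+ 2 * Q / 2 = \int[leb]_(t in T) (eps ^+ 2 / 2 * (q t ^+ 2 * lam0 t)).
  by rewrite [RHS](@RintegralZl _ _ _ leb T _ _ mT iQ) mulrAC.
rewrite -(@RintegralD _ _ _ leb T _ _ mT i1 iK).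
have -> : \int[leb]_(t in T) ((cos (h t) - 1) * lam0 t + eps ^+ 2 / 2 * (q t ^+ 2 * lam0 t)) =
    \int[leb]_(t in T) ((cos (h t) - 1 + h t ^+ 2 / 2) * lam0 t).
  by apply: eq_Rintegral => t _; rewrite hE; ring.
apply: (remainder _ _).2 => [|t Tt].
  apply: measurable_funD; first exact: measurable_funB.
  by apply: measurable_funM => //; exact: measurable_funX.
apply: le_trans (norm_cosB1D_le _) _; rewrite hE exprMn -[leRHS]mulrA.
apply: ler_wpM2l; first exact/exprn_ge0/ltW.
rewrite (exprD _ 2 2) ler_wpM2r ?sqr_ge0//.
by rewrite -(real_normK (num_real (q t))) lerXn2r ?nnegrE// qB.
Qed.

Let sin_part1 : leb.-integrable T (EFin \o (fun t => (sin (h t) - h t) * lam0 t)) /\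
  `|Is| <= eps ^+ 3 * B * Q.
Proof.
apply: remainder => [|t Tt]; first exact: measurable_funB.
apply: le_trans (norm_sinB_le _) _; rewrite hE normrM (gtr0_norm eps0) exprMn -[leRHS]mulrA.
apply: ler_wpM2l; first exact/exprn_ge0/ltW.
rewrite exprS (real_normK (num_real (q t))) ler_wpM2r ?sqr_ge0//.
exact: qB.
Qed.

Let sin_part2 : `|Is| <= 2 * eps ^+ 2 * Q.
Proof.
apply: (remainder _ _).2 => [|t Tt]; first exact: measurable_funB.
by apply: le_trans (norm_sinB_le2 _) _; rewrite hE exprMn mulrA.
Qed.

Definition noise (w : Omega) (i : 'I_d) : R :=
  (Num.sqrt k%:R)^-1 * \sum_(N <= j < k)
    (path_integral T (X j) (g i) w - \int[leb]_(t in T) (g i t * lam0 t)).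

Let has_cf_noise : has_cf P (fun w => \sum_i v i * noise w i)
  (expR (Ic *+ (k - N))) (Is *+ (k - N)).
Proof.
have ih : leb.-integrable T (EFin \o (fun t => h t * lam0 t)) by exact: weighted_integrable_sum.
pose mean := \int[leb]_(t in T) (h t * lam0 t).
have meanE : mean = \sum_i (eps * v i) * \int[leb]_(t in T) (g i t * lam0 t).
  have pi_ i : leb.-integrable T (EFin \o (fun t => (eps * v i) * (g i t * lam0 t))).
    exact: (@integrableZ_real _ _ _ leb T mT _ _ (wg i)).
  transitivity (\int[leb]_(t in T) \sum_i (eps * v i) * (g i t * lam0 t)).
    by apply: eq_Rintegral => t _; rewrite /h mulr_suml; apply: eq_bigr => i _; rewrite mulrA.
  rewrite [LHS](@Rintegral_sum _ _ _ leb T mT _ _ _ pi_); apply: eq_bigr => i _.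
  by rewrite [LHS](@RintegralZl _ _ _ leb T _ _ mT (wg i)).
have i1 := sin_part1.1.
have sE : \int[leb]_(t in T) (sin (h t) * lam0 t) = Is + mean.
  rewrite -(@RintegralD _ _ _ leb T _ _ mT i1 ih).
  by apply: eq_Rintegral => t _; rewrite -mulrDl subrK.
have := has_cf_addc (- (mean *+ (k - N))) (has_cf_poisson_sum (fun i => eps * v i) Nk).
rewrite -/h sE mulrnDl addrK; apply: eq_has_cf => w.
rewrite (_ : mean *+ (k - N) = \sum_(N <= j < k) mean); last first.
  by rewrite sumr_const_nat.
rewrite -sumrB meanE.
rewrite (eq_bigr (fun j => \sum_i (eps * v i) * (path_integral T (X j) (g i) w -
   \int[leb]_(t in T) (g i t * lam0 t)))); last first.
  by move=> j _; rewrite -sumrB; apply: eq_bigr => i _; rewrite mulrBr.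
rewrite exchange_big/=; apply: eq_bigr => i _.
by rewrite -mulr_sumr /noise mulrCA mulrA.
Qed.

Let algA (n e x : R) : n * (2 * e * x) = 2 * x * (n * e). Proof. by ring. Qed.
Let algB (n e b x : R) : n * (e ^+ 3 * b * x) = b * x * e * (n * e ^+ 2). Proof. by ring. Qed.
Let algC (n e b x : R) : n * (e ^+ 4 * b ^+ 2 * x) = b ^+ 2 * x * (e ^+ 2 * (n * e ^+ 2)).
Proof. by ring. Qed.
Let algD (n e i x s t : R) : n * e = 1 - t ->
  - (n * i) - s / 2 = - (n * (i + e * x / 2)) + ((x - s) / 2 - x * t / 2).
Proof.
move=> ne; have -> : n * (i + e * x / 2) = n * i + (n * e) * x / 2 by ring.
by rewrite ne; ring.
Qed.

Let nk : (k - N)%:R * eps ^+ 2 <= 1.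
Proof. by rewrite -[leRHS]keps; apply: ler_wpM2r; [exact: sqr_ge0|rewrite ler_nat leq_subr]. Qed.

Let nk0 : 0 <= (k - N)%:R * eps ^+ 2. Proof. by rewrite mulr_ge0// sqr_ge0. Qed.

Let Ic0 : Ic <= 0.
Proof.
rewrite -oppr_ge0 /Ic -[X in 0 <= X]mulN1r.
rewrite -(@RintegralZl _ _ _ leb T _ (-1) mT cos_part1.1).
apply: Rintegral_ge0 => t Tt; rewrite mulrA; apply: mulr_ge0; [|exact: lam_ge0].
by rewrite mulN1r opprB subr_ge0 cos_le1.
Qed.

(** The bound does not involve [B], thanks to the quadratic estimate for sin. As [Q] is quadratic in
    [v], scaling [v] by u yields terms in u^2 and u^4, the form required for extracting a second
    moment. *)
Lemma noise_moment_cf : \int[P]_w (1 - cos (\sum_i v i * noise w i)) <= Q + 4 * Q ^+ 2.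
Proof.
have mn : measurable_fun setT (fun w => \sum_i v i * noise w i).
  apply: measurable_sum => i; apply: measurable_funM => //; apply: measurable_funM => //.
  apply: measurable_sum => j; apply: measurable_funB => //.
  exact: measurable_Rpath_integral.
have mc : measurable_fun setT (fun w => cos (\sum_i v i * noise w i)).
  by have := measurable_cos_comp 0 mn; under eq_fun do rewrite addr0.
have ic : P.-integrable setT (EFin \o (fun w => cos (\sum_i v i * noise w i))).
  by apply: (bounded_integrable P (M := 1)) => // w; exact: cos_max.
have i1 : P.-integrable setT (EFin \o (fun _ : Omega => 1 : R)).
  by apply: (bounded_integrable P (M := 1)) => // w; rewrite normr1.
rewrite (@RintegralB _ _ _ P setT _ _ measurableT i1 ic) probability_Rintegral_cst.
have := has_cf_noise 0; rewrite addr0; under eq_Rintegral do rewrite addr0.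
move=> ->; rewrite -[Ic *+ _]mulr_natl -[Is *+ _]mulr_natl -[X in expR X]opprK.
have a0 : 0 <= - ((k - N)%:R * Ic) by rewrite oppr_ge0 mulr_ge0_le0.
apply: le_trans (one_sub_expR_cos_le _ a0) _; apply: lerD.
  have := cos_part1.2; rewrite ler_norml => /andP[hc _].
  move: nk nk0 hc Ic0 Q0; rewrite -/Ic; set n := (k - N)%:R; set e2 := eps ^+ 2.
  have : 0 <= n by rewrite /n.
  move: n e2 Ic Q => n e2 I q' n0 ne ne0 hI I0 q0.
  apply: (@le_trans _ _ (n * (e2 * q'))); first by rewrite -mulrN ler_wpM2l//; lra.
  by rewrite mulrA ler_piMl.
have hs := sin_part2.
have h2 : `|(k - N)%:R * Is| <= 2 * Q.
  rewrite normrM normr_nat; apply: (@le_trans _ _ ((k - N)%:R * (2 * eps ^+ 2 * Q))).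
    by rewrite ler_wpM2l.
  rewrite algA.
  by rewrite ler_piMr// mulr_ge0.
rewrite -(real_normK (num_real _)) (_ : 4 * Q ^+ 2 = (2 * Q) ^+ 2); last by ring.
by rewrite lerXn2r// nnegrE mulr_ge0.
Qed.

(** Only k - N terms are summed under the normalization by sqrt k, so the variance is (1 - N / k) Q;
    this explains the middle term. The last term collects the higher-order errors of modulus and
    phase. *)
Lemma noise_cf_approximation (sigma c : R) : 0 <= sigma ->
  `|\int[P]_w cos (\sum_i v i * noise w i + c) - expR (- (sigma / 2)) * cos c| <=
  `|Q - sigma| + Q * (N%:R / k%:R) + (B ^+ 2 * Q + B * Q) / Num.sqrt k%:R.
Proof.
move=> s0; rewrite has_cf_noise -[Ic *+ _]mulr_natl -[Is *+ _]mulr_natl -[X in expR X]opprK.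
have a0 : 0 <= - ((k - N)%:R * Ic) by rewrite oppr_ge0 mulr_ge0_le0.
have s20 : 0 <= sigma / 2 by rewrite divr_ge0.
apply: le_trans (@cf_approximation _ _ 0 _ _ c a0 s20) _.
have k0' : 0 < k%:R :> R by rewrite ltr0n.
have e1 : eps <= 1.
  by rewrite invf_le1 ?sqrtr_gt0// -[leLHS]sqrtr1 ler_sqrt ?ler1n.
have kn : (k - N)%:R * eps ^+ 2 = 1 - N%:R / k%:R.
  by rewrite natrB// mulrBl keps eps2.
have t0 : 0 <= N%:R / k%:R :> R by rewrite divr_ge0.
have h1 := cos_part2; have h2 := sin_part1.2.
have h3 : `|(k - N)%:R * Is| <= B * Q / Num.sqrt k%:R.
  rewrite normrM normr_nat; apply: (@le_trans _ _ ((k - N)%:R * (eps ^+ 3 * B * Q))).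
    by rewrite ler_wpM2l.
  rewrite algB.
  by rewrite ler_piMr// !mulr_ge0// ltW.
have h4 : `|- ((k - N)%:R * Ic) - sigma / 2| <=
    `|Q - sigma| + Q * (N%:R / k%:R) + B ^+ 2 * Q / Num.sqrt k%:R.
  have -> : - ((k - N)%:R * Ic) - sigma / 2 = - ((k - N)%:R * (Ic + eps ^+ 2 * Q / 2)) +
     ((Q - sigma) / 2 - Q * (N%:R / k%:R) / 2).
    exact: algD.
  apply: le_trans (ler_normD _ _) _; rewrite addrC; apply: lerD.
    apply: le_trans (ler_normB _ _) _.
    rewrite normrM [X in _ + X](ger0_norm _) ?mulr_ge0// (ger0_norm (_ : 0 <= 2^-1)) ?invr_ge0//.
    have := normr_ge0 (Q - sigma); have : 0 <= Q * (N%:R / k%:R) by rewrite mulr_ge0.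
    by lra.
  rewrite normrN normrM normr_nat.
  apply: (@le_trans _ _ ((k - N)%:R * (eps ^+ 4 * B ^+ 2 * Q))); first by rewrite ler_wpM2l.
  rewrite algC.
  apply: ler_wpM2l; first by rewrite mulr_ge0// sqr_ge0.
  apply: (@le_trans _ _ (eps ^+ 2)); first by rewrite ler_piMr// sqr_ge0.
  by rewrite expr2 -/eps ler_piMl// ltW.
rewrite mulrDl addrA; exact: lerD.
Qed.

End Noise.

Section Dot.
Context {R : realType} {d : nat}.
Implicit Types (u x : 'cV[R]_d) (M : 'M[R]_d).

Lemma dotE u x : dot u x = (u^T *m x) ord0 ord0.
Proof. by rewrite mxE; apply: eq_bigr => i _; rewrite mxE. Qed.

Lemma dot_mulmx M u x : dot u (M *m x) = dot (M^T *m u) x.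
Proof. by rewrite !dotE trmx_mul trmxK mulmxA. Qed.

Lemma dotBr u x x' : dot u (x - x') = dot u x - dot u x'.
Proof. by rewrite !dotE mulmxBr !mxE. Qed.

Lemma norm_dot_le u x : `|dot u x| <= d%:R * `|u| * `|x|.
Proof.
apply: le_trans (ler_norm_sum _ _ _) _.
apply: (@le_trans _ _ (\sum_i `|u| * `|x i ord0|)).
  by apply: ler_sum => i _; rewrite normrM ler_wpM2r// coord_norm_le.
by rewrite -mulr_sumr -mulrA mulrCA ler_wpM2l// sum_coord_le.
Qed.

End Dot.

(** * The normalized score, uniformly for parameters near [th0] *)

Section UniformBounds.
Context {R : realType} {d : nat} {dO : measure_display} {Omega : measurableType dO}.
Variables (T : set R) (Theta : set 'cV[R]_d) (lam : 'cV[R]_d -> R -> R).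
Hypothesis oT : observation_interval T.
Hypothesis openTheta : open Theta.
Hypothesis lamT : forall th, Theta th -> intensity T (lam th).
Hypothesis bd : bounded_derivatives 3 Theta T (ell lam).
Hypothesis fin : finite_integrals T lam Theta.
Variables (J : 'cV[R]_d -> 'M[R]_d) (c : R).
Hypothesis JE : is_information T Theta lam J.
Hypothesis cJ : forall x, Theta x -> coercive c (J x).
Variables (th0 : 'cV[R]_d) (rho C : R).
Hypothesis lb : local_bounds T Theta lam th0 rho C.
Hypothesis li : local_integrals T lam J th0 rho C.
Variables (P : probability Omega R) (X : nat -> Omega -> cumulative R R).
Hypothesis cX : forall j, counting_process T (X j).
Hypothesis PX : forall j, poisson_process P T (lam th0) (X j).
Hypothesis iX : mutually_independent P (fun j => sigma_process T (X j)).
Notation leb := lebesgue_measure.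

Let mT : measurable (T : set (measurableTypeR R)).
Proof. exact: observation_interval_measurable. Qed.

Let rho0 : 0 < rho. Proof. by have [] := lb. Qed.
Let C0 : 0 <= C. Proof. by have [] := lb. Qed.
Let D0 : Theta th0. Proof. by have [_ _ /(_ th0)[]] := lb; rewrite ?subrr ?normr0. Qed.
Let c0 : 0 < c. Proof. by have [] := cJ D0. Qed.

Let Dth th : `|th - th0| < rho -> Theta th.
Proof. by have [_ _ h] := lb => /h[]. Qed.

Definition fluctuation N k (th : 'cV[R]_d) (w : Omega) : 'cV[R]_d :=
  \col_i noise T X (lam th0) (score lam ^~ th) N k w i.

(** [a] bounds the inverse information in norm, [L] controls the dependence of the variance on the
    parameter, and [K] bounds that variance on the ball of radius [rho]. *)
Let a : R := d%:R / c.
Let L : R := 3 * C * d%:R ^+ 2 * a ^+ 2.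
Let K : R := d%:R * a + L * rho.

Let a0 : 0 <= a. Proof. by rewrite divr_ge0// ltW. Qed.
Let L0 : 0 <= L.
Proof. by apply: mulr_ge0; [apply: mulr_ge0; [exact: mulr_ge0|exact: sqr_ge0]|exact: sqr_ge0]. Qed.
Let K0 : 0 <= K.
Proof. by apply: addr_ge0; apply: mulr_ge0 => //; exact: ltW. Qed.

(** The covariance of the score at [th] under the true intensity; it agrees with the information
    only at [th0], or approximately nearby. *)
Let G (th : 'cV[R]_d) : 'M[R]_d :=
  \matrix_(i, j) \int[leb]_(t in T) (score lam i th t * score lam j th t * lam th0 t).

Let sqr_sumE (v s : 'I_d -> R) (l : R) : (\sum_i v i * s i) ^+ 2 * l =
  \sum_i \sum_j (v i * v j) * (s i * s j * l).
Proof.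
rewrite expr2 mulr_suml mulr_suml; apply: eq_bigr => i _.
rewrite mulr_sumr mulr_suml; apply: eq_bigr => j _; ring.
Qed.

Let quadratic_integral th (v : 'cV[R]_d) : `|th - th0| < rho ->
  \int[leb]_(t in T) ((\sum_i v i ord0 * score lam i th t) ^+ 2 * lam th0 t) =
  dot v (G th *m v).
Proof.
move=> thr; have [w1 _ _ _ _] := li thr; have [_ _ /(_ th thr)[_ sb _ _ _]] := lb.
have pi_ i j : leb.-integrable T (EFin \o (fun t =>
    score lam i th t * score lam j th t * lam th0 t)).
  have := @integrable_mul_bounded _ _ _ leb T mT _ (score lam i th) C
    (measurable_score openTheta lamT bd i (Dth thr)) (sb i) (w1 j).1.
  by apply: eq_integrable => // t _; rewrite /= mulrA.
have pz i j := @integrableZ_real _ _ _ leb T mT _ (v i ord0 * v j ord0) (pi_ i j).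
transitivity (\int[leb]_(t in T) \sum_i \sum_j (v i ord0 * v j ord0) *
    (score lam i th t * score lam j th t * lam th0 t)).
  by apply: eq_Rintegral => t _; exact: sqr_sumE.
have ps i := @integrable_sum_real _ _ _ leb T mT _ (index_enum 'I_d) _ (pz i).
rewrite [LHS](@Rintegral_sum _ _ _ leb T mT _ _ _ ps); apply: eq_bigr => i _.
rewrite [LHS](@Rintegral_sum _ _ _ leb T mT _ _ _ (pz i)) mxE mulr_sumr; apply: eq_bigr => j _.
by rewrite [LHS](@RintegralZl _ _ _ leb T _ _ mT (pi_ i j)) mxE mulrAC mulrA.
Qed.

Definition limit_variance (u : 'cV[R]_d) : R := dot u (invmx (J th0) *m u).

Lemma limit_variance_ge0 u : 0 <= limit_variance u.
Proof.
have [_ sJ h] := cJ D0; have uJ := coercive_unitmx (cJ D0).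
have := h (invmx (J th0) *m u); rewrite -mulmxA mulKVmx// => h'.
rewrite /limit_variance dotE; apply: le_trans (le_trans h' _).
  by rewrite mulr_ge0 ?(ltW c0)//; apply: sumr_ge0 => i _; exact: sqr_ge0.
by rewrite trmx_mul trmx_inv sJ mulmxA.
Qed.

Let direction th u : 'cV[R]_d := invmx (J th) *m u.

Let direction_le th u : `|th - th0| < rho -> `|direction th u| <= a * `|u|.
Proof. by move=> thr; exact: norm_invmx_le (cJ (Dth thr)). Qed.

Let dot_fluctuation N k th u w : `|th - th0| < rho ->
  dot u (invmx (J th) *m fluctuation N k th w) =
  \sum_i direction th u i ord0 * noise T X (lam th0) (score lam ^~ th) N k w i.
Proof.
move=> thr; have [_ sJ _] := cJ (Dth thr).
by rewrite dot_mulmx trmx_inv sJ; apply: eq_bigr => i _; rewrite !mxE.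
Qed.

Let score_comb th u t : `|th - th0| < rho -> T t ->
  `|\sum_i direction th u i ord0 * score lam i th t| <= C * d%:R * a * `|u|.
Proof.
move=> thr Tt; have [_ _ /(_ th thr)[_ sb _ _ _]] := lb.
apply: le_trans (ler_norm_sum _ _ _) _.
apply: (@le_trans _ _ (\sum_i C * `|direction th u i ord0|)).
  by apply: ler_sum => i _; rewrite normrM mulrC ler_wpM2r// sb.
rewrite -mulr_sumr -[leRHS]mulrA -[leRHS]mulrA; apply: ler_wpM2l => //.
apply: le_trans (sum_coord_le _) _; apply: ler_wpM2l => //.
exact: direction_le.
Qed.

Let alg1 (z u : R) : d%:R * (a * u) * (2 * C * z * d%:R * (a * u)) +
  d%:R * u * (a * (C * z * d%:R * (a * u))) = L * u ^+ 2 * z.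
Proof. by rewrite /L; ring. Qed.

Let alg3 (x : R) : K * x = d%:R * a * x + L * x * rho.
Proof. by rewrite /K; ring. Qed.

Let alg2 (p q s z : R) : `|p - s| <= C * z -> `|q - s| <= C * z -> `|p - q| <= 2 * C * z.
Proof.
move=> h1 h2; have -> : p - q = (p - s) - (q - s) by ring.
by apply: le_trans (ler_normB _ _) _; rewrite -mulrA mulr_natl mulr2n lerD.
Qed.

(** The deviation from the limit variance splits into v^T (G - J(th)) v, with v = J(th)^-1 u, and
    u^T (J(th)^-1 - J(th0)^-1) u. They contribute 2 and 1 to the factor 3 in [L]. *)
Let variance_bounds th u : `|th - th0| < rho ->
  let Q := \int[leb]_(t in T) ((\sum_i direction th u i ord0 * score lam i th t) ^+ 2 * lam th0 t) in
  `|Q - limit_variance u| <= L * `|u| ^+ 2 * `|th - th0| /\ 0 <= Q <= K * `|u| ^+ 2.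
Proof.
move=> thr Q; have [_ _ hG hJ _] := li thr.
have Q0 : 0 <= Q.
  apply: Rintegral_ge0 => t Tt; rewrite mulr_ge0 ?sqr_ge0//.
  by have [h _ _] := lamT D0; exact/ltW/h.
set z := `|th - th0| in hG hJ *; have z0 : 0 <= z := normr_ge0 _.
have uJ := coercive_unitmx (cJ (Dth thr)).
set v := direction th u in Q Q0 *; have va : `|v| <= a * `|u| := direction_le _ thr.
have h1 : `|Q - limit_variance u| <= L * `|u| ^+ 2 * z.
  have -> : Q - limit_variance u = dot v ((G th - J th) *m v) +
      dot u (direction th u - direction th0 u).
    rewrite /Q quadratic_integral// mulmxBl dotBr dotBr -/v /limit_variance -/(direction th0 u).
    have -> : dot v (J th *m v) = dot u v.
      rewrite /v /direction mulKVmx//.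
      by rewrite /dot; apply: eq_bigr => i _; rewrite mulrC.
    by rewrite addrA subrK.
  rewrite -alg1; apply: le_trans (ler_normD _ _) _; apply: lerD.
    apply: le_trans (norm_dot_le _ _) _; apply: ler_pM; [by apply: mulr_ge0|exact: normr_ge0|exact: ler_wpM2l|].
    apply: le_trans (norm_mulmx_le (B := 2 * C * z) _ _ _) _.
    - by rewrite !mulr_ge0.
    - move=> i j; have h1 := hG i j; have h2 := hJ i j.
      rewrite !mxE; move: h1 h2; exact: alg2.
    by rewrite ler_wpM2l// !mulr_ge0.
  apply: le_trans (norm_dot_le _ _) _; rewrite ler_wpM2l ?mulr_ge0//.
  apply: (norm_invmx_dist u (cJ (Dth thr)) (cJ D0) _ hJ).
  exact: mulr_ge0.
split => //; rewrite Q0/=.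
have h2 : limit_variance u <= d%:R * a * `|u| ^+ 2.
  apply: le_trans (ler_norm _) _; apply: le_trans (norm_dot_le _ _) _.
  rewrite expr2 [leRHS]mulrACA; apply: ler_wpM2l; first exact: mulr_ge0.
  exact: norm_invmx_le (cJ D0).
have h3 : L * `|u| ^+ 2 * z <= L * `|u| ^+ 2 * rho.
  by apply: ler_wpM2l; [apply: mulr_ge0 => //; exact: sqr_ge0|exact: ltW].
rewrite alg3; apply: le_trans (lerD h2 h3).
by move: h1; rewrite ler_norml => /andP[_ h1]; rewrite -lerBlDl.
Qed.

Variables N k : nat.
Hypotheses (Nk : (N <= k)%N) (k0 : (0 < k)%N).

Lemma fluctuation_moment_cf th u : `|th - th0| < rho ->
  \int[P]_w (1 - cos (dot u (invmx (J th) *m fluctuation N k th w))) <=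
  K * `|u| ^+ 2 + 4 * (K * `|u| ^+ 2) ^+ 2.
Proof.
move=> thr; have [w1 _ _ _ _] := li thr; have [_ /andP[Q0 QK]] := variance_bounds u thr.
under eq_Rintegral do rewrite dot_fluctuation//.
apply: le_trans (noise_moment_cf oT (lamT D0) cX PX iX
  (fun i => measurable_score openTheta lamT bd i (Dth thr)) (fun i => (w1 i).1)
  Nk k0 (fun t => @score_comb th u t thr)) _.
apply: lerD => //; apply: ler_wpM2l => //; apply: lerXn2r => //.
by rewrite nnegrE mulr_ge0 ?sqr_ge0.
Qed.

Let scale (u : 'cV[R]_d) : R := C * d%:R * a * `|u|.

Lemma fluctuation_cf th u e : `|th - th0| < rho ->
  `|\int[P]_w cos (dot u (invmx (J th) *m fluctuation N k th w) + e) -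
    expR (- (limit_variance u / 2)) * cos e| <=
  L * `|u| ^+ 2 * `|th - th0| + K * `|u| ^+ 2 * (N%:R / k%:R) +
  (scale u ^+ 2 + scale u) * (K * `|u| ^+ 2) / Num.sqrt k%:R.
Proof.
move=> thr; have [w1 _ _ _ _] := li thr; have [Qs /andP[Q0 QK]] := variance_bounds u thr.
under eq_Rintegral do rewrite dot_fluctuation//.
have B0 : 0 <= scale u by apply: mulr_ge0 => //; apply: mulr_ge0 => //; exact: mulr_ge0.
apply: le_trans (noise_cf_approximation oT (lamT D0) cX PX iX
  (fun i => measurable_score openTheta lamT bd i (Dth thr)) (fun i => (w1 i).1)
  Nk k0 B0 (fun t => @score_comb th u t thr) e (limit_variance_ge0 u)) _.
apply: lerD; first (apply: lerD => //).
  by apply: ler_wpM2r => //; exact: divr_ge0.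
rewrite -mulrDl; apply: ler_wpM2r; first by rewrite invr_ge0 sqrtr_ge0.
by apply: ler_wpM2l => //; apply: addr_ge0 => //; exact: sqr_ge0.
Qed.

Section RandomParameter.
Variables (th : Omega -> 'cV[R]_d) (r : R).
Hypothesis thr : forall w, `|th w - th0| <= r.
Hypothesis rrho : r < rho.
Let past := block T X `I_N.
Let future := block T X [set j | (N <= j)%N].
Hypothesis mth : forall i,
  measurable_fun [set: g_sigma_algebraType past] (fun w => th w i ord0).

Let near_th w : `|th w - th0| < rho. Proof. exact: le_lt_trans (thr w) rrho. Qed.

Definition fluctuation_at (w w' : Omega) : 'cV[R]_d :=
  invmx (J (th w)) *m fluctuation N k (th w) w'.

(** The parameter reads only the first component and the summed paths only the second, so
    measurability holds on the product of the two block sigma-algebras, as Fubini requires. *)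
Let measurable_joint i : measurable_fun
  [set: (g_sigma_algebraType past * g_sigma_algebraType future)%type]
  (fun z => fluctuation_at z.1 z.2 i ord0).
Proof.
pose A := (g_sigma_algebraType past * g_sigma_algebraType future)%type.
pose th1 (z : A) : 'cV[R]_d := th z.1.
have Dth1 z : Theta (th1 z) := Dth (near_th z.1).
have mth1 j : measurable_fun [set: A] (fun z => th1 z j ord0).
  exact: (measurableT_comp (mth j) measurable_fst).
have cX2 j : (N <= j)%N -> counting_process T (fun z : A => X j z.2).
  move=> Nj; have [pX mX] := counting_process_block (U := [set j | (N <= j)%N]) cX Nj.
  by split => [z|t Tt]; [exact: pX|exact: (measurableT_comp (mX t Tt) measurable_snd)].
rewrite (_ : (fun z => _) = (fun z : A => \sum_l invmx (J (th1 z)) i l *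
   ((Num.sqrt k%:R)^-1 * \sum_(N <= j < k)
     (\int[lsm (X j z.2)]_(t in T) score lam l (th1 z) t -
      \int[leb]_(t in T) (score lam l (th1 z) t * lam th0 t))))); last first.
  by apply/funext => z; rewrite mxE; apply: eq_bigr => l _; rewrite mxE.
apply: measurable_sum => l; apply: measurable_funM.
  exact: (measurable_inverse_information oT openTheta lamT bd Dth1 mth1 fin JE cJ).
apply: measurable_funM; first exact: measurable_cst.
apply: measurable_sum_nat => j /andP[Nj _]; apply: measurable_funB.
  exact: (measurable_score_path oT openTheta lamT bd Dth1 mth1 l (cX2 j Nj)).
exact: (measurable_score_drift oT openTheta lamT bd Dth1 mth1 l D0).
Qed.

Let idp (w : Omega) : g_sigma_algebraType past := w.
Let idf (w : Omega) : g_sigma_algebraType future := w.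

Let midp : measurable_fun setT idp. Proof. exact: measurable_block_id. Qed.
Let midf : measurable_fun setT idf. Proof. exact: measurable_block_id. Qed.

Let independence (A1 : set (g_sigma_algebraType past)) (A2 : set (g_sigma_algebraType future)) :
  measurable A1 -> measurable A2 ->
  P (idp @^-1` A1 `&` idf @^-1` A2) = (P (idp @^-1` A1) * P (idf @^-1` A2))%E.
Proof.
move=> m1 m2; apply: (@block_indep _ _ _ P T X cX iX `I_N [set j | (N <= j)%N] A1 A2 _ m1 m2).
by apply/seteqP; split => // j [/= h1 h2]; move: h1; rewrite ltnNge h2.
Qed.

(** A bound valid for every fixed parameter within [r] of [th0] transfers to the random parameter,
    which is confined to that ball and independent of the future block. *)
Let average (psi : 'cV[R]_d -> R) (M m e : R) :
  measurable_fun [set: (g_sigma_algebraType past * g_sigma_algebraType future)%type]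
    (fun z => psi (fluctuation_at z.1 z.2)) ->
  (forall x, `|psi x| <= M) ->
  (forall x : 'cV[R]_d, `|x - th0| <= r ->
    `|\int[P]_w psi (invmx (J x) *m fluctuation N k x w) - m| <= e) ->
  `|\int[P]_w psi (fluctuation_at w w) - m| <= e.
Proof.
move=> mpsi psiM h.
exact: (@indep_Rintegral_dist _ _ _ _ _ _ _ P idp idf midp midf independence
  (fun z => psi (fluctuation_at z.1 z.2)) M mpsi (fun z => psiM _) m e
  (fun w => h (th w) (thr w))).
Qed.

Lemma measurable_fluctuation_at i :
  measurable_fun setT (fun w => fluctuation_at w w i ord0).
Proof.
have mp : measurable_fun setT (fun w : Omega =>
    ((w : g_sigma_algebraType past), (w : g_sigma_algebraType future))).
  by apply: measurable_fun_pair; exact: measurable_block_id.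
exact: (measurableT_comp (measurable_joint i) mp).
Qed.

Lemma fluctuation_at_cf u e :
  `|\int[P]_w cos (dot u (fluctuation_at w w) + e) -
    expR (- (limit_variance u / 2)) * cos e| <=
  L * `|u| ^+ 2 * r + K * `|u| ^+ 2 * (N%:R / k%:R) +
  (scale u ^+ 2 + scale u) * (K * `|u| ^+ 2) / Num.sqrt k%:R.
Proof.
apply: (@average (fun x => cos (dot u x + e)) 1).
- by apply: measurable_cos_comp; exact: measurable_dot.
- by move=> x; exact: cos_max.
move=> x xr; apply: le_trans (fluctuation_cf u e (le_lt_trans xr rrho)) _.
by rewrite !lerD2r; apply: ler_wpM2l => //; apply: mulr_ge0 => //; exact: sqr_ge0.
Qed.

(** The moment estimate along multiples of a basis vector gives a second moment of at most 2 K, and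
    Chebyshev's inequality concludes with a bound free of N and k. *)
Lemma fluctuation_at_tail i (eta : R) : 0 < eta ->
  (P [set w | (eta < `|fluctuation_at w w i ord0|)%R] <= (2 * K / eta ^+ 2)%:E)%E.
Proof.
move=> eta0; apply: chebyshev_second_moment => //; first exact: measurable_fluctuation_at.
apply: (second_moment_cf (C := 4 * K ^+ 2)) => //; first exact: measurable_fluctuation_at.
  by rewrite mulr_ge0// sqr_ge0.
move=> s; pose u : 'cV[R]_d := s *: delta_mx i ord0.
have dotu (x : 'cV[R]_d) : s * x i ord0 = dot u x.
  rewrite /dot (bigD1 i)//= big1 ?addr0 ?mxE ?eqxx ?mulr1// => j ji.
  by rewrite !mxE (negbTE ji) mulr0 mul0r.
have us : `|u| ^+ 2 <= s ^+ 2.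
  rewrite -[leRHS](real_normK (num_real s)) lerXn2r ?nnegrE//.
  apply: norm_cV_le => // j; rewrite !mxE normrM; case: (_ && _); rewrite ?normr0 ?mulr0// normr1 mulr1//.
rewrite (_ : (fun w => _) = (fun w => 1 - cos (dot u (fluctuation_at w w)))); last first.
  by apply/funext => w; rewrite dotu.
have int1 th' w : `|(1 : R) - cos (dot u (invmx (J th') *m fluctuation N k th' w))| <= 2.
  by have := cos_max (dot u (invmx (J th') *m fluctuation N k th' w)); rewrite !ler_norml; lra.
apply: le_trans (ler_norm _) _; rewrite -[X in `|X|]subr0.
apply: (@average (fun x => 1 - cos (dot u x)) 2).
- apply: measurable_funB => //.
  rewrite (_ : (fun z => _) = fun z => cos (dot u (fluctuation_at z.1 z.2) + 0)).
    by apply: measurable_cos_comp; exact: measurable_dot.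
  by apply/funext => z; rewrite addr0.
- by move=> x; have := cos_max (dot u x); rewrite !ler_norml; lra.
move=> x xr; rewrite subr0 ger0_norm; last first.
  by apply: Rintegral_ge0 => w _; rewrite subr_ge0 cos_le1.
apply: le_trans (fluctuation_moment_cf u (le_lt_trans xr rrho)) _.
move: us; set p := `|u| ^+ 2; set q := s ^+ 2 => us.
have -> : s ^+ 4 = q ^+ 2 by rewrite /q -exprM.
have p0 : 0 <= p by rewrite /p sqr_ge0.
apply: lerD; first by rewrite mulrC ler_wpM2r.
by rewrite exprMn mulrA ler_wpM2l ?mulr_ge0 ?sqr_ge0// lerXn2r ?nnegrE// (le_trans p0).
Qed.

End RandomParameter.

End UniformBounds.

(** * The one-step estimator *)

Section Enorm.
Context {R : realType} {d : nat}.
Implicit Types x y : 'cV[R]_d.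

Lemma norm_le_enorm x : `|x| <= enorm x.
Proof.
rewrite -[leLHS]ger0_norm// -sqrtr_sqr /enorm ler_sqrt; first exact: norm_cV_sqr.
by apply: sumr_ge0 => i _; exact: sqr_ge0.
Qed.

Lemma coordB_norm_le x y i : `|x i ord0 - y i ord0| <= `|x - y|.
Proof. by have := coord_norm_le (x - y) i; rewrite !mxE. Qed.

Lemma enorm_le x (e : R) : 0 <= e -> (forall i, `|x i ord0| <= e) ->
  enorm x <= d.+1%:R * e.
Proof.
move=> e0 xe; rewrite -[leRHS]ger0_norm ?mulr_ge0// -sqrtr_sqr /enorm ler_sqrt ?sqr_ge0//.
apply: (@le_trans _ _ (\sum_(i < d) e ^+ 2)).
  by apply: ler_sum => i _; rewrite -(real_normK (num_real _)) lerXn2r ?nnegrE.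
rewrite sumr_const card_ord -[leLHS]mulr_natl exprMn ler_wpM2r ?sqr_ge0//.
by rewrite -natrX ler_nat (leq_trans (leqnSn d))// leq_pmulr.
Qed.

Lemma measurable_enorm {dA} {A : measurableType dA} (W : A -> 'cV[R]_d) :
  (forall i, measurable_fun setT (fun w => W w i ord0)) ->
  measurable_fun setT (fun w => enorm (W w)).
Proof.
move=> mW; apply: (measurableT_comp (continuous_measurable_fun (@sqrt_continuous R))).
by apply: measurable_sum => i; exact: measurable_funX.
Qed.

End Enorm.

Section UnionBound.
Context {R : realType} {dO : measure_display} {Omega : measurableType dO}.
Variable P : probability Omega R.

Lemma union_bound (d : nat) (A : 'I_d -> set Omega) (p : R) :
  (forall i, measurable (A i)) -> (forall i, (P (A i) <= p%:E)%E) ->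
  (P [set w | exists i, A i w] <= (d%:R * p)%:E)%E.
Proof.
move=> mA Ap.
rewrite (_ : [set w | _] = \big[setU/set0]_(i <- enum 'I_d) A i); last first.
  rewrite -bigcup_seq; apply/seteqP; split => w /= => [[i Aiw]|[i _ Aiw]]; exists i => //.
  by rewrite /= mem_enum.
rewrite -[X in (X%:R * p)%R]card_ord cardE.
elim: (enum 'I_d) => [|i s IH]; first by rewrite big_nil measure0 mul0r.
have mU : measurable (\big[setU/set0]_(j <- s) A j) by apply: bigsetU_measurable.
rewrite big_cons; apply: le_trans (measureU2 _ (mA i) mU) _.
by rewrite /= -natr1 mulrDl mul1r addrC EFinD leeD.
Qed.

Lemma measurable_lt_norm (f : Omega -> R) (e : R) : measurable_fun setT f ->
  measurable [set w | e < `|f w|].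
Proof.
move=> mf; have := @measurableT_comp _ _ _ _ _ _ _ _ _ (@normr_measurable R setT) mf.
move=> /(_ measurableT `]e, +oo[%classic (measurable_itv _)).
by rewrite setTI; congr (measurable _); apply/seteqP; split => w /=; rewrite in_itv/= andbT.
Qed.

Lemma Rintegral_dist_event (f g : Omega -> R) (M e p : R) (A : set Omega) :
  measurable_fun setT f -> measurable_fun setT g -> measurable A ->
  (forall w, `|f w| <= M) -> (forall w, `|g w| <= M) -> 0 <= M -> 0 <= e ->
  (forall w, ~ A w -> `|f w - g w| <= e) -> (P A <= p%:E)%E ->
  `|\int[P]_w f w - \int[P]_w g w| <= 2 * M * p + e.
Proof.
move=> mf mg mA fM gM M0 e0 fg Ap.
pose h w := 2 * M * \1_A w + e.
have mI : measurable_fun setT (fun w => \1_A w : R) by exact: measurable_indic.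
have mh : measurable_fun setT h.
  by apply: measurable_funD => //; apply: measurable_funM.
have hM w : `|h w| <= 2 * M + e.
  rewrite ger0_norm ?addr_ge0 ?mulr_ge0// lerD2r indicE.
  by case: (_ \in _); rewrite ?mulr1 ?mulr0 ?mulr_ge0.
have h1 : `|\int[P]_w f w - \int[P]_w g w| <= \int[P]_w h w.
  apply: (@Rintegral_le_gen _ _ _ P f g (2 * M + e) h) => //.
  - by move=> w; apply: le_trans (fM w) _; lra.
  - by move=> w; apply: le_trans (gM w) _; lra.
  move=> w; rewrite /h indicE; have [Aw|Aw] := pselect (A w).
    rewrite mem_set// mulr1; apply: le_trans (ler_normB _ _) _.
    by have := fM w; have := gM w; lra.
  by rewrite memNset// mulr0 add0r; exact: fg.
apply: le_trans h1 _.
have i1 : P.-integrable setT (EFin \o (fun w => \1_A w : R)).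
  apply: (@bounded_integrable _ _ _ P _ 1) => // w.
  by rewrite indicE; case: (_ \in _); rewrite ?normr0 ?normr1.
have i2 : P.-integrable setT (EFin \o (fun w => 2 * M * \1_A w)).
  exact: (@integrableZ_real _ _ _ P setT measurableT _ (2 * M) i1).
have i3 : P.-integrable setT (EFin \o (fun _ : Omega => e)).
  by apply: (@bounded_integrable _ _ _ P _ `|e|).
rewrite [leLHS](@RintegralD _ _ _ P setT _ _ measurableT i2 i3) probability_Rintegral_cst.
rewrite lerD2r [leLHS](@RintegralZl _ _ _ P setT _ (2 * M) measurableT i1).
rewrite ler_wpM2l ?mulr_ge0// /Rintegral integral_indic// setIT.
by rewrite -lee_fin fineK// fin_num_measure.
Qed.

End UnionBound.

Section OneStep.
Context {R : realType} {d : nat} {dO : measure_display} {Omega : measurableType dO}.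
Variables (T : set R) (Theta : set 'cV[R]_d) (lam : 'cV[R]_d -> R -> R).
Hypothesis oT : observation_interval T.
Hypothesis openTheta : open Theta.
Hypothesis lamT : forall th, Theta th -> intensity T (lam th).
Hypothesis bd : bounded_derivatives 3 Theta T (ell lam).
Hypothesis fin : finite_integrals T lam Theta.
Variables (J : 'cV[R]_d -> 'M[R]_d) (c : R).
Hypothesis JE : is_information T Theta lam J.
Hypothesis cJ : forall x, Theta x -> coercive c (J x).
Variables (th0 : 'cV[R]_d) (rho C : R).
Hypothesis lb : local_bounds T Theta lam th0 rho C.
Hypothesis li : local_integrals T lam J th0 rho C.
Variables (P : probability Omega R) (X : nat -> Omega -> cumulative R R).
Hypothesis cX : forall j, counting_process T (X j).
Hypothesis PX : forall j, poisson_process P T (lam th0) (X j).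
Hypothesis iX : mutually_independent P (fun j => sigma_process T (X j)).
Notation leb := lebesgue_measure.

Let D0 : Theta th0. Proof. by have [_ _ /(_ th0)[]] := lb; rewrite ?subrr ?normr0; have [] := lb. Qed.
Let c0 : 0 < c. Proof. by have [] := cJ D0. Qed.
Let C0 : 0 <= C. Proof. by have [] := lb. Qed.
Let a : R := d%:R / c.
Let a0 : 0 <= a. Proof. by rewrite divr_ge0// ltW. Qed.

Notation fluctuation := (fluctuation T lam th0 X).

(** The one-step estimate as a function of a deterministic parameter, with [J] for the
    information. *)
Definition step N k (th : 'cV[R]_d) (w : Omega) : 'cV[R]_d :=
  th + invmx (J th) *m (k%:R^-1 *: \sum_(N <= j < k) centered_score T lam th (X j w)).

Let step_algebra (A M : 'M[R]_d) (b F r : 'cV[R]_d) (s n m : R) : s != 0 ->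
  n + m = s ^+ 2 -> A *m (M *m b) = b ->
  s *: (b + A *m ((s ^+ 2)^-1 *: (s *: F + n *: (r - M *m b)))) =
  A *m F + ((m / s) *: b + (n / s) *: (A *m r)).
Proof.
move=> s0 nm AM; rewrite -scalemxAr mulmxDr -!scalemxAr mulmxBr AM scalerBr.
rewrite !scalerDr !scalerA; apply/matrixP => i j; rewrite !mxE.
have -> : m = s ^+ 2 - n by rewrite -nm addrAC subrr add0r.
move: ((A *m F) i j) ((A *m r) i j) (b i j) => p q z; by field.
Qed.

(** With b = th - th0, the k - N scores have total drift (k - N)(r - J b), where r is of second
    order. After division by k the correction removes only the fraction (k - N)/k of b; the rest, N
    b / k, times sqrt k is the first part of the bound. *)
Lemma step_expansion N k th w : (N <= k)%N -> (0 < k)%N -> `|th - th0| < rho ->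
  exists2 rem : 'cV[R]_d,
    Num.sqrt k%:R *: (step N k th w - th0) = invmx (J th) *m fluctuation N k th w + rem &
    `|rem| <= N%:R / Num.sqrt k%:R * `|th - th0| +
      Num.sqrt k%:R * (a * (C * `|th - th0| ^+ 2)).
Proof.
move=> Nk k0 thr; have [_ _ _ _ hr] := li thr.
have Dth : Theta th by have [_ _ /(_ th thr)[]] := lb.
set s := Num.sqrt k%:R; have s0 : 0 < s by rewrite sqrtr_gt0 ltr0n.
have s2 : s ^+ 2 = k%:R by rewrite sqr_sqrtr.
pose n : R := (k - N)%:R; pose b := th - th0.
pose Dl : 'cV[R]_d := \col_i (\int[leb]_(t in T) (score lam i th t * lam th0 t) -
  \int[leb]_(t in T) (score lam i th t * lam th t)).
(* The part of the drift beyond its linear term, of second order by the last clause of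
   [local_integrals]. *)
pose r := Dl + J th *m b.
have rC : `|r| <= C * `|b| ^+ 2.
  apply: norm_cV_le; first by rewrite mulr_ge0// sqr_ge0.
  move=> i; have := hr i; rewrite -/b => h.
  by rewrite [r i ord0]mxE [Dl i ord0]mxE.
have nm : n + N%:R = s ^+ 2 by rewrite s2 /n natrB// subrK.
have sumE : \sum_(N <= j < k) centered_score T lam th (X j w) =
    s *: fluctuation N k th w + n *: (r - J th *m b).
  rewrite /r addrK; apply/matrixP => i l; rewrite (ord1 l) summxE !mxE /noise -/s.
  rewrite mulrA divff ?gt_eqF// mul1r.
  rewrite (_ : n * _ = \sum_(N <= j < k) Dl i ord0); last first.
    by rewrite sumr_const_nat mxE mulr_natl.
  rewrite -big_split/=; apply: eq_bigr => j _; rewrite !mxE addrA subrK.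
  congr (_ - _); first by apply: eq_Rintegral => t _; rewrite dellE.
  by apply: eq_Rintegral => t _; rewrite dellE.
exists ((N%:R / s) *: b + (n / s) *: (invmx (J th) *m r)).
  have s0' : s != 0 by rewrite gt_eqF.
  rewrite -(@step_algebra _ (J th) _ _ _ s n N%:R s0' nm); last first.
    by rewrite mulKmx// (coercive_unitmx (cJ Dth)).
  rewrite -sumE s2 /step; congr (_ *: _).
  by rewrite /b addrAC.
apply: le_trans (ler_normD _ _) _; apply: lerD.
  by rewrite normrZ ger0_norm// divr_ge0// ltW.
rewrite normrZ; apply: ler_pM => //.
  rewrite ger0_norm ?divr_ge0 ?(ltW s0)// ler_pdivrMr// -expr2 s2 ler_nat.
  exact: leq_subr.
apply: le_trans (norm_invmx_le _ (cJ Dth)) _.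
exact: ler_wpM2l.
Qed.

Let L : R := 3 * C * d%:R ^+ 2 * a ^+ 2.
Let scale (u : 'cV[R]_d) : R := C * d%:R * a * `|u|.

Definition tail_constant : R := d%:R * a + L * rho.

(** The sum of the three coefficients in the error bound for the fluctuation, so that a single
    constant multiplies the sum of the rates. *)
Definition cf_constant (u : 'cV[R]_d) : R := L * `|u| ^+ 2 + tail_constant * `|u| ^+ 2 +
  (scale u ^+ 2 + scale u) * (tail_constant * `|u| ^+ 2).

Let L0 : 0 <= L.
Proof. by apply: mulr_ge0; [apply: mulr_ge0; [exact: mulr_ge0|exact: sqr_ge0]|exact: sqr_ge0]. Qed.

Lemma tail_constant_ge0 : 0 <= tail_constant.
Proof. by apply: addr_ge0; apply: mulr_ge0 => //; have [/ltW] := lb. Qed.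

Let cf_terms u : [/\ 0 <= L * `|u| ^+ 2, 0 <= tail_constant * `|u| ^+ 2 &
  0 <= (scale u ^+ 2 + scale u) * (tail_constant * `|u| ^+ 2)].
Proof.
have u2 : 0 <= `|u| ^+ 2 := sqr_ge0 _.
have t0 : 0 <= tail_constant * `|u| ^+ 2 by rewrite mulr_ge0 ?tail_constant_ge0.
have s0 : 0 <= scale u by apply: mulr_ge0 => //; apply: mulr_ge0 => //; exact: mulr_ge0.
by split => //; apply: mulr_ge0 => //; apply: addr_ge0 => //; exact: sqr_ge0.
Qed.

Lemma cf_constant_ge0 u : 0 <= cf_constant u.
Proof. by have [p q t] := cf_terms u; rewrite /cf_constant !addr_ge0. Qed.

Let alg2 (x1 x2 x3 r1 r2 r3 : R) : 0 <= x1 -> 0 <= x2 -> 0 <= x3 ->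
  0 <= r1 -> 0 <= r2 -> 0 <= r3 ->
  x1 * r1 + x2 * r2 + x3 * r3 <= (x1 + x2 + x3) * (r1 + r2 + r3).
Proof.
move=> x10 x20 x30 r10 r20 r30.
have h (x r : R) : 0 <= x -> 0 <= r -> 0 <= x * r by exact: mulr_ge0.
have := h _ _ x10 r20; have := h _ _ x10 r30; have := h _ _ x20 r10.
have := h _ _ x20 r30; have := h _ _ x30 r10; have := h _ _ x30 r20.
by move=> *; rewrite !mulrDl !mulrDr; lra.
Qed.

Section Estimator.
Variable thN : Omega -> 'cV[R]_d.
Hypothesis DthN : forall w, Theta (thN w).

Lemma measurable_step N k i :
  (forall i, measurable_fun setT (fun w => thN w i ord0)) ->
  measurable_fun setT (fun w => step N k (thN w) w i ord0).
Proof.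
move=> mth; rewrite (_ : (fun w => _) = (fun w => thN w i ord0 +
   \sum_l invmx (J (thN w)) i l * (k%:R^-1 * \sum_(N <= j < k)
     (\int[lsm (X j w)]_(t in T) score lam l (thN w) t -
      \int[leb]_(t in T) (score lam l (thN w) t * lam (thN w) t))))); last first.
  apply/funext => w; rewrite !mxE; congr (_ + _); apply: eq_bigr => l _; rewrite mxE summxE.
  congr (_ * (_ * _)); apply: eq_bigr => j _; rewrite mxE; congr (_ - _).
    by apply: eq_Rintegral => t _; rewrite dellE.
  by apply: eq_Rintegral => t _; rewrite dellE.
apply: measurable_funD => //; apply: measurable_sum => l; apply: measurable_funM.
  exact: (measurable_inverse_information oT openTheta lamT bd DthN mth fin JE cJ).
apply: measurable_funM => //; apply: measurable_sum => j; apply: measurable_funB.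
  exact: (measurable_score_path oT openTheta lamT bd DthN mth l (cX j)).
exact: (measurable_score_compensator oT openTheta lamT bd DthN mth l).
Qed.

Variables (N k : nat) (M : R).
Hypotheses (N0 : (0 < N)%N) (Nk : (N <= k)%N) (M0 : 0 <= M).
Hypothesis Mrho : M / Num.sqrt N%:R < rho.
Hypothesis mth : forall i,
  measurable_fun [set: g_sigma_algebraType (block T X `I_N)] (fun w => thN w i ord0).

Let k0 : (0 < k)%N. Proof. exact: leq_trans N0 Nk. Qed.
Let N0' : 0 < Num.sqrt (N%:R : R). Proof. by rewrite sqrtr_gt0 ltr0n. Qed.
Let k0' : 0 < Num.sqrt (k%:R : R). Proof. by rewrite sqrtr_gt0 ltr0n. Qed.
Let r : R := M / Num.sqrt N%:R.

Let far : set Omega := [set w | (M < enorm (Num.sqrt N%:R *: (thN w - th0)))%R].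

(* Truncation makes the plug-in parameter deterministically close to [th0]. *)
Let near_th (w : Omega) : 'cV[R]_d :=
  if M < enorm (Num.sqrt N%:R *: (thN w - th0)) then th0 else thN w.

Let near_le w : `|near_th w - th0| <= r.
Proof.
rewrite /near_th; case: ifPn => [_|]; first by rewrite subrr normr0 divr_ge0// ltW.
rewrite -leNgt => h; rewrite ler_pdivlMr// mulrC -[Num.sqrt _](ger0_norm (ltW N0')) -normrZ.
exact: le_trans (norm_le_enorm _) h.
Qed.

Let measurable_dist {dA} {A : measurableType dA} (W : A -> 'cV[R]_d) :
  (forall i, measurable_fun setT (fun w => W w i ord0)) ->
  measurable_fun setT (fun w => enorm (Num.sqrt N%:R *: (W w - th0))).
Proof.
move=> mW; apply: measurable_enorm => i.
rewrite (_ : (fun w => _) = fun w => Num.sqrt N%:R * (W w i ord0 - th0 i ord0)).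
  by apply: measurable_funM => //; apply: measurable_funB.
by apply/funext => w; rewrite !mxE.
Qed.

Let measurable_near i :
  measurable_fun [set: g_sigma_algebraType (block T X `I_N)] (fun w => near_th w i ord0).
Proof.
rewrite (_ : (fun w => _) = fun w : g_sigma_algebraType (block T X `I_N) =>
   if M < enorm (Num.sqrt N%:R *: (thN w - th0)) then th0 i ord0 else thN w i ord0).
  apply: measurable_fun_ifT => //; apply: measurable_fun_ltr => //.
  exact: (measurable_dist mth).
by apply/funext => w; rewrite /near_th; case: ifP.
Qed.

Let mthN i : measurable_fun setT (fun w => thN w i ord0).
Proof. move=> _ B mB; have := mth i measurableT mB; rewrite !setTI => h.
exact: (block_measurable cX h). Qed.

Let measurable_far : measurable far.
Proof.
have := measurable_dist mthN measurableT (measurable_itv `]M, +oo[).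
by rewrite setTI; congr (measurable _); apply/seteqP; split => w /=; rewrite in_itv/= andbT.
Qed.

Let Y (w : Omega) : 'cV[R]_d := Num.sqrt k%:R *: (step N k (thN w) w - th0).
Let F (w : Omega) : 'cV[R]_d := fluctuation_at T lam J th0 X N k near_th w w.
(** The remainder bound of [step_expansion] evaluated at distance M / sqrt N from [th0]. *)
Let e : R := M * (Num.sqrt N%:R / Num.sqrt k%:R) +
  a * C * M ^+ 2 * (Num.sqrt k%:R / N%:R).

Let e0 : 0 <= e.
Proof. by rewrite addr_ge0// !mulr_ge0// ?sqr_ge0// ?invr_ge0 ?(ltW k0')// ltW. Qed.

Let alg1 (n s m q : R) : 0 < n -> 0 < s ->
  n ^+ 2 / s * (m / n) + s * (q * (C * (m / n) ^+ 2)) =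
  m * (n / s) + q * C * m ^+ 2 * (s / n ^+ 2).
Proof. by move=> n0 s0; field; rewrite !gt_eqF. Qed.

Let close w : ~ far w -> `|Y w - F w| <= e.
Proof.
move=> /negP nfar; have thE : near_th w = thN w by rewrite /near_th (negbTE nfar).
have h := near_le w; rewrite thE in h.
have [rem remE remle] := step_expansion w Nk k0 (le_lt_trans h Mrho).
rewrite /Y remE /F /fluctuation_at thE addrAC subrr add0r; apply: le_trans remle _.
have N2 : N%:R = Num.sqrt N%:R ^+ 2 :> R by rewrite sqr_sqrtr.
rewrite /e [X in _ <= _ + _ * (_ / X)]N2 -(alg1 _ _ N0' k0') -N2; apply: lerD.
  by apply: ler_wpM2l => //; rewrite divr_ge0// ltW.
apply: ler_wpM2l; first exact: ltW.
do 2 (apply: ler_wpM2l => //); apply: lerXn2r => //; rewrite nnegrE//.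
by rewrite divr_ge0// ltW.
Qed.

Let mY i : measurable_fun setT (fun w => Y w i ord0).
Proof.
rewrite (_ : (fun w => _) = fun w => Num.sqrt k%:R * (step N k (thN w) w i ord0 - th0 i ord0)).
  by apply: measurable_funM => //; apply: measurable_funB => //; exact: measurable_step mthN.
by apply/funext => w; rewrite !mxE.
Qed.

Let mF i : measurable_fun setT (fun w => F w i ord0).
Proof.
exact: (measurable_fluctuation_at oT openTheta lamT bd fin JE cJ lb cX k near_le Mrho measurable_near).
Qed.

Variable eta : R.
Hypothesis far_le : (P far <= eta%:E)%E.

Lemma step_cf_bound u z :
  `|\int[P]_w cos (dot u (Y w) + z) - \int[P]_w cos (dot u (F w) + z)| <=
  2 * eta + d%:R * `|u| * e.
Proof.
rewrite -[X in X * eta]mulr1.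
apply: (@Rintegral_dist_event _ _ _ P _ _ 1 _ _ far) => //.
- by apply: measurable_cos_comp; exact: measurable_dot.
- by apply: measurable_cos_comp; exact: measurable_dot.
- by move=> w; exact: cos_max.
- by move=> w; exact: cos_max.
- by rewrite !mulr_ge0.
move=> w /close h; apply: le_trans (norm_cosB_le _ _) _.
rewrite opprD addrACA subrr addr0 -dotBr; apply: le_trans (norm_dot_le _ _) _.
by apply: ler_wpM2l => //; exact: mulr_ge0.
Qed.

(** Outside the event [far] the error and the fluctuation differ by at most 1, which lowers the
    level [l] by one. *)
Lemma step_tail_bound i (l : R) : e <= 1 -> 1 < l ->
  (P [set w | (l < `|Y w i ord0|)%R] <=
    eta%:E + P [set w | (l - 1 < `|F w i ord0|)%R])%E.
Proof.
move=> e1 l1; have mS := measurable_lt_norm (l - 1) (mF i).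
apply: (@le_trans _ _ (P (far `|` [set w | l - 1 < `|F w i ord0|]))).
  apply: le_measure; rewrite ?inE; [exact: (measurable_lt_norm l (mY i))|exact: (measurableU _ _ measurable_far mS)|].
  move=> w /= h; have [?|nf] := pselect (far w); [by left|right].
  have := le_trans (coordB_norm_le (Y w) (F w) i) (le_trans (close nf) e1).
  have := ler_normD (Y w i ord0 - F w i ord0) (F w i ord0); rewrite subrK.
  move: h; rewrite /=; move: (`|Y w i ord0|) (`|F w i ord0|) => p q; lra.
by apply: le_trans (measureU2 _ measurable_far mS) _; rewrite leeD2r.
Qed.

Lemma step_cf u z :
  `|\int[P]_w cos (dot u (Y w) + z) - expR (- (limit_variance J th0 u / 2)) * cos z| <=
  2 * eta + d%:R * `|u| * e +
  cf_constant u * (M / Num.sqrt N%:R + N%:R / k%:R + (Num.sqrt k%:R)^-1).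
Proof.
have -> : \int[P]_w cos (dot u (Y w) + z) - expR (- (limit_variance J th0 u / 2)) * cos z =
   (\int[P]_w cos (dot u (Y w) + z) - \int[P]_w cos (dot u (F w) + z)) +
   (\int[P]_w cos (dot u (F w) + z) - expR (- (limit_variance J th0 u / 2)) * cos z).
  by rewrite addrA subrK.
apply: le_trans (ler_normD _ _) _; apply: lerD; first exact: step_cf_bound.
apply: le_trans (fluctuation_at_cf oT openTheta lamT bd fin JE cJ lb li cX PX iX Nk k0
  near_le Mrho measurable_near u z) _.
have [t1 t2 t3] := cf_terms u.
apply: (alg2 t1 t2 t3).
- by rewrite divr_ge0// ltW.
- exact: divr_ge0.
- by rewrite invr_ge0 ltW.
Qed.

Lemma step_tail i (l : R) : e <= 1 -> 1 < l ->
  (P [set w | (l < `|Y w i ord0|)%R] <= (eta + 2 * tail_constant / (l - 1) ^+ 2)%:E)%E.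
Proof.
move=> e1 l1; apply: le_trans (step_tail_bound i e1 l1) _; rewrite EFinD leeD2l//.
apply: (fluctuation_at_tail oT openTheta lamT bd fin JE cJ lb li cX PX iX Nk k0
  near_le Mrho measurable_near i).
by rewrite subr_gt0.
Qed.

End Estimator.

End OneStep.

(** * Passage to the limit along N and k *)

Section Limits.
Context {R : realType} {d : nat} {dO : measure_display} {Omega : measurableType dO}.
Variables (T : set R) (Theta : set 'cV[R]_d) (lam : 'cV[R]_d -> R -> R).
Hypothesis oT : observation_interval T.
Hypothesis openTheta : open Theta.
Hypothesis lamT : forall th, Theta th -> intensity T (lam th).
Hypothesis bd : bounded_derivatives 3 Theta T (ell lam).
Hypothesis fin : finite_integrals T lam Theta.
Variables (J : 'cV[R]_d -> 'M[R]_d) (c : R).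
Hypothesis JE : is_information T Theta lam J.
Hypothesis cJ : forall x, Theta x -> coercive c (J x).
Variables (th0 : 'cV[R]_d) (rho C : R).
Hypothesis lb : local_bounds T Theta lam th0 rho C.
Hypothesis li : local_integrals T lam J th0 rho C.
Variables (P : probability Omega R) (X : nat -> Omega -> cumulative R R).
Hypothesis cX : forall j, counting_process T (X j).
Hypothesis PX : forall j, poisson_process P T (lam th0) (X j).
Hypothesis iX : mutually_independent P (fun j => sigma_process T (X j)).
Variables (thbar : nat -> Omega -> 'cV[R]_d) (N k : nat -> nat).
Hypothesis est : estimators T Theta X thbar.
Hypothesis bounded : bounded_in_probability P
  (fun n w => Num.sqrt n%:R *: (thbar n w - th0)).
Hypothesis rates : forall e : R, 0 < e -> \forall n \near \oo,
  [/\ (0 < N n)%N, (N n <= k n)%N, Num.sqrt (N n)%:R / Num.sqrt (k n)%:R <= e,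
      Num.sqrt (k n)%:R / (N n)%:R <= e & (Num.sqrt (N n)%:R)^-1 <= e].

Let D0 : Theta th0. Proof. by have [? _ /(_ th0)[]] := lb; rewrite ?subrr ?normr0. Qed.
Let rho0 : 0 < rho. Proof. by have [] := lb. Qed.
Let C0 : 0 <= C. Proof. by have [] := lb. Qed.
Let c0 : 0 < c. Proof. by have [] := cJ D0. Qed.

Let Dbar n w : Theta (thbar n w). Proof. by have [h _] := est; exact: h. Qed.

Let mbar n i :
  measurable_fun [set: g_sigma_algebraType (block T X `I_n)] (fun w => thbar n w i ord0).
Proof. by move=> _ B mB; rewrite setTI; have [_ h] := est; exact: h. Qed.

Let mbar' n i : measurable_fun setT (fun w => thbar n w i ord0).
Proof.
move=> _ B mB; have := @mbar n i measurableT B mB; rewrite !setTI => h.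
exact: (block_measurable cX h).
Qed.

Definition scaled_error n (w : Omega) : 'cV[R]_d :=
  Num.sqrt (k n)%:R *: (step T lam J X (N n) (k n) (thbar (N n) w) w - th0).

Lemma measurable_scaled_error n i :
  measurable_fun setT (fun w => scaled_error n w i ord0).
Proof.
rewrite (_ : (fun w => _) = fun w => Num.sqrt (k n)%:R *
    (step T lam J X (N n) (k n) (thbar (N n) w) w i ord0 - th0 i ord0)).
  apply: measurable_funM => //; apply: measurable_funB => //.
  exact: (measurable_step oT openTheta lamT bd fin JE cJ cX (Dbar (N n)) _ _ _ (@mbar' (N n))).
by apply/funext => w; rewrite !mxE.
Qed.

Let measurable_far n (M : R) :
  measurable [set w | M < enorm (Num.sqrt (N n)%:R *: (thbar (N n) w - th0))].
Proof.
have mE : measurable_fun setT (fun w => enorm (Num.sqrt (N n)%:R *: (thbar (N n) w - th0))).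
  apply: measurable_enorm => i.
  rewrite (_ : (fun w => _) = fun w => Num.sqrt (N n)%:R * (thbar (N n) w i ord0 - th0 i ord0)).
    by apply: measurable_funM => //; apply: measurable_funB => //; exact: mbar'.
  by apply/funext => w; rewrite !mxE.
have := mE measurableT _ (measurable_itv `]M, +oo[).
by rewrite setTI; congr (measurable _); apply/seteqP; split => w /=; rewrite in_itv/= andbT.
Qed.

Let preliminary_tail (eta : R) : 0 < eta -> exists2 M : R, 0 <= M & \forall n \near \oo,
  (P [set w | (M < enorm (Num.sqrt (N n)%:R *: (thbar (N n) w - th0)))%R] <= eta%:E)%E.
Proof.
move=> eta0; have [M [m _ hM]] := bounded eta0; exists `|M| => //.
(* The rate condition at this value forces [N n] to be at least [m], so the tail bound for the full
   sequence holds along [N n]. *)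
have s0 : 0 < (Num.sqrt (m.+1%:R : R))^-1 by rewrite invr_gt0 sqrtr_gt0.
apply: filterS (rates s0) => n [N0 _ _ _ h].
have mN : (m <= N n)%N.
  move: h; rewrite lef_pV2 ?posrE ?sqrtr_gt0 ?ltr0n// ler_sqrt ?ltr0n// ler_nat.
  exact: ltnW.
apply: le_trans (hM _ mN); apply: le_measure; rewrite ?inE.
- exact: measurable_far.
- exact: measurable_far.
- by move=> w /=; apply: le_lt_trans; exact: ler_norm.
Qed.

Let remainder_constant (M : R) : R := M + d%:R / c * C * M ^+ 2.

Let remainder_constant_ge0 M : 0 <= M -> 0 <= remainder_constant M.
Proof.
move=> M0; apply: addr_ge0 => //; apply: mulr_ge0; last exact: sqr_ge0.
by apply: mulr_ge0 => //; rewrite divr_ge0// ltW.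
Qed.

Let small_rates (M e : R) : 0 <= M -> 0 < e -> \forall n \near \oo,
  [/\ (0 < N n)%N, (N n <= k n)%N, M / Num.sqrt (N n)%:R < rho,
   M * (Num.sqrt (N n)%:R / Num.sqrt (k n)%:R) +
     d%:R / c * C * M ^+ 2 * (Num.sqrt (k n)%:R / (N n)%:R) <= remainder_constant M * e &
   M / Num.sqrt (N n)%:R + (N n)%:R / (k n)%:R + (Num.sqrt (k n)%:R)^-1 <= (M + 2) * e].
Proof.
move=> M0 e0; pose e' := Num.min (Num.min 1 e) (rho / (M + 1)).
have M1 : 0 < M + 1 by rewrite ltr_wpDl.
have e'0 : 0 < e' by rewrite !lt_min ltr01 e0 divr_gt0.
have e'1 : e' <= 1 by rewrite !ge_min lexx.
have e'e : e' <= e by rewrite !ge_min lexx orbT.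
have e'r : e' <= rho / (M + 1) by rewrite !ge_min lexx !orbT.
apply: filterS (rates e'0) => n [N0 Nk].
have k0 : (0 < k n)%N := leq_trans N0 Nk.
set x := Num.sqrt (N n)%:R / Num.sqrt (k n)%:R.
set y := Num.sqrt (k n)%:R / (N n)%:R; set q := (Num.sqrt (N n)%:R)^-1 => xe ye qe.
have sN : 0 < Num.sqrt ((N n)%:R : R) by rewrite sqrtr_gt0 ltr0n.
have sk : 0 < Num.sqrt ((k n)%:R : R) by rewrite sqrtr_gt0 ltr0n.
have x0 : 0 <= x by rewrite divr_ge0// ltW.
have q0 : 0 <= q by rewrite invr_ge0 ltW.
have xk : (N n)%:R / (k n)%:R = x ^+ 2 :> R.
  by rewrite /x expr_div_n !sqr_sqrtr.
have qk : (Num.sqrt (k n)%:R)^-1 <= q.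
  by rewrite /q lef_pV2 ?posrE// ler_sqrt ?ltr0n// ler_nat.
split => //.
- apply: (@le_lt_trans _ _ (M * (rho / (M + 1)))).
    by rewrite ler_wpM2l// (le_trans qe).
  by rewrite mulrA ltr_pdivrMr// mulrC ltr_pM2l// ltrDl.
- rewrite /remainder_constant mulrDl; apply: lerD.
    by rewrite ler_wpM2l// (le_trans xe).
  apply: ler_wpM2l; last exact: le_trans ye e'e.
  apply: mulr_ge0; last exact: sqr_ge0.
  by apply: mulr_ge0 => //; rewrite divr_ge0// ltW.
rewrite xk; have x2 : x ^+ 2 <= e.
  apply: le_trans (_ : x <= e); last exact: le_trans xe e'e.
  by rewrite expr2 ler_piMl// (le_trans xe).
have -> : (M + 2) * e = M * e + e + e by ring.
apply: lerD; last exact: le_trans qk (le_trans qe e'e).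
by apply: lerD => //; rewrite ler_wpM2l// (le_trans qe).
Qed.

Lemma scaled_error_cf u z : \int[P]_w cos (dot u (scaled_error n w) + z) @[n --> \oo] -->
  expR (- (limit_variance J th0 u / 2)) * cos z.
Proof.
apply/cvgrPdist_le => e e0; have e4 : 0 < e / 4 by rewrite divr_gt0.
have [M M0 hM] := preliminary_tail e4.
have kc := cf_constant_ge0 cJ lb u; have rc := remainder_constant_ge0 M0.
set K := cf_constant _ _ _ _ in kc.
(* All rate-dependent errors are at most [Z] times the rate; with [e'] they use e / 2, and the
   exceptional event uses 2 (e / 4). *)
pose Z := d%:R * `|u| * remainder_constant M + K * (M + 2).
have Z0 : 0 <= Z by rewrite addr_ge0// mulr_ge0// ?mulr_ge0// addr_ge0.
have Z1 : 0 < Z + 1 by rewrite ltr_wpDl.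
pose e' := e / (2 * (Z + 1)); have e'0 : 0 < e' by rewrite divr_gt0// mulr_gt0.
have Ze : Z * e' <= e / 2.
  rewrite /e' mulrA ler_pdivrMr ?mulr_gt0//.
  by rewrite (_ : e / 2 * (2 * (Z + 1)) = (Z + 1) * e); [rewrite ler_wpM2r ?lerDl// ltW|field].
have := small_rates M0 e'0; apply: filterS2 hM => n hM [N0 Nk Mr h1 h2].
rewrite distrC; apply: le_trans (step_cf oT openTheta lamT bd fin JE cJ lb li cX PX iX
  (Dbar (N n)) N0 Nk M0 Mr (@mbar (N n)) hM u z) _.
rewrite -/K [leRHS](_ : e = 2 * (e / 4) + e / 2); last by field.
rewrite -addrA lerD2l; apply: le_trans Ze.
rewrite [leRHS](_ : _ = d%:R * `|u| * (remainder_constant M * e') + K * ((M + 2) * e')); last first.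
  by rewrite [LHS]mulrDl -[X in X + _ = _]mulrA -[X in _ + X = _]mulrA.
apply: lerD.
  by apply: ler_wpM2l h1; exact: mulr_ge0.
exact: ler_wpM2l.
Qed.

Lemma scaled_error_tight : tight P scaled_error.
Proof.
move=> eta eta0; have eta2 : 0 < eta / 2 by rewrite divr_gt0.
have [M M0 hM] := preliminary_tail eta2.
have tc := tail_constant_ge0 cJ lb; set K := tail_constant _ _ _ in tc.
have rc := remainder_constant_ge0 M0.
have r1 : 0 < remainder_constant M + 1 by rewrite ltr_wpDl.
have e0 : 0 < (remainder_constant M + 1)^-1 by rewrite invr_gt0.
(* At level 2 + q, one unit is reserved for the remainder; then 2 K / (1 + q)^2 <= eta / 2, because
   (1 + q)^2 >= q. *)
pose q := 4 * K / eta; have q0 : 0 <= q by rewrite divr_ge0 ?mulr_ge0// ltW.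
have l1 : 1 < 2 + q by rewrite (lt_le_trans (ltr1n _ 2 : 1 < 2))// lerDl.
exists (2 + q); have := small_rates M0 e0; apply: filterS2 hM => n hM [N0 Nk Mr h1 _] i.
have e1 := le_trans h1 (_ : _ <= 1).
apply: le_trans (step_tail oT openTheta lamT bd fin JE cJ lb li cX PX iX
  (Dbar (N n)) N0 Nk M0 Mr (@mbar (N n)) hM i (e1 _) l1) _.
  by rewrite ler_pdivrMr// mul1r lerDl.
rewrite lee_fin -/K (_ : 2 + q - 1 = 1 + q); last by ring.
have p0 : 0 < (1 + q) ^+ 2 by rewrite exprn_gt0// ltr_pwDl.
have : 2 * K / (1 + q) ^+ 2 <= eta / 2.
  rewrite ler_pdivrMr//; apply: (@le_trans _ _ (eta / 2 * q)).
    by rewrite /q le_eqVlt; apply/orP; left; apply/eqP; field; rewrite gt_eqF.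
  rewrite ler_wpM2l ?(ltW eta2)// sqrrD expr1n mul1r; have := sqr_ge0 q; lra.
by lra.
Qed.

(** The estimation error is a tight sequence divided by sqrt k. Each coordinate is controlled at
    level eps / (d + 1), and a union bound recovers the Euclidean norm. *)
Lemma step_consistent : (forall A : R, \forall n \near \oo, A <= Num.sqrt (k n)%:R) ->
  cvg_in_probability P (fun n w => step T lam J X (N n) (k n) (thbar (N n) w) w) th0.
Proof.
move=> kinf eps eps0; pose e' : R := eps / d.+1%:R.
have e'0 : 0 < e' by rewrite divr_gt0.
have mS n i : measurable [set w | e' <
    `|(step T lam J X (N n) (k n) (thbar (N n) w) w - th0) i ord0|].
  apply: measurable_lt_norm.
  rewrite (_ : (fun w => _) = fun w =>
    step T lam J X (N n) (k n) (thbar (N n) w) w i ord0 - th0 i ord0).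
    apply: measurable_funB => //.
    exact: (measurable_step oT openTheta lamT bd fin JE cJ cX (Dbar (N n)) _ _ _ (@mbar' (N n))).
  by apply/funext => w; rewrite !mxE.
have mE n : measurable [set w | eps < enorm (step T lam J X (N n) (k n) (thbar (N n) w) w - th0)].
  have mm : measurable_fun setT (fun w => enorm (step T lam J X (N n) (k n) (thbar (N n) w) w - th0)).
    apply: measurable_enorm => i.
    rewrite (_ : (fun w => _) = fun w =>
      step T lam J X (N n) (k n) (thbar (N n) w) w i ord0 - th0 i ord0).
      apply: measurable_funB => //.
      exact: (measurable_step oT openTheta lamT bd fin JE cJ cX (Dbar (N n)) _ _ _ (@mbar' (N n))).
    by apply/funext => w; rewrite !mxE.
  have := mm measurableT _ (measurable_itv `]eps, +oo[).
  by rewrite setTI; congr (measurable _); apply/seteqP; split => w /=; rewrite in_itv/= andbT.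
have key (eta : R) : 0 < eta -> \forall n \near \oo,
    (P [set w | (eps < enorm (step T lam J X (N n) (k n) (thbar (N n) w) w - th0))%R] <= eta%:E)%E.
  move=> eta0; have eta1 : 0 < eta / d.+1%:R by rewrite divr_gt0.
  have [l hl] := scaled_error_tight eta1.
  apply: filterS2 (kinf ((`|l| + 1) / e')) hl => n kn hl.
  have sk : 0 <= Num.sqrt (k n)%:R :> R by exact: sqrtr_ge0.
  have sub i : (P [set w | (e' <
      `|(step T lam J X (N n) (k n) (thbar (N n) w) w - th0) i ord0|)%R] <= (eta / d.+1%:R)%:E)%E.
    apply: le_trans (hl i); apply: le_measure; rewrite ?inE; [exact: mS| |].
      by apply: measurable_lt_norm; exact: measurable_scaled_error.
    move=> w /= h; rewrite /scaled_error [X in `|X|]mxE normrM ger0_norm//.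
    move: kn; rewrite ler_pdivrMr// => kn.
    apply: (@lt_le_trans _ _ (`|l| + 1)); first by rewrite (le_lt_trans (ler_norm l))// ltrDl.
    by apply: le_trans kn _; rewrite ler_wpM2l// ltW.
  apply: le_trans (_ : ((d%:R * (eta / d.+1%:R))%:E <= _)%E); last first.
    rewrite lee_fin mulrCA ler_piMr ?(ltW eta0)// ler_pdivrMr// mul1r ler_nat//.
  apply: le_trans (union_bound (mS n) sub); apply: le_measure; rewrite ?inE//.
    rewrite (_ : [set w | _] = \bigcup_(i in [set: 'I_d]) [set w | e' <
      `|(step T lam J X (N n) (k n) (thbar (N n) w) w - th0) i ord0|]).
      by apply: fin_bigcup_measurable.
    by apply/seteqP; split => w [i]; exists i.
  move=> w /= h; apply: contrapT => nex.
  have le i : `|(step T lam J X (N n) (k n) (thbar (N n) w) w - th0) i ord0| <= e'.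
    by rewrite leNgt; apply/negP => hi; apply: nex; exists i.
  have := enorm_le (ltW e'0) le; rewrite /e' mulrCA divff// mulr1.
  by rewrite leNgt h.
apply/fine_cvgP; split.
  by apply: nearW => n; exact: fin_num_measure.
apply/cvgrPdist_le => e e0; apply: filterS (key e e0) => n h.
rewrite sub0r normrN ger0_norm /=; last by apply: fine_ge0; exact: measure_ge0.
by rewrite -lee_fin fineK// fin_num_measure.
Qed.

End Limits.

(** * Growth rates of N and k *)

Section Rates.
Context {R : realType}.

Lemma near_powR_ge (q A : R) : 0 < q -> \forall n \near \oo, A <= n%:R `^ q.
Proof.
move=> q0; pose B := Num.max A 0; have B0 : 0 <= B by rewrite le_max lexx orbT.
have AB : A <= B by rewrite le_max lexx.
apply: filterS (nbhs_infty_ger (B `^ q^-1)) => n hn; apply: (le_trans AB).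
have -> : B = (B `^ q^-1) `^ q by rewrite -powRrM mulVf ?gt_eqF// powRr1.
by apply: ge0_ler_powR => //; rewrite ?nnegrE ?powR_ge0// ltW.
Qed.

Lemma truncn_half (x : R) : 2 <= x -> x / 2 <= (Num.truncn x)%:R.
Proof.
move=> x2; have x0 : 0 <= x by lra.
by have /andP[_] := truncn_itv x0; rewrite -natr1; lra.
Qed.

Lemma sqrt_le_scaled (a b e : R) : 0 <= e -> 0 <= b -> a <= e ^+ 2 * b ->
  Num.sqrt a <= e * Num.sqrt b.
Proof.
move=> e0 b0 ab; rewrite -[e](ger0_norm e0) -sqrtr_sqr -sqrtrM ?sqr_ge0//.
by rewrite ler_wsqrtr.
Qed.

(** The ratio N / k is small because n^(1 - delta) grows, and sqrt k / N because n^(delta - 1/2)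
    grows. Taking integer parts costs a factor of at most 2, once the arguments exceed 2. *)
Lemma one_step_rates (delta s : R) : 1 / 2 < delta -> delta < 1 -> 0 < s -> s <= 1 ->
  let N (n : nat) := Num.truncn (n%:R `^ delta : R) in
  let k (n : nat) := Num.truncn (s * n%:R) in
  forall e : R, 0 < e -> \forall n \near \oo,
  [/\ (0 < N n)%N, (N n <= k n)%N, Num.sqrt (N n)%:R / Num.sqrt (k n)%:R <= e,
      Num.sqrt (k n)%:R / (N n)%:R <= e & (Num.sqrt (N n)%:R)^-1 <= e].
Proof.
move=> dl dr s0 s1 N k e e0.
have d0 : 0 < delta by lra.
have d1 : 0 < 1 - delta by rewrite subr_gt0.
have d2 : 0 < delta - 1 / 2 by rewrite subr_gt0.
have e20 : 0 < e ^+ 2 by rewrite exprn_gt0.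
have N1 := near_powR_ge (2 + 2 / e ^+ 2) d0.
have N2 := near_powR_ge (2 / s + 2 / (e ^+ 2 * s)) d1.
have N3 := near_powR_ge (2 / e) d2.
apply: filterS3 N1 N2 N3 => n; rewrite /N /k; set p : R := n%:R.
(* At n = 0 the power is 0, which contradicts the first threshold. *)
have [->|p0] := eqVneq p 0.
  by rewrite powR0 ?gt_eqF// => h; have := divr_gt0 (ltr0n R 2) e20; lra.
have {}p0 : 0 < p by rewrite lt_neqAle eq_sym p0 /p ler0n.
set a := p `^ delta; set b := p `^ (1 - delta); set g := p `^ (delta - 1 / 2) => h1 h2 h3.
have powp (x y : R) : p `^ (x + y) = p `^ x * p `^ y.
  by apply: powRD; rewrite (gt_eqF p0) implybT.
have ab : a * b = p.
  by rewrite /a /b -powp addrC subrK powRr1 ?ltW.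
have a0 : 0 < a by rewrite powR_gt0.
have ge : a = g * Num.sqrt p.
  by rewrite /a /g -powR12_sqrt ?ltW// -powp; congr (_ `^ _); lra.
have i1 : 0 < 2 / e ^+ 2 by rewrite divr_gt0.
have i2 : 0 < 2 / s by rewrite divr_gt0.
have i3 : 0 < 2 / (e ^+ 2 * s) by rewrite divr_gt0// mulr_gt0.
have a2 : 2 <= a by lra.
have ha := truncn_half a2; have /andP[Na _] := truncn_itv (ltW a0).
have bs : 2 / s <= b by lra.
have be : 2 / (e ^+ 2 * s) <= b by lra.
have sab : 2 * a <= s * p.
  by rewrite -ab mulrCA mulrC ler_wpM2l ?(ltW a0)//; move: bs; rewrite ler_pdivrMr// mulrC.
have sp2 : 2 <= s * p by lra.
have sp0 : 0 <= s * p by lra.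
have hk := truncn_half sp2; have /andP[ksp _] := truncn_itv sp0.
set Nn := Num.truncn a in ha Na *; set kn := Num.truncn (s * p) in hk ksp *.
have N0 : (0 < Nn)%N by rewrite -(ltr0n R); lra.
have Nk : (Nn <= kn)%N by rewrite -(ler_nat R); lra.
have sN : 0 < Num.sqrt (Nn%:R : R) by rewrite sqrtr_gt0 ltr0n.
have sk : 0 < Num.sqrt (kn%:R : R) by rewrite sqrtr_gt0 ltr0n (leq_trans N0).
split => //.
- rewrite ler_pdivrMr//; apply: (@sqrt_le_scaled Nn%:R kn%:R e (ltW e0) (ler0n R kn)).
  apply: (le_trans Na); apply: (@le_trans _ _ (e ^+ 2 * (s * p / 2))); last first.
    by rewrite ler_wpM2l// ltW.
  rewrite (_ : e ^+ 2 * (s * p / 2) = a * (e ^+ 2 * s * b / 2)); last by rewrite -ab; field.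
  rewrite ler_pMr// ler_pdivlMr// mul1r mulrC.
  by move: be; rewrite ler_pdivrMr ?mulr_gt0.
- rewrite ler_pdivrMr ?ltr0n//.
  apply: (@le_trans _ _ (Num.sqrt p)).
    by rewrite ler_wsqrtr// (le_trans ksp)// ler_piMl// ltW.
  apply: (@le_trans _ _ (e * (a / 2))); last by rewrite ler_wpM2l// ltW.
  rewrite ge (_ : e * (g * Num.sqrt p / 2) = (e * g / 2) * Num.sqrt p); last by field.
  rewrite ler_peMl ?sqrtr_ge0// ler_pdivlMr// mul1r mulrC.
  by move: h3; rewrite ler_pdivrMr.
- rewrite -[e]invrK lef_pV2 ?posrE ?invr_gt0//.
  rewrite -[e^-1]ger0_norm ?invr_ge0 ?(ltW e0)// -sqrtr_sqr ler_wsqrtr//.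
  apply: le_trans ha; rewrite exprVn ler_pdivlMr// mulrC.
  by have := h1; lra.
Qed.

End Rates.

Section AsymptoticNormality.
Context {R : realType} {d : nat} {dO : measure_display} {Omega : measurableType dO}.
Variables (T : set R) (Theta : set 'cV[R]_d) (lam : 'cV[R]_d -> R -> R).
Hypothesis oT : observation_interval T.
Hypothesis openTheta : open Theta.
Hypothesis lamT : forall th, Theta th -> intensity T (lam th).
Hypothesis bd : bounded_derivatives 3 Theta T (ell lam).
Hypothesis fin : finite_integrals T lam Theta.
Variable J : 'cV[R]_d -> 'M[R]_d.
Hypothesis JE : is_information T Theta lam J.
Hypothesis nondeg : uniformly_nondegenerate Theta J.
Variables (P : probability Omega R) (X : nat -> Omega -> cumulative R R).
Variables (th0 : 'cV[R]_d) (thbar : nat -> Omega -> 'cV[R]_d) (N k : nat -> nat).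
Hypothesis D0 : Theta th0.
Hypothesis cX : forall j, counting_process T (X j).
Hypothesis PX : forall j, poisson_process P T (lam th0) (X j).
Hypothesis iX : mutually_independent P (fun j => sigma_process T (X j)).
Hypothesis est : estimators T Theta X thbar.
Hypothesis bounded : bounded_in_probability P
  (fun n w => Num.sqrt n%:R *: (thbar n w - th0)).
Hypothesis rates : forall e : R, 0 < e -> \forall n \near \oo,
  [/\ (0 < N n)%N, (N n <= k n)%N, Num.sqrt (N n)%:R / Num.sqrt (k n)%:R <= e,
      Num.sqrt (k n)%:R / (N n)%:R <= e & (Num.sqrt (N n)%:R)^-1 <= e].

Let error := scaled_error T lam J th0 X thbar N k.

Lemma step_asymptotics :
  cvg_in_probability P (fun n w => step T lam J X (N n) (k n) (thbar (N n) w) w) th0 /\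
  cvg_in_law_normal P error 0 (invmx (J th0)).
Proof.
have sJ (th : 'cV[R]_d) : Theta th -> (J th)^T = J th.
  move=> Dth; apply/matrixP => i j; rewrite mxE (JE j i Dth) (JE i j Dth).
  apply: eq_Rintegral => t _.
  exact: (congr1 (fun x : R => x * lam th t) (mulrC _ _)).
have [c cJ] := @uniformly_nondegenerate_coercive R d Theta J sJ nondeg.
have [rho [C [lb li]]] := exists_local_integrals oT openTheta lamT fin bd JE D0.
have mY n i : measurable_fun setT (fun w => error n w i ord0).
  exact: (measurable_scaled_error oT openTheta lamT bd fin JE cJ th0 cX N k est).
have tY := scaled_error_tight oT openTheta lamT bd fin JE cJ lb li cX PX iX est bounded rates.
split.
  apply: (step_consistent oT openTheta lamT bd fin JE cJ lb li cX PX iX est bounded rates).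
  move=> A; pose e : R := (`|A| + 1)^-1.
  have A1 : 0 < `|A| + 1 by rewrite ltr_wpDl.
  have e0 : 0 < e by rewrite invr_gt0.
  (* The last rate makes sqrt N large, and k is at least N. *)
  apply: filterS (rates e0) => n [N0 Nk _ _].
  rewrite lef_pV2 ?posrE ?sqrtr_gt0 ?ltr0n// => h.
  apply: le_trans (ler_norm A) _; apply: (@le_trans _ _ (`|A| + 1)); first by rewrite lerDl.
  by apply: le_trans h _; rewrite ler_wsqrtr// ler_nat.
move=> f cf [M fM].
(* The limit law is represented by a random vector with covariance the inverse information, whose
   characteristic function matches the limit obtained for the scaled error. *)
have pS : posdef (invmx (J th0)) by apply: posdef_invmx; exact: coercive_posdef (cJ th0 D0).
have [dQ [OQ [Q [W [mW WE Wcf]]]]] := gaussian_representation pS.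
have weak : \int[P]_w f (error n w) @[n --> \oo] --> \int[Q]_w f (W w).
  apply: (cf_weak_convergence mY mW _ tY cf fM) => u z.
  rewrite Wcf mulNr -mulmxA -dotE.
  exact: (scaled_error_cf oT openTheta lamT bd fin JE cJ lb li cX PX iX est bounded rates).
rewrite (WE 0 f M cf fM); under eq_Rintegral do rewrite add0r.
have EE n : ('E_P[(fun w => f (error n w))])%E = (\int[P]_w f (error n w))%:E.
  rewrite unlock EFin_Rintegral//; apply: (bounded_integrable _ (M := M)) => //.
  exact: (measurable_continuous_bounded (mY n) cf fM).
apply/fine_cvgP; split; first by apply: nearW => n; exact: (congr1 (fun x => x \is a fin_num) (EE n)).
rewrite (_ : fine \o _ = fun n => \int[P]_w f (error n w)); first exact: weak.
by apply/funext => n; exact: (congr1 fine (EE n)).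
Qed.

End AsymptoticNormality.

Theorem theorem4p1 (R : realType) (d : nat) (T : set R)
    (Theta : set 'cV[R]_d) (lam : 'cV[R]_d -> R -> R)
    (dO : measure_display) (Omega : measurableType dO)
    (P : 'cV[R]_d -> probability Omega R)
    (X : nat -> Omega -> cumulative R R)
    (thbar : nat -> Omega -> 'cV[R]_d) (th0 : 'cV[R]_d) (delta : R) :
  (* the model *)
  observation_interval T ->
  open Theta -> convex_set Theta -> bounded_set Theta ->
  (forall th, Theta th -> intensity T (lam th)) ->
  finite_integrals T lam Theta ->
  (forall j, counting_process T (X j)) ->
  (forall th, Theta th ->
     (forall j, poisson_process (P th) T (lam th) (X j)) /\
     mutually_independent (P th) (fun j => sigma_process T (X j))) ->
  Theta th0 ->
  (* condition (P) *)
  estimators T Theta X thbar ->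
  cvg_in_probability (P th0) thbar th0 ->
  bounded_in_probability (P th0)
    (fun n w => Num.sqrt n%:R *: (thbar n w - th0)) ->
  (* condition (L) *)
  bounded_derivatives 3 Theta T (ell lam) ->
  uniformly_nondegenerate Theta (fisher T lam) ->
  (* the one-step MLE-process *)
  1 / 2 < delta -> delta < 1 ->
  let N (n : nat) : nat := Num.truncn (n%:R `^ delta : R) in
  let thstar (n k : nat) : Omega -> 'cV[R]_d := one_step T lam X thbar (N n) k in
  forall s : R, 0 < s -> s <= 1 ->
    let k (n : nat) : nat := Num.truncn (s * n%:R) in
    cvg_in_probability (P th0) (fun n => thstar n (k n)) th0 /\
    cvg_in_law_normal (P th0)
      (fun n w => Num.sqrt (k n)%:R *: (thstar n (k n) w - th0))
      0 (invmx (fisher T lam th0)).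
Proof.
move=> oT openTheta _ _ lamT fin cX PX D0 est _ bounded bd nondeg dl dr N thstar s s0 s1 k.
have [PX0 iX] := PX th0 D0.
have JE : is_information T Theta lam (fisher T lam).
  by move=> th i j Dth; exact: (fisherE openTheta lamT bd i j Dth).
exact: (step_asymptotics oT openTheta lamT bd fin JE nondeg D0 cX PX0 iX est bounded
  (one_step_rates dl dr s0 s1)).
Qed.
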